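(* Let $\mathfrak{p}\colon\mathcal{T}\to[0,\infty)$ be a continuous probability density function such that $\inf_{\mathcal{T}}\mathfrak{p}\ge 2\mathfrak{c}$ for some constant $\mathfrak{c}>0$. Let $\mathcal{S}_n$ be a set of $n$ independent samples from $\mathfrak{p}$. Then for every $\varepsilon>0$, $$\limsup_{n\to\infty}\frac1n\log\mathbb{P}\Big(\inf_{f\in\operatorname{argmax}J}\ \max_{(x,y)\in\mathcal{S}_n}|f(x)-y|\ge\varepsilon\ \Big|\ \mathcal{S}_n\text{ is a convex chain}\Big)<0.$$
   Context: $\mathcal{T}\subset\mathbb{R}^2$ is the closed triangle with vertices $(0,0),(1,1),(1,0)$. A finite set of points is in convex position if none of the points lies in the convex hull of the others. A finite set $\mathcal{C}\subset\mathcal{T}\setminus\{(0,0),(1,1)\}$ is a convex chain if $\mathcal{C}\cup\{(0,0),(1,1)\}$ is in convex position. $\mathcal{F}$ is the set of functions $f\colon[0,1]\to[0,1]$ that are convex and continuous with $f(0)=0$; such $f$ is twice differentiable almost everywhere and satisfies $(x,f(x))\in\mathcal{T}$. Define $J(f):=\int_0^1[f''(x)\cdot\mathfrak{p}(x,f(x))]^{1/3}\,dx$, $J_\star:=\sup_{f\in\mathcal{F}}J(f)$, and $\operatorname{argmax}J:=\{f\in\mathcal{F}: J(f)=J_\star\}$. *)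

(* Defs.v *)
From HB Require Import structures.
From mathcomp Require Import all_boot all_order all_algebra.
From mathcomp Require Import all_classical all_reals all_analysis.

Set Implicit Arguments.
Unset Strict Implicit.
Unset Printing Implicit Defensive.

Import Order.TTheory GRing.Theory Num.Def Num.Theory.
Import numFieldNormedType.Exports.

Local Open Scope classical_set_scope.
Local Open Scope ring_scope.

Section ConvexPosition.
Context {R : realType}.

Definition convex_hull (S : set (R * R)) : set (R * R) :=
  smallest (@convex_set R (R * R)%type) S.

Definition triangle : set (R * R) :=
  convex_hull [set z | [\/ z = (0, 0), z = (1, 1) | z = (1, 0)]].

Definition convex_position (S : set (R * R)) : Prop :=
  finite_set S /\ forall z, S z -> ~ convex_hull (S `\ z) z.

Definition convex_chain (C : set (R * R)) : Prop :=
  [/\ finite_set C,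
      C `<=` triangle `\` [set (0, 0); (1, 1)]
    & convex_position (C `|` [set (0, 0); (1, 1)])].

End ConvexPosition.

Section Functional.
Context {R : realType}.

(* A function on [0, 1] is represented by a function on R of which only the
   values on [0, 1] matter. *)
Definition convex_functions : set (R -> R) :=
  [set f | [/\ set_fun `[0, 1] `[0, 1] f,
               @convex_function R R `[0, 1] f,
               {within `[0, 1], continuous f}
             & f 0 = 0]].

(* The derivative at [x] of f', where f' is defined only at the points of
   differentiability of [f].  The iterated derivative [f^`(2)] would not do:
   [f^`()] takes a default value at the points where [f] has no derivative, and
   these may be dense for a convex [f].  Where the limit does not exist (a null
   set for convex [f]) the value is a default one. *)
Definition second_derivative (f : R -> R) (x : R) : R :=
  lim ((derive1 f y - derive1 f x) / (y - x)
         @[y --> within [set y | derivable f y 1] x^']).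

Definition J (p : R * R -> R) (f : R -> R) : \bar R :=
  (\int[lebesgue_measure]_(x in `[0%R, 1%R])
     ((second_derivative f x * p (x, f x)) `^ (3%:R^-1))%:E)%E.

Definition J_star (p : R * R -> R) : \bar R :=
  ereal_sup (J p @` convex_functions).

Definition argmax_J (p : R * R -> R) : set (R -> R) :=
  [set f | convex_functions f /\ J p f = J_star p].

Definition max_deviation n (f : R -> R) (s : 'I_n -> R * R) : R :=
  \big[maxr/0]_(i < n) `|f (s i).1 - (s i).2|.

(* An extended real, so that the infimum over an empty set would be +oo. *)
Definition distance_to_argmax n (p : R * R -> R) (s : 'I_n -> R * R) : \bar R :=
  ereal_inf [set (max_deviation f s)%:E | f in argmax_J p].

End Functional.

Section Probability.
Context {R : realType}.

Definition probability_density_on (T : set (R * R)) (p : R * R -> R) : Prop :=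
  (forall z, T z -> 0 <= p z) /\
  (\int[lebesgue_measure \x lebesgue_measure]_(z in T) (p z)%:E = 1)%E.

Definition has_density_on d (Omega : measurableType d) (P : probability Omega R)
    (T : set (R * R)) (p : R * R -> R) (X : {RV P >-> (R * R)%type}) : Prop :=
  forall A : set (R * R), measurable A ->
    distribution P X A =
    (\int[lebesgue_measure \x lebesgue_measure]_(z in T `&` A) (p z)%:E)%E.

Definition mutually_independent d (Omega : measurableType d)
    (P : probability Omega R) n (X : 'I_n -> {RV P >-> (R * R)%type}) : Prop :=
  forall (I : {set 'I_n}) (A : 'I_n -> set (R * R)),
    (forall i, measurable (A i)) ->
    P (\bigcap_(i in [set` I]) (X i @^-1` A i)) =
    (\prod_(i in I) P (X i @^-1` A i))%E.

Definition independent_samples d (Omega : measurableType d)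
    (P : probability Omega R) (T : set (R * R)) (p : R * R -> R)
    n (X : 'I_n -> {RV P >-> (R * R)%type}) : Prop :=
  mutually_independent X /\ forall i, has_density_on T p (X i).

Definition conditional_probability d (Omega : measurableType d)
    (P : probability Omega R) (A B : set Omega) : \bar R :=
  (P (A `&` B) / P B)%E.

End Probability.

(* Main.v *)
(** Sorted by abscissa, the points of a convex chain form a path with increasing slopes, and
    their interpolant is a convex function on [0, 1] from 0 to 1.  Cut [0, 1] into cells of
    mesh D.  Integrating over one point after the other, the ordered configurations with r
    points in a given cell, whose slopes run through an interval of length s, have measure about
    (p D^2 s / 4)^r / r!^3, and the sum over cells of the cube roots of p D^2 s is a Riemann sum
    of J.  Summing over the numbers of points in the cells and over the n! orders, the chains
    whose interpolant is close to g have probability at most n! (4^(-1/3) A)^(3 n) / n!^3 for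
    every A > J g, while all chains have probability at least the same expression for every
    A < J f with f in F, both up to factors polynomial in n.

    The interpolants lie in a set of convex functions which is compact for pointwise
    convergence, because a jump at 1 is allowed.  A function with a jump is not maximal:
    rounding it off on an interval of length d next to 1 gains d^(1/3) up to a constant, and
    costs o(d^(1/3)).  Hence every g in the compact set either is a maximizer, and then the
    chains with interpolant near g are close to it, or satisfies J g < J_star, and then such
    chains are exponentially rare among all chains.  Finitely many neighbourhoods suffice. *)

(* A point is best described by its abscissa and by the slope of the edge leading to it: the
   Jacobian of this change is the gap between abscissas, so the two orderings separate. For r points
   in a cell, abscissas weighted by gaps give D^(2r)/(2r)!, ordered slopes give s^r/r!, and (2r)! is
   4^r r!^2 up to a factor 2r+1. The result is a cube (a^r/r!)^3, and the multinomial theorem sums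
   such cubes.

   An edge crossing from one cell to the next couples the cells. The upper bound lets the first
   point of each cell be arbitrary, which costs one point per cell, hence a polynomial factor; the
   lower bound asks every cell to contain a point and confines the crossing edges too. Next to 1
   slopes are unbounded, so the last cell of the upper bound uses the chord to (1, 1) instead; its
   rate vanishes with its width.

   Since second derivatives exist only almost everywhere, J is bounded by the Riemann sums through
   Fatou's lemma. The converse truncates the cell values c and uses dominated convergence; the
   excess is controlled by the sum of the D c^3, in which slope increments telescope. *)
Require Import Defs.
From HB Require Import structures.
From mathcomp Require Import all_boot all_order all_algebra all_fingroup.
From mathcomp Require Import all_classical all_reals all_analysis.
From mathcomp Require Import measurable_realfun.
From mathcomp Require Import ring lra zify.
Import Order.TTheory GRing.Theory Num.Def Num.Theory.
Import numFieldNormedType.Exports.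
Set Implicit Arguments.
Unset Strict Implicit.
Unset Printing Implicit Defensive.
Local Open Scope classical_set_scope.
Local Open Scope ring_scope.

(** * Differentiability of monotone functions *)

Section MonotoneDifferentiation.
Context {R : realType}.
Local Notation mu := (@lebesgue_measure R).

(** The inverse of an expanding map is 1-Lipschitz, so a cover of [E] by short intervals pulls back
    to sets of comparable length. The factor 2 in [key] comes from centring an interval at an
    arbitrary point of the preimage. *)
Lemma null_preimage_expanding (a b : R) (S : R -> R) (E : set R) :
  (forall u v : R, u <= v -> v - u <= S v - S u) ->
  measurable E -> mu E = 0 -> mu (`]a, b[ `&` S @^-1` E) = 0.
Proof.
move=> Slip mE E0.
have Snd : nondecreasing_fun S.
  by move=> u v uv; rewrite -subr_ge0; apply: le_trans (Slip _ _ uv); rewrite subr_ge0.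
have mS : measurable_fun [set: R] S by exact: nondecreasing_measurable.
have mSpre (B : set R) : measurable B -> measurable (`]a, b[ `&` S @^-1` B).
  by move=> mB; apply: measurableI => //; rewrite -[X in measurable X]setTI; exact: mS.
have key (u v : R) : (mu (`]a, b[ `&` S @^-1` `]u, v]) <= (2 * (v - u)%R)%:E)%E
    \/ v <= u.
  have [uv|] := ltP u v; [left|by right].
  have [->|/set0P[x0 [_ /=]]] := eqVneq (`]a, b[ `&` S @^-1` `]u, v]) set0.
    by rewrite measure0 lee_fin mulr_ge0// subr_ge0 ltW.
  rewrite in_itv/= => /andP[ux0 x0v].
  apply: (@le_trans _ _ (mu `[x0 - (v - u), x0 + (v - u)])).
    apply: le_measure; rewrite ?inE//; first exact: mSpre.
    move=> x [_ /=]; rewrite !in_itv/= => /andP[ux xv].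
    by have [xx0|/ltW x0x] := leP x x0; have := Slip _ _ ltac:(eassumption); lra.
  rewrite lebesgue_measure_itv/= lte_fin ifT; last lra.
  by rewrite -EFinB lee_fin; lra.
apply/eqP; rewrite eq_le measure_ge0 andbT; apply/lee_addgt0Pr => e e0; rewrite add0e.
have e20 : 0 < e / 2 by rewrite divr_gt0.
have : (mu E < (e / 2)%:E)%E by rewrite E0 lte_fin.
(* Lebesgue measure is unfolded to its outer measure in order to extract a cover of [E] by half-open
   intervals of small total length. *)
rewrite {1}/lebesgue_measure /lebesgue_stieltjes_measure /measure_extension /mu_ext.
move=> /ereal_inf_lt[_ [A [mA EA] <-]] Ae.
have mA' i : @measurable _ (measurableTypeR R) (A i) by exact: sub_sigma_algebra.
apply: (@le_trans _ _ (\sum_(0 <= k <oo) mu (`]a, b[ `&` S @^-1` A k))%E).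
  apply: (@measure_sigma_subadditive _ _ _ mu) => //.
  - by move=> i; exact: mSpre (mA' i).
  - exact: mSpre mE.
  - by move=> x [abx /EA[i _ Aix]]; exists i.
apply: (@le_trans _ _ (\sum_(0 <= k <oo) (2%:E * wlength idfun (A k)))%E).
  apply: lee_nneseries => // k _.
  have [->|[[u v] /= uv ->]] := (ocitvP (A k)).1 (mA k).
    by rewrite preimage_set0 setI0 measure0 wlength0 mule0.
  have [|vu] := key u v; last by move: uv; rewrite /= ltNge vu.
  move=> /le_trans; apply.
  by rewrite wlength_itv/= lte_fin uv -EFinB -EFinM.
rewrite nneseriesZl//.
apply: (@le_trans _ _ (2%:E * (e / 2)%:E)%E); first by rewrite lee_pmul2l// ltW.
by rewrite -EFinM lee_fin mulrC divfK.
Qed.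

(** Near [x] the map [F] inverts [S] up to a constant, so the difference quotients of [S] are the
    inverses of those of [F], provided that [S] is continuous at [x]; this is [Sc]. *)
Lemma derivable_inverse (F S : R -> R) (x w e : R) :
  {homo F : u v / u <= v} -> 0 < e ->
  (forall y, `|y - x| < e -> F (S y) - F (S x) = y - x) ->
  derivable F (S x) 1 -> derive1 F (S x) = w -> w != 0 ->
  {homo S : u v / u < v} -> derivable S x 1.
Proof.
move=> Fnd e0 FS dF Fw w0 Sinc.
set a := S x in FS dF Fw *.
have Gw (d : R) : 0 < d -> exists2 d' : R, 0 < d' &
    forall t, t != a -> `|t - a| < d' -> `|w - (t - a)^-1 * (F t - F a)| < d.
  move=> d0.
  have : h^-1 *: (F (h + a) - F a) @[h --> 0^'] --> w.
    have E : (fun h => h^-1 *: ((F \o shift a) (h *: 1) - F a)) =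
             (fun h => h^-1 *: (F (h + a) - F a)).
      by apply/funext => h /=; rewrite [X in F (X + _)]mulr1.
    by move: dF; rewrite /derivable E -Fw.
  move/cvgrPdist_lt => /(_ _ d0); rewrite near_withinE => -[d' /= d'0 H].
  exists d' => // t ta tad.
  have := H (t - a); rewrite /= sub0r normrN subrK subr_eq0; exact.
have {w0} w0 : 0 < w.
  have /Gw[d d0 /(_ (a + d / 2))] : 0 < `|w| / 2 by rewrite divr_gt0 ?normr_gt0.
  have -> : a + d / 2 - a = d / 2 by lra.
  rewrite gtr0_norm; last lra.
  move=> /(_ ltac:(by rewrite gt_eqF// ltrDl; lra) ltac:(by lra)).
  have : 0 <= (d / 2)^-1 * (F (a + d / 2) - F a).
    by rewrite mulr_ge0 ?invr_ge0 ?subr_ge0 ?Fnd//; lra.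
  by rewrite ltr_distl; case: (ltrgt0P w) w0; lra.
(* If [S] jumped by [b] at [x], then [F], whose slope at [a] is [w], would change by at least
   [w / 2 * b], whereas [F (S y)] changes only by [y - x]. *)
have Sc (d : R) : 0 < d -> exists2 d' : R, 0 < d' &
    forall h, `|h| < d' -> `|S (h + x) - a| < d.
  move=> d0; have /Gw[d1 d10 Gd1] : 0 < w / 2 by lra.
  pose b := minr d d1 / 2.
  have b0 : 0 < b by rewrite /b divr_gt0// lt_min d0.
  have bd : b < d by have : minr d d1 <= d by [rewrite ge_min lexx]; rewrite /b; lra.
  have bd1 : b < d1 by have : minr d d1 <= d1 by [rewrite ge_min lexx orbT]; rewrite /b; lra.
  have Fr : F a + w / 2 * b <= F (a + b).
    have := Gd1 (a + b); have -> : a + b - a = b by lra.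
    rewrite gtr0_norm// => /(_ ltac:(by rewrite gt_eqF// ltrDl) bd1).
    by rewrite ltr_distlC => /andP[+ _]; rewrite [ltRHS]mulrC ltr_pdivlMr//; lra.
  have Fl : F (a - b) + w / 2 * b <= F a.
    have := Gd1 (a - b); have -> : a - b - a = - b by lra.
    rewrite normrN gtr0_norm// => /(_ ltac:(by rewrite lt_eqF//; lra) bd1).
    rewrite ltr_distlC => /andP[+ _]; rewrite invrN mulNr -mulrN opprB [ltRHS]mulrC.
    by rewrite ltr_pdivlMr//; lra.
  exists (minr e (w / 2 * b)); first by rewrite lt_min e0 mulr_gt0//; lra.
  move=> h; rewrite lt_min => /andP[he hwb].
  have := FS (h + x); rewrite addrK => /(_ he) FSh.
  have [h0|h0] := leP 0 h.
    move: hwb; rewrite ger0_norm// => hwb.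
    have aSh : a <= S (h + x).
      have [->|hn0] := eqVneq h 0; first by rewrite add0r.
      by apply/ltW/Sinc; rewrite ltrDr lt_neqAle eq_sym hn0.
    rewrite ger0_norm ?subr_ge0//; apply: lt_trans bd.
    by rewrite ltNge; apply/negP => /[!lerBrDl] /Fnd; lra.
  move: hwb; rewrite ltr0_norm// => hwb.
  have Sha : S (h + x) < a by apply: Sinc; lra.
  rewrite ltr0_norm ?subr_lt0//; apply: lt_trans bd.
  rewrite opprB ltNge; apply/negP => baS.
  have /Fnd : S (h + x) <= a - b by lra.
  by lra.
have : (S (h + x) - a)^-1 * h @[h --> 0^'] --> w.
  apply/cvgrPdist_lt => d d0; have [d1 d10 Gd1] := Gw _ d0.
  have [d2 d20 Sd2] := Sc _ d10.
  rewrite near_withinE; exists (minr d2 e) => [/=|h /=]; first by rewrite lt_min d20.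
  rewrite sub0r normrN lt_min => /andP[hd2 he] h0.
  have := Gd1 (S (h + x)); rewrite FS ?addrK//; apply; last exact: Sd2.
  have [h1|h1|h1] := ltgtP h 0; last by rewrite h1 eqxx in h0.
  - by rewrite lt_eqF//; apply: Sinc; lra.
  - by rewrite gt_eqF//; apply: Sinc; lra.
move=> /(cvgV (lt0r_neq0 w0)) HS.
rewrite /derivable; apply/cvg_ex; exists w^-1.
have E : (fun h => h^-1 *: ((S \o shift x) (h *: 1) - S x)) =
    (fun h => ((S (h + x) - a)^-1 * h)^-1).
  by apply/funext => h /=; rewrite [X in S (X + _)]mulr1 invfM invrK mulrC.
by rewrite E; exact: HS.
Qed.

(** The image of Lebesgue measure under [S] is absolutely continuous by [null_preimage_expanding].
    Its Radon-Nikodym density [w] has an indefinite integral [F] with [F (S y) = y - a],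
    differentiable almost everywhere, and [derivable_inverse] applies off the preimage of a null set
    and of the zeros of [w]. *)
Lemma ae_derivable_expanding (a b : R) (S : R -> R) :
  (forall u v : R, u <= v -> v - u <= S v - S u) ->
  exists N : set R, [/\ measurable N, mu N = 0 &
    forall x, `]a, b[%classic x -> ~ N x -> derivable S x 1].
Proof.
move=> Slip.
have Sinc : {homo S : u v / u < v}.
  by move=> u v uv; rewrite -subr_gt0; apply: lt_le_trans (Slip _ _ (ltW uv)); rewrite subr_gt0.
have Snd : nondecreasing_fun S.
  by move=> u v; rewrite le_eqVlt => /predU1P[->//|/Sinc/ltW].
have mS : measurable_fun [set: R] S by exact: nondecreasing_measurable.
have [ab|ba] := ltP a b; last first.
  exists set0; split => // x; rewrite /= in_itv/= => /andP[ax xb].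
  by have := lt_trans ax xb; rewrite ltNge ba.
have mab : measurable (`]a, b[%classic : set R) by exact: measurable_itv.
pose la := mrestr mu mab.
pose nu0 := pushforward la S.
have nu0fin : fin_num_fun nu0.
  move=> E mE; rewrite /nu0 /pushforward /la /mrestr ge0_fin_numE//.
  apply: (@le_lt_trans _ _ (mu `]a, b[)).
    apply: le_measure; rewrite ?inE//; apply: measurableI => //.
    by rewrite -[X in measurable X]setTI; exact: mS.
  by rewrite lebesgue_measure_itv/= lte_fin ab -EFinB ltry.
have [w [w0 wfin wint wE]] : exists f : R -> \bar R, [/\ forall x, (f x >= 0)%E,
    forall x, f x \is a fin_num, mu.-integrable [set: R] f &
    forall A, measurable A -> nu0 A = (\int[mu]_(x in A) f x)%E].
  pose Sm : {mfun measurableTypeR R >-> measurableTypeR R} :=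
    HB.pack (S : measurableTypeR R -> measurableTypeR R)
      (@isMeasurableFun.Build _ _ (measurableTypeR R) (measurableTypeR R) S mS).
  pose nuf : {finite_measure set (measurableTypeR R) -> \bar R} :=
    HB.pack (pushforward la Sm) (@Measure_isFinite.Build _ _ _ (pushforward la Sm) nu0fin).
  apply: (@radon_nikodym_sigma_finite _ _ _ mu (nuf mS mS mS mS)).
  move=> E E0 A mA AE; have := null_preimage_expanding a b Slip mA (E0 _ mA AE).
  by rewrite setIC.
pose v t := fine (w t).
have wv : w = EFin \o v by apply/funext => t; rewrite /= fineK.
have vint : mu.-integrable [set: R] (EFin \o v) by rewrite -wv.
have mv : measurable_fun [set: R] v by apply/measurable_EFinP; exact: measurable_int vint.
have locv : locally_integrable [set: R] v by apply: open_integrable_locally => //; exact: openT.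
have vintS (A : set R) : measurable A -> mu.-integrable A (EFin \o v).
  by move=> mA; apply: integrableS vint.
have := FTC1Ny (fun y => vintS _ (measurable_itv `]-oo, y])) locv.
set F := fun x => _.
move=> [N0 [mN0 muN0 sN0]].
have mZ : measurable (N0 `|` v @^-1` [set 0]).
  by apply: measurableU => //; rewrite -[X in measurable X]setTI; exact: mv.
exists (`]a, b[ `&` S @^-1` (N0 `|` v @^-1` [set 0])); split.
- by apply: measurableI => //; rewrite -[X in measurable X]setTI; exact: mS.
(* The preimage of the zero set of the density has as measure the integral of the density over that
   set, hence 0. *)
- have -> : mu (`]a, b[ `&` S @^-1` (N0 `|` v @^-1` [set 0])) = nu0 (N0 `|` v @^-1` [set 0]).
    by rewrite /nu0 /pushforward /la /mrestr setIC.
  rewrite wE// (negligible_integral mN0 mZ (integrableS measurableT mZ (@subsetT _ _) wint) muN0).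
  rewrite integral0_eq// => x [[//|/= vx0] _].
  by rewrite wv /= vx0.
move=> x abx /not_andP[//|]/not_orP[N0x vx].
have [dF Fv] : derivable F (S x) 1 /\ derive1 F (S x) = v (S x).
  by apply: contrapT => H; apply: N0x; exact: sN0.
pose e := minr (x - a) (b - x).
have FE t : F t = fine (nu0 `]-oo, t]%classic).
  by rewrite wE//= wv.
apply: (@derivable_inverse F S x (v (S x)) e) => //; last exact/eqP.
- move=> s t st; rewrite !FE fine_le//; try exact: nu0fin.
  rewrite /nu0 /pushforward /la /mrestr le_measure// ?inE.
  + by apply: measurableI => //; rewrite -[X in measurable X]setTI; exact: mS.
  + by apply: measurableI => //; rewrite -[X in measurable X]setTI; exact: mS.
  + by apply: setSI => z /=; rewrite !in_itv/= => /le_trans; exact.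
- rewrite lt_min !subr_gt0; move: abx; rewrite /= in_itv/=; exact.
- have FS y : `]a, b[%classic y -> F (S y) = y - a.
    rewrite /= in_itv/= => /andP[ay yb].
    rewrite FE /nu0 /pushforward /la /mrestr.
    have -> : S @^-1` `]-oo, S y] `&` `]a, b[ = `]a, y]%classic.
      apply/seteqP; split=> z /=; rewrite !in_itv/=.
        move=> [Szy /andP[az zb]]; rewrite az/=.
        by rewrite leNgt; apply/negP => /Sinc; rewrite ltNge Szy.
      by move=> /andP[az zy]; split; [exact: Snd|rewrite az (le_lt_trans zy)].
    by rewrite lebesgue_measure_itv/= lte_fin ay -EFinB.
  move=> y; rewrite lt_min !ltr_distl => /andP[/andP[y1 y2] /andP[y3 y4]].
  rewrite !FS// /= ?in_itv/=; last by apply/andP; split; lra.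
  lra.
Qed.

(* Writing [r] as the difference of the expanding map [x + r x] and the identity
   reduces the claim to the inverse of an expanding map, which is 1-Lipschitz,
   hence an indefinite integral. *)
Theorem ae_derivable_nondecreasing (r : R -> R) : nondecreasing_fun r ->
  exists N : set R, [/\ measurable N, mu N = 0 &
    forall x, ~ N x -> derivable r x 1].
Proof.
move=> rnd; pose S x := x + r x.
have Slip (u v : R) : u <= v -> v - u <= S v - S u.
  by move=> uv; rewrite /S; have := rnd _ _ uv; lra.
have H n := ae_derivable_expanding (- n%:R) n%:R Slip.
pose N n := sval (cid (H n)).
have HN n : [/\ measurable (N n), mu (N n) = 0 &
    forall x, `]-n%:R, n%:R[%classic x -> ~ N n x -> derivable S x 1].
  by rewrite /N; case: cid.
exists (\bigcup_n N n); split.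
- by apply: bigcup_measurable => n _; case: (HN n).
- apply/eqP; rewrite eq_le measure_ge0 andbT.
  apply: (@le_trans _ _ (\sum_(0 <= n <oo) mu (N n))%E).
    apply: measure_sigma_subadditive => //; first by move=> n; case: (HN n).
    by apply: bigcup_measurable => n _; case: (HN n).
  by rewrite eseries0// => n _ _; case: (HN n).
move=> x Nx; have [n xn] : exists n, `|x| < n%:R.
  by exists (truncn `|x|).+1; exact: truncnS_gt.
have dS : derivable S x 1.
  case: (HN n) => _ _; apply; last by move=> Nnx; apply: Nx; exists n.
  by rewrite /= in_itv/=; move: xn; rewrite ltr_norml.
have -> : r = S - id by apply/funext => y; rewrite /S /= !fctE; lra.
exact: derivableB.
Qed.

End MonotoneDifferentiation.

(** * Convex chains in the triangle *)

Section Hull.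
Context {R : realType}.
Implicit Types (A S : set (R * R)) (z u v : R * R).

Lemma convex_setP A : @convex_set R (R * R)%type A <->
  forall u v (t : R), A u -> A v -> 0 <= t -> t <= 1 ->
    A (t * u.1 + (1 - t) * v.1, t * u.2 + (1 - t) * v.2).
Proof.
split=> [cA u v t Au Av t0 t1|H u v t /set_mem Au /set_mem Av].
- have t01 : 0 <= t <= 1 by rewrite t0.
  have := cA u v (Itv01 t0 t1) (mem_set Au) (mem_set Av).
  by move/set_mem.
- by apply/mem_set; exact: (H u v t%:num).
Qed.

Lemma convex_hullP S z : convex_hull S z <->
  forall A, (forall u v (t : R), A u -> A v -> 0 <= t -> t <= 1 ->
    A (t * u.1 + (1 - t) * v.1, t * u.2 + (1 - t) * v.2)) -> S `<=` A -> A z.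
Proof.
split=> [H A /convex_setP cA SA|H A [cA SA]]; first exact: H.
by apply: H => //; apply/convex_setP.
Qed.

Lemma triangleP z : triangle z <-> 0 <= z.2 /\ z.2 <= z.1 /\ z.1 <= 1.
Proof.
split=> [/convex_hullP H|[z0 [zz z1]]].
- apply: (H [set z | 0 <= z.2 /\ z.2 <= z.1 /\ z.1 <= 1]).
    by move=> u v t /= [u0 [uu u1]] [v0 [vv v1]] t0 t1; split; [|split]; nra.
  by move=> _ /= [->|->|->] /=; split => //; split=> //; rewrite ?ler01.
- apply/convex_hullP => A cA SA.
  have A00 : A (0, 0) by apply: SA; constructor 1.
  have A11 : A (1, 1) by apply: SA; constructor 2.
  have A10 : A (1, 0) by apply: SA; constructor 3.
  have [x0|x0] := leP z.1 0.
    by have -> : z = (0, 0) by case: z z0 zz z1 x0 => a b /= *; congr (_, _); lra.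
  (* For [z.1 > 0] the point is on the segment from the origin to the point of ordinate [z.2 / z.1]
     on the right edge. *)
  have t0 : 0 <= z.2 / z.1 by rewrite divr_ge0// ltW.
  have t1 : z.2 / z.1 <= 1 by rewrite ler_pdivrMr ?mul1r.
  have H1 := cA _ _ _ A11 A10 t0 t1.
  have := cA _ _ _ H1 A00 (ltW x0) z1.
  congr A; case: z z0 zz z1 x0 t0 t1 {H1} => a b /= *; congr (_, _); field; lra.
Qed.

End Hull.

(** * Orientation of triples and convex position *)

Section Chain.
Context {R : realType}.
Local Notation pt := (R * R)%type.
Implicit Types (a b c z : pt) (l : seq pt).

Definition orient a b c : R := (b.1 - a.1) * (c.2 - a.2) - (b.2 - a.2) * (c.1 - a.1).

(** Abscissas alone do not order a chain: it may contain a point of the right edge, which shares its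
    abscissa with (1, 1). *)
Definition lex a b := (a.1 < b.1) || (a.1 == b.1) && (a.2 <= b.2).

Definition corners l : seq pt := (0, 0) :: rcons l (1, 1).

Definition ccw l := forall i j k, (i < j < k)%N -> (k < size l)%N ->
  0 < orient (nth (0, 0) l i) (nth (0, 0) l j) (nth (0, 0) l k).

Definition open_triangle : set pt := triangle `\` [set (0, 0); (1, 1)].

Lemma pair_eq a b : a.1 = b.1 -> a.2 = b.2 -> a = b.
Proof. by case: a b => [x y] [x' y'] /= -> ->. Qed.

Lemma lex_total : total lex.
Proof.
move=> a b; rewrite /lex; case: ltgtP => //= _; exact: le_total.
Qed.

Lemma lex_trans : transitive lex.
Proof.
move=> b a c; rewrite /lex => /orP[ab|/andP[/eqP ab ab2]] /orP[bc|/andP[/eqP bc bc2]].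
- by rewrite (lt_trans ab bc).
- by rewrite -bc ab.
- by rewrite ab bc.
- by rewrite ab bc eqxx (le_trans ab2 bc2) orbT.
Qed.

(** Were [b] on or above the chord from [a] to [c], it would lie on a vertical segment between a
    point [q] of that chord and a point [e] of the diagonal, since the triangle lies below the
    diagonal. Both are in the hull of the other points. A vertical chord is treated apart. *)
Lemma orient_gt0 (S : set pt) a b c : convex_position S ->
  S (0, 0) -> S (1, 1) -> S a -> S b -> S c -> triangle a -> triangle b -> triangle c ->
  lex a b -> lex b c -> a != b -> b != c -> b != (0, 0) -> b != (1, 1) -> 0 < orient a b c.
Proof.
move=> [_ Sconv] SO SE Sa Sb Sc Ta Tb Tc ab bc anb bnc b0 b1.
rewrite ltNge; apply/negP => o0; apply: (Sconv _ Sb); apply/convex_hullP => A cA SA.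
have Aa : A a by apply: SA; split=> //; exact/eqP.
have Ac : A c by apply: SA; split=> //=; apply/eqP; rewrite eq_sym.
have AO : A (0, 0) by apply: SA; split=> //=; apply/eqP; rewrite eq_sym.
have AE : A (1, 1) by apply: SA; split=> //=; apply/eqP; rewrite eq_sym.
move: Tb => /triangleP[tb0 [tb1 tb2]].
have bal : a.1 <= b.1 by move: ab; rewrite /lex => /orP[/ltW|/andP[/eqP-> _]].
have bcl : b.1 <= c.1 by move: bc; rewrite /lex => /orP[/ltW|/andP[/eqP-> _]].
have acl := le_trans bal bcl.
have [ac|ac] := eqVneq a.1 c.1.
  have ab1 : a.1 = b.1 by lra.
  have bc1 : b.1 = c.1 by lra.
  move: ab bc; rewrite /lex ab1 bc1 ltxx eqxx /= => ab bc.
  have [ac2|ac2] := eqVneq a.2 c.2.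
    have /eqP : a = b by apply: pair_eq => //; lra.
    by rewrite (negbTE anb).
  have t0 : 0 <= (c.2 - b.2) / (c.2 - a.2) by rewrite divr_ge0; lra.
  have t1 : (c.2 - b.2) / (c.2 - a.2) <= 1 by rewrite ler_pdivrMr; lra.
  have := cA _ _ _ Aa Ac t0 t1; congr A.
  by apply: pair_eq => /=; [rewrite ab1 bc1; ring|field; lra].
have {}acl : a.1 < c.1 by lra.
pose u := (c.1 - b.1) / (c.1 - a.1).
have u0 : 0 <= u by rewrite divr_ge0; lra.
have u1 : u <= 1 by rewrite ler_pdivrMr; lra.
have := cA _ _ _ Aa Ac u0 u1; set q := (_, _) => Aq.
have q1 : q.1 = b.1 by rewrite /q /u /=; field; lra.
have q2 : q.2 <= b.2.
  have -> : q.2 = a.2 + (b.1 - a.1) * (c.2 - a.2) / (c.1 - a.1) by rewrite /q /u /=; field; lra.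
  rewrite -lerBrDl ler_pdivrMr; last lra.
  by move: o0; rewrite /orient; lra.
have := cA _ _ b.1 AE AO ltac:(lra) tb2; set e := (_, _) => Ae.
have e1 : e.1 = b.1 by rewrite /e /=; lra.
have e2 : e.2 = b.1 by rewrite /e /=; lra.
clearbody q e.
have [qe|qe] := eqVneq q.2 e.2.
  by have -> // : b = e by apply: pair_eq; lra.
pose v := (e.2 - b.2) / (e.2 - q.2).
have v0 : 0 <= v by rewrite divr_ge0; lra.
have v1 : v <= 1 by rewrite ler_pdivrMr; lra.
have := cA _ _ _ Aq Ae v0 v1; congr A.
by apply: pair_eq => /=; [rewrite q1 e1; ring|rewrite /v; field; lra].
Qed.

(** Each point is separated from the others by a half-plane: the one bounded by the line through its
    two neighbours, or, at the two corners, positive abscissa and ordinate below 1. *)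
Lemma ccw_convex_position l : (forall z, z \in l -> open_triangle z) -> ccw (corners l) ->
  convex_position ([set` l] `|` [set (0, 0); (1, 1)]).
Proof.
move=> lT lccw; split.
  by rewrite finite_setU; split; [exact: finite_seq|exact: finite_set2].
have Scorners z : ([set` l] `|` [set (0, 0); (1, 1)]) z -> z \in corners l.
  by rewrite inE mem_rcons inE => -[zl|[->|->]]; rewrite ?eqxx ?zl ?orbT.
have open_gt z : open_triangle z -> 0 < z.1 /\ z.2 < 1.
  move=> [/triangleP[z0 [z1 z2]] /not_orP[zO zE]]; split; rewrite lt_neqAle.
    by apply/andP; split; [apply/eqP => z10; apply: zO; apply: pair_eq => /=|]; lra.
  by apply/andP; split; [apply/eqP => z10; apply: zE; apply: pair_eq => /=|]; lra.
move=> z Sz /convex_hullP hz.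
have [zO|zO] := eqVneq z (0, 0).
  have : [set z | 0 < z.1] z.
    apply: hz => [u v t /= u0 v0 t0 t1|w /=]; first by nra.
    by move=> [[/lT/open_gt[]//|[wO|->//]] wz]; case: wz; rewrite wO zO.
  by rewrite /= zO ltxx.
have [zE|zE] := eqVneq z (1, 1).
  have : [set z | z.2 < 1] z.
    apply: hz => [u v t /= u0 v0 t0 t1|w /=]; first by have [uv|uv] := leP u.2 v.2; nra.
    by move=> [[/lT/open_gt[]//|[->//|wE]] wz]; case: wz; rewrite wE zE.
  by rewrite /= zE ltxx.
have zl : z \in l by case: Sz => // -[] /eqP; rewrite ?(negbTE zO) ?(negbTE zE).
pose j := (index z l).+1.
have jl : (j < (size l).+1)%N by rewrite ltnS index_mem.
have zj : nth (0, 0) (corners l) j = z by rewrite /= nth_rcons index_mem zl nth_index.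
have sz : size (corners l) = (size l).+2 by rewrite /= size_rcons.
pose a := nth (0, 0) (corners l) j.-1; pose c := nth (0, 0) (corners l) j.+1.
have : [set w | 0 <= orient a c w] z.
  apply: hz => [u v t /= u0 v0 t0 t1|w /=]; first by move: u0 v0; rewrite /orient /=; nra.
  move=> [/Scorners/(nthP (0, 0))[k ksz <-] wz].
  have [kj|kj|kj] := ltngtP k j; last by case: wz; rewrite kj.
  - have [kj1|kj1] := eqVneq k j.-1; first by rewrite kj1 -/a /orient; lra.
    have /lccw : (k < j.-1 < j.+1)%N by rewrite ltn_neqAle kj1 /=; lia.
    move=> /(_ ltac:(lia)); rewrite -/a -/c /orient; lra.
  - have [kj1|kj1] := eqVneq k j.+1; first by rewrite kj1 -/c /orient; lra.
    have /lccw : (j.-1 < j.+1 < k)%N by apply/andP; split; lia.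
    by move=> /(_ ksz); rewrite -/a -/c /orient; lra.
have /lccw : (j.-1 < j < j.+1)%N by lia.
move=> /(_ ltac:(lia)); rewrite -/a -/c zj /orient /=; lra.
Qed.

End Chain.

(** * Paths of independent points *)

Import HBNNSimple.

Section MeasureComparison.
Context d (T : measurableType d) (R : realType).
Implicit Types m : {measure set T -> \bar R}.

(** A simple function below [f] is below [g], and its level sets for nonzero values lie in [D].
    Arguing on simple functions covers integrands such as the probability of an event that depends
    on a point. *)
Lemma le_measure_integral m1 m2 (D : set T) (f g : T -> \bar R) :
  measurable D -> (forall A, measurable A -> A `<=` D -> (m1 A <= m2 A)%E) ->
  (forall x, D x -> (0 <= f x)%E) -> (forall x, D x -> (f x <= g x)%E) ->
  (\int[m1]_(x in D) f x <= \int[m2]_(x in D) g x)%E.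
Proof.
move=> mD m12 f0 fg; rewrite !ge0_integralE//; last first.
  by move=> x Dx; exact: le_trans (f0 _ Dx) (fg _ Dx).
apply: ge_ereal_sup => _ [h /= hf <-].
apply: (@le_trans _ _ (sintegral m2 h)); last first.
  apply: ereal_sup_ubound => /=; exists h => // x; apply: le_trans (hf x) _.
  by rewrite !patchE; case: ifPn => // /set_mem; exact: fg.
rewrite !sintegralE; apply: lee_fsum => // r; move: r => r.
have [->|r0] := eqVneq r 0; first by rewrite !mul0e.
have [[x hx]|nx] := pselect (exists x, h x = r); last first.
  rewrite [_ @^-1` _](_ : _ = set0) ?measure0//.
  by rewrite -subset0 => x hx; apply: nx; exists x.
have r1 : 0 <= r by rewrite -hx.
move=> _; apply: lee_pmul => //; rewrite ?lee_fin//; apply: m12; first exact: measurable_sfunP.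
move=> z /= hz; have := hf z; rewrite patchE; case: ifPn => [/set_mem//|_].
by rewrite hz lee_fin => r2; move: r0; rewrite eq_le r1 r2.
Qed.

End MeasureComparison.

Lemma measurable_lt_set d (T : measurableType d) (R : realType) (f g : T -> R) :
  measurable_fun [set: T] f -> measurable_fun [set: T] g ->
  measurable [set x | f x < g x].
Proof.
move=> mf mg; have := measurable_fun_ltr mf mg measurableT (Y := [set true]).
by rewrite setTI; apply.
Qed.

Lemma measurable_le_set d (T : measurableType d) (R : realType) (f g : T -> R) :
  measurable_fun [set: T] f -> measurable_fun [set: T] g ->
  measurable [set x | f x <= g x].
Proof.
move=> mf mg; rewrite [X in measurable X](_ : _ = ~` [set x | g x < f x]).
  by apply: measurableC; exact: measurable_lt_set.
by apply/seteqP; split=> x /=; rewrite leNgt => /negP.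
Qed.

(** * Splitting off the first of several independent points *)

Section Independence.
Context d (Omega : measurableType d) d' (T : measurableType d') (R : realType)
  (P : probability Omega R).

Definition tuple_of n (X : 'I_n -> Omega -> T) (w : Omega) : n.-tuple T :=
  [tuple X i w | i < n].

(** Boxes over all indices are enough: a coordinate is left free by the choice [setT]. *)
Definition iid (mu : {measure set T -> \bar R}) n (X : 'I_n -> Omega -> T) :=
  (forall i, measurable_fun [set: Omega] (X i)) /\
  forall A : 'I_n -> set T, (forall i, measurable (A i)) ->
    P [set w | forall i, A i (X i w)] = (\prod_(i < n) mu (A i))%E.

Lemma measurable_tuple_of n (X : 'I_n -> Omega -> T) :
  (forall i, measurable_fun [set: Omega] (X i)) ->
  measurable_fun [set: Omega] (tuple_of X).
Proof.
move=> mX; apply/measurable_fun_tnthP => i.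
by rewrite (_ : _ \o _ = X i)//; apply/funext => w /=; rewrite tnth_mktuple.
Qed.

Lemma iid_behead (mu : probability T R) n (X : 'I_n.+1 -> Omega -> T) :
  iid mu X -> iid mu (fun i => X (lift ord0 i)).
Proof.
move=> [mX iX]; split => // A mA.
pose B i := oapp A setT (unlift ord0 i).
have := iX B; rewrite big_ord_recl /B unlift_none/= probability_setT mul1e.
move=> /(_ _)/esym; under eq_bigr do rewrite liftK/=.
move=> ->; last by move=> i; case: (unlift ord0 i) => /=.
congr (P _); apply/seteqP; split => w /= H i; last by have := H (lift ord0 i); rewrite liftK.
by case: unliftP => // j ->; exact: H.
Qed.

Lemma iid_perm (mu : {measure set T -> \bar R}) n (X : 'I_n -> Omega -> T) (s : 'S_n) :
  iid mu X -> iid mu (fun i => X (s i)).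
Proof.
move=> [mX iX]; split => // A mA.
have := iX (fun i => A ((s^-1)%g i)) (fun i => mA _).
rewrite (reindex_inj (@perm_inj _ s))/=; under eq_bigr do rewrite permK.
move=> <-; congr (P _); apply/seteqP; split => w /= H i; last by have := H (s i); rewrite permK.
by have := H ((s^-1)%g i); rewrite permKV.
Qed.

(** The first point is independent of the tuple of the others: in [key] both sides are finite
    measures in [A2] that agree on boxes, a generating family stable under intersection. The law of
    the pair is therefore a product measure, evaluated by sections. *)
Lemma iid_cons (mu : probability T R) n (X : 'I_n.+1 -> Omega -> T) (E : set (n.+1.-tuple T)) :
  iid mu X -> measurable E ->
  P (tuple_of X @^-1` E) =
  (\int[mu]_z P (tuple_of (fun i => X (lift ord0 i)) @^-1` [set t : n.-tuple T | E (cons_tuple z t)]))%E.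
Proof.
move=> iX mE; pose Y := tuple_of (fun i => X (lift ord0 i)); rewrite -/Y.
have [mX _] := iX.
have mY : measurable_fun [set: Omega] Y by apply: measurable_tuple_of.
have key (A1 : set T) (A2 : set (n.-tuple T)) : measurable A1 -> measurable A2 ->
    P (X ord0 @^-1` A1 `&` Y @^-1` A2) = (mu A1 * P (Y @^-1` A2))%E.
  move=> mA1 mA2.
  have mXA1 : measurable (X ord0 @^-1` A1) by rewrite -[X in measurable X]setTI; exact: mX.
  pose G := [set B : set (n.-tuple T) | exists2 A : 'I_n -> set T,
    (forall i, measurable (A i)) & B = [set t | forall i, A i (tnth t i)]].
  have mY' : measurable_fun [set: Omega] (Y : _ -> n.-tuple T) := mY.
  pose Ym : {mfun Omega >-> n.-tuple T} := HB.pack Y (isMeasurableFun.Build _ _ _ _ Y mY').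
  pose m1 : {measure set (n.-tuple T) -> \bar R} := pushforward (mrestr P mXA1) Ym.
  pose m2 : {measure set (n.-tuple T) -> \bar R} := mscale (NngNum (fine_ge0 (measure_ge0 mu A1))) (pushforward P Ym).
  have := @g_sigma_algebra_measure_unique _ R (n.-tuple T) G _ (fun=> setT) _ _ (m1 mY') (m2 mY') _ _ _ A2.
  rewrite /m1 /m2 /= /mscale /= /pushforward /mrestr /= fineK; last by rewrite fin_num_measure.
  move=> H; rewrite setIC; apply: H => //.
  - move=> _ [A mA ->].
    rewrite [X in measurable X](_ : _ = \bigcap_(i in [set: 'I_n]) ((@tnth n T)^~ i @^-1` A i)); last first.
      by apply/seteqP; split=> t /= H i; [move=> _|]; exact: H.
    apply: fin_bigcap_measurable => // i _; rewrite -[X in measurable X]setTI.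
    exact: measurable_tnth.
  - by move=> _; exists (fun=> setT) => //; apply/seteqP.
  - by rewrite bigcup_const//; exists 0%N.
  - move=> _ _ [A mA ->] [B mB ->]; exists (fun i => A i `&` B i).
      by move=> i; exact: measurableI.
    by apply/seteqP; split=> t /=; [move=> [H1 H2] i; split|move=> H; split=> i; case: (H i)].
  - move=> _ [A mA ->].
    have [_ iX'] := iid_behead iX.
    have -> : Y @^-1` [set t | forall i, A i (tnth t i)] =
        [set w | forall i, A i (X (lift ord0 i) w)].
      by apply/seteqP; split=> w /= H i; have := H i; rewrite tnth_mktuple.
    rewrite (iX' A mA) setIC.
    pose B i := oapp A A1 (unlift ord0 i).
    have := iX.2 B; rewrite big_ord_recl /B unlift_none/=.
    move=> /(_ _)/esym; under eq_bigr do rewrite liftK/=.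
    move=> ->; last by move=> i; case: (unlift ord0 i) => /=.
    congr (P _); apply/seteqP; split => w /=.
      by move=> [H1 H2] i; case: unliftP => [j|] ->.
    move=> H; split; first by have := H ord0; rewrite unlift_none.
    by move=> i; have := H (lift ord0 i); rewrite liftK.
  - move=> k; rewrite (le_lt_trans (probability_le1 _ _)) ?ltry//.
    by rewrite preimage_setT setTI.
  - have : g_sigma_preimage (fun i t => @tnth n T t i) A2 by exact: mA2.
    apply: sub_smallest2r; first exact: smallest_sigma_algebra.
    apply: (big_ind (fun S => S `<=` G)) => //.
      by move=> U V UG VG B [/UG|/VG].
    move=> i _ B [C mC <-].
    exists (fun j => if j == i then C else setT); first by move=> j; case: ifP.
    apply/seteqP; split=> t /=.
      by move=> [_ Ct] j; case: ifPn => // /eqP ->.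
    by move=> /(_ i); rewrite eqxx.
pose Z w := (X ord0 w, Y w).
have mZ : measurable_fun [set: Omega] Z by exact: measurable_fun_pair.
pose E' := [set zt : T * n.-tuple T | E (cons_tuple zt.1 zt.2)].
have mE' : measurable E'.
  have : measurable_fun [set: T * n.-tuple T] (fun zt => cons_tuple zt.1 zt.2).
    exact: measurable_cons.
  by move=> /(_ measurableT _ mE); rewrite setTI.
transitivity (pushforward P Z E').
  rewrite /pushforward; congr (P _); apply/seteqP; split=> w /=; rewrite /E' /=;
  have -> : cons_tuple (X ord0 w) (Y w) = tuple_of X w by
    apply/eq_from_tnth => i; rewrite /Y /tuple_of tnth_mktuple; case: (unliftP ord0 i) => [j|] ->;
    rewrite ?tnth0 ?tnthS ?tnth_mktuple.
  by [].
  by [].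
pose Ym : {mfun Omega >-> n.-tuple T} := HB.pack Y (isMeasurableFun.Build _ _ _ _ Y mY).
pose Zm : {mfun Omega >-> (T * n.-tuple T)%type} := HB.pack Z (isMeasurableFun.Build _ _ _ _ Z mZ).
have := @product_measure_unique _ _ _ _ R mu (distribution P Ym) (distribution P Zm).
move=> /(_ _ E' mE') => <-.
  rewrite /product_measure1; apply: eq_integral => z _ /=.
  by rewrite /distribution /pushforward; congr (P _); apply/seteqP; split=> w /=;
    rewrite /xsection /= inE.
move=> A B mA mB; rewrite /distribution /pushforward /= -key//.
Qed.

End Independence.

(** * The integral over one step in abscissa and slope *)

Section StepIntegral.
Context {R : realType}.
Local Notation mu := (@lebesgue_measure R).

Lemma integral_pow (u v : R) (k : nat) : u <= v ->
  (\int[mu]_(x in `]u, v[) ((v - x) ^+ k)%:E = ((v - u) ^+ k.+1 / k.+1%:R)%:E)%E.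
Proof.
rewrite le_eqVlt => /predU1P[->|uv].
  by rewrite set_itvoo0 integral_set0 subrr expr0n/= mul0r.
rewrite integral_itv_obnd_cbnd; last first.
  apply/measurable_EFinP/measurable_funX; apply: measurable_funB => //.
rewrite integral_itv_bndo_bndc; last first.
  apply/measurable_EFinP/measurable_funX; apply: measurable_funB => //.
pose F : R -> R := (- k.+1%:R^-1) *: (cst v - id) ^+ k.+1.
have FE x : F x = - ((v - x) ^+ k.+1 / k.+1%:R).
  by rewrite /F exprfctE /= [LHS]mulNr mulrC.
have dF (x : R) : is_derive x 1 F ((v - x) ^+ k).
  rewrite /F; apply: is_derive_eq.
  rewrite !fctE/= -![_ *: _]/(_ * _) sub0r mulrN1 mulrNN mulrA mulVf ?mul1r//.
have cF (x : R) : {for x, continuous F}.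
  by apply: differentiable_continuous; apply/derivable1_diffP; exact: ex_derive.
rewrite (@continuous_FTC2 _ (fun x => (v - x) ^+ k) F)//.
- by rewrite -EFinB !FE subrr expr0n/= mul0r oppr0 sub0r opprK.
- apply: continuous_subspaceT => x.
  apply: (@continuous_comp _ _ _ (fun x => v - x) (fun x => x ^+ k)).
    by apply: continuousB; [exact: cst_continuous|exact: id].
  exact: exprn_continuous.
- split; first by move=> x _; exact: ex_derive.
  + by apply: cvg_at_right_filter; exact: cF.
  + by apply: cvg_at_left_filter; exact: cF.
- by move=> x _; rewrite derive1E; exact: derive_val.
Qed.

(** Since [t - x = (e - x) - (e - t)], two instances of [integral_pow] give the value. The
    subtracted integral is first put on the other side as a sum of nonnegative integrals. *)
Lemma integral_pow_lin (x a e : R) (j : nat) : x <= a -> a <= e ->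
  (\int[mu]_(t in `]a, e[) ((t - x) * (e - t) ^+ j)%:E =
   ((e - x) * ((e - a) ^+ j.+1 / j.+1%:R) - (e - a) ^+ j.+2 / j.+2%:R)%:E)%E.
Proof.
move=> xa ae.
have mpow (i : nat) : measurable_fun `]a, e[%classic (fun t : R => (e - t) ^+ i).
  by apply: measurable_funX; apply: measurable_funB.
have : (\int[mu]_(t in `]a, e[) ((t - x) * (e - t) ^+ j)%:E +
  \int[mu]_(t in `]a, e[) ((e - t) ^+ j.+1)%:E =
  \int[mu]_(t in `]a, e[) ((e - x)%:E * ((e - t) ^+ j)%:E))%E.
  rewrite -ge0_integralD//.
  - by apply: eq_integral => t _; rewrite -EFinD -EFinM exprS; congr _%:E; ring.
  - move=> t /=; rewrite in_itv/= => /andP[at_ te]; rewrite lee_fin mulr_ge0 ?exprn_ge0//; lra.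
  - apply/measurable_EFinP; by apply: measurable_funM; [exact: measurable_funB|exact: mpow].
  - move=> t /=; rewrite in_itv/= => /andP[at_ te]; rewrite lee_fin exprn_ge0//; lra.
  - by apply/measurable_EFinP; exact: mpow.
rewrite ge0_integralZl//; first last.
- by rewrite lee_fin; lra.
- move=> t /=; rewrite in_itv/= => /andP[at_ te]; rewrite lee_fin exprn_ge0//; lra.
- by apply/measurable_EFinP; exact: mpow.
rewrite -[X in ((e - x)%:E * X)%E]/(\int[mu]_(t in `]a, e[) ((e - t) ^+ j)%:E)%E.
rewrite !integral_pow// -EFinM EFinB => <-; rewrite addeK//.
Qed.

Definition slope (z z' : R * R) := (z'.2 - z.2) / (z'.1 - z.1).

Definition cone (z : R * R) (a e lo hi : R) : set (R * R) :=
  [set z' | a < z'.1 < e /\ lo < slope z z' < hi].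

Lemma measurable_inv : measurable_fun [set: R] (@GRing.inv R).
Proof.
rewrite -(setUv [set 0]); apply/measurable_funU => //; first exact: measurableC.
split; first exact: measurable_fun_set1.
apply: open_continuous_measurable_fun; first by apply: closed_openC; exact: closed_eq.
by move=> x /set_mem /eqP x0; exact: inv_continuous.
Qed.

Lemma measurable_slope (z : R * R) : measurable_fun [set: R * R] (slope z).
Proof.
apply: measurable_funM; first by apply: measurable_funB.
by apply: (measurableT_comp measurable_inv); apply: measurable_funB.
Qed.

Lemma measurable_cone (z : R * R) (a e lo hi : R) : measurable (cone z a e lo hi).
Proof.
have -> : cone z a e lo hi = fst @^-1` `]a, e[ `&` slope z @^-1` `]lo, hi[.
  by apply/seteqP; split=> z' /=; rewrite !in_itv.
apply: measurableI; rewrite -[X in measurable X]setTI.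
  exact: measurable_fst.
by apply: measurable_slope.
Qed.

(** On a vertical line the slope from [z] replaces the ordinate; the Jacobian [x - z.1] turns the
    remaining integral over abscissas into [integral_pow_lin]. *)
Lemma step_integral (z : R * R) (a e lo hi : R) (j k : nat) :
  z.1 <= a -> a <= e -> lo <= hi ->
  (\int[(mu \x mu)%E]_(z' in cone z a e lo hi)
     ((e - z'.1) ^+ j * (hi - slope z z') ^+ k)%:E =
  (((e - z.1) * ((e - a) ^+ j.+1 / j.+1%:R) - (e - a) ^+ j.+2 / j.+2%:R) *
   ((hi - lo) ^+ k.+1 / k.+1%:R))%:E)%E.
Proof.
move=> za ae lohi.
rewrite integral_mkcond fubini_tonelli1/=; last 2 first.
- apply/(measurable_restrictT _ (measurable_cone _ _ _ _ _)).
  apply/measurable_funTS/measurable_EFinP; apply: measurable_funM.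
    by apply: measurable_funX; apply: measurable_funB => //; exact: measurable_fst.
  by apply: measurable_funX; apply: measurable_funB => //; exact: measurable_slope.
- move=> z'; rewrite patchE; case: ifPn => // /set_mem[/andP[az' z'e] /andP[loz zhi]].
  by rewrite lee_fin mulr_ge0// exprn_ge0// subr_ge0 ltW.
rewrite /fubini_F/=.
transitivity (\int[mu]_(x in `]a, e[)
   (((hi - lo) ^+ k.+1 / k.+1%:R)%:E * ((x - z.1) * (e - x) ^+ j)%:E)%E)%E.
  rewrite [RHS]integral_mkcond; apply: eq_integral => x _; rewrite patchE.
  case: ifPn => [|/negP xae]; last first.
    apply: integral0_eq => y _; rewrite patchE memNset// => -[/= H _]; apply: xae.
    by rewrite inE /= in_itv.
  rewrite inE/= in_itv/= => /andP[ax xe].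
  have xz : 0 < x - z.1 by lra.
  (* The ordinates at which the vertical line meets the two rays bounding the cone. *)
  pose lo' := z.2 + lo * (x - z.1); pose hi' := z.2 + hi * (x - z.1).
  transitivity (\int[mu]_(y in `]lo', hi'[)
      (((e - x) ^+ j / (x - z.1) ^+ k)%:E * ((hi' - y) ^+ k)%:E)%E)%E.
    rewrite [RHS]integral_mkcond; apply: eq_integral => y _; rewrite !patchE.
    have -> : ((x, y) \in cone z a e lo hi) =
        (y \in `]lo', hi'[%classic).
      apply/idP/idP; rewrite !inE /cone /slope/= in_itv/= /lo' /hi' ltr_pdivlMr// ltr_pdivrMr//.
        by move=> [_ /andP[? ?]]; apply/andP; split; lra.
      by move=> /andP[? ?]; rewrite ax xe; split => //; apply/andP; split; lra.
    case: ifPn => // _; rewrite -EFinM /slope/=; congr _%:E.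
    rewrite -mulrA; congr (_ * _).
    have -> : hi - (y - z.2) / (x - z.1) = (hi' - y) / (x - z.1).
      by rewrite /hi'; field; lra.
    by rewrite expr_div_n mulrC.
  have lh : lo' <= hi' by rewrite lerD2l ler_wpM2r// ltW.
  rewrite ge0_integralZl//; first last.
  - by rewrite lee_fin divr_ge0// exprn_ge0//; lra.
  - by move=> y /=; rewrite in_itv/= => /andP[? ?]; rewrite lee_fin exprn_ge0//; lra.
  - by apply/measurable_EFinP/measurable_funX; apply: measurable_funB.
  rewrite -[X in (_ * X)%E]/(\int[mu]_(t in `]lo', hi'[) ((hi' - t) ^+ k)%:E)%E.
  rewrite integral_pow// -!EFinM; congr _%:E.
  have -> : hi' - lo' = (hi - lo) * (x - z.1) by rewrite /hi' /lo'; ring.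
  rewrite exprMn [(x - z.1) ^+ k.+1]exprS; field.
  by rewrite expf_neq0 ?andbT ?nat1r ?pnatr_eq0// gt_eqF.
rewrite ge0_integralZl//; first last.
- by rewrite lee_fin divr_ge0// exprn_ge0// subr_ge0.
- move=> t /=; rewrite in_itv/= => /andP[at_ te]; rewrite lee_fin mulr_ge0 ?exprn_ge0//; lra.
- apply/measurable_EFinP; apply: measurable_funM; first exact: measurable_funB.
  by apply: measurable_funX; apply: measurable_funB.
rewrite -[X in (_ * X)%E]/(\int[mu]_(t in `]a, e[) ((t - z.1) * (e - t) ^+ j)%:E)%E.
by rewrite integral_pow_lin// -EFinM mulrC.
Qed.

End StepIntegral.

(** * Paths prescribed by a sequence of steps *)

Section Path.
Context {R : realType}.
Local Notation pt := (R * R)%type.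

(* A step either starts a new block of points, in which case only the position of the
   point is constrained, or extends the current block, in which case the abscissa and the
   slope have to increase. *)
Record step := Step {
  step_fresh : bool;
  step_dom : set pt;
  step_left : R;
  step_right : R;
  step_low : R;
  step_high : pt -> R }.

Definition step_set (q : step) (z : pt) (s : R) : set pt :=
  step_dom q `&`
  if step_fresh q then setT
  else cone z (maxr (step_left q) z.1) (step_right q) (maxr (step_low q) s) (step_high q z).

(** A fresh step forgets the edge by which its point was reached, and hands on the lower end of the
    slopes of its block. *)
Definition step_slope (q : step) (z z' : pt) : R :=
  if step_fresh q then step_low q else slope z z'.

Fixpoint path (st : seq step) (z : pt) (s : R) (t : seq pt) : Prop :=
  match st, t with
  | [::], [::] => True
  | q :: st, z' :: t => step_set q z s z' /\ path st z' (step_slope q z z') t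
  | _, _ => False
  end.

Fixpoint step_measurable (st : seq step) : Prop :=
  if st is q :: st then
    [/\ measurable (step_dom q), measurable_fun [set: pt] (step_high q)
      & step_measurable st]
  else True.

Lemma measurable_slope2 :
  measurable_fun [set: pt * pt] (fun zz => slope zz.1 zz.2).
Proof.
have m1 : measurable_fun [set: pt * pt] (fun zz => zz.1.1) by apply: measurableT_comp.
have m2 : measurable_fun [set: pt * pt] (fun zz => zz.1.2) by apply: measurableT_comp.
have m3 : measurable_fun [set: pt * pt] (fun zz => zz.2.1) by apply: measurableT_comp.
have m4 : measurable_fun [set: pt * pt] (fun zz => zz.2.2) by apply: measurableT_comp.
apply: measurable_funM; first exact: measurable_funB.
by apply: (measurableT_comp measurable_inv); exact: measurable_funB.
Qed.

(** Measurability is joint in the starting point, the starting slope and the tuple, because the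
    recursion moves the start. *)
Lemma measurable_path n (st : seq step) : size st = n -> step_measurable st ->
  measurable [set x : (pt * R) * n.-tuple pt | path st x.1.1 x.1.2 x.2].
Proof.
elim: n st => [|n IH] [|q st] //.
  move=> _ _; rewrite [X in measurable X](_ : _ = setT)//.
  by apply/seteqP; split => -[[z s] t]//= _; rewrite (tuple0 t).
move=> [sn] [mD mh mst]; have {IH} mst' := IH _ sn mst.
pose T3 := ((pt * R) * n.+1.-tuple pt)%type.
have mz : measurable_fun [set: T3] (fun x => x.1.1) by apply: measurableT_comp.
have ms : measurable_fun [set: T3] (fun x => x.1.2) by apply: measurableT_comp.
have mz1 : measurable_fun [set: T3] (fun x => x.1.1.1) by apply: measurableT_comp.
have mt : measurable_fun [set: T3] (fun x => thead x.2).
  by apply: (measurableT_comp (measurable_tnth ord0)).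
have mt1 : measurable_fun [set: T3] (fun x => (thead x.2).1) by apply: measurableT_comp.
have mb : measurable_fun [set: T3] (fun x => [tuple of behead x.2]).
  by apply: (measurableT_comp (@measurable_behead _ _ n)).
have mzt : measurable_fun [set: T3] (fun x => slope x.1.1 (thead x.2)).
  rewrite [X in measurable_fun _ X](_ : _ =
    (fun zz => slope zz.1 zz.2) \o (fun x : T3 => (x.1.1, thead x.2)))//.
  by apply: measurableT_comp; [exact: measurable_slope2|exact: measurable_fun_pair].
rewrite [X in measurable X](_ : _ =
   [set x : T3 | step_set q x.1.1 x.1.2 (thead x.2)] `&`
   (fun x : T3 => (thead x.2, step_slope q x.1.1 (thead x.2), [tuple of behead x.2])) @^-1`
   [set x : (pt * R) * n.-tuple pt | path st x.1.1 x.1.2 x.2]); last first.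
  by apply/seteqP; split => -[[z s] t] /=; case: (tupleP t) => z' t' /=; rewrite theadE.
apply: measurableI.
  rewrite /step_set; case fq: (step_fresh q).
    rewrite [X in measurable X](_ : _ = (fun x : T3 => thead x.2) @^-1` step_dom q).
      by rewrite -[X in measurable X]setTI; exact: mt.
    by rewrite setIT.
  rewrite [X in measurable X](_ : _ = (fun x : T3 => thead x.2) @^-1` step_dom q `&`
   ([set x : T3 | maxr (step_left q) x.1.1.1 < (thead x.2).1] `&`
    [set x : T3 | (thead x.2).1 < step_right q]) `&`
   ([set x : T3 | maxr (step_low q) x.1.2 < slope x.1.1 (thead x.2)] `&`
    [set x : T3 | slope x.1.1 (thead x.2) < step_high q x.1.1])); last first.
    apply/seteqP; split => x /=; rewrite /cone /=.
      by move=> [D [/andP[? ?] /andP[? ?]]].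
    by move=> [[D [-> ->]] [-> ->]].
  apply: measurableI; first apply: measurableI.
  - by rewrite -[X in measurable X]setTI; exact: mt.
  - by apply: measurableI; apply: measurable_lt_set => //; exact: measurable_maxr.
  - apply: measurableI; apply: measurable_lt_set => //.
      exact: measurable_maxr.
    exact: measurableT_comp.
rewrite -[X in measurable X]setTI.
have : measurable_fun [set: T3] (fun x => (thead x.2, step_slope q x.1.1 (thead x.2), [tuple of behead x.2])).
  apply: measurable_fun_pair => //; apply: measurable_fun_pair => //.
  by rewrite /step_slope; case: (step_fresh q).
by apply.
Qed.

Lemma measurable_path_section n (st : seq step) (z : pt) (s : R) :
  size st = n -> step_measurable st -> measurable [set t : n.-tuple pt | path st z s t].
Proof.
move=> sn mst; have := measurable_path sn mst.
have mc : measurable_fun [set: n.-tuple pt] (fun t => ((z, s), t)).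
  by apply: measurable_fun_pair => //; exact: measurable_cst.
by move=> /(mc measurableT); rewrite setTI.
Qed.

Lemma measurable_step_set (q : step) (z : pt) (s : R) :
  measurable (step_dom q) -> measurable (step_set q z s).
Proof.
by move=> mD; apply: measurableI => //; case: ifP => // _; exact: measurable_cone.
Qed.

End Path.

(** * Probability bounds for one step and for one block *)

Section PathBounds.
Context {R : realType} d (Omega : measurableType d) (P : probability Omega R)
  (mu : probability (measurableTypeR R * measurableTypeR R)%type R).
Local Notation pt := (measurableTypeR R * measurableTypeR R)%type.
Local Notation leb2 := (@lebesgue_measure R \x @lebesgue_measure R)%E.

Definition path_event n (X : 'I_n -> Omega -> pt) (st : seq (@step R)) (z : pt) (s : R) :=
  tuple_of X @^-1` [set t : n.-tuple pt | path st z s t].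

Lemma path_event_cons n (X : 'I_n.+1 -> Omega -> pt) (q : step) (st : seq step) (z : pt) (s : R) :
  iid P mu X -> size st = n -> step_measurable (q :: st) ->
  P (path_event X (q :: st) z s) =
  (\int[mu]_(z' in step_set q z s)
     P (path_event (fun i => X (lift ord0 i)) st z' (step_slope q z z')))%E.
Proof.
move=> iX sn mst.
have mE : measurable [set t : n.+1.-tuple pt | path (q :: st) z s t].
  by apply: measurable_path_section => //=; rewrite sn.
rewrite [LHS](iid_cons iX mE) [RHS]integral_mkcond.
apply: eq_integral => z' _; rewrite patchE.
case: ifPn => [/set_mem zq|/negP zq].
  congr (P _); apply/seteqP; split=> w /=; first by case.
  by [].
rewrite (_ : _ @^-1` _ = set0) ?measure0//.
by rewrite -subset0 => w /= [zq' _]; apply: zq; exact/mem_set.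
Qed.

(** Relaxing the domain to the whole cone from [z] and the law to [M] times Lebesgue measure makes
    [step_integral] applicable: the degree in the remaining width rises by 2, that in the remaining
    slope range by 1. *)
Lemma link_upper n (X : 'I_n.+1 -> Omega -> pt) (q : step) (st : seq step) (z : pt) (s : R)
    (C M : R) (j k : nat) :
  iid P mu X -> size st = n -> step_measurable (q :: st) -> step_fresh q = false ->
  0 <= C -> 0 <= M ->
  (forall A, measurable A -> A `<=` step_dom q -> (mu A <= M%:E * leb2 A)%E) ->
  step_left q <= z.1 -> z.1 <= step_right q -> step_low q <= s -> s <= step_high q z ->
  (forall z', step_set q z s z' ->
    (P (path_event (fun i => X (lift ord0 i)) st z' (slope z z')) <=
     (C * ((step_right q - z'.1) ^+ j * (step_high q z - slope z z') ^+ k))%:E)%E) ->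
  (P (path_event X (q :: st) z s) <=
    (C * M * ((step_right q - z.1) ^+ j.+2 / (j.+1%:R * j.+2%:R) *
     ((step_high q z - s) ^+ k.+1 / k.+1%:R)))%:E)%E.
Proof.
move=> iX sn mst fq C0 M0 muM az ze los shi H.
rewrite (path_event_cons _ _ iX sn mst) /step_slope fq.
have [mD _ _] := mst.
(* With [M] inside the measure, [le_measure_integral] compares measures and integrands at once. *)
pose Ml := mscale (NngNum M0) leb2.
have mg : measurable_fun [set: pt]
    (fun z' => ((step_right q - z'.1) ^+ j * (step_high q z - slope z z') ^+ k)%:E).
  apply/measurable_EFinP; apply: measurable_funM.
    by apply: measurable_funX; apply: measurable_funB => //; exact: measurable_fst.
  by apply: measurable_funX; apply: measurable_funB => //; exact: measurable_slope.
have -> : (C * M * ((step_right q - z.1) ^+ j.+2 / (j.+1%:R * j.+2%:R) *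
     ((step_high q z - s) ^+ k.+1 / k.+1%:R)))%:E =
   (\int[Ml]_(z' in cone z z.1 (step_right q) s (step_high q z))
     (C%:E * ((step_right q - z'.1) ^+ j * (step_high q z - slope z z') ^+ k)%:E))%E.
  rewrite ge0_integral_mscale//=; last 3 first.
  - exact: measurable_cone.
  - by apply/measurable_funTS/emeasurable_funM.
  - move=> z' [/andP[z1 z2] /andP[z3 z4]]; rewrite -EFinM lee_fin mulr_ge0//.
    by rewrite mulr_ge0// exprn_ge0// subr_ge0 ltW.
  rewrite ge0_integralZl//; last 3 first.
  - exact: measurable_cone.
  - exact/measurable_funTS.
  - move=> z' [/andP[z1 z2] /andP[z3 z4]]; rewrite lee_fin.
    by rewrite mulr_ge0// exprn_ge0// subr_ge0 ltW.
  rewrite step_integral// -!EFinM; congr _%:E.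
  rewrite (exprS (step_right q - z.1) j.+1).
  move: (_ ^+ j.+1) (_ ^+ k.+1) => T S; field.
  by rewrite ?nat1r -?natrD /= ?pnatr_eq0 ?addSn.
apply: (@le_trans _ _ (\int[Ml]_(z' in step_set q z s)
     (C%:E * ((step_right q - z'.1) ^+ j * (step_high q z - slope z z') ^+ k)%:E))%E).
  apply: le_measure_integral.
  - exact: measurable_step_set.
  - move=> A mA AD; apply: muM => //.
    by apply: subset_trans AD _; exact: subIsetl.
  - by [].
  - by move=> z' zz'; rewrite -EFinM; exact: H.
have zcone : step_set q z s `<=` cone z z.1 (step_right q) s (step_high q z).
  by rewrite /step_set fq => z' [_]; rewrite (max_idPr az) (max_idPr los).
apply: ge0_subset_integral => //.
- exact: measurable_step_set.
- exact: measurable_cone.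
- by apply/measurable_funTS/emeasurable_funM.
- move=> z' [/andP[z1 z2] /andP[z3 z4]]; rewrite -EFinM lee_fin mulr_ge0//.
  by rewrite mulr_ge0// exprn_ge0// subr_ge0 ltW.
Qed.

(** The cone starts at the left end of the cell when [z] lies before it. Replacing then the factor
    [e - z.1] in [step_integral] by the smaller [e - a] gives the same form as in [link_upper]. *)
Lemma link_lower n (X : 'I_n.+1 -> Omega -> pt) (q : step) (st : seq step) (z : pt) (s : R)
    (C M : R) (j k : nat) :
  iid P mu X -> size st = n -> step_measurable (q :: st) -> step_fresh q = false ->
  step_dom q = setT -> 0 <= C -> 0 <= M ->
  (forall A, measurable A -> A `<=` step_set q z s -> (M%:E * leb2 A <= mu A)%E) ->
  maxr (step_left q) z.1 <= step_right q -> maxr (step_low q) s <= step_high q z ->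
  (forall z', step_set q z s z' ->
    ((C * ((step_right q - z'.1) ^+ j * (step_high q z - slope z z') ^+ k))%:E <=
     P (path_event (fun i => X (lift ord0 i)) st z' (slope z z')))%E) ->
  ((C * M * ((step_right q - maxr (step_left q) z.1) ^+ j.+2 / (j.+1%:R * j.+2%:R) *
     ((step_high q z - maxr (step_low q) s) ^+ k.+1 / k.+1%:R)))%:E <=
   P (path_event X (q :: st) z s))%E.
Proof.
move=> iX sn mst fq Dq C0 M0 muM ae los H.
rewrite (path_event_cons _ _ iX sn mst) /step_slope fq.
have [mD _ _] := mst.
pose a := maxr (step_left q) z.1; pose lo := maxr (step_low q) s.
have za : z.1 <= a by rewrite le_max lexx orbT.
have Sq : step_set q z s = cone z a (step_right q) lo (step_high q z).
  by rewrite /step_set fq Dq setTI.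
have mcone : measurable (cone z a (step_right q) lo (step_high q z)) := measurable_cone _ _ _ _ _.
pose Ml := mscale (NngNum M0) leb2.
have mg : measurable_fun [set: pt]
    (fun z' => ((step_right q - z'.1) ^+ j * (step_high q z - slope z z') ^+ k)%:E).
  apply/measurable_EFinP; apply: measurable_funM.
    by apply: measurable_funX; apply: measurable_funB => //; exact: measurable_fst.
  by apply: measurable_funX; apply: measurable_funB => //; exact: measurable_slope.
apply: (@le_trans _ _ (\int[Ml]_(z' in step_set q z s)
     (C%:E * ((step_right q - z'.1) ^+ j * (step_high q z - slope z z') ^+ k)%:E))%E); last first.
  apply: le_measure_integral.
  - exact: measurable_step_set.
  - by move=> A mA AS; exact: muM.
  - rewrite Sq => z' [/andP[z1 z2] /andP[z3 z4]]; rewrite -EFinM lee_fin mulr_ge0//.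
    by rewrite mulr_ge0// exprn_ge0// subr_ge0 ltW.
  - by move=> z' zz'; rewrite -EFinM; exact: H.
rewrite Sq ge0_integral_mscale//=; last 2 first.
- by apply/measurable_funTS/emeasurable_funM.
- move=> z' [/andP[z1 z2] /andP[z3 z4]]; rewrite -EFinM lee_fin mulr_ge0//.
  by rewrite mulr_ge0// exprn_ge0// subr_ge0 ltW.
rewrite ge0_integralZl//; last 2 first.
- exact/measurable_funTS.
- move=> z' [/andP[z1 z2] /andP[z3 z4]]; rewrite lee_fin.
  by rewrite mulr_ge0// exprn_ge0// subr_ge0 ltW.
rewrite step_integral// -!EFinM lee_fin -/a -/lo.
rewrite (mulrC C M) -(mulrA M C) ler_wpM2l// ler_wpM2l// ler_wpM2r//.
  by rewrite divr_ge0// exprn_ge0// subr_ge0.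
have j12 : j.+1%:R != 0 :> R /\ j.+2%:R != 0 :> R by rewrite !pnatr_eq0.
have -> : (step_right q - a) ^+ j.+2 / (j.+1%:R * j.+2%:R) =
   (step_right q - a) * ((step_right q - a) ^+ j.+1 / j.+1%:R) -
   (step_right q - a) ^+ j.+2 / j.+2%:R.
  rewrite (exprS _ j.+1); move: (_ ^+ j.+1) => T; field.
  by rewrite ?nat1r -?natrD /= ?pnatr_eq0 ?addSn.
rewrite lerD2r ler_wpM2r//; last by rewrite lerD2l lerN2.
by rewrite divr_ge0// exprn_ge0// subr_ge0.
Qed.

(** The position of a fresh point is bounded by total mass 1, which loses a single point per
    block. *)
Lemma fresh_upper n (X : 'I_n.+1 -> Omega -> pt) (q : step) (st : seq step) (z : pt) (s B : R) :
  iid P mu X -> size st = n -> step_measurable (q :: st) -> step_fresh q -> 0 <= B ->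
  (forall z', step_dom q z' ->
    (P (path_event (fun i => X (lift ord0 i)) st z' (step_low q)) <= B%:E)%E) ->
  (P (path_event X (q :: st) z s) <= B%:E)%E.
Proof.
move=> iX sn mst fq B0 H; have [mD _ _] := mst.
rewrite (path_event_cons _ _ iX sn mst) /step_slope fq.
apply: (@le_trans _ _ (\int[mu]_(z' in step_set q z s) (cst B%:E z'))%E).
  apply: le_measure_integral => //; first exact: measurable_step_set.
  by move=> z' [Dz _]; exact: H.
rewrite integral_cst//; last exact: measurable_step_set.
rewrite -[leRHS]mule1; apply: lee_pmul => //; rewrite probability_le1//.
exact: measurable_step_set.
Qed.

(** [v k] bounds the contribution of the [k] points that follow the first one of a block. The bound
    [B] for the continuation holds from every state, as a continuation begins with a fresh step; so
    bounds of successive blocks multiply. *)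
Definition block_bound (q : step) (v : nat -> R) :=
  [/\ measurable (step_dom q), measurable_fun [set: pt] (step_high q),
    (forall k, 0 <= v k) &
  forall k n st B, 0 <= B -> size st = n -> step_measurable st ->
    (forall X : 'I_n -> Omega -> pt, iid P mu X ->
       forall z s, (P (path_event X st z s) <= B%:E)%E) ->
    forall X : 'I_(k + n) -> Omega -> pt, iid P mu X -> forall z, step_dom q z ->
    (P (path_event X (nseq k q ++ st) z (step_low q)) <= (B * v k)%:E)%E].

Lemma step_measurable_cat (st st' : seq (@step R)) :
  step_measurable st -> step_measurable st' -> step_measurable (st ++ st').
Proof. by elim: st => //= q st IH [mq hq /IH{}IH] /IH. Qed.

Lemma step_measurable_nseq k (q : @step R) : measurable (step_dom q) ->
  measurable_fun [set: R * R] (step_high q) -> step_measurable (nseq k q).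
Proof. by move=> ? ?; elim: k. Qed.

(** Each point adds two integrations in the abscissa and one in the slope, whence the factorials of
    [2 k] and of [k]. *)
Lemma block_bound_flat (D : set pt) (a e lo hi M : R) : measurable D -> lo <= hi -> 0 <= M ->
  (forall z, D z -> a <= z.1 <= e) -> a <= e ->
  (forall A, measurable A -> A `<=` D -> (mu A <= M%:E * leb2 A)%E) ->
  block_bound (Step false D a e lo (cst hi))
    (fun k => M ^+ k * ((e - a) ^+ k.*2 / (k.*2)`!%:R) * ((hi - lo) ^+ k / k`!%:R)).
Proof.
move=> mD lohi M0 Dae ae muM; split => //.
  by move=> k; rewrite !mulr_ge0 ?invr_ge0// exprn_ge0// subr_ge0.
move=> k n st B B0 sn mst HB X iX z Dz.
set q := Step _ _ _ _ _ _.
(* The induction needs an arbitrary starting point and slope: the bound then depends on the width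
   and the slope range still available. *)
suff H s : lo <= s -> s <= hi -> (P (path_event X (nseq k q ++ st) z s) <=
    (B * (M ^+ k * ((e - z.1) ^+ k.*2 / (k.*2)`!%:R) * ((hi - s) ^+ k / k`!%:R)))%:E)%E.
  apply: le_trans (H _ _ _) _ => //.
  have /andP[az ze] := Dae _ Dz.
  rewrite lee_fin ler_wpM2l// ler_wpM2r ?divr_ge0 ?exprn_ge0 ?subr_ge0//.
  rewrite ler_wpM2l ?exprn_ge0// ler_wpM2r ?invr_ge0//.
  by rewrite lerXn2r ?nnegrE ?subr_ge0// lerD2l lerN2.
elim: k X iX z Dz s => [|k IH] X iX z Dz s los shi.
  by rewrite !expr0 fact0 !divr1 !mulr1; exact: HB.
have /andP[az ze] := Dae _ Dz.
have mqst : step_measurable (q :: nseq k q ++ st).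
  by split => //; apply: step_measurable_cat => //; exact: step_measurable_nseq.
have sz : size (nseq k q ++ st) = (k + n)%N by rewrite size_cat size_nseq sn.
pose C := B * (M ^+ k / (k.*2)`!%:R / k`!%:R).
have C0 : 0 <= C by rewrite !mulr_ge0 ?invr_ge0 ?exprn_ge0.
have := @link_upper _ X q (nseq k q ++ st) z s C M k.*2 k iX sz mqst erefl C0 M0 muM az ze los shi.
move=> /(_ _)/le_trans; apply.
  move=> z' [Dz' [/andP[z1 z2] /andP[z3 z4]]].
  apply: le_trans (IH _ (iid_behead iX) z' Dz' _ _ _) _; rewrite ?(ltW z4)//.
    by rewrite (le_trans _ (ltW z3))// le_max lexx.
  rewrite lee_fin /C /= le_eqVlt; apply/orP; left; apply/eqP.
  by move: (_ ^+ k.*2) (_ ^+ k) => T T'; ring.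
rewrite lee_fin le_eqVlt; apply/orP; left; apply/eqP.
rewrite /C doubleS !factS !natrM [M ^+ k.+1]exprS /=.
move: (_ ^+ k.*2.+2) (_ ^+ k.+1) (M ^+ k) => T T' T''.
have f1 : (k.*2)`!%:R != 0 :> R by rewrite pnatr_eq0 -lt0n fact_gt0.
have f2 : k`!%:R != 0 :> R by rewrite pnatr_eq0 -lt0n fact_gt0.
have f3 : k.*2.+1%:R != 0 :> R by rewrite pnatr_eq0.
have f4 : k.*2.+2%:R != 0 :> R by rewrite pnatr_eq0.
have f5 : k.+1%:R != 0 :> R by rewrite pnatr_eq0.
move: f1 f2 f3 f4 f5; move: (_`!%:R) (_`!%:R) k.*2.+1%:R k.*2.+2%:R k.+1%:R => *.
by field; do !(apply/andP; split).
Qed.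

End PathBounds.

(** * Compositions of an integer *)

Section Combinatorics.
Context {R : realType}.

Fixpoint comps (m n : nat) : seq (seq nat) :=
  if m is m'.+1 then
    flatten [seq [seq r :: c | c <- comps m' (n - r)] | r <- iota 0 n.+1]
  else if n == 0%N then [:: [::]] else [::].

Lemma mem_comps m n (c : seq nat) : (c \in comps m n) = (size c == m) && (sumn c == n).
Proof.
elim: m n c => [|m IH] n c.
  rewrite /=; case: c => [|r c]; case: n => [|n]; rewrite ?inE//=.
have -> : comps m.+1 n =
  flatten [seq [seq r :: c | c <- comps m (n - r)] | r <- iota 0 n.+1] by [].
apply/flatten_mapP/andP => [[r + /mapP[c' + ->]]|].
  rewrite mem_iota add0n /= ltnS IH => rn /andP[/eqP<- /eqP sc] /=.
  by rewrite sc subnKC.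
case: c => [|r c] [//= /eqP[sc] /eqP rc]; exists r.
  by rewrite -[0%N :: _]/(iota 0 n.+1) mem_iota add0n ltnS -rc leq_addr.
by apply/mapP; exists c => //; rewrite IH sc -rc addKn !eqxx.
Qed.

Lemma sum_cube_le (I : Type) (l : seq I) (f : I -> R) : (forall i, 0 <= f i) ->
  \sum_(i <- l) f i ^+ 3 <= (\sum_(i <- l) f i) ^+ 3.
Proof.
move=> f0; elim: l => [|i l IH]; first by rewrite !big_nil expr0n.
rewrite !big_cons; set S := \sum_(j <- l) f j in IH *.
have S0 : 0 <= S by exact: sumr_ge0.
apply: (@le_trans _ _ (f i ^+ 3 + S ^+ 3)); first by rewrite lerD2l.
by have := f0 i; nra.
Qed.

Definition weight (E : nat -> nat -> R) (c : seq nat) : R :=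
  \prod_(i < size c) E i (nth 0%N c i).

Lemma binomial_fact (a b : R) n :
  \sum_(r <- iota 0 n.+1) (a ^+ r / r`!%:R) * (b ^+ (n - r) / (n - r)`!%:R) =
  (a + b) ^+ n / n`!%:R.
Proof.
rewrite addrC exprDn mulr_suml -[iota 0 n.+1]/(index_iota 0 n.+1) big_mkord.
apply: eq_bigr => i _; have in_ : (i <= n)%N by rewrite -ltnS.
rewrite -(bin_fact in_) !natrM -mulr_natr.
have f0 k : k`!%:R != 0 :> R by rewrite pnatr_eq0 -lt0n fact_gt0.
have b0 : 'C(n, i)%:R != 0 :> R by rewrite pnatr_eq0 -lt0n bin_gt0.
by field; rewrite !f0 b0.
Qed.

(** A sum of cubes of nonnegative numbers is at most the cube of their sum, which the multinomial
    theorem evaluates. Taking one cell at a time reduces this to the binomial theorem, and each cell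
    contributes one factor [K * n.+1%:R ^+ q]. *)
Lemma sum_comps_le (E : nat -> nat -> R) (a : nat -> R) (K : R) (q m n : nat) :
  0 <= K -> (forall i, 0 <= a i) -> (forall i r, 0 <= E i r) ->
  (forall i r, (i < m)%N -> E i r <= K * (r.+1%:R ^+ q) * (a i ^+ r / r`!%:R) ^+ 3) ->
  \sum_(c <- comps m n) weight E c <=
    (K * n.+1%:R ^+ q) ^+ m * ((\sum_(i < m) a i) ^+ n / n`!%:R) ^+ 3.
Proof.
move=> K0; elim: m n E a => [|m IH] n E a a0 E0 HE.
  rewrite big_ord0 expr0 mul1r /=; case: n => [|n].
    by rewrite big_seq1 /weight big_ord0 expr0 fact0 divr1 expr1n.
  by rewrite big_nil exprn_ge0// divr_ge0// expr0n.
have -> : comps m.+1 n =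
  flatten [seq [seq r :: c | c <- comps m (n - r)] | r <- iota 0 n.+1] by [].
rewrite big_flatten big_map.
apply: (@le_trans _ _ (\sum_(r <- iota 0 n.+1)
   (K * n.+1%:R ^+ q) ^+ m.+1 * ((a 0%N ^+ r / r`!%:R) *
    ((\sum_(i < m) a i.+1) ^+ (n - r) / (n - r)`!%:R)) ^+ 3)).
  rewrite big_seq [leRHS]big_seq; apply: ler_sum => r; rewrite mem_iota add0n /= ltnS => rn.
  rewrite big_map.
  have -> : \sum_(c <- comps m (n - r)) weight E (r :: c) =
      E 0%N r * \sum_(c <- comps m (n - r)) weight (fun i => E i.+1) c.
    by rewrite mulr_sumr; apply: eq_bigr => c _; rewrite /weight big_ord_recl.
  have le1 : E 0%N r <= K * n.+1%:R ^+ q * (a 0%N ^+ r / r`!%:R) ^+ 3.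
    apply: le_trans (HE 0%N r isT) _; rewrite ler_wpM2r//.
      by rewrite exprn_ge0// divr_ge0// exprn_ge0.
    by rewrite ler_wpM2l// lerXn2r ?nnegrE// ler_nat ltnS.
  have le2 := IH (n - r)%N (fun i => E i.+1) (fun i => a i.+1)
    (fun i => a0 _) (fun i => E0 _) (fun i r im => HE i.+1 r im).
  have le3 : \sum_(c <- comps m (n - r)) weight (fun i => E i.+1) c <=
      (K * n.+1%:R ^+ q) ^+ m * ((\sum_(i < m) a i.+1) ^+ (n - r) / (n - r)`!%:R) ^+ 3.
    apply: le_trans le2 _; rewrite ler_wpM2r//.
      by rewrite exprn_ge0// divr_ge0// exprn_ge0// sumr_ge0.
    rewrite lerXn2r ?nnegrE// ?mulr_ge0// ?exprn_ge0// ler_wpM2l//.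
    by rewrite lerXn2r ?nnegrE// ler_nat ltnS leq_subr.
  apply: le_trans (ler_pM _ _ le1 le3) _ => //.
    by apply: sumr_ge0 => c _; apply: prodr_ge0.
  rewrite (exprS _ m); move: (K * n.+1%:R ^+ q) (a 0%N ^+ r / r`!%:R) (_ / (n - r)`!%:R) => U V W.
  by rewrite -subr_ge0 (_ : _ - _ = 0)//; ring.
rewrite -mulr_sumr ler_wpM2l//; first by rewrite exprn_ge0// mulr_ge0// exprn_ge0.
apply: le_trans (sum_cube_le _ _) _.
  by move=> r; rewrite mulr_ge0// divr_ge0// exprn_ge0// sumr_ge0.
by rewrite binomial_fact big_ord_recl.
Qed.

(** Of the [n.+1] terms of a binomial expansion one is at least the average; choosing such a term
    cell by cell loses one factor [n.+1] each time. *)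
Lemma comps_max (a : nat -> R) (m n : nat) : (forall i, 0 < a i) -> (0 < m)%N ->
  exists2 c : seq nat, size c = m /\ sumn c = n &
    (\sum_(i < m) a i) ^+ n / n`!%:R <=
     n.+1%:R ^+ m * \prod_(i < m) (a i ^+ nth 0%N c i / (nth 0%N c i)`!%:R).
Proof.
elim: m n a => [//|m IH] n a a0 _.
have [->|m0] := posnP m.
  exists [:: n]; first by rewrite /= addn0.
  rewrite !big_ord_recl !big_ord0 addr0 mulr1 /= expr1 ler_peMl//.
    by rewrite divr_ge0// exprn_ge0// ltW.
  by rewrite ler1n.
pose A := \sum_(i < m) a i.+1.
have A0 : 0 <= A by apply: sumr_ge0 => i _; exact: ltW.
pose f r := (a 0%N ^+ r / r`!%:R) * (A ^+ (n - r) / (n - r)`!%:R).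
have [r rn fr] : exists2 r, (r <= n)%N & (a 0%N + A) ^+ n / n`!%:R <= n.+1%:R * f r.
  have [[r rn fr]|H] := pselect (exists2 r, (r <= n)%N & (a 0%N + A) ^+ n / n`!%:R <= n.+1%:R * f r).
    by exists r.
  exfalso; have : \sum_(r <- iota 0 n.+1) n.+1%:R * f r <
      \sum_(r <- iota 0 n.+1) (a 0%N + A) ^+ n / n`!%:R.
    rewrite -[iota 0 n.+1]/(index_iota 0 n.+1) !big_mkord; apply: ltr_sum => [|i _].
      by apply/hasP; exists ord0 => //; rewrite mem_index_enum.
    by rewrite ltNge; apply/negP => H1; apply: H; exists i => //; rewrite -ltnS.
  rewrite -mulr_sumr binomial_fact -[iota 0 n.+1]/(index_iota 0 n.+1) big_mkord.
  by rewrite sumr_const card_ord mulr_natl ltxx.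
have [c [sc nc] cP] := IH (n - r)%N (fun i => a i.+1) (fun i => a0 _) m0.
exists (r :: c); first by rewrite /= sc nc subnKC.
rewrite !big_ord_recl /= -/A; apply: le_trans fr _; rewrite exprS -mulrA ler_wpM2l// /f.
rewrite [leRHS]mulrCA ler_wpM2l//; first by rewrite divr_ge0// exprn_ge0// ltW.
apply: le_trans cP _; rewrite ler_wpM2r//.
  by apply: prodr_ge0 => i _; rewrite divr_ge0// exprn_ge0// ltW.
by rewrite lerXn2r ?nnegrE// ler_nat ltnS leq_subr.
Qed.

End Combinatorics.

(** * Convex paths *)

Section Enumeration.
Context {R : realType}.
Local Notation pt := (R * R)%type.
Implicit Types (l : seq pt) (z w a b : pt) (s : R).

Fixpoint convex_path z s l : Prop :=
  if l is w :: l' then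
    [/\ z.1 < w.1, s * (w.1 - z.1) < w.2 - z.2
      & convex_path w ((w.2 - z.2) / (w.1 - z.1)) l']
  else True.

(** Slopes increase along the path, so what follows lies above the line of the first edge, which
    itself rises faster than slope [s]. *)
Lemma convex_path_above z s l w : convex_path z s l -> w \in l ->
  z.1 < w.1 /\ s * (w.1 - z.1) < w.2 - z.2.
Proof.
elim: l z s => //= a l IH z s [za sa pl]; rewrite inE => /predU1P[->//|wl].
have [aw saw] := IH _ _ pl wl.
have E : (a.2 - z.2) / (a.1 - z.1) * (a.1 - z.1) = a.2 - z.2 by rewrite divfK//; lra.
move: E saw; set q := (_ / _) => E saw.
split; first lra.
have sq : s < q by rewrite -(ltr_pM2r (x := a.1 - z.1)); lra.
have : s * (w.1 - a.1) < q * (w.1 - a.1) by rewrite ltr_pM2r; lra.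
lra.
Qed.

Lemma convex_path_orient z s l i j : convex_path z s l -> (i < j)%N -> (j < size l)%N ->
  (nth (0, 0) l i).1 < (nth (0, 0) l j).1 /\
  0 < orient z (nth (0, 0) l i) (nth (0, 0) l j).
Proof.
elim: l z s i j => //= a l IH z s i j.
move=> [za sa pl]; case: j => [|j]; first by rewrite ltn0.
have E : (a.2 - z.2) / (a.1 - z.1) * (a.1 - z.1) = a.2 - z.2 by rewrite divfK//; lra.
move: E pl; set q := (_ / _) => E pl.
case: i => [|i] ij jl /=.
  have [aw qw] := convex_path_above pl (mem_nth (0, 0) (jl : (j < size l)%N)).
  by split => //; rewrite /orient; nra.
have [] := IH _ _ _ _ pl (ij : (i < j)%N) (jl : (j < size l)%N).
have [] := convex_path_above pl (mem_nth (0, 0) (jl : (j < size l)%N)).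
have [] := convex_path_above pl (mem_nth (0, 0) (ltn_trans (ij : (i < j)%N) jl : (i < size l)%N)).
move: (nth _ l i) (nth _ l j) => u v; rewrite /orient => au qu av qv uv1 uv.
split => //.
(* [U] and [V] are the heights of [u] and [v] above the line of the first edge, which contains [z].
   Moving the viewpoint from [a] back to [z] adds [h * (V - U)] to the orientation, and [U < V]
   because [v] is further right and seen from [a] under a steeper slope. *)
have [h h0 hE] : exists2 h, 0 < h & h = a.1 - z.1 by exists (a.1 - z.1) => //; lra.
have [U U0 UE] : exists2 U, 0 < U & u.2 = a.2 + q * (u.1 - a.1) + U.
  by exists (u.2 - a.2 - q * (u.1 - a.1)); lra.
have [V V0 VE] : exists2 V, 0 < V & v.2 = a.2 + q * (v.1 - a.1) + V.
  by exists (v.2 - a.2 - q * (v.1 - a.1)); lra.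
have aE : z.2 = a.2 - q * h by rewrite hE; lra.
have uv' : 0 < (u.1 - a.1) * V - U * (v.1 - a.1).
  by move: uv; rewrite UE VE; congr (0 < _); ring.
have UV : U < V.
  rewrite -(ltr_pM2l (x := u.1 - a.1)); last lra.
  have : 0 < U * (v.1 - u.1) by rewrite mulr_gt0//; lra.
  lra.
rewrite (_ : _ - _ = ((u.1 - a.1) * V - U * (v.1 - a.1)) + h * (V - U)).
  by rewrite addr_gt0// mulr_gt0//; lra.
by rewrite UE VE aE (_ : z.1 = a.1 - h); [ring|lra].
Qed.

(* The final condition says that the last edge, ending in (1, 1), is steeper than the
   previous one. *)
Fixpoint path_end z s l : Prop :=
  if l is w :: l' then path_end w ((w.2 - z.2) / (w.1 - z.1)) l'
  else z.1 < 1 /\ z.2 + s * (1 - z.1) < 1.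

Lemma convex_path_rcons z s l : convex_path z s l -> path_end z s l ->
  convex_path z s (rcons l (1, 1)).
Proof.
elim: l z s => [|w l IH] z s /=; first by move=> _ [? ?]; split => //; lra.
by move=> [? ? ?] ?; split => //; exact: IH.
Qed.

Lemma convex_path_ccw l : convex_path (0, 0) 0 l -> path_end (0, 0) 0 l -> ccw (corners l).
Proof.
move=> pl el; have := convex_path_rcons pl el.
rewrite /corners; move: (rcons l (1, 1)) {pl el} => {}l pl.
move=> i j k ijk; rewrite [size _]/= => kl; move: ijk; case: i => [|i].
  case: j k kl => [//|j] [//|k] kl /andP[_ jk] /=.
  by have [] := convex_path_orient pl (jk : (j < k)%N) (kl : (k < size l)%N).
case: j k kl => [//|j] [|k] kl; first by rewrite ltn0 andbF.
move=> /andP[ij jk]; rewrite /=.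
have {pl} [z [s pl]] : exists z s, convex_path z s l by exists (0, 0), 0.
elim: l z s pl i j k ij jk kl => //= a l IH z s [_ _ pl] i [//|j] [//|k] ij jk kl.
case: i ij => [_|i ij] /=; first by have [] := convex_path_orient pl (jk : (j < k)%N) (kl : (k < size l)%N).
by apply: (IH _ _ pl); rewrite ltnS.
Qed.

Lemma convex_path_sub z s l w : convex_path z s l -> path_end z s l -> w \in l ->
  z.1 < w.1 < 1 /\ w.2 - z.2 < (1 - z.2) / (1 - z.1) * (w.1 - z.1).
Proof.
move=> pl el wl; have := convex_path_rcons pl el.
have [k kl <-] : exists2 k, (k < size l)%N & nth (0, 0) l k = w.
  by exists (index w l); rewrite ?index_mem// nth_index.
move=> pr; have := convex_path_orient pr (kl : (k < size l)%N).
rewrite size_rcons => /(_ (ltnSn _)); rewrite !nth_rcons kl ltnn eqxx => -[/= w1].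
have [zw _] := convex_path_above pl (mem_nth (0, 0) kl).
rewrite /orient /= => o; split; first by rewrite zw w1.
by rewrite mulrAC ltr_pdivlMr; lra.
Qed.

Lemma convex_path_triangle l : convex_path (0, 0) 0 l -> path_end (0, 0) 0 l ->
  forall w, w \in l -> open_triangle w.
Proof.
move=> pl el w wl; have [/andP[w0 w1]] := convex_path_sub pl el wl.
have [_] := convex_path_above pl wl.
rewrite /= !subr0 divr1 mul0r mul1r => w2 w21.
split; first by apply/triangleP; lra.
by move=> [] E; move: w0 w1; rewrite E /= ?ltxx.
Qed.

(** If the later point were not to the right of the earlier one, the two could not turn left both as
    seen from (0, 0) and towards (1, 1), since the earlier one is on or below the diagonal and left
    of abscissa 1. *)
Lemma ccw_lt l i j : (forall z, z \in l -> open_triangle z) -> (forall z, z \in l -> z.1 < 1) ->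
  ccw (corners l) -> (i < j)%N -> (j < size l)%N ->
  (nth (0, 0) l i).1 < (nth (0, 0) l j).1.
Proof.
move=> lT l1 cl ij jl; have il := ltn_trans ij jl.
have := cl 0%N i.+1 j.+1; have := cl i.+1 j.+1 (size l).+1.
rewrite /corners /= !ltnS ij jl size_rcons leqnn (ltn_trans jl (ltnSn _)) !nth_rcons il jl ltnn eqxx.
move=> /(_ isT isT) + /(_ isT isT).
have := l1 _ (mem_nth (0, 0) il); have [/triangleP + _] := lT _ (mem_nth (0, 0) il).
have := l1 _ (mem_nth (0, 0) jl); have [/triangleP + _] := lT _ (mem_nth (0, 0) jl).
move: (nth _ l i) (nth _ l j) => a b; rewrite /orient /= => bT b1 aT a1 o2 o1.
rewrite ltNge; apply/negP => ba.
have [u u0 uE] : exists2 u, 0 <= u & b.1 = a.1 - u by exists (a.1 - b.1); lra.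
have [v vE] : exists v, b.2 = a.2 - v by exists (a.2 - b.2); lra.
rewrite uE vE in o1 o2.
have : 0 <= u * (a.1 - a.2) by rewrite mulr_ge0//; lra.
have : v * a.1 < u * a.1 by nra.
nra.
Qed.

Lemma ccw_convex_path w l : (forall z, z \in w :: l -> open_triangle z) ->
  (forall z, z \in w :: l -> z.1 < 1) -> ccw (corners (w :: l)) ->
  0 < w.1 /\ convex_path w (w.2 / w.1) (rcons l (1, 1)).
Proof.
move=> lT l1 cl.
have wT : triangle w by have [] := lT w (mem_head _ _).
have w0 : 0 < w.1.
  have [/triangleP wT' /not_orP[wO _]] := lT w (mem_head _ _).
  rewrite lt0r; apply/andP; split; last lra.
  by apply/eqP => w10; apply: wO; apply: pair_eq => /=; lra.
split => //.
have inc i : (i.+1 < size (w :: l))%N -> (nth (0, 0) (w :: l) i).1 < (nth (0, 0) (w :: l) i.+1).1.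
  by move=> il; exact: ccw_lt.
have {cl} H : forall i, (i.+2 < size (corners (w :: l)))%N ->
   0 < orient (nth (0, 0) (corners (w :: l)) i) (nth (0, 0) (corners (w :: l)) i.+1)
     (nth (0, 0) (corners (w :: l)) i.+2) by move=> i il; apply: cl => //; rewrite !ltnSn.
(* The origin is replaced by an arbitrary previous point [z], for the induction along the chain. *)
have aux z : z.1 < w.1 -> (forall i, (i.+2 < (size l).+3)%N ->
   0 < orient (nth (0, 0) (z :: rcons (w :: l) ((1, 1) : pt)) i)
     (nth (0, 0) (z :: rcons (w :: l) ((1, 1) : pt)) i.+1)
     (nth (0, 0) (z :: rcons (w :: l) ((1, 1) : pt)) i.+2)) ->
   convex_path w ((w.2 - z.2) / (w.1 - z.1)) (rcons l (1, 1)).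
  move=> zw {}H; elim: l z w {w0 wT lT} l1 inc H zw => [|a l IH] z w l1 inc H zw.
    have := H 0%N isT; rewrite /orient /= => o.
    have w1 := l1 w (mem_head _ _).
    by split => //; rewrite mulrAC ltr_pdivrMr; lra.
  have := H 0%N isT; rewrite /= => o.
  have wa : w.1 < a.1 by exact: (inc 0%N isT).
  split => //.
    by rewrite mulrAC ltr_pdivrMr ?subr_gt0//; move: o; rewrite /orient; lra.
  apply: IH => //.
  - by move=> u ul; apply: l1; rewrite inE ul orbT.
  - by move=> i il; exact: (inc i.+1 il).
  - by move=> i il; exact: (H i.+1 il).
have := aux (0, 0) w0; rewrite /= !subr0; apply=> i il; apply: H.
by rewrite /= !size_rcons.
Qed.

End Enumeration.

(** * Enumeration and interpolation of a convex chain *)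

Section ChainEnumeration.
Context {R : realType}.
Local Notation pt := (R * R)%type.
Implicit Types (l : seq pt) (C : set pt).

Lemma ccw_convex_chain l : (forall z, z \in l -> open_triangle z) -> ccw (corners l) ->
  convex_chain [set` l].
Proof.
move=> lT cl; split; [by apply/finite_seqP; exists l|exact: lT|exact: ccw_convex_position].
Qed.

Lemma sorted_lex_corners l : (forall z, z \in l -> open_triangle z) -> sorted (@lex R) l ->
  sorted (@lex R) (corners l).
Proof.
move=> lT sl; rewrite /corners /=.
have lex0 z : triangle z -> lex (0, 0) z.
  by move=> /triangleP zT; rewrite /lex /=; case: ltgtP => /=; lra.
have lex1 z : triangle z -> lex z (1, 1).
  by move=> /triangleP zT; rewrite /lex /=; case: ltgtP => /=; lra.
have T1 : triangle ((1, 1) : pt) by apply/triangleP => /=; lra.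
case: l lT sl => [|a l] lT /= sl; first by rewrite lex0.
rewrite lex0 /=; last by have [] := lT a (mem_head _ _).
rewrite rcons_path sl /= lex1//.
by have [] := lT _ (mem_last a l).
Qed.

(** Lexicographic sorting keeps (0, 0) first and (1, 1) last, and makes [orient_gt0] applicable to
    every triple in this order. *)
Lemma convex_chain_seq C : convex_chain C ->
  exists l, [/\ [set` l] = C, forall z, z \in l -> open_triangle z, uniq l & ccw (corners l)].
Proof.
move=> [/finite_seqP[s ->] CT cp].
pose l := sort (@lex R) (undup s).
have ls z : (z \in l) = (z \in s) by rewrite mem_sort mem_undup.
have lT z : z \in l -> open_triangle z by rewrite ls => /CT.
have ul : uniq l by rewrite sort_uniq undup_uniq.
exists l; split => //; first by apply/seteqP; split => z /=; rewrite ls.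
have slc := sorted_lex_corners lT (sort_sorted (@lex_total R) _).
have uc : uniq (corners l).
  have O : ((0, 0) : pt) \notin l by apply/negP => /lT[_]; apply; left.
  have E : ((1, 1) : pt) \notin l by apply/negP => /lT[_]; apply; right.
  rewrite /corners cons_uniq mem_rcons rcons_uniq E ul /= inE negb_or O !andbT.
  by apply/eqP => -[/eqP]; rewrite eq_sym oner_eq0.
have sc : size (corners l) = (size l).+2 by rewrite /= size_rcons.
move=> i j k /andP[ij jk] kl.
have jl := ltn_trans jk kl; have il := ltn_trans ij jl.
have inS m : (m < size (corners l))%N ->
    ([set` s] `|` [set ((0, 0) : pt); (1, 1)]) (nth (0, 0) (corners l) m) /\
    triangle (nth (0, 0) (corners l) m).
  move=> ml; have : nth (0, 0) (corners l) m \in corners l by rewrite mem_nth.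
  rewrite /corners inE mem_rcons inE => /orP[/eqP->|/orP[/eqP->|zl]].
  - by split; [right; left|apply/triangleP => /=; lra].
  - by split; [right; right|apply/triangleP => /=; lra].
  - by split; [left; rewrite /= -ls|have [] := lT _ zl].
have [Si Ti] := inS _ il; have [Sj Tj] := inS _ jl; have [Sk Tk] := inS _ kl.
apply: (orient_gt0 cp) => //; try by right; [left|right].
- by right; left.
- by right; right.
- by apply: (sorted_ltn_nth (@lex_trans R)).
- by apply: (sorted_ltn_nth (@lex_trans R)).
- by rewrite nth_uniq// ltn_eqF.
- by rewrite nth_uniq// ltn_eqF.
- have -> : (0, 0) = nth (0, 0) (corners l) 0 by [].
  by rewrite nth_uniq// gtn_eqF// (leq_ltn_trans _ ij).
- have -> : (1, 1) = nth (0, 0) (corners l) (size l).+1.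
    by rewrite /= nth_rcons ltnn eqxx.
  rewrite nth_uniq// ?sc// ltn_eqF//.
  by move: kl; rewrite sc ltnS; exact: leq_trans.
Qed.

(** The interpolant is the maximum of 0 and of the lines through consecutive points. By orientation
    each line passes on or below all the other points, so at every abscissa of the chain the maximum
    is attained by an adjacent edge. *)
Lemma chain_interpolant l : (forall z, z \in l -> open_triangle z) ->
  (forall z, z \in l -> z.1 < 1) -> ccw (corners l) ->
  exists h : R -> R, [/\ forall x y t, 0 <= t <= 1 ->
      h (t * x + (1 - t) * y) <= t * h x + (1 - t) * h y,
    forall x, 0 <= h x, h 0 = 0, h 1 = 1 & forall z, z \in l -> h z.1 = z.2].
Proof.
move=> lT l1 cl; pose q i : pt := nth (0, 0) (corners l) i.
have sc : size (corners l) = (size l).+2 by rewrite /= size_rcons.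
have q0 : q 0%N = (0, 0) by [].
have qE : q (size l).+1 = (1, 1) by rewrite /q /= nth_rcons ltnn eqxx.
have ql i : (i < size l)%N -> q i.+1 = nth (0, 0) l i by move=> il; rewrite /q /= nth_rcons il.
have l0 z : z \in l -> 0 < z.1.
  move=> zl; have [/triangleP zT /not_orP[zO _]] := lT z zl.
  rewrite lt0r; apply/andP; split; last lra.
  by apply/eqP => z10; apply: zO; apply: pair_eq => /=; lra.
have inc i : (i < (size l).+1)%N -> (q i).1 < (q i.+1).1.
  case: i => [|i] il.
    case: (posnP (size l)) => [s0|s0]; first by rewrite q0 -{1}s0 qE /=.
    by rewrite q0 ql//= l0// mem_nth.
  rewrite ql//; move: il; rewrite ltnS leq_eqVlt => /predU1P[il|il].
    by rewrite il qE l1// mem_nth// -il.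
  by rewrite ql//; apply: ccw_lt.
pose L i x := (q i).2 + ((q i.+1).2 - (q i).2) / ((q i.+1).1 - (q i).1) * (x - (q i).1).
pose h x := \big[maxr/0]_(i < (size l).+1) L i x.
have L1 i : (i < (size l).+1)%N -> L i (q i).1 = (q i).2 by rewrite /L subrr mulr0 addr0.
have L2 i : (i < (size l).+1)%N -> L i (q i.+1).1 = (q i.+1).2.
  by move=> /inc ii; rewrite /L divfK ?subr_eq0 ?gt_eqF// addrC subrK.
have Lle i k : (i < (size l).+1)%N -> (k < (size l).+2)%N -> L i (q k).1 <= (q k).2.
  move=> il kl; have ii := inc _ il.
  have [ki|ik|->] := ltngtP k i; last by rewrite L1.
  - have := cl k i i.+1; rewrite ki ltnSn sc ltnS il => /(_ isT isT).
    rewrite -/(q k) -/(q i) -/(q i.+1) /orient /L mulrAC -lerBrDl ler_pdivrMr ?subr_gt0//; clear; lra.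
  move: ik; rewrite leq_eqVlt => /predU1P[<-|ik]; first by rewrite L2.
  have := cl i i.+1 k; rewrite ik ltnSn sc kl => /(_ isT isT).
  rewrite -/(q k) -/(q i) -/(q i.+1) /orient /L mulrAC -lerBrDl ler_pdivrMr ?subr_gt0//; clear; lra.
have q20 k : (k < (size l).+2)%N -> 0 <= (q k).2.
  case: k => [|k]; first by rewrite q0.
  rewrite ltnS ltnS leq_eqVlt => /predU1P[->|kl]; first by rewrite qE ler01.
  by rewrite ql//; have [/triangleP[]] := lT _ (mem_nth (0, 0) kl).
have hq k : (k < (size l).+2)%N -> h (q k).1 = (q k).2.
  move=> kl; apply/eqP; rewrite eq_le; apply/andP; split.
    by apply: bigmax_le => [|i _]; [exact: q20|exact: Lle].
  case: k kl => [|k] kl.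
    by rewrite -(L1 0%N)//; exact: (le_bigmax 0 (fun i : 'I_(size l).+1 => L i _) ord0).
  rewrite -(L2 k)//.
  exact: (le_bigmax 0 (fun i : 'I_(size l).+1 => L i _) (Ordinal (kl : (k < (size l).+1)%N))).
have h0 x : 0 <= h x by rewrite /h; exact: bigmax_ge_id.
exists h; split => //.
- move=> x y t /andP[t0 t1]; apply: bigmax_le => [|i _].
    by rewrite addr_ge0// mulr_ge0// subr_ge0.
  apply: (@le_trans _ _ (t * L i x + (1 - t) * L i y)).
    by rewrite le_eqVlt /L; apply/orP; left; apply/eqP; ring.
  by rewrite lerD// ler_wpM2l ?subr_ge0//; exact: (le_bigmax 0 (fun i : 'I_(size l).+1 => L i _) i).
- by have := hq 0%N isT; rewrite q0.
- by have := hq _ (ltnSn (size l).+1); rewrite qE.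
- move=> z zl; have il : (index z l < size l)%N by rewrite index_mem.
  by have := hq (index z l).+1; rewrite ql// nth_index// ltnS ltnS => /(_ (ltnW il)).
Qed.

End ChainEnumeration.

(** * Measurability of the two events *)

Section MeasurableEvents.
Context {R : realType} d (Omega : measurableType d).
Local Notation pt := (R * R)%type.

Lemma measurable_exists (I : countType) (Q : I -> Omega -> Prop) :
  (forall i, measurable [set w | Q i w]) -> measurable [set w | exists i, Q i w].
Proof.
move=> mQ; rewrite (_ : mkset _ = \bigcup_i [set w | Q i w]); last first.
  by apply/seteqP; split => w /=; [move=> [i Qi]; exists i|move=> [i _ Qi]; exists i].
by apply: countable_bigcupT_measurable.
Qed.

Lemma measurable_forall (I : countType) (Q : I -> Omega -> Prop) :
  (forall i, measurable [set w | Q i w]) -> measurable [set w | forall i, Q i w].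
Proof.
move=> mQ; rewrite (_ : mkset _ = ~` [set w | exists i, ~ Q i w]).
  by apply: measurableC; apply: measurable_exists => i; exact: (measurableC (mQ i)).
by apply/seteqP; split => w /=; [move=> H [i]; apply; exact: H|move=> /forallNP H i; exact: contrapT].
Qed.

Lemma measurable_impl (A : Prop) (Q : Omega -> Prop) :
  (A -> measurable [set w | Q w]) -> measurable [set w | A -> Q w].
Proof.
move=> mQ; have [a|na] := pselect A.
  rewrite (_ : mkset _ = [set w | Q w]); first exact: mQ.
  by apply/seteqP; split => w /=; tauto.
by rewrite (_ : mkset _ = setT)//; apply/seteqP; split => w /=; tauto.
Qed.

Lemma measurable_and (Q1 Q2 : Omega -> Prop) : measurable [set w | Q1 w] ->
  measurable [set w | Q2 w] -> measurable [set w | Q1 w /\ Q2 w].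
Proof. exact: measurableI. Qed.

Lemma measurable_const (A : Prop) : measurable [set _ : Omega | A].
Proof.
have [a|na] := pselect A.
  by rewrite (_ : mkset _ = setT)//; apply/seteqP; split.
by rewrite (_ : mkset _ = set0)//; apply/seteqP; split.
Qed.

Lemma measurable_triangle : measurable (@triangle R).
Proof.
rewrite (_ : triangle = [set z : pt | 0 <= z.2] `&` [set z : pt | z.2 <= z.1] `&` [set z : pt | z.1 <= 1]).
  by apply: measurableI; first apply: measurableI; apply: measurable_le_set => //;
    exact: measurable_cst.
apply/seteqP; split => z /=; first by move=> /triangleP; tauto.
by move=> ?; apply/triangleP; tauto.
Qed.

Lemma measurable_open_triangle : measurable (@open_triangle R).
Proof.
apply: measurableD; first exact: measurable_triangle.
have m1 (a b : R) : measurable [set ((a, b) : pt)].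
  rewrite (_ : [set _] = [set a] `*` [set b]); first exact: measurableX.
  by apply/seteqP; split => -[u v] /=; [move=> [-> ->]|move=> [-> ->]].
by apply: measurableU; exact: m1.
Qed.

Lemma measurable_nth_seq (s : seq (Omega -> pt)) i :
  (forall f, List.In f s -> measurable_fun [set: Omega] f) ->
  measurable_fun [set: Omega] (fun w => nth (0, 0) [seq f w | f <- s] i).
Proof.
elim: s i => [|f s IH] [|i] H /=; try exact: measurable_cst.
  by apply: H; left.
by apply: IH => g gs; apply: H; right.
Qed.

Lemma measurable_ccw (s : seq (Omega -> pt)) :
  (forall f, List.In f s -> measurable_fun [set: Omega] f) ->
  measurable [set w | ccw [seq f w | f <- s]].
Proof.
move=> H; have m1 i : measurable_fun [set: Omega] (fun w => (nth (0, 0) [seq f w | f <- s] i).1).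
  by apply: (measurableT_comp (@measurable_fst _ _ _ _)); exact: measurable_nth_seq.
have m2 i : measurable_fun [set: Omega] (fun w => (nth (0, 0) [seq f w | f <- s] i).2).
  by apply: (measurableT_comp (@measurable_snd _ _ _ _)); exact: measurable_nth_seq.
rewrite (_ : mkset _ = [set w | forall i j k, (i < j < k)%N -> (k < size s)%N ->
    0 < orient (nth (0, 0) [seq f w | f <- s] i) (nth (0, 0) [seq f w | f <- s] j)
      (nth (0, 0) [seq f w | f <- s] k)]); last first.
  by apply/seteqP; split => w /=; rewrite /ccw size_map.
do 3 apply: measurable_forall => ?; apply: measurable_impl => _.
apply: measurable_impl => _; apply: measurable_lt_set; first exact: measurable_cst.
by rewrite /orient; apply: measurable_funB; apply: measurable_funM; apply: measurable_funB.
Qed.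

(** The event is a countable union over index sequences [e] that list the points counterclockwise.
    An index may be left out of [e] if its point coincides with a listed one, as samples may
    coincide. *)
Lemma measurable_convex_chain n (X : 'I_n -> Omega -> pt) :
  (forall i, measurable_fun [set: Omega] (X i)) ->
  measurable [set w | convex_chain (range (fun i => X i w))].
Proof.
move=> mX.
have [cs [csE mcs]] : exists cs : seq 'I_n -> seq (Omega -> pt),
    (forall e w, [seq f w | f <- cs e] = corners [seq X i w | i <- e]) /\
    forall e f, List.In f (cs e) -> measurable_fun [set: Omega] f.
  exists (fun e => cst (0, 0) :: rcons [seq X i | i <- e] (cst (1, 1))); split => e.
    by move=> w; rewrite /corners /= map_rcons -map_comp.
  move=> f /= -[<-|]; first exact: measurable_cst.
  rewrite -cats1 => /List.in_app_iff[|[<-|//]]; last exact: measurable_cst.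
  by move=> /List.in_map_iff[i [<- _]].
rewrite (_ : mkset _ = [set w | exists e : seq 'I_n,
   (forall i, open_triangle (X i w)) /\
   (forall i, exists j, (j \in e) /\ X i w = X j w) /\
   ccw [seq f w | f <- cs e]]); last first.
  apply/seteqP; split => w /=.
    move=> /convex_chain_seq[l [lE lT _ cl]].
    have [e eE] : exists e : seq 'I_n, [seq X i w | i <- e] = l.
      have : forall z, z \in l -> exists i, X i w = z.
        by move=> z zl; have : [set` l] z by []; rewrite lE => -[i _ <-]; exists i.
      elim: l {lE lT cl} => [|z l IH] zl; first by exists [::].
      have [i iz] := zl z (mem_head _ _).
      have [|e eE] := IH; first by move=> u ul; apply: zl; rewrite inE ul orbT.
      by exists (i :: e); rewrite /= iz eE.
    exists e; rewrite csE eE; split; last split => //.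
      by move=> i; apply: lT; have : [set` l] (X i w) by rewrite lE; exists i.
    move=> i; have : X i w \in l by have : [set` l] (X i w) by rewrite lE; exists i.
    by rewrite -eE => /mapP[j je ->]; exists j.
  move=> [e [XT [Xe]]]; rewrite csE => cl.
  rewrite [X in convex_chain X](_ : _ = [set` [seq X i w | i <- e]]).
    by apply: ccw_convex_chain => // z /mapP[i _ ->]; exact: XT.
  apply/seteqP; split => z /=; last by move=> /mapP[i _ ->]; exists i.
  by move=> [i _ <-]; have [j [je ->]] := Xe i; rewrite map_f.
apply: measurable_exists => e; apply: measurable_and; last apply: measurable_and.
- apply: measurable_forall => i; rewrite -[X in measurable X]setTI.
  by apply: mX => //; exact: measurable_open_triangle.
- apply: measurable_forall => i; apply: measurable_exists => j; apply: measurable_and.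
    exact: measurable_const.
  have m1 k : measurable_fun [set: Omega] (fun w => (X k w).1).
    by apply: (measurableT_comp (@measurable_fst _ _ _ _)).
  have m2 k : measurable_fun [set: Omega] (fun w => (X k w).2).
    by apply: (measurableT_comp (@measurable_snd _ _ _ _)).
  rewrite (_ : mkset _ = [set w | (X i w).1 <= (X j w).1] `&` [set w | (X j w).1 <= (X i w).1] `&`
     ([set w | (X i w).2 <= (X j w).2] `&` [set w | (X j w).2 <= (X i w).2])).
    by apply: measurableI; apply: measurableI; exact: measurable_le_set.
  apply/seteqP; split => w /=; first by move=> ->; rewrite !lexx.
  by move=> [[? ?] [? ?]]; apply: pair_eq; apply/eqP; rewrite eq_le; apply/andP.
apply: measurable_ccw; exact: mcs.
Qed.

(** A union over all of [Phi] is uncountable. By continuity, a function that is close to the points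
    stays close on a whole box around them with rational centre and radius 1/(k+1), so countably
    many boxes suffice. *)
Lemma measurable_close_to_some n (X : 'I_n -> Omega -> pt) (Phi : set (R -> R)) (eps : R) :
  (forall i, measurable_fun [set: Omega] (X i)) -> 0 < eps ->
  (forall f, Phi f -> {within `[0, 1], continuous f}) ->
  measurable [set w | (forall i, triangle (X i w)) /\
    exists2 f, Phi f & max_deviation f (fun i => X i w) < eps].
Proof.
move=> mX e0 cPhi.
pose box (q : {ffun 'I_n -> rat * rat}) (k : nat) (i : 'I_n) : set pt :=
  [set z : pt | ((ratr (q i).1 - k.+1%:R^-1 < z.1) && (z.1 < ratr (q i).1 + k.+1%:R^-1)) &&
    ((ratr (q i).2 - k.+1%:R^-1 < z.2) && (z.2 < ratr (q i).2 + k.+1%:R^-1))].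
pose good q k := exists2 f, Phi f &
  forall s : 'I_n -> pt, (forall i, triangle (s i) /\ box q k i (s i)) -> max_deviation f s < eps.
rewrite (_ : mkset _ = [set w | exists qk : {ffun 'I_n -> rat * rat} * nat,
   good qk.1 qk.2 /\ forall i, triangle (X i w) /\ box qk.1 qk.2 i (X i w)]); last first.
  apply/seteqP; split => w /=; last first.
    move=> [[q k] [[f Pf Hf] Hw]]; split; first by move=> i; case: (Hw i).
    by exists f => //; exact: Hf.
  move=> [XT [f Pf /bigmax_ltP[_ Xf]]].
  have H i : exists2 dl, 0 < dl & forall z, triangle z -> `|z.1 - (X i w).1| < dl ->
      `|z.2 - (X i w).2| < dl -> `|f z.1 - z.2| < eps.
    have g0 : 0 < (eps - `|f (X i w).1 - (X i w).2|) / 2 by have := Xf i isT; lra.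
    have /triangleP Ti := XT i.
    have xi : `[0, 1]%classic (X i w).1 by rewrite /= in_itv /=; lra.
    have /subspace_continuousP/(_ _ xi)/cvgrPdist_lt/(_ _ g0) := cPhi _ Pf.
    rewrite near_withinE => /nbhs_ballP[dl /= dl0 Hdl].
    exists (minr dl ((eps - `|f (X i w).1 - (X i w).2|) / 2)); first by rewrite lt_min dl0.
    move=> z /triangleP zT; rewrite !lt_min => /andP[z1 _] /andP[_ z2].
    have z01 : `[0, 1]%classic z.1 by rewrite /= in_itv /=; lra.
    have := Hdl z.1; rewrite /ball /= distrC => /(_ z1 z01).
    have -> : f z.1 - z.2 = (f (X i w).1 - (X i w).2) - (f (X i w).1 - f z.1) - (z.2 - (X i w).2).
      by ring.
    move=> fz; apply: le_lt_trans (ler_normB _ _) _.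
    apply: le_lt_trans (lerD (ler_normB _ _) (lexx _)) _.
    move: fz z2 g0; lra.
  have /choice[dl Hdl] : forall i, exists dl, 0 < dl /\ forall z, triangle z ->
      `|z.1 - (X i w).1| < dl -> `|z.2 - (X i w).2| < dl -> `|f z.1 - z.2| < eps.
    by move=> i; have [dl ? ?] := H i; exists dl.
  have [k kdl] : exists k : nat, forall i, k.+1%:R^-1 + k.+1%:R^-1 < dl i.
    pose m := \big[minr/1]_i dl i.
    have m0 : 0 < m by apply/bigmin_gtP; split => // i _; case: (Hdl i).
    have [k _ Hk] := near_infty_natSinv_lt (PosNum (divr_gt0 m0 (ltr0n _ 2))).
    exists k => i; have := Hk k (leqnn _) => /= km.
    apply: (@lt_le_trans _ _ m); last exact: bigmin_le.
    by rewrite [ltRHS](splitr m) ltrD.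
  have [rho rhoE] : exists rho : R, k.+1%:R^-1 = rho by exists (k.+1%:R^-1).
  have k0 : 0 < rho by rewrite -rhoE invr_gt0.
  rewrite rhoE in kdl.
  have /choice[q Hq] : forall i : 'I_n, exists q : rat * rat,
      (`|ratr q.1 - (X i w).1| < rho) && (`|ratr q.2 - (X i w).2| < rho).
    move=> i.
    have [q1] := @rat_in_itvoo R ((X i w).1 - rho) ((X i w).1 + rho) ltac:(lra).
    have [q2] := @rat_in_itvoo R ((X i w).2 - rho) ((X i w).2 + rho) ltac:(lra).
    rewrite !in_itv /= => /andP[? ?] /andP[? ?]; exists (q1, q2) => /=.
    by rewrite !ltr_norml; apply/andP; split; apply/andP; split; lra.
  exists ([ffun i => q i], k); split => /=; last first.
    move=> i; split => //; have := Hq i; rewrite /box /= ffunE rhoE !ltr_norml.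
    by move=> /andP[/andP[? ?] /andP[? ?]]; apply/andP; split; apply/andP; split; lra.
  exists f => // s Hs; apply/bigmax_ltP; split => // i _.
  have [_ Hi] := Hdl i; have [sT] := Hs i; rewrite /box /= ffunE rhoE => sb.
  apply: Hi => //.
    have kd := kdl i; have := Hq i; rewrite !ltr_norml => /andP[/andP[? ?] _].
    move: sb => /andP[/andP[? ?] _].
    by apply/andP; split; lra.
  have kd := kdl i; have := Hq i; rewrite !ltr_norml => /andP[_ /andP[? ?]].
  by move: sb => /andP[_ /andP[? ?]]; apply/andP; split; lra.
apply: measurable_exists => -[q k] /=; apply: measurable_and; first exact: measurable_const.
apply: measurable_forall => i; rewrite -[X in measurable X]setTI.
apply: (mX i measurableT (triangle `&` box q k i)).
apply: measurableI; first exact: measurable_triangle.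
rewrite (_ : box q k i = ([set z : pt | ratr (q i).1 - k.+1%:R^-1 < z.1] `&` [set z : pt | z.1 < ratr (q i).1 + k.+1%:R^-1]) `&`
    ([set z : pt | ratr (q i).2 - k.+1%:R^-1 < z.2] `&` [set z : pt | z.2 < ratr (q i).2 + k.+1%:R^-1])).
  by apply: measurableI; apply: measurableI; apply: measurable_lt_set => //; exact: measurable_cst.
by apply/seteqP; split => z /=; rewrite /box /=; [move=> /andP[/andP[? ?] /andP[? ?]]|move=> [[? ?] [? ?]]; apply/andP; split; apply/andP].
Qed.

End MeasurableEvents.

(** * Blocks and strips *)

Section Blocks.
Context {R : realType} d (Omega : measurableType d) (P : probability Omega R)
  (mu : probability (measurableTypeR R * measurableTypeR R)%type R).
Local Notation pt := (measurableTypeR R * measurableTypeR R)%type.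
Local Notation leb2 := (@lebesgue_measure R \x @lebesgue_measure R)%E.

(** No uniform bound on slopes exists next to 1; the upper end is the slope of the chord to (1, 1),
    which varies with the point. The controlled quantity is the distance from (1, 1) down to the
    point where the current edge, prolonged, reaches abscissa 1. *)
Lemma block_bound_corner (D : set pt) (a M : R) : measurable D -> 0 <= M -> a <= 1 ->
  (forall z, D z -> [/\ a <= z.1, z.1 < 1, 0 <= z.2 & z.2 <= 1]) ->
  (forall A, measurable A -> A `<=` D -> (mu A <= M%:E * leb2 A)%E) ->
  block_bound P mu (Step false D a 1 0 (fun z => slope z (1, 1)))
    (fun k => M ^+ k * ((1 - a) ^+ k / (k`!%:R * k`!%:R * k.+1`!%:R))).
Proof.
move=> mD M0 a1 Dae muM; split => //=.
- rewrite /slope; apply: measurable_funM; first by apply: measurable_funB.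
  by apply: (measurableT_comp measurable_inv); apply: measurable_funB.
- by move=> k; rewrite mulr_ge0 ?exprn_ge0// divr_ge0 ?exprn_ge0 ?mulr_ge0// subr_ge0.
move=> k n st B B0 sn mst HB X iX z Dz.
set q := Step _ _ _ _ _ _.
have mhi : measurable_fun [set: pt] (step_high q).
  rewrite /= /slope; apply: measurable_funM; first by apply: measurable_funB.
  by apply: (measurableT_comp measurable_inv); apply: measurable_funB.
suff H s : 0 <= s -> s <= step_high q z -> (P (path_event X (nseq k q ++ st) z s) <=
    (B * (M ^+ k * ((1 - z.1) ^+ k * ((1 - z.1) * (step_high q z - s)) ^+ k /
      (k`!%:R * k`!%:R * k.+1`!%:R))))%:E)%E.
  have [az z1 z20 z21] := Dae _ Dz.
  apply: le_trans (H _ _ _) _ => //.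
    by rewrite /= /slope /= divr_ge0// subr_ge0// ltW.
  rewrite lee_fin ler_wpM2l// ler_wpM2l ?exprn_ge0// ler_wpM2r//.
  have -> : (1 - z.1) * (step_high q z - 0) = 1 - z.2.
    by rewrite /= /slope /= subr0 mulrC divfK; lra.
  rewrite -[leRHS]mulr1 ler_pM ?exprn_ge0//; try lra.
    by rewrite lerXn2r ?nnegrE; lra.
  by rewrite exprn_ile1; lra.
elim: k X iX z Dz s => [|k IH] X iX z Dz s s0 shi.
  rewrite [X in (_ <= X%:E)%E](_ : _ = B); first exact: HB.
  by rewrite !expr0 !factS !fact0 !muln1 !mul1r !mulr1n; field.
have [az z1 z20 z21] := Dae _ Dz.
have mqst : step_measurable (q :: nseq k q ++ st).
  by split => //; apply: step_measurable_cat => //; exact: step_measurable_nseq.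
have sz : size (nseq k q ++ st) = (k + n)%N by rewrite size_cat size_nseq sn.
pose C := B * (M ^+ k * (1 - z.1) ^+ k / (k`!%:R * k`!%:R * k.+1`!%:R)).
have C0 : 0 <= C.
  by rewrite !mulr_ge0 ?invr_ge0 ?mulr_ge0 ?exprn_ge0//; lra.
have := @link_upper _ _ _ _ mu _ X q (nseq k q ++ st) z s C M k k iX sz mqst erefl C0 M0 muM az (ltW z1) s0 shi.
move=> /(_ _)/le_trans; apply.
  move=> z' [Dz' [/andP[zz1 zz2] /andP[zz3 zz4]]].
  move: zz1 zz3; rewrite /= !gt_max => /andP[_ zz1] /andP[zz0 zz3].
  have [az' z1' z20' z21'] := Dae _ Dz'.
  (* Both sides are that distance for the edge from [z] to [z'], computed from either of its
     ends. *)
  have E : (1 - z'.1) * (step_high q z' - slope z z') = (1 - z.1) * (step_high q z - slope z z').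
    rewrite /= /slope /=; field; apply/andP; split; lra.
  have shi' : slope z z' <= step_high q z'.
    have : 0 <= (1 - z.1) * (step_high q z - slope z z').
      by rewrite mulr_ge0// subr_ge0 ltW.
    by rewrite -E pmulr_rge0 ?subr_ge0 ?subr_gt0.
  apply: le_trans (IH _ (iid_behead iX) z' Dz' _ (ltW zz0) shi') _.
  rewrite lee_fin E /C [X in X <= _](_ : _ = C * ((1 - z'.1) ^+ k * (step_high q z - slope z z') ^+ k))//.
  rewrite /C exprMn.
  by move: (_ ^+ k) (_ ^+ k) (_ ^+ k) (_ ^+ k) => T T' T1 T2; ring.
rewrite lee_fin le_eqVlt; apply/orP; left; apply/eqP.
rewrite /C [step_right q]/= (factS k.+1) (factS k) !natrM [M ^+ k.+1]exprS exprMn !(exprS _ k.+1) (exprS (1 - z.1) k).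
have f2 : k`!%:R != 0 :> R by rewrite pnatr_eq0 -lt0n fact_gt0.
have f4 : k.+2%:R != 0 :> R by rewrite pnatr_eq0.
have f5 : k.+1%:R != 0 :> R by rewrite pnatr_eq0.
move: (_ ^+ k.+1) (_ ^+ k) (M ^+ k) f2 f4 f5; move: (_`!%:R) k.+2%:R k.+1%:R => *.
by field; do ?(apply/andP; split).
Qed.

Definition fresh (q : @step R) : step :=
  Step true (step_dom q) (step_left q) (step_right q) (step_low q) (step_high q).

Definition block (q : @step R) (r : nat) : seq step :=
  if r is r'.+1 then fresh q :: nseq r' q else [::].

Fixpoint blocks (q : nat -> @step R) (c : seq nat) : seq step :=
  if c is r :: c' then block (q 0%N) r ++ blocks (fun i => q i.+1) c' else [::].

Lemma size_blocks q c : size (blocks q c) = sumn c.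
Proof.
elim: c q => //= r c IH q; rewrite size_cat IH; case: r => //= r.
by rewrite size_nseq.
Qed.

(** The first point of a block is free, so [r'.+1] points weigh [v i r']. *)
Definition block_weight (v : nat -> nat -> R) (i r : nat) : R :=
  if r is r'.+1 then v i r' else 1.

Lemma step_measurable_blocks q (v : nat -> nat -> R) c :
  (forall i, (i < size c)%N -> block_bound P mu (q i) (v i)) -> step_measurable (blocks q c).
Proof.
elim: c q v => //= r c IH q v H.
have [m1 m2 _ _] := H 0%N isT.
apply: step_measurable_cat.
  by case: r {H} => //= r; split => //; exact: step_measurable_nseq.
by apply: (IH _ (fun i => v i.+1)) => i ic; exact: H.
Qed.

Lemma path_event_blocks q (v : nat -> nat -> R) c :
  (forall i, (i < size c)%N -> block_bound P mu (q i) (v i)) ->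
  forall X : 'I_(sumn c) -> Omega -> pt, iid P mu X -> forall z s,
  (P (path_event X (blocks q c) z s) <= (weight (block_weight v) c)%:E)%E.
Proof.
elim: c q v => [|r c IH] q v H X iX z s.
  rewrite /weight big_ord0 [X in P X](_ : _ = setT) ?probability_setT//.
  by rewrite -subTset => w _; change (path [::] z s (tuple_of X w)); rewrite (tuple0 (tuple_of X w)).
have H' i : (i < size c)%N -> block_bound P mu (q i.+1) (v i.+1) by move=> ic; exact: H.
have {}IH := IH _ _ H'.
have v0 i k : (i < (size c).+1)%N -> 0 <= v i k by move=> ic; case: (H i ic) => _ _ /(_ k).
have W0 : 0 <= weight (block_weight (fun i => v i.+1)) c.
  by apply: prodr_ge0 => i _; rewrite /block_weight; case: (nth _ _ _) => // k; apply: v0; rewrite ltnS.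
have WE : weight (block_weight v) (r :: c) =
    block_weight v 0%N r * weight (block_weight (fun i => v i.+1)) c.
  by rewrite /weight big_ord_recl.
have [m1 m2 _ bb] := H 0%N isT.
rewrite WE; case: r X iX {H WE} => [|r] X iX; first by rewrite mul1r; exact: IH.
have ms := step_measurable_blocks H'.
rewrite mulrC.
apply: (@fresh_upper _ _ _ P mu (r + sumn c)%N X (fresh (q 0%N))
  (nseq r (q 0%N) ++ blocks (fun i => q i.+1) c)) => //.
- by rewrite size_cat size_nseq size_blocks.
- by split => //; apply: step_measurable_cat => //; exact: step_measurable_nseq.
- by rewrite mulr_ge0//; exact: v0.
move=> z' Dz'; apply: bb => //; first exact: size_blocks.
exact: iid_behead iX.
Qed.

End Blocks.

(** * Lower bounds for paths through consecutive strips *)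

Section LowerBlocks.
Context {R : realType} d (Omega : measurableType d) (P : probability Omega R)
  (mu : probability (measurableTypeR R * measurableTypeR R)%type R).
Local Notation pt := (measurableTypeR R * measurableTypeR R)%type.
Local Notation leb2 := (@lebesgue_measure R \x @lebesgue_measure R)%E.
Implicit Types (t sigma : nat -> R) (E I : pt -> R -> Prop).

Definition strip t sigma i : @step R :=
  Step false setT (t i) (t i.+1) (sigma i) (cst (sigma i.+1)).

(** Unlike [blocks], no step is fresh: the edges between strips are confined too, since a lower
    bound must produce genuine convex paths. *)
Fixpoint strips t sigma i (c : seq nat) : seq step :=
  if c is r :: c' then nseq r (strip t sigma i) ++ strips t sigma i.+1 c' else [::].

Lemma size_strips t sigma i c : size (strips t sigma i c) = sumn c.
Proof. by elim: c i => //= r c IH i; rewrite size_cat size_nseq IH. Qed.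

Lemma step_measurable_strips t sigma i c : step_measurable (strips t sigma i c).
Proof.
elim: c i => //= r c IH i; apply: step_measurable_cat => //.
by apply: step_measurable_nseq; [exact: measurableT|exact: measurable_cst].
Qed.

Definition strip_bound t sigma (M : R) i r (x s : R) : R :=
  M ^+ r * ((t i.+1 - maxr (t i) x) ^+ r.*2 / (r.*2)`!%:R) *
    ((sigma i.+1 - maxr (sigma i) s) ^+ r / r`!%:R).

(** [E] and [I] abstract the states on entering the strip and inside it; steps lead into [I], where
    the density bound holds. Starting from [E] at least one point is required, because only a state
    in [I] can be passed on to the next strip. *)
Lemma strip_lower t sigma i (M B : R) E I n (st : seq step) :
  0 <= M -> 0 <= B -> t i <= t i.+1 -> sigma i <= sigma i.+1 ->
  size st = n -> step_measurable st ->
  (forall A, measurable A -> A `<=` [set z | exists s, I z s] ->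
    (M%:E * leb2 A <= mu A)%E) ->
  (forall z s, E z s -> z.1 <= t i /\ s <= sigma i) ->
  (forall z s, I z s -> z.1 <= t i.+1 /\ s <= sigma i.+1) ->
  (forall z s z', E z s \/ I z s -> step_set (strip t sigma i) z s z' -> I z' (slope z z')) ->
  (forall X : 'I_n -> Omega -> pt, iid P mu X -> forall z s, I z s ->
    (B%:E <= P (path_event X st z s))%E) ->
  forall r, (forall X : 'I_(r + n) -> Omega -> pt, iid P mu X -> forall z s, I z s ->
    ((B * strip_bound t sigma M i r z.1 s)%:E <=
      P (path_event X (nseq r (strip t sigma i) ++ st) z s))%E) /\
  (forall X : 'I_(r.+1 + n) -> Omega -> pt, iid P mu X -> forall z s, E z s ->
    ((B * strip_bound t sigma M i r.+1 z.1 s)%:E <=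
      P (path_event X (nseq r.+1 (strip t sigma i) ++ st) z s))%E).
Proof.
move=> M0 B0 tt ss sn mst muM Eb Ib stepI HB.
have main r : (forall X : 'I_(r + n) -> Omega -> pt, iid P mu X -> forall z s, I z s ->
    ((B * strip_bound t sigma M i r z.1 s)%:E <=
      P (path_event X (nseq r (strip t sigma i) ++ st) z s))%E) ->
  (forall X : 'I_(r.+1 + n) -> Omega -> pt, iid P mu X -> forall z s, E z s \/ I z s ->
    ((B * strip_bound t sigma M i r.+1 z.1 s)%:E <=
      P (path_event X (nseq r.+1 (strip t sigma i) ++ st) z s))%E).
  move=> IH X iX z s EI.
  have [z1 s1] : z.1 <= t i.+1 /\ s <= sigma i.+1.
    case: EI => [/Eb[z1 s1]|/Ib//].
    by split; [exact: le_trans z1 tt|exact: le_trans s1 ss].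
  pose q := strip t sigma i.
  have mqst : step_measurable (q :: nseq r q ++ st).
    split; [exact: measurableT|exact: measurable_cst|apply: step_measurable_cat => //].
    by apply: step_measurable_nseq; [exact: measurableT|exact: measurable_cst].
  have sz : size (nseq r q ++ st) = (r + n)%N by rewrite size_cat size_nseq sn.
  pose C := B * (M ^+ r / ((r.*2)`!%:R * r`!%:R)).
  have C0 : 0 <= C by rewrite !mulr_ge0 ?invr_ge0 ?mulr_ge0 ?exprn_ge0.
  have := @link_lower _ _ _ P mu (r + n)%N X q (nseq r q ++ st) z s C M r.*2 r iX sz mqst
    erefl erefl C0 M0.
  have IX := iid_behead iX.
  move=> H; apply: (le_trans _ (H _ _ _ _)) => {H}; last first.
  - move=> z' z'q.
    have Iz' := stepI _ _ _ EI z'q.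
    apply: le_trans _ (IH _ IX _ _ Iz').
    rewrite lee_fin /C /strip_bound.
    have zt : t i <= z'.1.
      by case: z'q => _ [/andP[+ _] _]; rewrite gt_max => /andP[/ltW].
    have zs : sigma i <= slope z z'.
      by case: z'q => _ [_ /andP[+ _]]; rewrite gt_max => /andP[/ltW].
    rewrite (max_r zt) (max_r zs) [step_right _]/= [step_high _ _]/=.
    rewrite le_eqVlt; apply/orP; left; apply/eqP.
    rewrite invfM.
    by move: (_ ^+ _) (_ ^+ _) (_ ^+ _) => T T' T1; ring.
  - by rewrite /q /= ge_max ss.
  - by rewrite /q /= ge_max tt.
  - move=> A mA Aq; apply: muM => // z' /Aq z'q.
    by exists (slope z z'); exact: stepI EI z'q.
  rewrite lee_fin /strip_bound /C [step_right _]/= [step_high _ _]/= [step_left _]/= [step_low _]/=.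
  rewrite le_eqVlt; apply/orP; left; apply/eqP.
  rewrite doubleS (factS r.*2.+1) (factS r.*2) (factS r) !natrM [M ^+ r.+1]exprS.
  have f1 : (r.*2)`!%:R != 0 :> R by rewrite pnatr_eq0 -lt0n fact_gt0.
  have f2 : r`!%:R != 0 :> R by rewrite pnatr_eq0 -lt0n fact_gt0.
  have f4 : r.*2.+2%:R != 0 :> R by rewrite pnatr_eq0.
  have f5 : r.*2.+1%:R != 0 :> R by rewrite pnatr_eq0.
  have f6 : r.+1%:R != 0 :> R by rewrite pnatr_eq0.
  move: (_ ^+ r.*2.+2) (_ ^+ r.+1) (M ^+ r) f1 f2 f4 f5 f6.
  move: (r.*2)`!%:R r`!%:R r.*2.+2%:R r.*2.+1%:R r.+1%:R => *.
  by field; do ?(apply/andP; split).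
move=> r.
suff H : forall X : 'I_(r + n) -> Omega -> pt, iid P mu X -> forall z s, I z s ->
    ((B * strip_bound t sigma M i r z.1 s)%:E <=
      P (path_event X (nseq r (strip t sigma i) ++ st) z s))%E.
  by split => // X iX z s Ez; apply: main => //; left.
elim: r => [|r IH] X iX z s Iz; last by apply: main => //; right.
rewrite (_ : strip_bound _ _ _ _ _ _ _ = 1) ?mulr1; first exact: HB.
by rewrite /strip_bound !expr0 !fact0; field.
Qed.

(** As every strip receives a point, an entering state becomes an inside state, which is an entering
    state of the next strip; an entering state lies before the strip, so the full widths enter the
    product. *)
Lemma strips_lower t sigma (M : nat -> R) (E I : nat -> pt -> R -> Prop) N :
  (forall i, (i < N)%N -> 0 <= M i) ->
  (forall i, (i < N)%N -> t i <= t i.+1) -> (forall i, (i < N)%N -> sigma i <= sigma i.+1) ->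
  (forall i A, (i < N)%N -> measurable A -> A `<=` [set z | exists s, I i z s] ->
    ((M i)%:E * leb2 A <= mu A)%E) ->
  (forall i z s, (i <= N)%N -> E i z s -> z.1 <= t i /\ s <= sigma i) ->
  (forall i z s, (i < N)%N -> I i z s -> E i.+1 z s) ->
  (forall i z s z', (i < N)%N -> E i z s \/ I i z s -> step_set (strip t sigma i) z s z' ->
    I i z' (slope z z')) ->
  forall c i, (i + size c <= N)%N -> (forall r, r \in c -> (0 < r)%N) ->
  forall X : 'I_(sumn c) -> Omega -> pt, iid P mu X -> forall z s, E i z s ->
  ((\prod_(k < size c) strip_bound t sigma (M (i + k)%N) (i + k) (nth 0%N c k) (t (i + k)%N)
     (sigma (i + k)%N))%:E <=
   P (path_event X (strips t sigma i c) z s))%E.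
Proof.
move=> M0 tt ss muM Eb IE stepI; elim => [|r c IH] i iN c0 X iX z s Ez.
  rewrite big_ord0 [X in P X](_ : _ = setT) ?probability_setT//.
  by rewrite -subTset => w _; change (path [::] z s (tuple_of X w)); rewrite (tuple0 (tuple_of X w)).
have iN' : (i < N)%N by move: iN; rewrite /=; lia.
have r0 : (0 < r)%N by apply: c0; rewrite mem_head.
case: r r0 c0 X iX {iN} (iN : (i + (size c).+1 <= N)%N) => // r _ c0 X iX iN.
pose B := \prod_(k < size c) strip_bound t sigma (M (i.+1 + k)%N) (i.+1 + k) (nth 0%N c k)
  (t (i.+1 + k)%N) (sigma (i.+1 + k)%N).
have B0 : 0 <= B.
  apply: prodr_ge0 => k _.
  have kN : (i.+1 + k < N)%N by have := ltn_ord k; lia.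
  rewrite /strip_bound !maxxx !mulr_ge0 ?invr_ge0 ?exprn_ge0// ?M0 ?subr_ge0 ?tt ?ss//.
have [_] := @strip_lower t sigma i (M i) B (E i) (I i) (sumn c) (strips t sigma i.+1 c)
  (M0 _ iN') B0 (tt _ iN') (ss _ iN') (size_strips _ _ _ _) (step_measurable_strips _ _ _ _)
  (fun A => muM i A iN') (fun z s => Eb i z s (ltnW iN'))
  (fun z s Iz => Eb i.+1 z s iN' (IE _ _ _ iN' Iz)) (fun z s z' => stepI i z s z' iN')
  (fun X' iX' z' s' Iz' => IH i.+1 ltac:(lia)
     (fun r' r'c => c0 r' (mem_behead (s := r.+1 :: c) r'c)) X' iX' z' s' (IE _ _ _ iN' Iz')) r.
move=> /(_ X iX z s Ez); apply: le_trans.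
have [z1 s1] := Eb _ _ _ (ltnW iN') Ez.
rewrite lee_fin [leLHS]big_ord_recl addn0 [leLHS]mulrC /=.
have -> : strip_bound t sigma (M i) i r.+1 (t i) (sigma i) =
    strip_bound t sigma (M i) i r.+1 z.1 s.
  by rewrite /strip_bound !maxxx (max_l z1) (max_l s1).
by rewrite le_eqVlt /B; apply/orP; left; apply/eqP; congr (_ * _); apply: eq_bigr => k _;
  rewrite /bump /= add1n addnS addSn.
Qed.

End LowerBlocks.

(** * Convex functions on the unit interval *)

Section ConvexFunctions.
Context {R : realType}.
Implicit Types (f g : R -> R) (x y z t : R).

(* Unlike for [convex_functions], a jump at [1] is allowed. *)
Definition convex01 g : Prop :=
  [/\ set_fun `[0, 1] `[0, 1] g, @convex_function R R `[0, 1] g & g 0 = 0].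

Lemma convex01_le g x y t : convex01 g -> 0 <= x <= 1 -> 0 <= y <= 1 -> 0 <= t <= 1 ->
  g (t * x + (1 - t) * y) <= t * g x + (1 - t) * g y.
Proof.
move=> [_ cg _] x01 y01 /andP[t0 t1].
have t01 : 0 <= t <= 1 by rewrite t0.
have := cg (Itv01 t0 t1) x y; rewrite !inE /= !in_itv /= => /(_ x01 y01).
by [].
Qed.

Lemma convex01_slope g x y z : convex01 g -> 0 <= x -> x < y -> y < z -> z <= 1 ->
  (g y - g x) * (z - y) <= (g z - g y) * (y - x).
Proof.
move=> cg x0 xy yz z1.
have t0 : 0 <= (z - y) / (z - x) by rewrite divr_ge0; lra.
have t1 : (z - y) / (z - x) <= 1 by rewrite ler_pdivrMr; lra.
have := convex01_le cg (x := x) (y := z) (t := (z - y) / (z - x)).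
move=> /(_ ltac:(lra) ltac:(lra)); rewrite t0 t1 => /(_ isT).
have -> : (z - y) / (z - x) * x + (1 - (z - y) / (z - x)) * z = y by field; lra.
rewrite (_ : _ + _ = ((z - y) * g x + (y - x) * g z) / (z - x)); last by field; lra.
by rewrite ler_pdivlMr; lra.
Qed.

Lemma convex01_range g x : convex01 g -> 0 <= x <= 1 -> 0 <= g x <= 1.
Proof. by move=> [gr _ _] x01; have := gr x; rewrite /= !in_itv /=; exact. Qed.

Lemma convex01_homo g x y : convex01 g -> 0 <= x -> x <= y -> y <= 1 -> g x <= g y.
Proof.
move=> cg x0; rewrite le_eqVlt => /predU1P[->//|xy] y1.
have g0 : g 0 = 0 by case: cg.
have /andP[gy0 _] : 0 <= g y <= 1 by apply: convex01_range => //; lra.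
have t0 : 0 <= x / y by rewrite divr_ge0; lra.
have t1 : x / y <= 1 by rewrite ler_pdivrMr; lra.
have := convex01_le cg (x := y) (y := 0) (t := x / y) ltac:(lra) ltac:(lra).
rewrite t0 t1 g0 !mulr0 !addr0 divfK; last lra.
by move=> /(_ isT)/le_trans; apply; rewrite ler_piMl.
Qed.

Lemma convex01_le_id g x : convex01 g -> 0 <= x <= 1 -> g x <= x.
Proof.
move=> cg x01; have g0 : g 0 = 0 by case: cg.
have /andP[_ g11] : 0 <= g 1 <= 1 by apply: convex01_range => //; lra.
have := convex01_le cg (x := 1) (y := 0) (t := x) ltac:(lra) ltac:(lra) x01.
by rewrite g0 !mulr0 !addr0 mulr1; nra.
Qed.

Definition right_slopes g x : set R := [set (g y - g x) / (y - x) | y in `]x, 1]%classic].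

(** The right derivative on [0, 1), as an infimum of chord slopes. The value 0 at negative arguments
    keeps it nondecreasing when enlarged grid cells reach to the left of 0. *)
Definition right_slope g x : R := if x < 0 then 0 else inf (right_slopes g x).

Lemma right_slopes_lb g x : convex01 g -> 0 <= x -> lbound (right_slopes g x) 0.
Proof.
move=> cg x0 _ [y /= + <-]; rewrite in_itv /= => /andP[xy y1].
by rewrite divr_ge0// subr_ge0; [apply: convex01_homo => //|]; exact: ltW.
Qed.

Lemma right_slopes_has_inf g x : convex01 g -> 0 <= x -> x < 1 -> has_inf (right_slopes g x).
Proof.
move=> cg x0 x1; split; last by exists 0; exact: right_slopes_lb.
by exists ((g 1 - g x) / (1 - x)), 1 => //; rewrite /= in_itv /= x1 lexx.
Qed.

Lemma right_slope_ge0 g x : convex01 g -> x < 1 -> 0 <= right_slope g x.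
Proof.
move=> cg x1; rewrite /right_slope; case: ltP => // x0.
by apply: lb_le_inf; [case: (right_slopes_has_inf cg x0 x1)|exact: right_slopes_lb].
Qed.

Lemma right_slope_le g x y : convex01 g -> 0 <= x -> x < y -> y <= 1 ->
  right_slope g x * (y - x) <= g y - g x.
Proof.
move=> cg x0 xy y1; rewrite -ler_pdivlMr ?subr_gt0// /right_slope ltNge x0 /=.
apply: ge_inf; first by exists 0; exact: right_slopes_lb.
by exists y => //; rewrite /= in_itv /= xy.
Qed.

Lemma right_slope_ge g x y : convex01 g -> 0 <= x -> x < y -> y < 1 ->
  g y - g x <= right_slope g y * (y - x).
Proof.
move=> cg x0 xy y1; rewrite -ler_pdivrMr ?subr_gt0// /right_slope ltNge (le_trans x0 (ltW xy)) /=.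
apply: lb_le_inf; first by case: (right_slopes_has_inf cg (le_trans x0 (ltW xy)) y1).
move=> _ [z /= + <-]; rewrite in_itv /= => /andP[yz z1].
rewrite ler_pdivrMr ?subr_gt0// mulrAC ler_pdivlMr ?subr_gt0//.
exact: convex01_slope.
Qed.

Lemma right_slope_homo g x y : convex01 g -> x <= y -> y < 1 ->
  right_slope g x <= right_slope g y.
Proof.
move=> cg; rewrite le_eqVlt => /predU1P[->//|xy] y1.
have [x0|x0] := ltP x 0; first by rewrite {1}/right_slope x0 right_slope_ge0.
rewrite -(@ler_pM2r _ (y - x)) ?subr_gt0//.
exact: le_trans (right_slope_le cg x0 xy (ltW y1)) (right_slope_ge cg x0 xy y1).
Qed.

(* The right derivative, truncated at [b < 1] so that it becomes a bounded
   nondecreasing function on the whole line. *)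
Definition clamped_slope g b x : R := right_slope g (minr x b).

Lemma clamped_slope_nd g b : convex01 g -> b < 1 -> nondecreasing_fun (clamped_slope g b).
Proof.
move=> cg b1 x y xy; apply: right_slope_homo => //.
  by rewrite le_min !ge_min xy lexx /= orbT.
by rewrite gt_min b1 orbT.
Qed.

Lemma clamped_slopeE g b x : x <= b -> clamped_slope g b x = right_slope g x.
Proof. by move=> xb; rewrite /clamped_slope (min_idPl xb). Qed.

Lemma convex01_continuous g x : convex01 g -> 0 < x -> x < 1 -> {for x, continuous g}.
Proof.
move=> cg x0 x1; apply/cvgrPdist_lt => e e0.
(* Left of [b] the function is Lipschitz with the right slope at [b] as constant. *)
pose b := (x + 1) / 2; pose L := right_slope g b.
have b1 : b < 1 by rewrite /b; lra.
have L0 : 0 <= L by exact: right_slope_ge0.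
near=> y.
have yb : 0 < y < b.
  apply/andP; split; near: y.
    exact: lt_nbhsr.
  by apply: lt_nbhsl; rewrite /b; lra.
have yx : `|x - y| < e / (L + 1).
  near: y; apply: (@cvgr_dist_lt _ R^o _ _ _ id x); first exact: cvg_id.
  by rewrite divr_gt0// ltr_wpDl.
have key u v : 0 <= u -> u < v -> v <= b -> `|g v - g u| <= L * (v - u).
  move=> u0 uv vb; rewrite ger0_norm; last first.
    by rewrite subr_ge0; apply: convex01_homo => //; lra.
  apply: le_trans (right_slope_ge cg u0 uv _) _; first lra.
  by rewrite ler_wpM2r ?subr_ge0 ?(ltW uv)// right_slope_homo.
have [xy|xy|->] := ltgtP x y; last by rewrite subrr normr0.
- rewrite distrC; apply: le_lt_trans (key _ _ (ltW x0) xy _) _; first lra.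
  move: yx; rewrite ltr0_norm ?subr_lt0// ltr_pdivlMr; last by rewrite ltr_wpDl.
  by nra.
- apply: le_lt_trans (key _ _ _ xy _) _; rewrite /b; try lra.
  move: yx; rewrite gtr0_norm ?subr_gt0// ltr_pdivlMr; last by rewrite ltr_wpDl.
  by nra.
Unshelve. all: by end_near. Qed.

End ConvexFunctions.

Section NegligibleIntegral.
Import HBNNSimple.
Context d (T : measurableType d) (R : realType) (mu : {measure set T -> \bar R}).

(** The null set is removed from the simple functions below [f]. This suits the integrand of [J],
    which has default values on a null set. *)
Lemma integral_setD_null (D N : set T) (f : T -> \bar R) :
  measurable D -> measurable N -> mu N = 0%E -> (forall x, D x -> (0 <= f x)%E) ->
  (\int[mu]_(x in D) f x = \int[mu]_(x in D `\` N) f x)%E.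
Proof.
move=> mD mN N0 f0; apply/eqP; rewrite eq_le; apply/andP; split; last first.
  rewrite [leLHS]integral_mkcond [leRHS]integral_mkcond.
  apply: le_measure_integral => // x _; rewrite !patchE.
    by case: ifPn => // /set_mem[? _]; exact: f0.
  case: ifPn => [/set_mem[Dx _]|_]; first by rewrite mem_set.
  by case: ifPn => // /set_mem; exact: f0.
have mDN : measurable (D `\` N) by exact: measurableD.
rewrite [leLHS]integral_mkcond [leRHS]integral_mkcond.
rewrite !ge0_integralTE; first last.
- by move=> x; rewrite patchE; case: ifPn => // /set_mem; exact: f0.
- by move=> x; rewrite patchE; case: ifPn => // /set_mem[? _]; exact: f0.
apply: ub_ereal_sup => _ [h /= hf <-].
pose h' := mul_nnsfun h (indic_nnsfun R (measurableC mN)).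
apply: (@le_trans _ _ (sintegral mu h')); last first.
  apply: ereal_sup_ubound; exists h' => // x /=.
  rewrite mindicE; have [Nx|Nx] := pselect (N x).
    by rewrite memNset ?mulr0 ?patchE//; case: ifPn => // /set_mem[? _]; exact: f0.
  rewrite mem_set ?mulr1//; apply: le_trans (hf x) _; rewrite !patchE.
  by case: ifPn => [/set_mem Dx|Dx]; [rewrite mem_set//|rewrite memNset// => -[/mem_set Dx']; move: Dx; rewrite Dx'].
rewrite -!integralT_nnsfun.
rewrite (@ae_eq_integral _ _ _ mu setT (EFin \o h) (EFin \o h'))//.
- exact/measurable_EFinP.
- exact/measurable_EFinP.
exists N; split => // x /= /not_implyP[_]; apply: contra_notP => Nx.
by rewrite mindicE mem_set// mulr1.
Qed.

End NegligibleIntegral.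

(** * The second derivative of a convex function almost everywhere *)

Section Differentiability.
Context {R : realType}.
Local Notation mu := (@lebesgue_measure R).
Implicit Types (f g : R -> R) (x y : R).

Lemma derive1_quotient (r : R -> R) x : derivable r x 1 ->
  (fun y => (r y - r x) / (y - x)) @ x^' --> derive1 r x.
Proof.
move=> dr.
have := dr; rewrite /derivable => /cvg_ex[l hl].
have lE : derive1 r x = l.
  by rewrite derive1E; apply: cvg_lim => //; exact: hl.
rewrite lE; apply/cvgrPdist_lt => e e0.
move/cvgrPdist_lt: hl => /(_ _ e0) /nbhs_ballP[dl /= dl0 H].
apply/nbhs_ballP; exists dl => //= y xy yx.
have := H (y - x); rewrite /ball /= sub0r normrN distrC => /(_ xy).
rewrite subr_eq0 => /(_ yx); rewrite /= /GRing.scale /= !mulr1 subrK.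
by rewrite mulrC.
Qed.

(** A difference quotient is squeezed between the right slopes at the two ends of its interval. *)
Lemma convex01_derive1 g x : convex01 g -> 0 < x -> x < 1 ->
  {for x, continuous (right_slope g)} -> derivable g x 1 /\ derive1 g x = right_slope g x.
Proof.
move=> cg x0 x1 cr.
suff H : h^-1 *: ((g \o shift x) (h *: (1 : R)) - g x) @[h --> 0^'] --> right_slope g x.
  split; first by apply/cvg_ex; exists (right_slope g x).
  by rewrite derive1E; apply: cvg_lim.
apply/cvgrPdist_lt => e e0.
move/cvgrPdist_lt: cr => /(_ _ e0) /nbhs_ballP[dl /= dl0 H].
apply/nbhs_ballP; exists (minr dl (minr x (1 - x))) => /=; first by rewrite !lt_min dl0 x0 subr_gt0.
move=> h; rewrite /ball /= sub0r normrN !lt_min => /and3P[hdl hx hx1] h0.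
rewrite /GRing.scale /= mulr1.
have hh : x + h = h + x by rewrite addrC.
have := H (h + x); rewrite /ball /= opprD addrCA subrr addr0 normrN => /(_ hdl).
move: hx hx1; rewrite !ltr_norml => /andP[hx _] /andP[_ hx1].
have [hp|hn|hE] := ltgtP 0 h; last by rewrite -hE eqxx in h0.
- have A := right_slope_le cg (ltW x0) (_ : x < h + x) (_ : h + x <= 1).
  have {A} := A ltac:(lra) ltac:(lra).
  have A := right_slope_ge cg (ltW x0) (_ : x < h + x) (_ : h + x < 1).
  have {A} := A ltac:(lra) ltac:(lra).
  rewrite addrK => A B.
  have {A}A : h^-1 * (g (h + x) - g x) <= right_slope g (h + x) by rewrite mulrC ler_pdivrMr.
  have {B}B : right_slope g x <= h^-1 * (g (h + x) - g x) by rewrite [leRHS]mulrC ler_pdivlMr.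
  by move=> /andP[C D]; apply/andP; split; lra.
- have A := right_slope_le cg (_ : 0 <= h + x) (_ : h + x < x) (ltW x1).
  have {A} := A ltac:(lra) ltac:(lra).
  have A := right_slope_ge cg (_ : 0 <= h + x) (_ : h + x < x) x1.
  have {A} := A ltac:(lra) ltac:(lra).
  move=> A B.
  have E : h^-1 * (g (h + x) - g x) * h = g (h + x) - g x by rewrite mulrC mulrA mulfV ?mul1r.
  have {A}A : h^-1 * (g (h + x) - g x) <= right_slope g x by rewrite -(ler_nM2r hn); lra.
  have {B}B : right_slope g (h + x) <= h^-1 * (g (h + x) - g x) by rewrite -(ler_nM2r hn); lra.
  by move=> /andP[C D]; apply/andP; split; lra.
Qed.

Lemma derivable_near (f1 f2 : R -> R) x : (\forall y \near x, f1 y = f2 y) ->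
  derivable f1 x 1 -> derivable f2 x 1.
Proof.
move=> H; rewrite /derivable => /cvg_ex[l hl]; apply/cvg_ex; exists l.
apply: cvg_trans hl; apply: near_eq_cvg.
move: H => /nbhs_ballP[dl /= dl0 H]; apply/nbhs_ballP; exists dl => //= h.
rewrite /ball /= sub0r normrN => hdl _; rewrite !H//; first exact: ballxx.
by rewrite /ball /= /GRing.scale /= mulr1 opprD addrCA subrr addr0 normrN.
Qed.

(** The right slope may explode at 1, so it is clamped at the points 1 - 1/(k+1), which gives
    nondecreasing functions on the line and countably many null sets. *)
Lemma ae_right_slope_derivable g : convex01 g -> exists N : set R, [/\ measurable N, mu N = 0%E &
  forall x, 0 < x -> x < 1 -> ~ N x -> derivable (right_slope g) x 1].
Proof.
move=> cg; pose b k : R := 1 - k.+1%:R^-1.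
have b1 k : b k < 1 by rewrite /b ltrBlDr ltrDl invr_gt0.
have /choice[N HN] k := ae_derivable_nondecreasing (clamped_slope_nd cg (b1 k)).
exists (\bigcup_k N k); split.
- by apply: bigcup_measurable => k _; case: (HN k).
- apply/eqP; rewrite eq_le measure_ge0 andbT.
  have <- : (\sum_(0 <= k <oo) mu (N k) = 0)%E by apply: eseries0 => k _ _; case: (HN k).
  apply: generalized_Boole_inequality => //; first by move=> k; case: (HN k).
  by apply: bigcup_measurable => k _; case: (HN k).
move=> x x0 x1 Nx.
have px : 0 < 1 - x by rewrite subr_gt0.
have [k _ Hk] := near_infty_natSinv_lt (PosNum px).
have /= xk := Hk k (leqnn _).
have xb : x < b k by rewrite /b ltrBrDr -ltrBrDl.
have [_ _ /(_ x)] := HN k; move=> /(_ (fun Nk => Nx (ex_intro2 _ _ k I Nk))).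
apply: derivable_near; near=> y; rewrite clamped_slopeE//.
by apply: ltW; near: y; exact: lt_nbhsl.
Unshelve. all: by end_near. Qed.

(** [second_derivative] runs over all points where [g] is differentiable, so the value of the
    derivative is needed at points where the right slope is not known to be continuous. Quotients
    close to [x] on its right give both inequalities. *)
Lemma convex01_derive1E g x : convex01 g -> 0 < x -> x < 1 -> derivable g x 1 ->
  derive1 g x = right_slope g x.
Proof.
move=> cg x0 x1 dg.
have close e w : 0 < e -> x < w -> exists z, x < z < w /\ `|derive1 g x - (g z - g x) / (z - x)| < e.
  move=> e0 xw; have /cvgrPdist_lt/(_ _ e0)/nbhs_ballP[dl /= dl0 H] := derive1_quotient dg.
  pose m := minr dl (w - x).
  have m0 : 0 < m by rewrite lt_min dl0 subr_gt0.
  have ml : m <= dl by rewrite ge_min lexx.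
  have mw : m <= w - x by rewrite ge_min lexx orbT.
  exists (x + m / 2); split; first lra.
  by apply: H => /=; [rewrite /ball /= opprD addNKr normrN gtr0_norm; lra|rewrite gt_eqF; lra].
apply/eqP; rewrite eq_le; apply/andP; split.
  rewrite /right_slope ltNge (ltW x0) /=.
  apply: lb_le_inf; first by case: (right_slopes_has_inf cg (ltW x0) x1).
  move=> _ [w /= + <-]; rewrite in_itv /= => /andP[xw w1].
  apply/ler_addgt0Pr => e e0; have [z [/andP[xz zw]]] := close _ _ e0 xw.
  rewrite ltr_norml => /andP[_ H].
  have : (g z - g x) / (z - x) <= (g w - g x) / (w - x).
    rewrite ler_pdivrMr ?subr_gt0// mulrAC ler_pdivlMr ?subr_gt0//.
    have := convex01_slope cg (ltW x0) xz zw w1; nra.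
  by move: H; move: (_ / _) (_ / _) => ? ? ? ?; lra.
apply/ler_addgt0Pr => e e0; have [z [/andP[xz z1]]] := close _ _ e0 x1.
rewrite ltr_norml => /andP[H _].
have : right_slope g x <= (g z - g x) / (z - x).
  by rewrite ler_pdivlMr ?subr_gt0//; apply: right_slope_le => //; exact: ltW.
by move: H; move: (_ / _) => ? ? ?; lra.
Qed.

Lemma second_derivativeE g x (N : set R) : convex01 g -> 0 < x -> x < 1 ->
  mu N = 0%E -> measurable N ->
  (forall x, 0 < x -> x < 1 -> ~ N x -> derivable (right_slope g) x 1) -> ~ N x ->
  second_derivative g x = derive1 (right_slope g) x.
Proof.
move=> cg x0 x1 N0 mN HN Nx.
have cr y : 0 < y -> y < 1 -> ~ N y -> derivable g y 1 /\ derive1 g y = right_slope g y.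
  move=> y0 y1 Ny; apply: convex01_derive1 => //.
  by apply: differentiable_continuous; apply/derivable1_diffP; exact: HN.
pose F : set_system R := within [set y | derivable g y 1] x^'.
(* A limit is meaningful only if points of differentiability accumulate at [x]; they do, as their
   complement in (0, 1) lies in a null set. *)
have FF : ProperFilter F.
  apply: Build_ProperFilter_ex => A; rewrite /F withinE => -[B /nbhs_ballP[dl /= dl0 HB] BA].
  pose b := minr (x + dl) 1.
  have xb : x < b by rewrite /b lt_min ltrDl dl0.
  have [y [Ny /andP[xy yb]]] : exists y, ~ N y /\ x < y < b.
    apply: contrapT => /forallNP H.
    have : (mu `]x, b[ <= mu N)%E.
      apply: le_measure; rewrite ?inE//.
      by move=> y /=; rewrite in_itv /= => xyb; apply: contrapT => Ny; apply: (H y).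
    rewrite N0 lebesgue_measure_itv /= lte_fin xb leNgt -EFinD lte_fin subr_gt0 xb//.
  move: yb; rewrite /b lt_min => /andP[yd y1].
  have y0 := lt_trans x0 xy.
  have : (B `&` [set y | derivable g y 1]) y.
    split; last by case: (cr _ y0 y1 Ny).
    apply: HB; last by rewrite /= gt_eqF.
    by rewrite /ball /= distrC gtr0_norm ?subr_gt0//; lra.
  by rewrite -BA => -[]; exists y.
have dr := HN _ x0 x1 Nx.
rewrite /second_derivative; apply: (@cvg_lim _ _ _ F); first exact: norm_hausdorff.
pose f1 y := (right_slope g y - right_slope g x) / (y - x).
pose f2 y := (derive1 g y - derive1 g x) / (y - x).
have E : \forall y \near F, f1 y = f2 y.
  rewrite /F near_withinE.
  apply/nbhs_ballP; exists (minr x (1 - x)) => /=; first by rewrite lt_min x0 subr_gt0.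
  move=> y; rewrite /ball /= lt_min !ltr_norml => /andP[/andP[? ?] /andP[? ?]] _ dgy.
  rewrite /f1 /f2 !convex01_derive1E//; try lra; by case: (cr _ x0 x1 Nx).
apply: (cvg_trans (near_eq_cvg E)).
apply: cvg_trans (derive1_quotient dr).
apply: cvg_app; exact: cvg_within.
Qed.

End Differentiability.

(** * Grid sums *)

Section CubeRoot.
Context {R : realType}.
Implicit Types u v e : R.

Definition cbrt u : R := u `^ (3%:R^-1).

Lemma cbrt_ge0 u : 0 <= cbrt u. Proof. exact: powR_ge0. Qed.

Lemma cbrtK u : 0 <= u -> cbrt u ^+ 3 = u.
Proof.
move=> u0; rewrite /cbrt -powR_mulrn ?powR_ge0// -powRrM mulVf ?pnatr_eq0// powRr1//.
Qed.

Lemma cbrt_le u v : 0 <= u -> u <= v -> cbrt u <= cbrt v.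
Proof. by move=> u0 uv; apply: ge0_ler_powR; rewrite ?nnegrE// (le_trans u0). Qed.

Lemma cbrtM u v : 0 <= u -> 0 <= v -> cbrt (u * v) = cbrt u * cbrt v.
Proof. exact: powRM. Qed.

Lemma exprK_cbrt u : 0 <= u -> cbrt (u ^+ 3) = u.
Proof.
by move=> u0; rewrite /cbrt -powR_mulrn// -powRrM mulfV ?powRr1// pnatr_eq0.
Qed.

(** For nonnegative numbers the cube of a sum is at least the sum of the cubes. *)
Lemma cbrt_close u v e : 0 <= u -> 0 <= v -> 0 < e -> `|u - v| < e ^+ 3 ->
  `|cbrt u - cbrt v| < e.
Proof.
wlog uv : u v / v <= u.
  move=> H u0 v0 e0; have [/H|/ltW/H] := leP v u; first exact.
  by rewrite distrC [X in _ -> X < _]distrC; exact.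
move=> u0 v0 e0; rewrite !ger0_norm ?subr_ge0 ?cbrt_le// => uve.
rewrite ltNge; apply/negP => H.
have : (cbrt v + e) ^+ 3 <= cbrt u ^+ 3.
  by rewrite lerXn2r ?nnegrE ?addr_ge0 ?cbrt_ge0//; [exact: ltW|lra].
rewrite cbrtK//; move: uve; rewrite -{1}(cbrtK v0); have := cbrt_ge0 v.
move: (cbrt v) => w w0 uve.
have := mulr_ge0 w0 (mulr_ge0 (ltW e0) (ltW e0)); have := mulr_ge0 (mulr_ge0 w0 w0) (ltW e0).
lra.
Qed.

End CubeRoot.

Section GridSums.
Context {R : realType}.
Local Notation mu := (@lebesgue_measure R).
Implicit Types (g r : R -> R) (p : R * R -> R) (D x tau : R).

(* [tau = 0] gives the increment of the right derivative over a cell of the grid of mesh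
   [D]; [tau = 1] enlarges it by lower-order terms, to leave room for perturbations. *)
Definition increment g tau D (i : nat) : R :=
  right_slope g (i.+1%:R * D + tau * D ^+ 2) - right_slope g (i%:R * D - tau * D ^+ 2)
    + 4 * tau * D ^+ 2.

Definition cell p g tau D (i : nat) : R :=
  cbrt (p (i%:R * D, g (i%:R * D)) * (increment g tau D i / D)).

Definition grid_sum p g tau D n : R := \sum_(i < n) D * cell p g tau D i.

Definition step_fun (c : nat -> R) D (n : nat) x : R :=
  \sum_(i < n) c i * \1_(`[i%:R * D, i.+1%:R * D[) x.

Lemma step_funE c D n x (i : nat) : 0 < D -> (i < n)%N -> i%:R * D <= x < i.+1%:R * D ->
  step_fun c D n x = c i.
Proof.
move=> D0 il xi; rewrite /step_fun (bigD1 (Ordinal il))//= indicE mem_set/=; last by rewrite in_itv.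
rewrite mulr1 big1 ?addr0// => j ji; rewrite indicE memNset ?mulr0//= in_itv /= => /andP[j1 j2].
move: xi => /andP[i1 i2].
have := le_lt_trans i1 j2; rewrite ltr_pM2r// ltr_nat ltnS => ij.
have := le_lt_trans j1 i2; rewrite ltr_pM2r// ltr_nat ltnS => ji'.
by move: ji; rewrite -val_eqE /= eqn_leq ij ji'.
Qed.

Lemma step_fun_out c D n x : x < 0 \/ n%:R * D <= x -> 0 < D -> step_fun c D n x = 0.
Proof.
move=> H D0; rewrite /step_fun big1// => i _; rewrite indicE memNset ?mulr0//= in_itv /= => /andP[i1 i2].
case: H => H.
  suff : 0 <= i%:R * D by lra.
  by rewrite mulr_ge0// ltW.
suff : i.+1%:R * D <= n%:R * D by lra.
by rewrite ler_pM2r// ler_nat.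
Qed.

Lemma step_fun_ge0 c D n x : (forall i, 0 <= c i) -> 0 <= step_fun c D n x.
Proof. by move=> c0; apply: sumr_ge0 => i _; rewrite mulr_ge0// indicE. Qed.

Lemma measurable_step_fun c D n : measurable_fun [set: R] (step_fun c D n).
Proof.
apply: measurable_sum => i; apply: measurable_funM; first exact: measurable_cst.
exact: measurable_indic.
Qed.

Lemma grid_index D x : 0 < D -> 0 <= x -> exists i : nat, i%:R * D <= x < i.+1%:R * D.
Proof.
move=> D0 x0; exists (Num.truncn (x / D)).
have : 0 <= x / D by rewrite divr_ge0// ltW.
by move=> /truncn_itv; rewrite ler_pdivlMr// ltr_pdivrMr.
Qed.

Lemma integral_step_fun c D n : (forall i, 0 <= c i) -> 0 < D ->
  (\int[mu]_x (step_fun c D n x)%:E = (\sum_(i < n) D * c i)%:E)%E.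
Proof.
move=> c0 D0; under eq_integral do rewrite /step_fun -sumEFin.
rewrite ge0_integral_sum//; first last.
- by move=> i x _; rewrite lee_fin mulr_ge0// indicE.
- move=> i; apply/measurable_EFinP; apply: measurable_funM; first exact: measurable_cst.
  exact: measurable_indic.
rewrite -sumEFin; apply: eq_bigr => i _.
under eq_integral do rewrite EFinM.
rewrite ge0_integralZl//; first last.
- by rewrite lee_fin.
- by apply/measurable_EFinP; exact: measurable_indic.
rewrite integral_indic// setIT.
have E : (mu `[(i%:R * D)%R, (i.+1%:R * D)%R[%classic = D%:E)%E.
  rewrite lebesgue_measure_itv /= lte_fin ltr_pM2r// ltr_nat ltnSn.
  by rewrite -EFinB -mulrBl -natrB// subSnn mul1r.
by rewrite [X in (_ * X)%E]E -EFinM mulrC.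
Qed.

Lemma integral_step_fun_le c D n (A : set R) : (forall i, 0 <= c i) -> 0 < D -> measurable A ->
  (\int[mu]_(x in A) (step_fun c D n x)%:E <= (\sum_(i < n) D * c i)%:E)%E.
Proof.
move=> c0 D0 mA; rewrite -integral_step_fun//; apply: ge0_subset_integral => //.
  by apply/measurable_EFinP; exact: measurable_step_fun.
by move=> x _; rewrite lee_fin step_fun_ge0.
Qed.

(** A grid cell contains [x] without having it as an end; splitting the increment at [x] bounds the
    quotient over the cell all the same. *)
Lemma straddle r x (L e : R) : derivable r x 1 -> L = derive1 r x -> 0 < e ->
  exists2 dl, 0 < dl & forall a b, a <= x -> x <= b -> b - a < dl ->
    `|r b - r a - L * (b - a)| <= e * (b - a).
Proof.
move=> dr LE e0.
have /cvgrPdist_lt/(_ _ e0)/nbhs_ballP[dl /= dl0 H] := derive1_quotient dr.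
exists dl => // a b ax xb ab.
have key y : `|y - x| < dl -> `|r y - r x - L * (y - x)| <= e * `|y - x|.
  have [->|yx] := eqVneq y x; first by rewrite !subrr mulr0 subrr !normr0 mulr0.
  move=> yd; have := H y; rewrite /ball /= distrC => /(_ yd yx)/ltW; rewrite -LE.
  rewrite -(ler_pM2r (x := `|y - x|)) ?normr_gt0 ?subr_eq0// -normrM.
  by rewrite mulrBl divfK ?subr_eq0// distrC.
have A : `|r a - r x - L * (a - x)| <= e * `|a - x|.
  by apply: key; rewrite distrC ger0_norm; lra.
have B : `|r b - r x - L * (b - x)| <= e * `|b - x| by apply: key; rewrite ger0_norm; lra.
rewrite (_ : r b - r a - L * (b - a) = (r b - r x - L * (b - x)) - (r a - r x - L * (a - x))); last by ring.
apply: le_trans (ler_normB _ _) _; apply: le_trans (lerD B A) _.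
rewrite (distrC a) !ger0_norm ?subr_ge0//; lra.
Qed.

Lemma increment_ge0 g tau D i : convex01 g -> 0 <= tau -> 0 < D ->
  i.+1%:R * D + tau * D ^+ 2 < 1 -> 0 <= increment g tau D i.
Proof.
move=> cg t0 D0 i1; have d0 : 0 <= tau * D ^+ 2 by rewrite mulr_ge0// exprn_ge0// ltW.
rewrite /increment addr_ge0//; last by rewrite -mulrA mulr_ge0.
rewrite subr_ge0; apply: right_slope_homo => //.
by rewrite -natr1 mulrDl mul1r; lra.
Qed.

Lemma right_slope_derive1_ge0 g x : convex01 g -> x < 1 -> derivable (right_slope g) x 1 ->
  0 <= derive1 (right_slope g) x.
Proof.
move=> cg x1 dr; set L := derive1 _ x.
rewrite leNgt; apply/negP => Ln.
have h0 : 0 < - L / 2 by rewrite divr_gt0// oppr_gt0.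
have [dl dl0 H] := straddle dr erefl h0.
pose b := x + minr dl (1 - x) / 2.
have m0 : 0 < minr dl (1 - x) by rewrite lt_min dl0 subr_gt0.
have md : minr dl (1 - x) <= dl by rewrite ge_min lexx.
have mx : minr dl (1 - x) <= 1 - x by rewrite ge_min lexx orbT.
have := H x b (lexx _); rewrite -/L ler_norml => /(_ ltac:(rewrite /b; lra) ltac:(rewrite /b; lra)) /andP[_].
have : right_slope g x <= right_slope g b by apply: right_slope_homo => //; rewrite /b; lra.
have : L * (b - x) < 0 by rewrite nmulr_rlt0 ?subr_gt0// /b; lra.
by move: (right_slope g b) (right_slope g x) => ? ?; lra.
Qed.

(** The enlargements of a cell by multiples of [D ^+ 2] disappear after division by [D], so both
    values of [tau] give the integrand of [J] in the limit. *)
Lemma cell_cvg p g tau x (e : R) : convex01 g -> 0 <= tau <= 1 -> 0 < x -> x < 1 ->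
  (forall z, triangle z -> 0 <= p z) -> {within triangle, continuous p} ->
  derivable (right_slope g) x 1 -> 0 < e ->
  exists2 dl, 0 < dl & forall D i, 0 < D -> D < dl -> i%:R * D <= x < i.+1%:R * D ->
    `|cell p g tau D i - cbrt (derive1 (right_slope g) x * p (x, g x))| < e.
Proof.
move=> cg /andP[t0 t1] x0 x1 p0 pc dr e0.
set L := derive1 _ x; set q := p (x, g x).
have tri y : 0 <= y <= 1 -> triangle (y, g y).
  move=> y01; apply/triangleP => /=; have := convex01_range cg y01.
  by have := convex01_le_id cg y01; lra.
have q0 : 0 <= q by apply: p0; apply: tri; lra.
have L0 : 0 <= L by exact: right_slope_derive1_ge0.
(* Choose the tolerances [a] on the difference quotient and [b] on the density so that
   the product moves by less than [e ^+ 3]. *)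
have e30 : 0 < e ^+ 3 by rewrite exprn_gt0.
pose b := minr 1 (e ^+ 3 / (2 * (L + 2))).
have b0 : 0 < b by rewrite lt_min ltr01 divr_gt0//; lra.
have b1 : b <= 1 by rewrite ge_min lexx.
have bE : b * (L + 2) <= e ^+ 3 / 2.
  by rewrite -ler_pdivlMr; [rewrite -mulrA -invfM ge_min lexx orbT|lra].
pose a := minr 1 (e ^+ 3 / (3 * (q + 1))).
have a0 : 0 < a by rewrite lt_min ltr01 divr_gt0//; lra.
have a1 : a <= 1 by rewrite ge_min lexx.
have aE : a * (q + 1) <= e ^+ 3 / 3.
  by rewrite -ler_pdivlMr; [rewrite -mulrA -invfM ge_min lexx orbT|lra].
have a6 : 0 < a / 6 by lra.
have [dl1 dl10 H1] := straddle dr erefl a6.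
have gx := convex01_continuous cg x0 x1.
have px : triangle (x, g x) by apply: tri; lra.
have /subspace_continuousP/(_ _ px)/cvgrPdist_lt/(_ _ b0) := pc.
rewrite near_withinE => /nbhs_ballP[dl2 /= dl20 H2].
have /cvgrPdist_lt/(_ _ dl20)/nbhs_ballP[dl3 /= dl30 H3] := gx.
(* The first bound absorbs the terms of order [(L + 2) * D ^+ 2], the second keeps the enlarged cell
   inside the range of [straddle]. *)
pose dl := minr (minr (a / (12 * (L + 2))) (dl1 / 3)) (minr (minr dl2 dl3) (minr 1 ((1 - x) / 2))).
have dl0 : 0 < dl.
  by rewrite !lt_min dl20 dl30 !divr_gt0 ?ltr01//; lra.
exists dl => // D i D0; rewrite !lt_min => /andP[/andP[Da D1] /andP[/andP[D2 D3] /andP[Dl Dx]]].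
move=> /andP[i1 i2].
have i2' : i.+1%:R * D = i%:R * D + D by rewrite -natr1 mulrDl mul1r.
move: i2; rewrite i2' => i2.
have DD0 : 0 <= D ^+ 2 by rewrite exprn_ge0// ltW.
have DD : D ^+ 2 <= D by rewrite expr2 ler_piMl// ltW.
have tD0 : 0 <= tau * D ^+ 2 by rewrite mulr_ge0.
have tD : tau * D ^+ 2 <= D ^+ 2 by rewrite ler_piMl.
have iD0 : 0 <= i%:R * D by rewrite mulr_ge0// ltW.
set u := i%:R * D in i1 i2 i2' iD0 *.
have pu0 : 0 <= p (u, g u) by apply: p0; apply: tri; lra.
have inc0 : 0 <= increment g tau D i by apply: increment_ge0 => //; rewrite i2' -/u; lra.
apply: cbrt_close => //; [|by rewrite mulr_ge0|].
  by rewrite mulr_ge0// divr_ge0// ltW.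
have Hp : `|q - p (u, g u)| < b.
  apply: H2; last by apply: tri; lra.
  split; rewrite /ball /=.
    by rewrite ger0_norm; lra.
  by apply: H3; rewrite /ball /= ger0_norm; lra.
have Da' : D * (12 * (L + 2)) < a by rewrite -ltr_pdivlMr//; lra.
have Hd : `|increment g tau D i / D - L| <= a.
  have := H1 (u - tau * D ^+ 2) (u + D + tau * D ^+ 2) ltac:(lra) ltac:(lra) ltac:(lra).
  rewrite -/L /increment i2' -/u (_ : u + D + _ - _ = D + 2 * (tau * D ^+ 2)); last by ring.
  move: (right_slope g _) (right_slope g _) => rb ra.
  rewrite !ler_norml => /andP[h1 h2].
  have LD : 0 <= L * (tau * D ^+ 2) by rewrite mulr_ge0.
  have LD2 : L * (tau * D ^+ 2) <= L * (D * D) by rewrite ler_wpM2l// -expr2.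
  have aD : a * (tau * D ^+ 2) <= a * D by rewrite ler_pM2l//; lra.
  have DDa : D * D * (12 * (L + 2)) <= a * D by rewrite -mulrA mulrC ler_pM2r// ltW.
  have tDD : tau * D ^+ 2 <= D * D by rewrite -expr2.
  rewrite lerBrDr lerBlDr ler_pdivrMr// ler_pdivlMr//.
  have aDp : 0 <= a * D by rewrite mulr_ge0// ltW.
  by move: h1 h2 LD LD2 aD DDa tDD aDp tD0; clear; move=> *; apply/andP; split; lra.
have E : p (u, g u) * (increment g tau D i / D) - L * q =
  p (u, g u) * (increment g tau D i / D - L) - L * (q - p (u, g u)) by ring.
rewrite E; apply: le_lt_trans (ler_normB _ _) _; rewrite !normrM (ger0_norm L0) (ger0_norm pu0).
have pq : p (u, g u) <= q + 1.
  by move: Hp; rewrite ltr_norml => /andP[]; lra.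
have A1 : p (u, g u) * `|increment g tau D i / D - L| <= (q + 1) * a by rewrite ler_pM.
have A2 : L * `|q - p (u, g u)| <= L * b by rewrite ler_wpM2l// ltW.
lra.
Qed.

Lemma J_setD_null p g : convex01 g -> (forall z, triangle z -> 0 <= p z) ->
  exists N : set R, [/\ measurable N, mu N = 0%E,
    forall x, (`[0, 1] `\` N) x -> [/\ 0 < x, x < 1 & derivable (right_slope g) x 1] &
    J p g = (\int[mu]_(x in `[0%R, 1%R] `\` N)
      (cbrt (derive1 (right_slope g) x * p (x, g x)))%:E)%E].
Proof.
move=> cg p0; have [N [mN N0 HN]] := ae_right_slope_derivable cg.
have [N' [mN' N'0 N'P]] : exists N' : set R, [/\ measurable N', mu N' = 0%E &
    forall x, ~ N' x -> [/\ ~ N x, x != 0 & x != 1]].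
  exists (N `|` [set 0] `|` [set 1]); split.
  - by apply: measurableU; [exact: measurableU|exact: measurable_set1].
  - apply/eqP; rewrite eq_le measure_ge0 andbT.
    apply: le_trans (measureU2 _ _ _) _; [exact: measurableU|exact: measurable_set1|].
    apply: le_trans (leeD (measureU2 _ _ _) (lexx _)) _; [exact: mN|exact: measurable_set1|].
    by rewrite [X in (X + _ + _)%E]N0 [X in (_ + X + _)%E]lebesgue_measure_set1
      [X in (_ + X)%E]lebesgue_measure_set1 !adde0.
  - by move=> x /not_orP[/not_orP[Nx /= nx0] /= nx1]; split => //; exact/eqP.
have in01 x : (`[0, 1] `\` N') x -> [/\ 0 < x, x < 1 & ~ N x].
  move=> [/=]; rewrite in_itv /= => /andP[x0 x1] /N'P[Nx nx0 nx1].
  by split; [rewrite lt0r nx0|rewrite lt_neqAle nx1|].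
exists N'; split; [exact: mN'|exact: N'0| |].
  by move=> x /in01[x0 x1 Nx]; split => //; exact: HN.
rewrite /J; etransitivity.
  apply: (@integral_setD_null _ _ R mu _ N' _ _ mN' N'0); first exact: measurable_itv.
  by move=> x _; rewrite lee_fin powR_ge0.
apply: eq_integral => x /set_mem/in01[x0 x1 Nx].
by rewrite (second_derivativeE cg x0 x1 N0 mN HN Nx).
Qed.

Lemma limn_esup_le_near (u : nat -> \bar R) (B : \bar R) :
  (\forall k \near \oo, (u k <= B)%E) -> (limn_esup u <= B)%E.
Proof.
move=> H; apply: (@le_trans _ _ (ereal_sup (u @` [set k | (u k <= B)%E]))).
  by apply: ereal_inf_lbound; exists [set k | (u k <= B)%E].
by apply: ub_ereal_sup => _ [k ? <-].
Qed.

Lemma ltr_dist_min (u v L e : R) : `|u - v| < e -> `|minr u L - minr v L| < e.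
Proof.
rewrite !ltr_norml => /andP[? ?].
by have [?|?] := leP u L; have [?|?] := leP v L; apply/andP; split; lra.
Qed.

Lemma ltr_dist_le (u v a e : R) : `|u - v| < e -> u <= a -> v < a + e.
Proof. by rewrite ltr_norml => /andP[? ?] ?; lra. Qed.

Lemma exists_large (C e : R) : 0 < C -> 0 < e -> exists2 L, 0 < L & C / L ^+ 2 < e.
Proof.
move=> C0 e0; have q0 : 0 < C / e by rewrite divr_gt0.
exists (1 + C / e); first by lra.
rewrite ltr_pdivrMr ?exprn_gt0//; last by lra.
rewrite -ltr_pdivrMl// mulrC; move: (C / e) q0 => q q0.
have := mulr_ge0 (ltW q0) (ltW q0); lra.
Qed.

(** This is Fatou's lemma for step functions. *)
Lemma integral_le_step_sums (c : nat -> nat -> R) (D : nat -> R) (n : nat -> nat) (E : set R)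
    (h : R -> R) (B : R) :
  measurable E -> (forall k i, 0 <= c k i) -> (forall k, 0 < D k) ->
  (forall x, E x -> (fun k => step_fun (c k) (D k) (n k) x) @ \oo --> h x) ->
  (\forall k \near \oo, \sum_(i < n k) D k * c k i <= B) ->
  (\int[mu]_(x in E) (h x)%:E <= B%:E)%E.
Proof.
move=> mE c0 D0 hE HB; pose f k := step_fun (c k) (D k) (n k).
have -> : (\int[mu]_(x in E) (h x)%:E = \int[mu]_(x in E) limn_einf (fun k => (f k x)%:E))%E.
  apply: eq_integral => x /set_mem Ex.
  have H : (fun k => (f k x)%:E) @ \oo --> (h x)%:E.
    by apply: cvg_EFin; [exact: nearW|exact: hE].
  by have [-> _] := cvg_limn_einf_sup H.
apply: le_trans (fatou mu mE _ _) _.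
- by move=> k; apply/measurable_EFinP/measurable_funTS; exact: measurable_step_fun.
- by move=> k x _; rewrite lee_fin step_fun_ge0.
apply: le_trans (limn_einf_sup _) _; apply: limn_esup_le_near.
near=> k; apply: le_trans (integral_step_fun_le _ (c0 k) (D0 k) mE) _.
by rewrite lee_fin; near: k.
Unshelve. all: by end_near. Qed.

Section GridSequence.
Context (p : R * R -> R) (g : R -> R) (tau : R) (D : nat -> R) (n : nat -> nat) (E : set R).
Context (cg : convex01 g) (tau01 : 0 <= tau <= 1)
  (p0 : forall z, triangle z -> 0 <= p z) (pc : {within triangle, continuous p})
  (D0 : forall k, 0 < D k) (Dcvg : D @ \oo --> (0 : R)) (mE : measurable E)
  (EN : forall x, E x -> [/\ 0 < x, x < 1 & derivable (right_slope g) x 1])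
  (En : forall x, E x -> \forall k \near \oo, x < (n k)%:R * D k).

Let c k := cell p g tau (D k).
Let f k := step_fun (c k) (D k) (n k).
Let psi x := cbrt (derive1 (right_slope g) x * p (x, g x)).

Lemma step_fun_cvg x : E x -> f ^~ x @ \oo --> psi x.
Proof.
move=> Ex; have [x0 x1 dr] := EN Ex.
apply/cvgrPdist_lt => e e0.
have [dl dl0 H] := cell_cvg cg tau01 x0 x1 p0 pc dr e0.
have Hd : \forall k \near \oo, `|0 - D k| < dl.
  by move/cvgrPdist_lt: Dcvg; exact.
near=> k.
have Dk : D k < dl.
  have : `|0 - D k| < dl by near: k.
  by rewrite sub0r normrN gtr0_norm.
have xn : x < (n k)%:R * D k by near: k; exact: En.
have [i ix] := grid_index (D0 k) (ltW x0).
have il : (i < n k)%N.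
  move: ix => /andP[ix _]; have := le_lt_trans ix xn.
  by rewrite ltr_pM2r// ltr_nat.
rewrite /f (step_funE _ (D0 k) il ix) distrC.
exact: H.
Unshelve. all: by end_near. Qed.

Lemma integral_le_grid_sum (B : R) :
  (\forall k \near \oo, grid_sum p g tau (D k) (n k) <= B) ->
  (\int[mu]_(x in E) (psi x)%:E <= B%:E)%E.
Proof.
apply: (@integral_le_step_sums c) => //; last exact: step_fun_cvg.
by move=> k i; exact: cbrt_ge0.
Qed.

Lemma measurable_integrand : measurable_fun E (fun x => (psi x)%:E).
Proof.
apply: (@emeasurable_fun_cvg _ _ _ _ (fun k x => (f k x)%:E)).
  by move=> k; apply/measurable_EFinP/measurable_funTS; exact: measurable_step_fun.
by move=> x Ex; apply: cvg_EFin; [exact: nearW|exact: step_fun_cvg].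
Qed.

Lemma step_fun_min x k (L : R) : 0 <= x < (n k)%:R * D k ->
  step_fun (fun i => minr (c k i) L) (D k) (n k) x = minr (f k x) L.
Proof.
move=> /andP[x0 xn]; have [i ix] := grid_index (D0 k) x0.
have il : (i < n k)%N.
  move: ix => /andP[ix _]; have := le_lt_trans ix xn.
  by rewrite ltr_pM2r// ltr_nat.
by rewrite /f !(step_funE _ (D0 k) il ix).
Qed.

(** Cell values are truncated at a level [L]. The truncated sums converge by dominated convergence
    to at most the integral, and what is cut off is bounded by the sum of [D * c ^+ 3 / L ^+ 2],
    uniformly in the grid. *)
Lemma grid_sum_lt_integral (A C b : R) (N : set R) : 
  (forall k, (n k)%:R * D k = b) -> (forall x, E x <-> (`[0, b[%classic `\` N) x) -> measurable N -> mu N = 0%E ->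
  (\int[mu]_(x in E) (psi x)%:E < A%:E)%E ->
  (\forall k \near \oo, \sum_(i < n k) D k * c k i ^+ 3 <= C) ->
  \forall k \near \oo, grid_sum p g tau (D k) (n k) < A.
Proof.
move=> nDb EE mN N0 IA HC.
have [a aE] : exists a, (\int[mu]_(x in E) (psi x)%:E)%E = a%:E.
  have : (0 <= \int[mu]_(x in E) (psi x)%:E)%E.
    by apply: integral_ge0 => x _; rewrite lee_fin cbrt_ge0.
  by move: IA; case: (\int[mu]_(x in E) _)%E => // a _ _; exists a.
rewrite aE lte_fin in IA.
have [C0 C0' CC0] : exists2 C0, 0 < C0 & C <= C0.
  by exists (maxr C 1); rewrite ?lt_max ?ltr01 ?orbT// le_max lexx.
have [L L0 LC] : exists2 L, 0 < L & C0 / L ^+ 2 < (A - a) / 2.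
  by apply: exists_large => //; rewrite divr_gt0// subr_gt0.
pose f' k x := step_fun (fun i => minr (c k i) L) (D k) (n k) x.
have mf' k (B : set R) : measurable_fun B (fun x => (f' k x)%:E).
  by apply/measurable_EFinP/measurable_funTS; exact: measurable_step_fun.
have c'0 k i : 0 <= minr (c k i) L by rewrite le_min cbrt_ge0 ltW.
have E0b x : E x -> 0 <= x < b by move=> /EE[/=]; rewrite in_itv.
have f'L k x : E x -> `|f' k x| <= L.
  move=> Ex; rewrite ger0_norm; last exact: step_fun_ge0.
  by rewrite /f' step_fun_min ?nDb ?E0b// ge_min lexx orbT.
have f'cvg x : E x -> (fun k => (f' k x)%:E) @ \oo --> (minr (psi x) L)%:E.
  move=> Ex; apply: cvg_EFin; first exact: nearW.
  apply/cvgrPdist_lt => e e0; have /cvgrPdist_lt/(_ _ e0) := step_fun_cvg Ex.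
  apply: filterS => k; rewrite /= /f' step_fun_min ?nDb ?E0b//.
  exact: ltr_dist_min.
have [_ _ cvgI] : [/\ mu.-integrable E (fun x => (minr (psi x) L)%:E),
   (fun k => \int[mu]_(x in E) `|(f' k x)%:E - (minr (psi x) L)%:E|)%E @ \oo --> 0%E &
   (fun k => \int[mu]_(x in E) (f' k x)%:E)%E @ \oo --> (\int[mu]_(x in E) (minr (psi x) L)%:E)%E].
  apply: (@dominated_convergence _ _ _ mu E mE (fun k x => (f' k x)%:E) _ (cst L%:E)).
  - by move=> k; exact: mf'.
  - by apply: (@emeasurable_fun_cvg _ _ _ _ (fun k x => (f' k x)%:E)) => // k; exact: mf'.
  - by apply: aeW => x Ex; exact: f'cvg.
  - apply/integrableP; split; first exact: measurable_cst.
    rewrite integral_cst//= gtr0_norm//.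
    apply: (@le_lt_trans _ _ (L%:E * mu `[0%R, b]%classic)%E); last first.
      by rewrite lebesgue_measure_itv /=; case: ifP => _; rewrite ?mule0 ?ltry// -EFinB -EFinM ltry.
    rewrite lee_pmul2l//; apply: le_measure; rewrite ?inE//.
    by move=> x /E0b; rewrite /= in_itv /= => /andP[-> /ltW].
  - by apply: aeW => x k Ex; rewrite /= lee_fin f'L.
have minle : (\int[mu]_(x in E) (minr (psi x) L)%:E <= a%:E)%E.
  rewrite -aE; apply: le_measure_integral => // x _; last by rewrite lee_fin ge_min lexx.
  by rewrite lee_fin le_min cbrt_ge0 ltW.
have [l lE] : exists l, (\int[mu]_(x in E) (minr (psi x) L)%:E)%E = l%:E.
  have : (0 <= \int[mu]_(x in E) (minr (psi x) L)%:E)%E.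
    by apply: integral_ge0 => x _; rewrite lee_fin le_min cbrt_ge0 ltW.
  by move: minle; case: (\int[mu]_(x in E) _)%E => // l _ _; exists l.
rewrite lE lee_fin in minle; rewrite lE in cvgI.
have /fine_cvgP[finI /cvgrPdist_lt cvgF] := cvgI.
have Aa : 0 < (A - a) / 2 by rewrite divr_gt0// subr_gt0.
have {}cvgF := cvgF _ Aa.
near=> k.
have Ik : (\int[mu]_(x in E) (f' k x)%:E < (a + (A - a) / 2)%:E)%E.
  rewrite -[ltLHS]fineK; last by near: k.
  rewrite lte_fin; apply: ltr_dist_le minle.
  by near: k.
have S' : \sum_(i < n k) D k * minr (c k i) L < a + (A - a) / 2.
  rewrite -lte_fin; apply: le_lt_trans Ik.
  rewrite -(integral_step_fun (n k) (c'0 k) (D0 k)).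
  rewrite (@integral_setD_null _ _ R mu _ N _ _ mN N0)//; last by move=> x _; rewrite lee_fin step_fun_ge0.
  rewrite le_eqVlt [X in X == _]integral_mkcond [X in _ == X]integral_mkcond.
  apply/orP; left; apply/eqP; apply: eq_integral => x _; rewrite !patchE.
  have [Nx|Nx] := pselect (N x).
    by rewrite !memNset//; [move=> /EE[]|case].
  rewrite (@mem_set _ (_ `\` _))//; have [xb|xb] := pselect (`[0, b[%classic x).
    by rewrite mem_set//; apply/EE.
  rewrite memNset; last by move=> /EE[].
  rewrite step_fun_out// nDb; have [x0|x0] := ltP x 0; [by left|right].
  by rewrite leNgt; apply/negP => xb'; apply: xb; rewrite /= in_itv /= x0.
(* Above the level [L] one has [c <= c * (c / L) ^+ 2]. *)
have cL i : c k i <= minr (c k i) L + c k i ^+ 3 / L ^+ 2.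
  have ci := cbrt_ge0 (p (i%:R * D k, g (i%:R * D k)) * (increment g tau (D k) i / D k)).
  rewrite -/(cell _ _ _ _ _) -/(c k i) in ci.
  have [cl|cl] := leP (c k i) L; first by rewrite lerDl divr_ge0 ?exprn_ge0// ltW.
  rewrite -[leLHS]add0r lerD//; first exact: ltW.
  rewrite ler_pdivlMr ?exprn_gt0// (exprS _ 2) ler_wpM2l//.
  by rewrite lerXn2r ?nnegrE// ltW.
apply: (@le_lt_trans _ _ (\sum_(i < n k) (D k * minr (c k i) L + D k * c k i ^+ 3 / L ^+ 2))).
  by apply: ler_sum => i _; rewrite -(mulrA (D k)) -mulrDr ler_pM2l//; exact: cL.
rewrite big_split /= -mulr_suml.
have : \sum_(i < n k) D k * c k i ^+ 3 <= C by near: k.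
move=> SC; have : (\sum_(i < n k) D k * c k i ^+ 3) / L ^+ 2 < (A - a) / 2.
  by apply: le_lt_trans LC; rewrite ler_pM2r ?invr_gt0 ?exprn_gt0//; exact: le_trans CC0.
move=> SL; apply: lt_le_trans (ltrD S' SL) _.
by rewrite -addrA -splitr addrC subrK.
Unshelve. all: by end_near. Qed.
End GridSequence.

(** An enlarged cell reaches into its two neighbours, so its increment is at most one over three
    cells; such increments telescope with shift 3. *)
Lemma sum_shift3_le (u : nat -> R) m : (forall i, (i <= 2)%N -> 0 <= u i) ->
  \sum_(i < m) (u i.+3 - u i) <= u m.+2 + u m.+1 + u m.
Proof.
move=> u0; suff -> : \sum_(i < m) (u i.+3 - u i) = u m.+2 + u m.+1 + u m - (u 2 + u 1 + u 0).
  by rewrite gerBl !addr_ge0// u0.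
elim: m => [|m IH]; first by rewrite big_ord0 subrr.
by rewrite big_ord_recr /= IH; ring.
Qed.

Lemma sum_increment_le g D b m : convex01 g -> 0 < D -> D <= 1 -> m%:R * D = b -> b + D < 1 ->
  \sum_(i < m) increment g 1 D i <= 3 * right_slope g (b + D) + 4 * b.
Proof.
move=> cg D0 D1 mb bD1.
have DD0 : 0 <= D ^+ 2 by rewrite exprn_ge0// ltW.
have DD : D ^+ 2 <= D by rewrite expr2 ler_piMl// ltW.
pose u j := right_slope g ((j%:R - 1) * D).
have jm j : (j <= m.+2)%N -> (j%:R - 1) * D <= b + D.
  move=> jm; have -> : b + D = (m%:R + 1) * D by rewrite mulrDl mul1r mb.
  by rewrite ler_pM2r// lerBlDr !natr1 ler_nat.
have u0 j : (j <= m.+2)%N -> 0 <= u j by move=> /jm jb; apply: right_slope_ge0 => //; lra.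
have ub j : (j <= m.+2)%N -> u j <= right_slope g (b + D).
  by move=> /jm jb; apply: right_slope_homo.
apply: (@le_trans _ _ (\sum_(i < m) (u i.+3 - u i) + \sum_(i < m) 4 * D)).
  rewrite -big_split /=; apply: ler_sum => i _.
  have im := jm i.+3 (ltn_ord i).
  have E3 : (i.+3%:R - 1) * D = i.+1%:R * D + D.
    by rewrite -[i.+3]addn1 natrD addrK -[i.+2]addn1 natrD mulrDl mul1r.
  have E0 : (i%:R - 1) * D = i%:R * D - D by rewrite mulrBl mul1r.
  have E1 : i.+1%:R * D = i%:R * D + D by rewrite -natr1 mulrDl mul1r.
  rewrite /increment /u E3 E0; rewrite E3 in im.
  rewrite !mul1r mulr1 -!addrA; apply: lerD.
    by apply: right_slope_homo => //; [rewrite lerD2l|lra].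
  apply: lerD; last by rewrite ler_pM2l.
  rewrite lerN2; apply: right_slope_homo => //; first by rewrite lerD2l lerN2.
  by rewrite E1 in im; lra.
rewrite sumr_const card_ord -(mulr_natr (4 * D)) -mulrA [D * _]mulrC mb lerD2r.
apply: le_trans (sum_shift3_le _ _) _; first by move=> i i2; apply: u0; apply: leq_trans i2 _.
by have := ub m.+2 (leqnn _); have := ub m.+1 (leqnSn _); have := ub m (leq_trans (leqnSn _) (leqnSn _)); lra.
Qed.

(** Up to [b < 1] the right slope is bounded. Since [D * cell ^+ 3] is the density times the
    increment of the slope, the sums of cubes are bounded by telescoping, as [grid_sum_lt_integral]
    requires. *)
Lemma grid_sum_upper p g (M A b : R) : convex01 g -> 0 < b -> b < 1 ->
  (forall z, triangle z -> 0 <= p z <= M) -> {within triangle, continuous p} ->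
  (J p g < A%:E)%E ->
  \forall k \near \oo, grid_sum p g 1 (b / k.+1%:R) k.+1 < A.
Proof.
move=> cg b0 b1 pM pc JA.
have p0 z : triangle z -> 0 <= p z by move=> /pM/andP[].
have [N [mN N0 HN JE]] := J_setD_null cg p0.
pose E : set R := `[0, b[%classic `\` N.
have EI : E `<=` `[0, 1]%classic `\` N.
  move=> x [xb Nx]; split; last exact: Nx.
  rewrite /= in_itv /=; move: xb; rewrite /= in_itv /= => /andP[x0 xb].
  by apply/andP; split; [exact: x0|exact: ltW (lt_trans xb b1)].
have D0 k : 0 < b / k.+1%:R by rewrite divr_gt0.
have nD k : k.+1%:R * (b / k.+1%:R) = b by rewrite mulrC divfK// pnatr_eq0.
have Dcvg : (fun k : nat => b / k.+1%:R) @ \oo --> (0 : R).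
  by rewrite -(mulr0 b); apply: cvgM; [exact: cvg_cst|exact: cvg_harmonic].
have mE : measurable E by apply: measurableD; [exact: measurable_itv|exact: mN].
apply: (@grid_sum_lt_integral p g 1 _ (fun k => k.+1) E cg _ p0 pc D0 Dcvg mE _ _ A
  (M * (3 * right_slope g ((1 + b) / 2) + 4)) b N nD _ mN N0).
- by rewrite ler01 lexx.
- by move=> x /EI/HN.
- by move=> x [/=]; rewrite in_itv /= => /andP[_ xb] _; apply: nearW => k; rewrite nD.
- by move=> x; split; exact: id.
- apply: le_lt_trans JA; rewrite JE [leLHS]integral_mkcond [leRHS]integral_mkcond.
  apply: le_measure_integral; [exact: measurableT|by move=> *; exact: lexx| |] => x _; rewrite !patchE.
    by case: ifP => _; [rewrite lee_fin cbrt_ge0|exact: lexx].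
  case: ifPn => [/set_mem/EI/mem_set ->|_]; first exact: lexx.
  by case: ifP => _; [rewrite lee_fin cbrt_ge0|exact: lexx].
clear JA JE HN EI mE N0 mN; clear E N.
have d0 : 0 < minr 1 ((1 - b) / 2) by rewrite lt_min ltr01 divr_gt0// subr_gt0.
have /cvgrPdist_lt/(_ _ d0) := Dcvg.
apply: filterS => k; rewrite sub0r normrN (gtr0_norm (D0 k)) lt_min => /andP[D1 Db].
have M0 : 0 <= M.
  have /pM/andP[/le_trans h /h //] : triangle ((0, 0) : R * R) by apply/triangleP => /=; lra.
have cE i : (i < k.+1)%N -> b / k.+1%:R * cell p g 1 (b / k.+1%:R) i ^+ 3 <=
    M * increment g 1 (b / k.+1%:R) i.
  move=> ik; rewrite /cell.
  have i1 : i.+1%:R * (b / k.+1%:R) <= b by rewrite -[leRHS](nD k) ler_pM2r// ler_nat.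
  have i0 : 0 <= i%:R * (b / k.+1%:R) by rewrite mulr_ge0// ltW.
  have i2 : i%:R * (b / k.+1%:R) <= b by apply: le_trans i1; rewrite ler_pM2r// ler_nat.
  have inc0 : 0 <= increment g 1 (b / k.+1%:R) i.
    apply: increment_ge0 => //.
    have : (b / k.+1%:R) ^+ 2 <= b / k.+1%:R by rewrite expr2 ler_piMl// ltW.
    by move: i1 Db; move: (b / k.+1%:R) => DD; rewrite mul1r; lra.
  have /pM/andP[q0 qM] : triangle (i%:R * (b / k.+1%:R), g (i%:R * (b / k.+1%:R))).
    move: i0 i2; move: (_ * _) => t t0 tb; apply/triangleP => /=.
    have t01 : 0 <= t <= 1 by lra.
    by have := convex01_range cg t01; have := convex01_le_id cg t01; lra.
  rewrite cbrtK; last by rewrite mulr_ge0// divr_ge0// ltW.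
  have dE (d q I : R) : 0 < d -> d * (q * (I / d)) = q * I.
    by move=> dd0; field; rewrite gt_eqF.
  rewrite dE//.
  by rewrite ler_wpM2r.
apply: (@le_trans _ _ (\sum_(i < k.+1) M * increment g 1 (b / k.+1%:R) i)).
  by apply: ler_sum => i _; exact: cE.
rewrite -mulr_sumr ler_wpM2l//.
have bD : b + b / k.+1%:R < (1 + b) / 2 by move: Db; move: (b / k.+1%:R) => DD; lra.
have h1 : (1 + b) / 2 < 1 by lra.
have bD1 := lt_trans bD h1.
apply: le_trans (sum_increment_le cg (D0 k) (ltW D1) (nD k) bD1) _.
apply: lerD; last lra.
rewrite ler_pM2l//; apply: right_slope_homo => //; exact: ltW.
Qed.

(** If all sums from [k0] on were at most [A], Fatou's lemma would give [J p f <= A]. With mesh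
    1/(k+1) only [k] cells are used, which keeps away from a possible explosion of the slope at
    1. *)
Lemma grid_sum_lower p f (A : R) k0 : convex01 f ->
  (forall z, triangle z -> 0 <= p z) -> {within triangle, continuous p} ->
  (A%:E < J p f)%E ->
  exists2 k, (k0 <= k)%N & A < grid_sum p f 0 (k.+1%:R^-1) k.
Proof.
move=> cg p0 pc JA.
have [N [mN N0 HN JE]] := J_setD_null cg p0.
apply: contrapT => H; move: JA; apply/negP; rewrite -leNgt JE.
clear JE N0.
apply: (@integral_le_grid_sum p f 0 (fun k => k.+1%:R^-1) id (`[0, 1]%classic `\` N) cg _ p0 pc).
- by rewrite lexx ler01.
- by move=> k; rewrite invr_gt0.
- exact: cvg_harmonic.
- by apply: measurableD; [exact: measurable_itv|exact: mN].
- by move=> x /HN.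
- move=> x /HN[x0 x1 _].
  have x10 : 0 < 1 - x by rewrite subr_gt0.
  have [k _ Hk] := near_infty_natSinv_lt (PosNum x10).
  exists k => // m /Hk /=; rewrite -(ltrD2r x) subrK => xm.
  have : m%:R * m.+1%:R^-1 = 1 - m.+1%:R^-1 :> R.
    by rewrite -natr1; field; rewrite natr1 pnatr_eq0.
  by move=> ->; rewrite ltrBrDr addrC.
exists k0 => // k /= kk0; rewrite leNgt; apply/negP => Ak; apply: H; by exists k.
Qed.

End GridSums.

(** * Jumps at the right endpoint *)

Section MonotoneIntegral.
Context {R : realType}.
Local Notation mu := (@lebesgue_measure R).
Implicit Types (g G : R -> R) (x : R).

Lemma sum_pos_increments G (x0 B D : R) m : 0 < D ->
  (forall x y, x0 <= x -> x <= y -> y <= m%:R * D -> G x <= G y) ->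
  (forall x, x0 <= x -> x <= m%:R * D -> G x <= B) -> G x0 <= B ->
  \sum_(i < m) (if x0 <= i%:R * D then G (i.+1%:R * D) - G (i%:R * D) else 0) <= B - G x0.
Proof.
move=> D0 ndG GB GB0.
suff H k : (k <= m)%N ->
    \sum_(i < k) (if x0 <= i%:R * D then G (i.+1%:R * D) - G (i%:R * D) else 0) <=
    if x0 <= k%:R * D then G (k%:R * D) - G x0 else 0.
  apply: le_trans (H m (leqnn _)) _; case: ifP => xm; last by rewrite subr_ge0.
  by rewrite lerD2r GB.
elim: k => [|k IH] km; first by rewrite big_ord0; case: ifP => // h; rewrite subr_ge0 ndG// ler_wpM2r// ltW.
rewrite big_ord_recr /=; apply: le_trans (lerD (IH (ltnW km)) (lexx _)) _.
have kk : k%:R * D <= k.+1%:R * D by rewrite ler_pM2r// ler_nat.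
case: ifP => h1; first by rewrite (le_trans h1 kk) ; lra.
rewrite add0r; case: ifP => // h2; rewrite subr_ge0 ndG// ler_pM2r// ler_nat//.
Qed.

(** Fatou's lemma is applied to the difference quotients of [G] over a grid, whose sums telescope.
    Cells starting before [x0] and the last cell before 1 get the value 0. *)
Lemma integral_derive1_le G (x0 B : R) (E : set R) : 0 <= x0 -> x0 < 1 -> measurable E ->
  (forall x y, x0 <= x -> x <= y -> y < 1 -> G x <= G y) ->
  (forall x, x0 <= x -> x < 1 -> G x <= B) ->
  (forall x, E x -> [/\ x0 < x, x < 1 & derivable G x 1]) ->
  (\int[mu]_(x in E) (derive1 G x)%:E <= (B - G x0)%:E)%E.
Proof.
move=> x00 x01 mE ndG GB EG.
pose D k : R := k.+1%:R^-1.
have D0 k : 0 < D k by rewrite invr_gt0.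
have kD k : k%:R * D k < 1 by rewrite /D ltr_pdivrMr// mul1r ltr_nat.
have ik i k : (i <= k)%N -> i%:R * D k <= k%:R * D k by move=> ?; rewrite ler_pM2r// ler_nat.
pose c k i : R := if (i < k)%N && (x0 <= i%:R * D k)
  then (G (i.+1%:R * D k) - G (i%:R * D k)) / D k else 0.
apply: (@integral_le_step_sums _ c D id) => //.
- move=> k i; rewrite /c; case: ifP => // /andP[il xi].
  rewrite divr_ge0 ?(ltW (D0 k))// subr_ge0 ndG//.
    by rewrite ler_pM2r// ler_nat.
  by apply: le_lt_trans (kD k); exact: ik.
- move=> x Ex; have [x0x x1 dG] := EG _ Ex.
  apply/cvgrPdist_le => e e0.
  have [dl dl0 H] := straddle dG erefl e0.
  have m0 : 0 < minr dl (minr (x - x0) (1 - x)) by rewrite !lt_min dl0 !subr_gt0 x0x.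
  have [K _ HK] := near_infty_natSinv_lt (PosNum m0).
  exists K => // k /HK /=; rewrite !lt_min => /and3P[kdl kx0 kx1].
  rewrite -/(D k) in kdl kx0 kx1.
  have [i /andP[i1 i2]] := grid_index (D0 k) (ltW (le_lt_trans x00 x0x)).
  have E1 : i.+1%:R * D k = i%:R * D k + D k by rewrite -natr1 mulrDl mul1r.
  have il : (i < k)%N.
    rewrite ltnNge; apply/negP => ki.
    have : k%:R * D k <= x by apply: le_trans i1; rewrite ler_pM2r// ler_nat.
    have : k.+1%:R * D k = 1 by rewrite /D mulfV// pnatr_eq0.
    by rewrite -natr1 mulrDl mul1r; move: kx1; clear; lra.
  rewrite (step_funE _ (D0 k) il) ?i1// /c il /=.
  have -> : x0 <= i%:R * D k by move: i2 kx0; rewrite E1; clear; lra.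
  have := H (i%:R * D k) (i.+1%:R * D k) i1 (ltW i2); rewrite E1 addrAC subrr add0r => /(_ kdl).
  move: (D k) (D0 k) (G _) (G _) (derive1 G x) => d d0 v u L H'.
  rewrite distrC (_ : (u - v) / d - L = (u - v - L * d) / d); last by field; rewrite gt_eqF.
  by rewrite normrM normfV (gtr0_norm d0) ler_pdivrMr.
- apply: nearW => k.
  have [xk|xk] := leP x0 (k%:R * D k); last first.
    rewrite big1 => [|i _]; first by rewrite subr_ge0 GB.
    rewrite /c ltn_ord /= leNgt (le_lt_trans (ik _ _ (ltnW (ltn_ord i))) xk) /=.
    by rewrite mulr0.
  apply: le_trans (sum_pos_increments (x0 := x0) (B := B) (D := D k) (m := k) (G := G) _ _ _ _).
  - apply: ler_sum => i _; rewrite /c ltn_ord /=; case: ifP => _; last by rewrite mulr0.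
    by rewrite mulrC divfK// gt_eqF.
  - exact: D0.
  - by move=> x y ? ? yk; apply: ndG => //; exact: le_lt_trans yk (kD k).
  - by move=> x ? xk'; apply: GB => //; exact: le_lt_trans xk' (kD k).
  - exact: GB.
Qed.

Lemma amgm3 (u v : R) : 0 <= u -> 0 <= v -> 3 * u * v ^+ 2 <= u ^+ 3 + 2 * v ^+ 3.
Proof.
move=> u0 v0; rewrite -subr_ge0.
have -> : u ^+ 3 + 2 * v ^+ 3 - 3 * u * v ^+ 2 = (u - v) ^+ 2 * (u + 2 * v) by ring.
by rewrite mulr_ge0 ?sqr_ge0//; lra.
Qed.

(** The tangent at [x] stays below [g]; its value at 1 is the limit of its values at [y < 1], which
    are at most [h]. *)
Lemma convex01_tangent_le g (h : R) x : convex01 g ->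
  (forall x, x < 1 -> 0 <= x -> g x <= h) -> 0 <= x -> x < 1 ->
  (1 - x) * right_slope g x + g x <= h.
Proof.
move=> cg gh x0' x1.
apply/ler_addgt0Pr => e e0.
have r0 := right_slope_ge0 cg x1.
pose y := maxr ((1 + x) / 2) (1 - e / (right_slope g x + 1)).
have yx : x < y by rewrite lt_max; apply/orP; left; lra.
have e1 : 0 < e / (right_slope g x + 1) by rewrite divr_gt0//; lra.
have y1 : y < 1 by rewrite gt_max; apply/andP; split; lra.
have := right_slope_le cg x0' yx (ltW y1).
have := gh y y1 (le_trans x0' (ltW yx)).
have : 1 - y <= e / (right_slope g x + 1) by rewrite lerBlDl -lerBlDr le_max lexx orbT.
rewrite ler_pdivlMr; last lra.
have : 0 <= (1 - y) by lra.
nra.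
Qed.

(* The weight [1 - x] compensates the possible explosion of the derivative at [1]. *)
Lemma tail_integral_le g (x0 h lam : R) (E : set R) : convex01 g -> 0 <= x0 -> x0 < 1 ->
  (forall x, x < 1 -> 0 <= x -> g x <= h) -> 0 < lam -> measurable E ->
  (forall x, E x -> [/\ x0 < x, x < 1 & derivable (right_slope g) x 1]) ->
  (\int[mu]_(x in E) (cbrt (derive1 (right_slope g) x))%:E <=
   ((lam ^+ 2 * (h - g x0) + 4 / lam * Num.sqrt (1 - x0)) / 3)%:E)%E.
Proof.
move=> cg x00 x01 gh lam0 mE EG.
(* The derivative of [G] is the arithmetic mean of [lam ^+ 2 * (1 - x) * r'], with [r'] the
   derivative of the right slope, and twice the inverse of [lam * Num.sqrt (1 - x)]. The product of
   these three numbers is [r'], so its cube root is at most the derivative of [G]. *)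
pose G x := lam ^+ 2 / 3 * ((1 - x) * right_slope g x + g x) - 4 / (3 * lam) * Num.sqrt (1 - x).
have ndH x y : x0 <= x -> x <= y -> y < 1 ->
    (1 - x) * right_slope g x + g x <= (1 - y) * right_slope g y + g y.
  move=> x0x; rewrite le_eqVlt => /predU1P[->//|xy] y1.
  have x0' := le_trans x00 x0x.
  have A := right_slope_le cg x0' xy (ltW y1).
  have B := right_slope_homo cg (ltW xy) y1.
  have : 0 <= (1 - y) * (right_slope g y - right_slope g x) by rewrite mulr_ge0 ?subr_ge0// ltW.
  lra.
have Hh x : x0 <= x -> x < 1 -> (1 - x) * right_slope g x + g x <= h.
  by move=> x0x x1; apply: (convex01_tangent_le cg gh) => //; exact: le_trans x0x.
have sqrt_nd x y : x <= y -> Num.sqrt (1 - y) <= Num.sqrt (1 - x) by move=> xy; apply: ler_wsqrtr; lra.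
have l3 : 0 <= lam ^+ 2 / 3 by rewrite divr_ge0 ?sqr_ge0.
have l4 : 0 <= 4 / (3 * lam) by rewrite divr_ge0// mulr_ge0// ltW.
pose G' x := lam ^+ 2 / 3 * ((1 - x) * derive1 (right_slope g) x) + 2 / (3 * lam) / Num.sqrt (1 - x).
have dG x : E x -> is_derive x (1 : R) G (G' x).
  move=> /EG[x0x x1 dr].
  have xp : 0 < x by exact: le_lt_trans x0x.
  have cr : {for x, continuous (right_slope g)}.
    by apply: differentiable_continuous; apply/derivable1_diffP.
  have [dg dgE] := convex01_derive1 cg xp x1 cr.
  have dr' : is_derive x (1 : R) (right_slope g) (derive1 (right_slope g) x).
    by rewrite derive1E; exact: derivableP.
  have dg' : is_derive x (1 : R) g (right_slope g x) by rewrite -dgE derive1E; exact: derivableP.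
  have s0 : 0 < Num.sqrt (1 - x) by rewrite sqrtr_gt0 subr_gt0.
  have px : 0 < 1 - x by rewrite subr_gt0.
  have ds : is_derive x (1 : R) (fun y => Num.sqrt (1 - y)) ((2 * Num.sqrt (1 - x))^-1 * -1).
    have := @is_derive1_comp _ Num.sqrt (fun y : R => 1 - y) x _ _ (is_derive1_sqrt px).
    have d1 : is_derive x (1 : R) (fun y : R => 1 - y) (-1).
      by apply: is_derive_eq; rewrite add0r mul1r.
    by move=> /(_ _ d1).
  apply: is_derive_eq; rewrite /GRing.scale /= /G'.
  by field; rewrite !gt_eqF.
have main : (\int[mu]_(x in E) (derive1 G x)%:E <= (lam ^+ 2 / 3 * h - G x0)%:E)%E.
  apply: (@integral_derive1_le G x0 _ E x00 x01 mE).
  - move=> x y x0x xy y1; rewrite /G lerB// ?ler_wpM2l//; [exact: ndH|exact: sqrt_nd].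
  - move=> x x0x x1; rewrite /G lerBlDr ler_wpDr//; first by rewrite mulr_ge0// sqrtr_ge0.
    by rewrite ler_wpM2l// Hh.
  - move=> x Ex; have [x0x x1 dr] := EG _ Ex; have [dGx _] := dG _ Ex.
    split; [exact: x0x|exact: x1|exact: dGx].
clear sqrt_nd ndH Hh.
apply: le_trans _ (le_trans main _).
  apply: le_measure_integral; [exact: mE|by move=> *; exact: lexx|by move=> *; rewrite lee_fin cbrt_ge0|move=> x Ex].
  have [x0x x1 dr] := EG _ Ex.
  have [_ dGE] := dG _ Ex.
  rewrite lee_fin [X in _ <= X]derive1E [X in _ <= X]dGE /G' => {dGE}.
  have L0 := right_slope_derive1_ge0 cg x1 dr.
  move: (derive1 (right_slope g) x) L0 => L L0.
  have px : 0 < 1 - x by rewrite subr_gt0.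
  have s0 : 0 < Num.sqrt (1 - x) by rewrite sqrtr_gt0.
  have sE : Num.sqrt (1 - x) ^+ 2 = 1 - x by rewrite sqr_sqrtr// ltW.
  move: (Num.sqrt (1 - x)) s0 sE => q q0 <-.
  have h1 : 0 <= lam ^+ 2 * (q ^+ 2 * L) by rewrite mulr_ge0 ?sqr_ge0// mulr_ge0// sqr_ge0.
  have h2 : 0 <= (lam * q)^-1 by rewrite invr_ge0 mulr_ge0// ltW.
  have := amgm3 (cbrt_ge0 (lam ^+ 2 * (q ^+ 2 * L))) (cbrt_ge0 (lam * q)^-1).
  have E1 : cbrt (lam ^+ 2 * (q ^+ 2 * L)) * cbrt (lam * q)^-1 ^+ 2 = cbrt L.
    rewrite -(exprK_cbrt (mulr_ge0 (cbrt_ge0 _) (exprn_ge0 _ (cbrt_ge0 _)))) exprMn exprAC !cbrtK//.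
    by congr cbrt; field; rewrite !gt_eqF.
  rewrite -mulrA E1 !cbrtK//; move=> H; rewrite -(ler_pM2l (_ : 0 < 3 :> R))//.
  apply: le_trans H _; rewrite le_eqVlt; apply/orP; left; apply/eqP.
  by field; rewrite !gt_eqF.
rewrite lee_fin /G.
have r0 := right_slope_ge0 cg x01.
have -> : lam ^+ 2 / 3 * h - (lam ^+ 2 / 3 * ((1 - x0) * right_slope g x0 + g x0) -
    4 / (3 * lam) * Num.sqrt (1 - x0)) =
  (lam ^+ 2 * (h - g x0) + 4 / lam * Num.sqrt (1 - x0)) / 3 -
   lam ^+ 2 / 3 * ((1 - x0) * right_slope g x0) by field; rewrite gt_eqF.
by rewrite gerBl mulr_ge0// mulr_ge0// subr_ge0 ltW.
Qed.

End MonotoneIntegral.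

(** * Rounding off a convex function next to 1 *)

Section Corner.
Context {R : realType}.
Local Notation mu := (@lebesgue_measure R).
Implicit Types (f g : R -> R) (p : R * R -> R) (x y : R).

Lemma convex01_support f (rho : R -> R) : set_fun `[0, 1] `[0, 1] f -> f 0 = 0 ->
  (forall z y, 0 <= z <= 1 -> 0 <= y <= 1 -> f z + rho z * (y - z) <= f y) -> convex01 f.
Proof.
move=> fr f0 H; split => // t x y; rewrite !inE /= !in_itv /= => x01 y01.
change (f (t%:num * x + (1 - t%:num) * y) <= t%:num * f x + (1 - t%:num) * f y).
have t0 : 0 <= t%:num by [].
have t1 : t%:num <= 1 by [].
move: (t%:num) t0 t1 => {}t t0 t1; set z := t * x + _.
have z01 : 0 <= z <= 1 by rewrite /z; apply/andP; split; nra.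
have A := H z x z01 x01; have B := H z y z01 y01.
have := ler_wpM2l t0 A; have := ler_wpM2l (_ : 0 <= 1 - t) B; rewrite subr_ge0 => /(_ t1).
have : t * (rho z * (x - z)) + (1 - t) * (rho z * (y - z)) = 0 by rewrite /z; ring.
lra.
Qed.

Lemma convex01_convex_functions f : convex01 f ->
  (forall e, 0 < e -> exists2 dl, 0 < dl & forall x, 1 - dl < x -> x < 1 -> `|f 1 - f x| < e) ->
  convex_functions f.
Proof.
move=> cf H1; have [fr cvf f0] := cf; split => //.
apply/subspace_continuousP => x /=; rewrite in_itv /= => /andP[x0 x1].
have [xE|xn0] := eqVneq x 0.
  rewrite /from_subspace xE f0; apply/cvgrPdist_lt => e e0; rewrite near_withinE.
  apply/nbhs_ballP; exists e => // y; rewrite /ball /= !sub0r !normrN in_itv /= => ye /andP[y0 y1].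
  have y01 : 0 <= y <= 1 by rewrite y0.
  have /andP[fy0 _] := convex01_range cf y01.
  rewrite ger0_norm//; apply: le_lt_trans (convex01_le_id cf y01) _.
  by move: ye; rewrite ger0_norm.
have [xE|xn1] := eqVneq x 1.
  rewrite /from_subspace xE; apply/cvgrPdist_lt => e e0; rewrite near_withinE.
  have [dl dl0 H] := H1 e e0.
  apply/nbhs_ballP; exists dl => // y; rewrite /ball /= in_itv /= => yd /andP[y0].
  rewrite le_eqVlt => /predU1P[->|y1]; first by rewrite subrr normr0.
  by apply: H => //; move: yd; rewrite ltr_norml => /andP[_]; lra.
apply: cvg_within_filter; apply: convex01_continuous => //; first by rewrite lt_neqAle eq_sym xn0.
by rewrite lt_neqAle xn1.
Qed.

(** By convexity chords from [x] to points beyond [x0] are at least as steep as the chord to [x0],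
    so the infimum depends only on the values up to [x0]. *)
Lemma right_slope_local f g x0 x : convex01 f -> convex01 g ->
  (forall y, 0 <= y -> y <= x0 -> f y = g y) -> x0 <= 1 -> 0 <= x -> x < x0 ->
  right_slope f x = right_slope g x.
Proof.
wlog suff : f g / convex01 f -> convex01 g -> (forall y, 0 <= y -> y <= x0 -> f y = g y) ->
    x0 <= 1 -> 0 <= x -> x < x0 -> right_slope f x <= right_slope g x.
  move=> H cf cg fg x01 xp xx0; apply/eqP; rewrite eq_le !H// => y y0 yx0.
  by rewrite fg.
move=> cf cg fg x01 xp xx0.
have x1 := lt_le_trans xx0 x01.
rewrite [leRHS]/right_slope ltNge xp /=; apply: lb_le_inf; first by case: (right_slopes_has_inf cg xp x1).
move=> _ [y /= + <-]; rewrite in_itv /= => /andP[xy y1].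
rewrite ler_pdivlMr ?subr_gt0//.
have [yx0|x0y] := leP y x0.
  apply: le_trans (right_slope_le cf xp xy y1) _.
  by rewrite !fg// ?(ltW xx0)// (le_trans xp (ltW xy)).
have A := right_slope_le cf xp xx0 x01.
have B := convex01_slope cg xp xx0 x0y y1.
rewrite !fg// ?(ltW xx0)// ?(le_trans xp (ltW xx0))// in A.
move: A B; move: (right_slope f x) (g x) (g x0) (g y) => r a b c A B.
have A' : r * (x0 - x) * (y - x0) <= (b - a) * (y - x0) by rewrite ler_pM2r// subr_gt0.
have : r * (y - x0) <= c - b.
  rewrite -(ler_pM2r (x := x0 - x)) ?subr_gt0//; lra.
lra.
Qed.

(** Beyond [x0] the tangent is bent upwards by a parabola, which has constant second derivative
    [2 * k]. *)
Definition corner g x0 (k : R) x : R :=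
  if x <= x0 then g x else g x0 + right_slope g x0 * (x - x0) + k * (x - x0) ^+ 2.

Lemma cornerE g x0 k x : x0 <= x ->
  corner g x0 k x = g x0 + right_slope g x0 * (x - x0) + k * (x - x0) ^+ 2.
Proof.
rewrite le_eqVlt => /predU1P[<-|x0x]; rewrite /corner.
  by rewrite lexx subrr expr0n /= !mulr0 !addr0.
by rewrite leNgt x0x.
Qed.

Lemma convex01_corner g x0 k : convex01 g -> 0 <= x0 -> x0 < 1 -> 0 <= k ->
  g x0 + right_slope g x0 * (1 - x0) + k * (1 - x0) ^+ 2 <= 1 -> convex01 (corner g x0 k).
Proof.
move=> cg x00 x01 k0 f1.
have r0 := right_slope_ge0 cg x01.
have g0 : g 0 = 0 by case: cg.
have /andP[gx0 gx1] : 0 <= g x0 <= 1 by apply: convex01_range => //; rewrite x00 ltW.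
pose rho z := if z < x0 then right_slope g z else right_slope g x0 + 2 * k * (z - x0).
apply: (@convex01_support _ rho).
- move=> x /=; rewrite !in_itv /= => x01'.
  rewrite /corner; case: ifPn => [_|]; first exact: convex01_range.
  rewrite -ltNge => x0x; apply/andP; split.
    by rewrite !addr_ge0// mulr_ge0 ?exprn_ge0//; lra.
  apply: le_trans f1; rewrite lerD//; first by rewrite lerD2l ler_wpM2l//; lra.
  by rewrite ler_wpM2l// lerXn2r ?nnegrE; lra.
- by rewrite /corner x00.
move=> z y z01 y01; rewrite /rho.
have [zx0|x0z] := ltP z x0.
  have cz : corner g x0 k z = g z by rewrite /corner ltW.
  rewrite cz; have [yx0|x0y] := leP y x0.
    have -> : corner g x0 k y = g y by rewrite /corner yx0.
    have [zy|yz|->] := ltgtP z y; last by rewrite subrr mulr0 addr0.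
      by rewrite -lerBrDl; apply: right_slope_le => //; lra.
    by have := right_slope_ge cg (_ : 0 <= y) yz (_ : z < 1); move=> /(_ ltac:(lra) ltac:(lra)); lra.
  rewrite (cornerE _ _ (ltW x0y)).
  have A := right_slope_le cg (_ : 0 <= z) zx0 (ltW x01); have {}A := A ltac:(lra).
  have B := right_slope_homo cg (ltW zx0) x01.
  have : 0 <= k * (y - x0) ^+ 2 by rewrite mulr_ge0 ?exprn_ge0//; lra.
  have : 0 <= (right_slope g x0 - right_slope g z) * (y - x0) by rewrite mulr_ge0; lra.
  lra.
rewrite (cornerE _ _ x0z).
have [yx0|x0y] := leP y x0.
  have -> : corner g x0 k y = g y by rewrite /corner yx0.
  have : g x0 - g y <= right_slope g x0 * (x0 - y).
    move: yx0; rewrite le_eqVlt => /predU1P[->|yx0]; first by rewrite !subrr mulr0.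
    by apply: right_slope_ge => //; lra.
  have : 0 <= k * ((z - x0) * (x0 - y)) by rewrite !mulr_ge0; lra.
  have : 0 <= k * (z - x0) ^+ 2 by rewrite mulr_ge0 ?exprn_ge0//; lra.
  lra.
rewrite (cornerE _ _ (ltW x0y)).
have : 0 <= k * (y - z) ^+ 2 by rewrite mulr_ge0 ?sqr_ge0.
lra.
Qed.

Lemma corner_convex_functions g x0 k : convex01 g -> 0 <= x0 -> x0 < 1 -> 0 <= k ->
  g x0 + right_slope g x0 * (1 - x0) + k * (1 - x0) ^+ 2 <= 1 ->
  convex_functions (corner g x0 k).
Proof.
move=> cg x00 x01 k0 f1; apply: convex01_convex_functions; first exact: convex01_corner.
have r0 := right_slope_ge0 cg x01.
move=> e e0; pose L := right_slope g x0 + 2 * k + 1.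
have L0 : 0 < L by rewrite /L; lra.
exists (minr (1 - x0) (e / L)); first by rewrite lt_min subr_gt0 x01 divr_gt0.
move=> x; rewrite ltrBlDr -ltrBlDl lt_min => /andP[x0x xe] x1.
rewrite !cornerE; [|lra|exact: ltW].
have xL : (1 - x) * L < e by rewrite -ltr_pdivlMr.
rewrite (_ : _ - _ = (1 - x) * (right_slope g x0 + k * ((1 - x0) + (x - x0)))); last by ring.
have q0 : 0 <= k * ((1 - x0) + (x - x0)) by rewrite mulr_ge0; lra.
rewrite ger0_norm; last by apply: mulr_ge0; [lra|exact: addr_ge0].
apply: le_lt_trans xL; rewrite ler_wpM2l//; first lra.
have : k * ((1 - x0) + (x - x0)) <= k * 2 by rewrite ler_wpM2l//; lra.
rewrite /L; lra.
Qed.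

Lemma near_derive1 f g x : (\forall y \near x, f y = g y) -> derive1 f x = derive1 g x.
Proof. by move=> fg; rewrite !derive1E; apply: near_eq_derive. Qed.

Lemma right_slope_corner g x0 k x : convex01 g -> 0 <= x0 -> x0 < 1 -> 0 <= k ->
  g x0 + right_slope g x0 * (1 - x0) + k * (1 - x0) ^+ 2 <= 1 -> x0 < x -> x < 1 ->
  right_slope (corner g x0 k) x = right_slope g x0 + 2 * k * (x - x0).
Proof.
move=> cg x00 x01 k0 f1 x0x x1; have cf := convex01_corner cg x00 x01 k0 f1.
have H : \forall y \near x, g x0 + right_slope g x0 * (y - x0) + k * (y - x0) ^+ 2 = corner g x0 k y.
  by near=> y; rewrite cornerE//; apply: ltW; near: y; exact: lt_nbhsr.
have dq : is_derive x (1 : R) (fun y => g x0 + right_slope g x0 * (y - x0) + k * (y - x0) ^+ 2)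
    (right_slope g x0 + 2 * k * (x - x0)).
  apply: is_derive_eq; rewrite /GRing.scale /=; ring.
have [dq1 dqE] := dq.
rewrite -(convex01_derive1E cf) -?(near_derive1 H)//; last exact: derivable_near H dq1.
  by rewrite derive1E dqE.
exact: le_lt_trans x0x.
Unshelve. all: by end_near. Qed.

End Corner.

(** * Suboptimality of functions with a jump at 1 *)

Section JumpNotMaximal.
Context {R : realType}.
Local Notation mu := (@lebesgue_measure R).
Context (p : R * R -> R) (M c : R) (g : R -> R).
Context (cg : convex01 g) (c0 : 0 < c) (pcM : forall z, triangle z -> c <= p z <= M)
  (pc : {within triangle, continuous p}).

Let p0 z : triangle z -> 0 <= p z.
Proof. by move=> /pcM/andP[/(le_trans (ltW c0))]. Qed.

Let M0 : 0 < M.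
Proof.
have /pcM/andP[cp pM] : triangle ((0, 0) : R * R) by apply/triangleP => /=; lra.
by apply: lt_le_trans c0 _; exact: le_trans cp pM.
Qed.

Let psi f x := cbrt (derive1 (right_slope f) x * p (x, f x)).

(** The exceptional set may be enlarged, which allows two functions to be compared on a common
    domain. *)
Lemma J_setD_null_of f (N : set R) : convex01 f -> measurable N -> mu N = 0%E ->
  exists N' : set R, [/\ measurable N', mu N' = 0%E, N `<=` N',
    (forall x, (`[0, 1] `\` N') x -> [/\ 0 < x, x < 1 & derivable (right_slope f) x 1]) &
    forall N2 : set R, measurable N2 -> mu N2 = 0%E -> N' `<=` N2 ->
      J p f = (\int[mu]_(x in `[0%R, 1%R] `\` N2) (psi f x)%:E)%E].
Proof.
move=> cf mN N0; have [N1 [mN1 N10 HN1 JE]] := J_setD_null cf p0.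
exists (N1 `|` N); split.
- exact: measurableU.
- apply/eqP; rewrite eq_le measure_ge0 andbT.
  apply: le_trans (measureU2 _ _ _) _; [exact: mN1|exact: mN|].
  by rewrite [X in (X + _)%E]N10 [X in (_ + X)%E]N0 adde0.
- by move=> x; right.
- move=> x [x01 /not_orP[N1x _]]; exact: (HN1 x (conj x01 N1x)).
move=> N2 mN2 N20 sub; rewrite JE.
rewrite (_ : `[0, 1]%classic `\` N2 = (`[0, 1]%classic `\` N1) `\` N2).
  apply: (@integral_setD_null _ _ R mu _ N2 _ _ mN2 N20); first by apply: measurableD.
  by move=> x _; rewrite lee_fin cbrt_ge0.
clear JE HN1; apply/seteqP; split => x [].
  move=> x01 N2x; split; last exact: N2x.
  by split; [exact: x01|move=> N1x; apply: N2x; apply: sub; left].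
by move=> [x01 _] N2x; split; [exact: x01|exact: N2x].
Qed.

(** The integrand is a pointwise limit of step functions on grids. *)
Lemma measurable_psi (q : R * R -> R) (f : R -> R) (E : set R) : convex01 f -> (forall z, triangle z -> 0 <= q z) ->
  {within triangle, continuous q} -> measurable E ->
  (forall x, E x -> [/\ 0 < x, x < 1 & derivable (right_slope f) x 1]) ->
  measurable_fun E (fun x => (cbrt (derive1 (right_slope f) x * q (x, f x)))%:E).
Proof.
move=> cf q0 qc mE EN.
apply: (@measurable_integrand _ q f 0 (fun k => k.+1%:R^-1) id E cf _ q0 qc).
- by rewrite lexx ler01.
- by move=> k; rewrite invr_gt0.
- exact: cvg_harmonic.
- exact: EN.
move=> x /EN[_ x1 _]; have x10 : 0 < 1 - x by rewrite subr_gt0.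
have [k _ Hk] := near_infty_natSinv_lt (PosNum x10).
exists k => // m /Hk /=; rewrite -(ltrD2r x) subrK => xm.
have : m%:R * m.+1%:R^-1 = 1 - m.+1%:R^-1 :> R.
  by rewrite -natr1; field; rewrite natr1 pnatr_eq0.
by move=> ->; rewrite ltrBrDr addrC.
Qed.

Lemma tail_psi_le f (x0 h lam : R) (E : set R) : convex01 f -> 0 <= x0 -> x0 < 1 ->
  (forall x, x < 1 -> 0 <= x -> f x <= h) -> 0 < lam -> measurable E ->
  (forall x, E x -> [/\ x0 < x, x < 1 & derivable (right_slope f) x 1]) ->
  (\int[mu]_(x in E) (psi f x)%:E <=
   (cbrt M * ((lam ^+ 2 * (h - f x0) + 4 / lam * Num.sqrt (1 - x0)) / 3))%:E)%E.
Proof.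
move=> cf x00 x01 fh lam0 mE EN.
have EN0 x : E x -> [/\ 0 < x, x < 1 & derivable (right_slope f) x 1].
  by move=> /EN[x0x x1 dr]; split; [exact: le_lt_trans x0x|exact: x1|exact: dr].
have mf : measurable_fun E (fun x => (cbrt (derive1 (right_slope f) x))%:E).
  have c1 : {within triangle, continuous (cst 1 : R * R -> R)}.
    by apply: continuous_subspaceT => ?; exact: cvg_cst.
  have := @measurable_psi (cst 1) f E cf (fun _ _ => ler01) c1 mE EN0.
  rewrite (_ : (fun x => (cbrt (_ * _))%:E) = (fun x => (cbrt (derive1 (right_slope f) x))%:E))//.
  by apply/funext => x; rewrite mulr1.
apply: (@le_trans _ _ (\int[mu]_(x in E) ((cbrt M)%:E * (cbrt (derive1 (right_slope f) x))%:E))%E).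
  apply: le_measure_integral; [exact: mE|by move=> *; exact: lexx|by move=> *; rewrite lee_fin cbrt_ge0|].
  move=> x Ex; have [x0' x1 dr] := EN0 _ Ex.
  have L0 := right_slope_derive1_ge0 cf x1 dr.
  rewrite -EFinM lee_fin -cbrtM//; last exact: ltW.
  have x01' : 0 <= x <= 1 by rewrite !ltW.
  have /pcM/andP[pl pM] : triangle (x, f x).
    apply/triangleP => /=; have := convex01_range cf x01'; have := convex01_le_id cf x01'.
    by move: x01' => /andP[? ?] ? /andP[? ?].
  apply: cbrt_le; first by rewrite mulr_ge0// (le_trans (ltW c0)).
  by rewrite mulrC ler_wpM2r.
rewrite ge0_integralZl//; first last.
- by rewrite lee_fin cbrt_ge0.
- by move=> x _; rewrite lee_fin cbrt_ge0.
rewrite EFinM lee_wpmul2l// ?lee_fin ?cbrt_ge0//.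
exact: tail_integral_le.
Qed.

Lemma common_domain (x0 : R) f1 f2 : convex01 f1 -> convex01 f2 ->
  exists N D : set R, measurable N /\ (mu N = 0%E /\ True) /\ measurable D /\
    (forall x, D x <-> 0 <= x <= 1 /\ ~ N x) /\
    (forall x, D x -> [/\ 0 < x, x < 1, x != x0, derivable (right_slope f1) x 1 &
      derivable (right_slope f2) x 1]) /\
    J p f1 = (\int[mu]_(x in D) (psi f1 x)%:E)%E /\ J p f2 = (\int[mu]_(x in D) (psi f2 x)%:E)%E.
Proof.
move=> cf1 cf2.
have [N1 [mN1 N10 sub1 HN1 JN1]] := J_setD_null_of cf1 (measurable_set1 x0) (lebesgue_measure_set1 x0).
have [N [mN N0 sub HN JN]] := J_setD_null_of cf2 mN1 N10.
have {}JN1 := JN1 N mN N0 sub; have {}JN := JN N mN N0 (@subset_refl _ N).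
exists N, (`[0, 1]%classic `\` N); split; first exact: mN.
split; first by split; [exact: N0|].
split; first by apply: measurableD; [exact: measurable_itv|exact: mN].
split; first by clear; move=> x; rewrite /setD /mkset /= in_itv.
split; last by split; [exact: JN1|exact: JN].
clear JN JN1 N0 N10; move=> x Dx; have [x0' x1' df] := HN _ Dx.
have D1x : (`[0, 1] `\` N1) x.
  by split; [case: Dx|move=> N1x; case: Dx => _; apply; exact: sub].
have [_ _ dg] := HN1 _ D1x; split; [exact: x0'|exact: x1'| |exact: dg|exact: df].
by apply/eqP => xx0; case: D1x => _; apply; apply: sub1; rewrite xx0.
Qed.

(** [h] is the left limit of [g] at 1. Gain and loss are both compared with [s], the cube root of
    the rounding length. *)
Lemma jump_not_maximal (h : R) : h < 1 -> (forall x, x < 1 -> 0 <= x -> g x <= h) ->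
  (forall e, 0 < e -> exists x, [/\ 0 <= x, x < 1 & h - g x < e]) ->
  (J p g < J_star p)%E.
Proof.
move=> h1 gh hg.
pose K0 := cbrt (2 * c * (1 - h)).
have K00 : 0 < K0.
  by rewrite /K0 powR_gt0// !mulr_gt0// subr_gt0.
pose M1 := cbrt M + 1; have M10 : 0 < M1 by have := cbrt_ge0 M; rewrite /M1; lra.
(* Then [4 / Lam * M1] is [K0 / 2], and [x0] is chosen so close to 1 that
   [Lam ^+ 2 * (h - g x0) * M1] stays below [K0]: a third of the sum is below the gain factor
   [K0]. *)
pose Lam := 8 * M1 / K0.
have Lam0 : 0 < Lam by rewrite divr_gt0// mulr_gt0.
have [x0 [x00 x01 hx0]] := hg (K0 / (Lam ^+ 2 * M1)) (divr_gt0 K00 (mulr_gt0 (exprn_gt0 _ Lam0) M10)).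
pose dl := 1 - x0; have dl0 : 0 < dl by rewrite subr_gt0.
pose s := cbrt dl; have s0 : 0 < s by rewrite powR_gt0.
have sE : s ^+ 3 = dl by rewrite cbrtK// ltW.
(* The parabola rises by exactly the available room [1 - h]. *)
pose k := (1 - h) / dl ^+ 2; have k0 : 0 < k by rewrite divr_gt0 ?exprn_gt0// subr_gt0.
pose f := corner g x0 k.
have f1 : g x0 + right_slope g x0 * (1 - x0) + k * (1 - x0) ^+ 2 <= 1.
  have := convex01_tangent_le cg gh x00 x01.
  have -> : k * (1 - x0) ^+ 2 = 1 - h by rewrite /k -/dl divfK// expf_neq0// gt_eqF.
  lra.
have cf : convex01 f by apply: convex01_corner => //; exact: ltW.
have Ff : convex_functions f by apply: corner_convex_functions => //; exact: ltW.
have fE x : x <= x0 -> f x = g x by rewrite /f /corner => ->.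
have [N [D [mN [N0 [mD [DN [HD JE]]]]]]] := common_domain x0 cg cf.
pose D1 := D `&` [set x | x < x0]; pose D2 := D `&` [set x | x0 < x].
have DE : D = D1 `|` D2.
  apply/seteqP; split => x; last by move=> [[]|[]].
  move=> Dx; have [_ _ xx0 _ _] := HD _ Dx.
  by have [lt|gt|eq] := ltgtP x x0; [left|right|rewrite eq eqxx in xx0].
have mD1 : measurable D1.
  apply: measurableI => //; rewrite (_ : mkset _ = `]-oo, x0[%classic)//.
have mD2 : measurable D2.
  apply: measurableI => //; rewrite (_ : mkset _ = `]x0, +oo[%classic); first exact: measurable_itv.
  by apply/seteqP; split => x /=; rewrite in_itv /= andbT.
have dis : [disjoint D1 & D2].
  apply/disj_setPS => x [[_ /= h2] [_ /= h3]]; have := lt_trans h2 h3; by rewrite ltxx.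
have split_J u : convex01 u -> (forall x, D x -> [/\ 0 < x, x < 1 & derivable (right_slope u) x 1]) ->
    (\int[mu]_(x in D) (psi u x)%:E = \int[mu]_(x in D1) (psi u x)%:E + \int[mu]_(x in D2) (psi u x)%:E)%E.
  move=> cu Hu; rewrite DE; apply: ge0_integral_setU => //.
    by rewrite -DE; apply: measurable_psi.
  by move=> x _; rewrite lee_fin cbrt_ge0.
have E1 : (\int[mu]_(x in D1) (psi f x)%:E = \int[mu]_(x in D1) (psi g x)%:E)%E /\ True.
  split; last by [].
  apply: eq_integral => x /set_mem[Dx /= xx0]; have [x0' x1' _ _ _] := HD _ Dx.
  suff dfg : derive1 (right_slope f) x = derive1 (right_slope g) x.
    by rewrite /psi (fE x (ltW xx0)) dfg.
  apply: near_derive1.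
  have fg y : 0 <= y -> y <= x0 -> f y = g y by move=> _; exact: fE.
  near=> y; apply: (right_slope_local cf cg fg (ltW x01)).
    by apply: ltW; near: y; exact: lt_nbhsr.
  by near: y; exact: lt_nbhsl.
have gainE : ((K0 * s)%:E <= \int[mu]_(x in D2) (psi f x)%:E)%E.
  have muD2 : mu D2 = dl%:E /\ True.
    split; last by [].
    have -> : D2 = `]x0, 1[%classic `\` N.
      apply/seteqP; split => x; rewrite /D2 /setI /setD /mkset /= in_itv /=.
        by move=> [Dx xx0]; have [_ x1' _ _ _] := HD _ Dx; case/DN: Dx => _ Nx; rewrite xx0.
      move=> [/andP[xx0 x1'] Nx]; split => //; apply/DN; split => //.
      by rewrite (ltW x1') (ltW (le_lt_trans x00 xx0)).
    have L01 : mu `]x0, 1%R[%classic = dl%:E /\ True.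
      by split => //; rewrite lebesgue_measure_itv /= lte_fin x01 -EFinB.
    rewrite measureD; [|exact: measurable_itv|exact: mN|]; last first.
      by rewrite [X in (X < _)%E]L01.1 ltry.
    rewrite [X in (X - _)%E]L01.1 [X in (_ - X)%E](_ : _ = 0%E) ?sube0//.
    apply/eqP; rewrite eq_le measure_ge0 andbT -N0.1; apply: le_measure; rewrite ?inE//.
    exact: measurableI.
  have kc0 : 0 <= 2 * k * c := mulr_ge0 (mulr_ge0 (ler0n _ 2) (ltW k0)) (ltW c0).
  have ch0 : 0 <= 2 * c * (1 - h).
    by apply: mulr_ge0; [exact: mulr_ge0 (ler0n _ 2) (ltW c0)|rewrite subr_ge0; exact: ltW].
  have -> : K0 * s = cbrt (2 * k * c) * dl.
    rewrite -(exprK_cbrt (mulr_ge0 (ltW K00) (ltW s0))) -[in RHS](exprK_cbrt (mulr_ge0 (cbrt_ge0 _) (ltW dl0))).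
    rewrite !exprMn sE !cbrtK; first last.
    - exact: ch0.
    - exact: kc0.
    by congr cbrt; rewrite /k; field; rewrite gt_eqF.
  rewrite EFinM -muD2.1 -integral_cst//.
  apply: le_measure_integral => // x [Dx /= xx0]; first by rewrite lee_fin cbrt_ge0.
  have [x0' x1' _ _ df] := HD _ Dx; rewrite lee_fin.
  have H : \forall y \near x, right_slope g x0 + 2 * k * (y - x0) = right_slope f y.
    near=> y; rewrite /f right_slope_corner//; [exact: ltW| |].
      by near: y; exact: lt_nbhsr.
    by near: y; exact: lt_nbhsl.
  have dE : derive1 (right_slope f) x = 2 * k.
    rewrite -(near_derive1 H) derive1E.
    have [_ ->] // : is_derive x (1 : R) (fun y => right_slope g x0 + 2 * k * (y - x0)) (2 * k).
    by apply: is_derive_eq; rewrite /GRing.scale /=; ring.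
  rewrite /psi dE; apply: cbrt_le; first exact: kc0.
  rewrite ler_wpM2l//; first exact: mulr_ge0 (ler0n _ 2) (ltW k0).
  have x01' : 0 <= x <= 1 by rewrite !ltW.
  have /pcM/andP[] // : triangle (x, f x).
  apply/triangleP => /=; have := convex01_range cf x01'; have := convex01_le_id cf x01'.
  by move: x01' => /andP[? ?] ? /andP[? ?].
have lossE : (\int[mu]_(x in D2) (psi g x)%:E < (K0 * s)%:E)%E.
  have sq0 : 0 < Num.sqrt s by rewrite sqrtr_gt0.
  have lam0 : 0 < Lam * Num.sqrt s by rewrite mulr_gt0.
  (* With [lam] proportional to the square root of [s], both terms of the tail bound are
     proportional to [s]. *)
  have := @tail_psi_le g x0 h (Lam * Num.sqrt s) D2 cg x00 x01 gh lam0 mD2.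
  move=> /(_ _)/le_lt_trans; apply.
    by move=> x [Dx xx0]; have [? ? _ ? _] := HD _ Dx.
  rewrite lte_fin -/dl -sE.
  have ss : Num.sqrt s ^+ 2 = s by rewrite sqr_sqrtr// ltW.
  have -> : Num.sqrt (s ^+ 3) = s * Num.sqrt s.
    by rewrite (exprS _ 2) mulrC sqrtrM ?exprn_ge0 ?(ltW s0)// sqrtr_sqr gtr0_norm.
  have -> : (Lam * Num.sqrt s) ^+ 2 * (h - g x0) + 4 / (Lam * Num.sqrt s) * (s * Num.sqrt s) =
      s * (Lam ^+ 2 * (h - g x0) + 4 / Lam).
    by rewrite exprMn ss; field; rewrite !gt_eqF.
  have A1 : 4 / Lam * M1 = K0 / 2.
    by rewrite /Lam; field; rewrite !gt_eqF.
  have A2 : Lam ^+ 2 * (h - g x0) * M1 < K0.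
    rewrite (_ : _ * M1 = (h - g x0) * (Lam ^+ 2 * M1)); last by ring.
    by rewrite -ltr_pdivlMr// mulr_gt0 ?exprn_gt0.
  have hg0 : 0 <= h - g x0 by rewrite subr_ge0 gh.
  have B0 : 0 <= Lam ^+ 2 * (h - g x0) + 4 / Lam.
    by rewrite addr_ge0 ?mulr_ge0 ?exprn_ge0 ?invr_ge0// ltW.
  have : cbrt M * (Lam ^+ 2 * (h - g x0) + 4 / Lam) <= M1 * (Lam ^+ 2 * (h - g x0) + 4 / Lam).
    by rewrite ler_wpM2r// lerDl.
  move: (Lam ^+ 2 * (h - g x0)) (4 / Lam) A1 A2 => u v A1 A2 A3.
  have : cbrt M * (u + v) < 3 * K0 by lra.
  move=> A4; rewrite (_ : _ * _ = s * (cbrt M * (u + v)) / 3); last by field.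
  rewrite (_ : K0 * s = s * (3 * K0) / 3); last by field.
  by rewrite ltr_pM2r ?invr_gt0// ltr_pM2l.
have fin1 : (\int[mu]_(x in D1) (psi g x)%:E < +oo)%E.
  apply: le_lt_trans (@tail_psi_le g 0 h 1 D1 cg (lexx _) ltr01 gh ltr01 mD1 _) (ltry _).
  by move=> x [Dx _]; have [? ? _ ? _] := HD _ Dx.
apply: (@lt_le_trans _ _ (J p f)); last by apply: ereal_sup_ubound; exists f.
rewrite JE.1 JE.2 !split_J//; first last.
- by move=> x /HD[].
- by move=> x /HD[].
rewrite E1.1.
have fin0 : (0 <= \int[mu]_(x in D1) (psi g x)%:E)%E.
  by apply: integral_ge0 => x _; rewrite lee_fin cbrt_ge0.
apply: lt_le_trans (_ : _ < \int[mu]_(x in D1) (psi g x)%:E + (K0 * s)%:E)%E _.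
  by rewrite lteD2lE// ge0_fin_numE.
by rewrite leeD2l.
Unshelve. all: by end_near. Qed.

End JumpNotMaximal.

(** * The lower bound *)

Section LowerPath.
Context {R : realType}.
Local Notation pt := (R * R)%type.
Implicit Types (f : R -> R) (t sigma : nat -> R) (z : pt).

(* A path through the strips follows the graph of [F], whose slope at [i * D] is
   [sigma i]: the distance to the graph grows by at most the oscillation of the slope. *)
Definition entering (F : R -> R) sigma (D : R) (i : nat) z (s : R) : Prop :=
  [/\ i.-1%:R * D <= z.1 <= i%:R * D, 0 <= s <= sigma i, 0 <= z.2 <= s * z.1 &
    `|z.2 - F z.1| <= 2 * D * (sigma i + sigma i.-1)].

Definition inside (F : R -> R) sigma (D : R) (i : nat) z (s : R) : Prop :=
  [/\ i%:R * D <= z.1 <= i.+1%:R * D, sigma i <= s <= sigma i.+1, 0 <= z.2 <= s * z.1 &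
    `|z.2 - F z.1| <= 2 * D * (sigma i + sigma i.-1) +
      (sigma i.+1 - sigma i.-1) * (z.1 - i.-1%:R * D)].

Section Invariant.
Context (F slopeF : R -> R) (D : R) (k : nat).
Context (D0 : 0 < D) (kD1 : k%:R * D < 1)
  (slopeF_ge0 : forall x, 0 <= x -> x < 1 -> 0 <= slopeF x)
  (slopeF_homo : forall x y, 0 <= x -> x <= y -> y < 1 -> slopeF x <= slopeF y)
  (F_ge : forall x y, 0 <= x -> x < y -> y <= 1 -> slopeF x * (y - x) <= F y - F x)
  (F_le : forall x y, 0 <= x -> x < y -> y < 1 -> F y - F x <= slopeF y * (y - x)).

Let t i : R := i%:R * D.
Let sigma i := slopeF (t i).

Let t_ge0 i : 0 <= t i. Proof. by rewrite mulr_ge0// ltW. Qed.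

Let t_le i j : (i <= j)%N -> t i <= t j. Proof. by move=> ij; rewrite ler_pM2r// ler_nat. Qed.

Let t_lt1 i : (i <= k)%N -> t i < 1. Proof. by move=> /t_le/le_lt_trans; exact. Qed.

Let tS i : t i.+1 = t i + D. Proof. by rewrite /t -natr1 mulrDl mul1r. Qed.

Let tP i : t i <= t i.-1 + D.
Proof. by case: i => [|i]; [rewrite lerDl ltW|rewrite tS]. Qed.

Lemma sigma_ge0 i : (i <= k)%N -> 0 <= sigma i.
Proof. by move=> ik; rewrite /sigma slopeF_ge0// t_lt1. Qed.

Lemma sigma_homo i j : (i <= j)%N -> (j <= k)%N -> sigma i <= sigma j.
Proof. by move=> ij jk; rewrite /sigma slopeF_homo// ?t_lt1// t_le. Qed.

(** The error [2 * D * (sigma i + sigma i.-1)] is designed to telescope: a drift of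
    [sigma i.+1 - sigma i.-1] over a horizontal distance of at most [2 * D] turns it into the same
    expression for [i.+1]. *)
Lemma inside_entering i z s : (i < k)%N -> inside F sigma D i z s -> entering F sigma D i.+1 z s.
Proof.
move=> ik [zi si z2 err]; split => //.
  have s0 := sigma_ge0 (ltnW ik); by apply/andP; split; lra.
apply: le_trans err _; rewrite /=.
have ss : sigma i.-1 <= sigma i.+1.
  by apply: sigma_homo => //; apply: leq_trans (leq_pred _) _.
have := tP i; have := tS i; rewrite -/(t i) -/(t i.-1) -/(t i.+1) in zi *.
have : (sigma i.+1 - sigma i.-1) * (z.1 - t i.-1) <= (sigma i.+1 - sigma i.-1) * (2 * D).
  rewrite ler_wpM2l ?subr_ge0//; have := tP i; have := tS i; lra.
lra.
Qed.

(** A point entering strip [i] lies in cell [i.-1] or on its border, so the slope of the edge and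
    that of the chord of [F] below it both lie between [sigma i.-1] and [sigma i.+1]. *)
Lemma step_inside i z s z' : (i < k)%N -> entering F sigma D i z s \/ inside F sigma D i z s ->
  step_set (strip t sigma i) z s z' ->
  [/\ inside F sigma D i z' (slope z z'), z.1 < z'.1 & s * (z'.1 - z.1) < z'.2 - z.2].
Proof.
move=> ik H [_ [/andP[]]]; rewrite /= !gt_max => /andP[tz' zz'] z't /andP[/andP[sv1 sv2] sv3].
have X0 : 0 < z'.1 - z.1 by rewrite subr_gt0.
have vE : slope z z' * (z'.1 - z.1) = z'.2 - z.2 by rewrite /slope divfK// gt_eqF.
move: (slope z z') vE sv1 sv2 sv3 => v vE sv1 sv2 sv3.
have [z1 z1' s0 z2 err] : [/\ t i.-1 <= z.1, 0 <= z.1, 0 <= s, 0 <= z.2 <= s * z.1 &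
    `|z.2 - F z.1| <= 2 * D * (sigma i + sigma i.-1) +
      (sigma i.+1 - sigma i.-1) * (z.1 - t i.-1)].
  have ss : sigma i.-1 <= sigma i.+1.
    by apply: sigma_homo => //; apply: leq_trans (leq_pred _) _.
  case: H => -[/andP[h1 h2] /andP[h3 h4] h5 h6]; split => //.
  - by apply: le_trans h1; exact: t_ge0.
  - apply: le_trans h6 _; rewrite lerDl mulr_ge0// subr_ge0//.
  - by apply: le_trans h1; apply: t_le; exact: leq_pred.
  - by apply: le_trans h1; exact: t_ge0.
  - by apply: le_trans h3; exact: sigma_ge0 (ltnW ik).
have z'1 : z'.1 < 1 by apply: lt_trans z't _; exact: t_lt1.
have B1 := F_ge z1' zz' (ltW z'1); have B2 := F_le z1' zz' z'1.
have S1 : sigma i.-1 <= slopeF z.1 by apply: slopeF_homo => //; exact: lt_trans zz' z'1.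
have S2 : slopeF z'.1 <= sigma i.+1.
  by apply: slopeF_homo; [exact: ltW (le_lt_trans z1' zz')|exact: ltW|exact: t_lt1].
have S3 : sigma i.-1 <= sigma i by apply: sigma_homo; [exact: leq_pred|exact: ltnW].
have C1 : sigma i.-1 * (z'.1 - z.1) <= F z'.1 - F z.1.
  by apply: le_trans B1; rewrite ler_pM2r.
have C2 : F z'.1 - F z.1 <= sigma i.+1 * (z'.1 - z.1).
  by apply: le_trans B2 _; rewrite ler_pM2r.
have C3 : v * (z'.1 - z.1) <= sigma i.+1 * (z'.1 - z.1) by rewrite ler_pM2r// ltW.
have C4 : sigma i.-1 * (z'.1 - z.1) <= v * (z'.1 - z.1).
  by rewrite ler_pM2r//; exact: le_trans S3 (ltW sv1).
have sz : s * z.1 <= v * z.1 by rewrite ler_wpM2r// ltW.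
have v0 : 0 < v by exact: le_lt_trans s0 sv2.
have vX : 0 < v * (z'.1 - z.1) by rewrite mulr_gt0.
split; [split|exact: zz'|].
- by rewrite -/(t i) -/(t i.+1) !ltW.
- by rewrite !ltW.
- by move: z2 => /andP[? ?]; apply/andP; split; lra.
- rewrite -/(t i.-1); move: err; rewrite !ler_norml => /andP[? ?]; apply/andP; split; lra.
- by rewrite -vE ltr_pM2r.
Qed.

(** The final state is exposed because the condition on the last edge, to (1, 1), depends on it
    alone. *)
Lemma path_strips_convex c i z s l : (i + size c = k)%N -> (forall r, r \in c -> (0 < r)%N) ->
  entering F sigma D i z s -> path (strips t sigma i c) z s l ->
  convex_path z s l /\ exists z' s', entering F sigma D k z' s' /\ (path_end z' s' [::] -> path_end z s l).
Proof.
elim: c i z s l => [|r c IH] i z s l /=.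
  rewrite addn0 => <- _ Ez; case: l => // _; split => //; exists z, s; split => //.
move=> ik c0 Ez.
have ik' : (i < k)%N by lia.
have {}IH z' s' l' : inside F sigma D i z' s' -> path (strips t sigma i.+1 c) z' s' l' ->
  convex_path z' s' l' /\ exists z'' s'', entering F sigma D k z'' s'' /\ (path_end z'' s'' [::] -> path_end z' s' l').
  move=> Iz'; have E : (i.+1 + size c = k)%N by rewrite addSnnS.
  apply: (IH i.+1 _ _ _ E).
    by move=> r' r'c; apply: c0; rewrite inE r'c orbT.
  exact: inside_entering.
have inner r' z1 s1 l1 : inside F sigma D i z1 s1 ->
    path (nseq r' (strip t sigma i) ++ strips t sigma i.+1 c) z1 s1 l1 ->
  convex_path z1 s1 l1 /\ exists z'' s'', entering F sigma D k z'' s'' /\ (path_end z'' s'' [::] -> path_end z1 s1 l1).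
  elim: r' z1 s1 l1 => [|r' IHr] z1 s1 l1 Iz1; first exact: IH.
  case: l1 => // w l1 /= [st pt'].
  have [Iw h1 h2] := step_inside ik' (or_intror Iz1) st.
  have [cl [z'' [s'' [E1 E2]]]] := IHr _ _ _ Iw pt'.
  by split; [split|exists z'', s''].
have : (0 < r)%N by apply: c0; rewrite mem_head.
case: r c0 ik => // r c0 ik _; case: l => // w l [st pt'].
have [Iw h1 h2] := step_inside ik' (or_introl Ez) st.
have [cl [z'' [s'' [E1 E2]]]] := inner r _ _ _ Iw pt'.
by split; [split|exists z'', s''].
Qed.

End Invariant.
End LowerPath.

Section Factorials.
Context {R : realType}.

(** This bounds the central binomial coefficient by [4 ^ r]; with the converse below, up to
    [r.*2.+1], it is the origin of the constant 1/4 in the rates. *)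
Lemma fact_double_le r : ((r.*2)`! <= 4 ^ r * r`! ^ 2)%N.
Proof.
elim: r => // r IH; rewrite doubleS !factS expnS.
have -> : (4 * 4 ^ r * (r.+1 * r`!) ^ 2 = (2 * r.+1) * (2 * r.+1) * (4 ^ r * r`! ^ 2))%N.
  by rewrite expnMn; ring.
rewrite mulnA leq_mul//; rewrite -muln2; nia.
Qed.

Lemma fact_double_ge r : (4 ^ r * r`! ^ 2 <= (r.*2.+1) * (r.*2)`!)%N.
Proof.
elim: r => // r IH; rewrite doubleS !factS expnS.
have -> : (4 * 4 ^ r * (r.+1 * r`!) ^ 2 = (2 * r.+1) * (2 * r.+1) * (4 ^ r * r`! ^ 2))%N.
  by rewrite expnMn; ring.
apply: (@leq_trans ((2 * r.+1) * (2 * r.+1) * (r.*2.+1 * (r.*2)`!))).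
  by rewrite leq_mul2l IH orbT.
rewrite -muln2; move: (_`!) => F; nia.
Qed.

End Factorials.

(** * A grid and a perturbed function for the lower bound *)

Section LowerGrid.
Context {R : realType}.

Lemma convex_functions_convex01 (f : R -> R) : convex_functions f -> convex01 f.
Proof. by move=> [fr cf _ f0]; split. Qed.

Lemma convex_functions_left1 (f : R -> R) e : convex_functions f -> 0 < e ->
  exists2 dl, 0 < dl & forall x, 0 <= x -> 1 - dl < x -> x <= 1 -> `|f 1 - f x| < e.
Proof.
move=> [_ _ fc _] e0.
have i1 : `[0, 1]%classic (1 : R) by rewrite /= in_itv /= ler01 lexx.
have /subspace_continuousP/(_ _ i1)/cvgrPdist_lt/(_ _ e0) := fc.
rewrite near_withinE => /nbhs_ballP[dl /= dl0 H].
exists dl => // x x0 xd x1; apply: H; last by rewrite /= in_itv /= x0.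
by rewrite /ball /= ger0_norm ?subr_ge0//; lra.
Qed.

Lemma triangle_graph (f : R -> R) x : convex01 f -> 0 <= x <= 1 -> triangle (x, f x).
Proof.
move=> cf x01; apply/triangleP => /=.
by have := convex01_range cf x01; have := convex01_le_id cf x01; lra.
Qed.

(* [f] is perturbed in order to have strictly increasing slopes, smaller than those of the
   chord to (1, 1). *)
Definition perturb (f : R -> R) eta x : R := (1 - eta) * f x + eta * x ^+ 2 / 2.

Definition perturb_slope (f : R -> R) eta x : R := (1 - eta) * right_slope f x + eta * x.

Definition lower_cell (m : nat -> R) (slopeF : R -> R) (D : R) i : R :=
  cbrt (4^-1 * m i * D ^+ 2 * (slopeF (i.+1%:R * D) - slopeF (i%:R * D))).

Section Perturbation.
Context (f : R -> R) (eta : R) (cf : convex01 f) (eta0 : 0 < eta) (eta12 : eta <= 1 / 2).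
Local Notation F := (perturb f eta).
Local Notation slopeF := (perturb_slope f eta).
Local Notation r := (right_slope f).

Let eta1 : 0 <= 1 - eta. Proof. by rewrite subr_ge0 (le_trans eta12)// ler_pdivrMr// mul1r ler1n. Qed.

Lemma perturb_slope_ge0 x : 0 <= x -> x < 1 -> 0 <= slopeF x.
Proof.
move=> x0 x1; rewrite addr_ge0// mulr_ge0//; [exact: right_slope_ge0|exact: ltW].
Qed.

Lemma perturb_slope_homo x y : 0 <= x -> x <= y -> y < 1 -> slopeF x <= slopeF y.
Proof.
move=> x0 xy y1; rewrite lerD ?ler_wpM2l//; [exact: right_slope_homo|exact: ltW].
Qed.

Lemma perturb_ge x y : 0 <= x -> x < y -> y <= 1 -> slopeF x * (y - x) <= F y - F x.
Proof.
move=> x0 xy y1; rewrite /perturb /perturb_slope.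
have := ler_wpM2l eta1 (right_slope_le cf x0 xy y1).
have : 0 <= eta * (y - x) ^+ 2 by rewrite mulr_ge0 ?sqr_ge0// ltW.
lra.
Qed.

Lemma perturb_le x y : 0 <= x -> x < y -> y < 1 -> F y - F x <= slopeF y * (y - x).
Proof.
move=> x0 xy y1; rewrite /perturb /perturb_slope.
have := ler_wpM2l eta1 (right_slope_ge cf x0 xy y1).
have : 0 <= eta * (y - x) ^+ 2 by rewrite mulr_ge0 ?sqr_ge0// ltW.
lra.
Qed.

(** The gap [eta / 2] below 1 is the room for the last edge to be steeper than the others. *)
Lemma perturb_one_le : F 1 <= 1 - eta / 2.
Proof.
have /andP[_ f1] : 0 <= f 1 <= 1 by apply: convex01_range => //; rewrite ler01 lexx.
by have := ler_wpM2l eta1 f1; rewrite /perturb expr1n; lra.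
Qed.

Section Grid.
Context (D e1 : R) (k : nat).
Context (D0 : 0 < D) (kD : k%:R * D = 1 - D) (De1 : D < e1) (we1 : D * r (1 - D) <= e1)
  (e1e : e1 <= eta ^+ 2 / 128).
Local Notation t := (fun i : nat => i%:R * D).

Let t0 i : 0 <= i%:R * D. Proof. by rewrite mulr_ge0// ltW. Qed.

Let tk i : (i <= k)%N -> i%:R * D <= 1 - D.
Proof. by move=> ik; rewrite -kD ler_pM2r// ler_nat. Qed.

Let tS i : i.+1%:R * D = i%:R * D + D. Proof. by rewrite -natr1 mulrDl mul1r. Qed.

Let tp i : i%:R * D - D <= i.-1%:R * D.
Proof. by case: i => [|i] /=; rewrite ?tS ?addrK// mul0r sub0r oppr_le0 ltW. Qed.

Let e1eta : e1 <= eta / 256.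
Proof.
apply: le_trans e1e _; have : eta ^+ 2 <= eta * (1 / 2) by rewrite expr2 ler_pM2l.
by move: (eta ^+ 2) => u; lra.
Qed.

Let D1 : D < 1. Proof. by move: De1 e1eta eta12; lra. Qed.

(** The largest slope on the grid is that at [1 - D], and its product with [D] is small by the
    hypothesis [we1], which stems from the continuity of [f] at 1. *)
Lemma slope_step i : (i <= k)%N -> D * slopeF (i%:R * D) <= 2 * e1.
Proof.
move=> ik; apply: (@le_trans _ _ (D * slopeF (1 - D))).
  by rewrite ler_pM2l// perturb_slope_homo ?tk// ltrBlDr ltrDl.
have r0 : 0 <= r (1 - D) by apply: right_slope_ge0 => //; rewrite ltrBlDr ltrDl.
have w0 : 0 <= D * r (1 - D) by rewrite mulr_ge0// ltW.
have h1 : (1 - eta) * (D * r (1 - D)) <= D * r (1 - D).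
  by apply: ler_piMl => //; rewrite lerBlDr lerDl ltW.
have h2 : eta * (1 - D) <= 1.
  by apply: mulr_ile1; rewrite ?(ltW eta0) ?subr_ge0 ?(ltW D1)//; move: eta12 D0; lra.
have h3 : D * (eta * (1 - D)) <= D by rewrite ger_pMr.
by rewrite /perturb_slope mulrDr mulrCA; move: h1 h3 we1 De1; lra.
Qed.

Lemma inside_close i z s : (i < k)%N -> inside F (fun i => slopeF (i%:R * D)) D i z s ->
  [/\ i%:R * D <= z.1, z.1 <= 1 - D & `|z.2 - F z.1| <= 8 * e1].
Proof.
move=> ik [/andP[z1 z1'] /andP[s1 s1'] /andP[z2 z2'] err].
split => //; first exact: le_trans z1' (tk ik).
have ss : slopeF (i.-1%:R * D) <= slopeF (i.+1%:R * D).
  apply: perturb_slope_homo => //; last by rewrite (le_lt_trans (tk ik))// ltrBlDr ltrDl.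
  by rewrite ler_pM2r// ler_nat (leq_trans (leq_pred i)).
apply: le_trans err _.
have h : (slopeF (i.+1%:R * D) - slopeF (i.-1%:R * D)) * (z.1 - i.-1%:R * D) <=
    (slopeF (i.+1%:R * D) - slopeF (i.-1%:R * D)) * (2 * D).
  rewrite ler_wpM2l ?subr_ge0//; move: (tp i) z1'; rewrite tS; lra.
have := slope_step ik; have := slope_step (ltnW ik); move: h.
move: (slopeF _) (slopeF _) (slopeF _) => u v w; lra.
Qed.

(** If slopes are at most 1 here, a point reached from the origin is below the diagonal. Otherwise
    the abscissa of the right end is at least [eta / 2], as [F] cannot rise beyond [1 - eta / 2];
    there [F] is below the diagonal by at least 3/16 of [eta ^+ 2], more than the error [8 * e1]. *)
Lemma inside_triangle i z s : (i < k)%N -> inside F (fun i => slopeF (i%:R * D)) D i z s ->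
  triangle z.
Proof.
move=> ik Iz; have [z1 z11 err] := inside_close ik Iz.
have [/andP[_ z1'] /andP[_ s1'] /andP[z2 z2'] _] := Iz.
have z10 : 0 <= z.1 by exact: le_trans (t0 i) z1.
have z11' : z.1 < 1 by rewrite (le_lt_trans z11)// ltrBlDr ltrDl.
apply/triangleP; split => //; split; last exact: ltW.
have [s11|s11] := leP (slopeF (i.+1%:R * D)) 1.
  by apply: le_trans z2' _; apply: ler_piMl => //; exact: le_trans s1' s11.
have ti0 : 0 <= i.+1%:R * D by exact: t0.
have ti1 : i.+1%:R * D < 1 by rewrite (le_lt_trans (tk ik))// ltrBlDr ltrDl.
have t1 : eta / 2 <= i.+1%:R * D.
  rewrite leNgt; apply/negP => te.
  have h1 := perturb_ge ti0 ti1 (lexx _).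
  have F0 : 0 <= F (i.+1%:R * D).
    rewrite addr_ge0//; last by rewrite divr_ge0// mulr_ge0 ?sqr_ge0// ltW.
    rewrite mulr_ge0//; have /andP[] // : 0 <= f (i.+1%:R * D) <= 1.
    by apply: convex01_range => //; rewrite ti0 ltW.
  have h2 : (1 - i.+1%:R * D) < slopeF (i.+1%:R * D) * (1 - i.+1%:R * D) by rewrite ltr_pMl// subr_gt0.
  by move: h1 h2 F0 te perturb_one_le; lra.
have fz : f z.1 <= z.1 by apply: convex01_le_id => //; rewrite z10 ltW.
have Fz : F z.1 <= z.1 - eta / 2 * z.1.
  have := ler_wpM2l eta1 fz; have : eta * z.1 ^+ 2 <= eta * z.1.
    by rewrite ler_pM2l// expr2 ler_piMl// ltW.
  by rewrite /perturb; move: (z.1 ^+ 2) => q; lra.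
have h1 : eta * (eta / 2 - D) <= eta * z.1.
  by rewrite ler_pM2l//; move: t1 z1; rewrite tS; lra.
have h2 : eta * D <= eta * (eta / 8).
  by rewrite ler_pM2l//; move: De1 e1eta eta0; lra.
move: err; rewrite ler_norml => /andP[_ err].
move: err Fz h1 h2 e1e (sqr_ge0 eta); rewrite (_ : eta * (eta / 2 - D) = eta ^+ 2 / 2 - eta * D); last by ring.
rewrite (_ : eta * (eta / 8) = eta ^+ 2 / 8); last by ring.
rewrite (_ : eta / 2 * z.1 = eta * z.1 / 2); last by ring.
move: (eta * z.1) (eta ^+ 2) (eta * D) (F z.1) => u v w y; lra.
Qed.

Lemma inside_near i z s : (i < k)%N -> inside F (fun i => slopeF (i%:R * D)) D i z s ->
  `|z.1 - i%:R * D| <= D /\ `|z.2 - f (i%:R * D)| <= 9 * e1 + eta.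
Proof.
move=> ik Iz; have [z1 z11 err] := inside_close ik Iz.
have [/andP[_ z1'] _ _ _] := Iz.
have z10 : 0 <= z.1 by exact: le_trans (t0 i) z1.
have z11' : z.1 < 1 by rewrite (le_lt_trans z11)// ltrBlDr ltrDl.
split; first by rewrite ger0_norm ?subr_ge0// lerBlDl -tS.
have ff : f z.1 - f (i%:R * D) <= e1.
  move: z1; rewrite le_eqVlt => /predU1P[->|z1].
    by rewrite subrr (le_trans (ltW D0))// ltW.
  apply: le_trans (right_slope_ge cf (t0 i) z1 z11') _.
  apply: le_trans we1; rewrite mulrC ler_pM//.
  - by rewrite subr_ge0 ltW.
  - exact: right_slope_ge0.
  - by rewrite lerBlDl -tS.
  - by apply: right_slope_homo => //; rewrite ltrBlDr ltrDl.
have ff0 : f (i%:R * D) <= f z.1 by apply: convex01_homo => //; exact: ltW.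
have Ff' : `|F z.1 - f z.1| <= eta.
  have /andP[fz0 fz1] : 0 <= f z.1 <= 1 by apply: convex01_range => //; rewrite z10 ltW.
  have h1 : eta * f z.1 <= eta by rewrite ger_pMr.
  have h2 : 0 <= eta * f z.1 by rewrite mulr_ge0// ltW.
  have h3 : eta * z.1 ^+ 2 <= eta by rewrite ger_pMr// expr2 mulr_ile1// ltW.
  have h4 : 0 <= eta * z.1 ^+ 2 by rewrite mulr_ge0 ?sqr_ge0// ltW.
  rewrite /perturb ler_norml; move: h1 h2 h3 h4 eta0; move: (z.1 ^+ 2) => q.
  by move=> *; apply/andP; split; lra.
move: err Ff' ff ff0; rewrite !ler_norml; move: (F z.1) (f z.1) (f _) => u v w.
by move=> /andP[? ?] /andP[? ?] ? ?; apply/andP; split; lra.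
Qed.

(** At most [2 * D] remains to abscissa 1, so the prolonged edge rises by at most [4 * e1]; with the
    error [8 * e1] this is less than the gap [eta / 2]. *)
Lemma entering_corner z s : entering F (fun i => slopeF (i%:R * D)) D k z s ->
  z.1 < 1 /\ z.2 + s * (1 - z.1) < 1.
Proof.
move=> [/andP[z1 z1'] /andP[s1 s1'] _ err].
have z10 : 0 <= z.1 by exact: le_trans (t0 _) z1.
have z11 : z.1 < 1 by rewrite (le_lt_trans z1')// kD ltrBlDr ltrDl.
split => //.
have h1 := slope_step (leqnn k); have h2 := slope_step (leq_pred k).
have h3 := perturb_ge z10 z11 (lexx _).
have h4 : 0 <= slopeF z.1 * (1 - z.1) by rewrite mulr_ge0 ?perturb_slope_ge0// subr_ge0 ltW.
have zD : 1 - z.1 <= 2 * D by move: (tp k) z1; rewrite kD; lra.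
have h5 : s * (1 - z.1) <= slopeF (k%:R * D) * (2 * D).
  rewrite ler_pM//; first by rewrite subr_ge0 ltW.
have h6 := perturb_one_le.
move: err; rewrite ler_norml => /andP[_ err].
apply: (@le_lt_trans _ _ (1 - eta / 2 + 12 * e1)); last by move: e1eta eta0; lra.
have Fz : F z.1 <= 1 - eta / 2 by apply: le_trans h6; rewrite -subr_ge0 (le_trans h4).
have h7 : 2 * D * (slopeF (k%:R * D) + slopeF (k.-1%:R * D)) <= 8 * e1.
  by move: h1 h2; move: (slopeF _) (slopeF _) => u v; lra.
have h8 : slopeF (k%:R * D) * (2 * D) <= 4 * e1 by move: h1; move: (slopeF _) => u; lra.
have {}err := le_trans err h7; have {}h5 := le_trans h5 h8.
by move: err h5 Fz; move: (F _) (s * _) => u v; lra.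
Qed.

End Grid.
End Perturbation.

(** Inside the cube root [1 - th] becomes its cube: one factor pays for the density, the other two
    for the factor [1 - eta] on slope increments. *)
Lemma lower_cell_perturb (p : R * R -> R) (f : R -> R) eta th D i : convex01 f -> 0 < eta ->
  eta <= th -> th <= 1 / 2 -> 0 < D -> (i.+1%:R * D < 1) -> 0 <= p (i%:R * D, f (i%:R * D)) ->
  cbrt 4^-1 * ((1 - th) * (D * cell p f 0 D i)) <=
  lower_cell (fun i => (1 - th) * p (i%:R * D, f (i%:R * D))) (perturb_slope f eta) D i.
Proof.
move=> cf eta0 etath th12 D0.
rewrite /lower_cell /perturb_slope /cell /increment !mul0r !mulr0 !mul0r !addr0 subr0.
have tS : i.+1%:R * D = i%:R * D + D by rewrite -natr1 mulrDl mul1r.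
rewrite tS; move: (i%:R * D) => t t1.
have inc0 : 0 <= right_slope f (t + D) - right_slope f t.
  by rewrite subr_ge0 right_slope_homo// lerDl ltW.
move: (right_slope f (t + D)) (right_slope f t) (p _) inc0 => r' r P inc0 P0.
have th10 : 0 <= 1 - th by lra.
have PI0 : 0 <= P * ((r' - r) / D) by rewrite mulr_ge0// divr_ge0// ltW.
rewrite -[leLHS]exprK_cbrt; last by rewrite !mulr_ge0 ?cbrt_ge0// ltW.
apply: cbrt_le; first by rewrite exprn_ge0// !mulr_ge0 ?cbrt_ge0// ltW.
rewrite 3!exprMn !cbrtK ?invr_ge0//.
rewrite [leLHS](_ : _ = 4^-1 * (1 - th) * P * D ^+ 2 * ((1 - th) ^+ 2 * (r' - r))); last first.
  by field; rewrite gt_eqF.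
rewrite [leRHS](_ : _ = 4^-1 * (1 - th) * P * D ^+ 2 *
    ((1 - eta) * (r' - r) + eta * D)); last by ring.
apply: ler_wpM2l; first by rewrite !mulr_ge0 ?invr_ge0 ?(ltW D0).
have h : (1 - th) ^+ 2 * (r' - r) <= (1 - eta) * (r' - r).
  apply: ler_wpM2r => //; rewrite expr2; apply: (@le_trans _ _ (1 - th)); last by lra.
  by apply: ler_piMl => //; lra.
by apply: le_trans h _; rewrite lerDl mulr_ge0// ltW.
Qed.

(** Everything that the probabilistic estimate needs is collected here, so that [f] can be forgotten
    afterwards. *)
Lemma lower_grid (p : R * R -> R) (M c : R) (f : R -> R) (A : R) :
  0 < c -> (forall z, triangle z -> c <= p z <= M) -> {within triangle, continuous p} ->
  (forall e, 0 < e -> exists2 rho, 0 < rho & forall z z', triangle z -> triangle z' ->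
     `|z.1 - z'.1| < rho -> `|z.2 - z'.2| < rho -> `|p z - p z'| < e) ->
  convex_functions f -> 0 <= A -> (A%:E < J p f)%E ->
  exists (k : nat) (D : R) (F slopeF : R -> R) (m : nat -> R),
  [/\ 0 < D, k%:R * D < 1, F 0 = 0, (0 < k)%N &
   [/\ forall x, 0 <= x -> x < 1 -> 0 <= slopeF x,
      forall x y, 0 <= x -> x <= y -> y < 1 -> slopeF x <= slopeF y,
      forall x y, 0 <= x -> x < y -> y <= 1 -> slopeF x * (y - x) <= F y - F x &
      forall x y, 0 <= x -> x < y -> y < 1 -> F y - F x <= slopeF y * (y - x)]] /\
  [/\ forall i z s, (i < k)%N -> inside F (fun i => slopeF (i%:R * D)) D i z s ->
        triangle z /\ m i <= p z,
      forall z s, entering F (fun i => slopeF (i%:R * D)) D k z s -> z.1 < 1 /\ z.2 + s * (1 - z.1) < 1,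
      forall i, (i < k)%N -> 0 < m i,
      forall i, (i < k)%N -> slopeF (i%:R * D) < slopeF (i.+1%:R * D) &
      cbrt 4^-1 * A < \sum_(i < k) lower_cell m slopeF D i].
Proof.
move=> c0 pcM pc p_unif Ff A0 AJ; have cf := convex_functions_convex01 Ff.
have [A2 A12 A2J] : exists2 A2, A < A2 & (A2%:E < J p f)%E.
  move: AJ; case: (J p f) => [j| |] //; last by move=> _; exists (A + 1); rewrite ?ltry//; lra.
  by rewrite lte_fin => Aj; exists ((A + j) / 2); rewrite ?lte_fin; lra.
have A20 : 0 < A2 by lra.
(* A relative loss of [th] takes [A2] halfway back to [A]. *)
pose th := (A2 - A) / (2 * A2).
have thE : th * A2 = (A2 - A) / 2 by rewrite /th; field; rewrite gt_eqF.
have th0 : 0 < th by rewrite divr_gt0//; lra.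
have th1 : th <= 1 / 2 by rewrite ler_pdivrMr; lra.
have [rho rho0 Hrho] := p_unif _ (mulr_gt0 th0 c0).
pose eta := minr th (rho / 4).
have eta0 : 0 < eta by rewrite lt_min th0 divr_gt0.
have etath : eta <= th by rewrite ge_min lexx.
have etarho : eta <= rho / 4 by rewrite ge_min lexx orbT.
(* The first bound makes the deviation [9 * e1 + eta] from the graph of [f] smaller than [rho], the
   second keeps the path in the triangle. *)
pose e1 := minr (rho / 40) (eta ^+ 2 / 128).
have e10 : 0 < e1 by rewrite lt_min !divr_gt0// exprn_gt0.
have e1r : e1 <= rho / 40 by rewrite ge_min lexx.
have e1e : e1 <= eta ^+ 2 / 128 by rewrite ge_min lexx orbT.
clearbody e1; clearbody eta; clearbody th.
have [dl dl0 Hdl] := convex_functions_left1 Ff e10.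
have m0 : 0 < minr dl e1 by rewrite lt_min dl0.
have [k0 _ Hk0] := near_infty_natSinv_lt (PosNum m0).
have p0 z : triangle z -> 0 <= p z by move=> /pcM/andP[/(le_trans (ltW c0))].
have [k kk0 Ak] := grid_sum_lower k0 cf p0 pc A2J.
pose D : R := k.+1%:R^-1.
have D0 : 0 < D by rewrite invr_gt0.
have := Hk0 k kk0; rewrite /= -/D lt_min => /andP[Ddl De1].
have kD : k%:R * D = 1 - D.
  by rewrite /D -natr1; field; rewrite natr1 pnatr_eq0.
have k_gt0 : (0 < k)%N.
  case: (k) Ak => //; rewrite /grid_sum big_ord0 => h; move: h A20; lra.
clear kk0 Hk0 m0 AJ A2J; rewrite -/D in Ak; move: D D0 Ddl De1 kD Ak => D D0 Ddl De1 kD Ak.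
have D1 : D < 1.
  have eta2 : eta ^+ 2 <= 1.
    apply: exprn_ile1; first exact: ltW.
    by move: etath th1; clear; lra.
  by move: De1 e1e eta2; move: (eta ^+ 2) => u; clear; lra.
(* The tangent at [1 - D] stays below [f], so its rise up to 1 is at most [f 1 - f (1 - D)]. *)
have we1 : D * right_slope f (1 - D) <= e1.
  have := right_slope_le cf (_ : 0 <= 1 - D) (_ : 1 - D < 1) (lexx 1).
  move=> /(_ ltac:(lra) ltac:(lra)); rewrite (_ : 1 - (1 - D) = D); last by ring.
  move=> h.
  have := Hdl (1 - D) ltac:(lra) ltac:(lra) ltac:(lra).
  by rewrite ltr_norml => /andP[_]; rewrite mulrC; move: h; lra.
clear dl dl0 Hdl Ddl k0.
have eta12 : eta <= 1 / 2 by exact: le_trans etath th1.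
have t0 i : 0 <= i%:R * D by rewrite mulr_ge0// ltW.
have tk i : (i <= k)%N -> i%:R * D <= 1 - D by move=> ik; rewrite -kD ler_pM2r// ler_nat.
have Tt i : (i <= k)%N -> triangle (i%:R * D, f (i%:R * D)).
  by move=> ik; apply: triangle_graph => //; rewrite t0 (le_trans (tk i ik))// lerBlDr lerDl ltW.
have f0 : f 0 = 0 by case: cf.
exists k, D, (perturb f eta), (perturb_slope f eta), (fun i => (1 - th) * p (i%:R * D, f (i%:R * D))).
split.
  split => //; first by rewrite kD ltrBlDr ltrDl.
    by rewrite /perturb f0 expr0n /= !mulr0 mul0r addr0.
  split; [exact: perturb_slope_ge0|exact: perturb_slope_homo|exact: perturb_ge|exact: perturb_le].
split.
- move=> i z s ik Iz.
  have Tz := inside_triangle cf eta0 eta12 D0 kD De1 we1 e1e ik Iz.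
  have [n1 n2] := inside_near cf eta0 eta12 D0 kD De1 we1 e1e ik Iz.
  split => //.
  have h1 : `|z.1 - (i%:R * D, f (i%:R * D)).1| < rho.
    by apply: le_lt_trans n1 _; move: De1 e1r rho0; clear; lra.
  have h2 : `|z.2 - (i%:R * D, f (i%:R * D)).2| < rho.
    by apply: le_lt_trans n2 _; move: etarho e1r rho0; clear; lra.
  have := Hrho _ _ Tz (Tt _ (ltnW ik)) h1 h2; rewrite ltr_norml => /andP[h _].
  have /pcM/andP[pt1 _] := Tt _ (ltnW ik).
  have h3 : th * c <= th * p (i%:R * D, f (i%:R * D)) by rewrite ler_pM2l.
  by move: h h3; move: (p _) (p z) => u v; clear; lra.
- exact: (entering_corner cf eta0 eta12 D0 kD De1 we1 e1e).
- move=> i ik; have /pcM/andP[/(lt_le_trans c0) pt0 _] := Tt _ (ltnW ik).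
  by rewrite mulr_gt0// subr_gt0 (le_lt_trans th1)// ltr_pdivrMr// mul1r ltr1n.
- move=> i ik; have tS : i%:R * D < i.+1%:R * D by rewrite ltr_pM2r// ltr_nat.
  rewrite /perturb_slope ler_ltD ?ltr_pM2l// ler_wpM2l//.
    by move: eta12; clear; lra.
  apply: right_slope_homo => //; first exact: ltW.
  by rewrite (le_lt_trans (tk _ ik))// ltrBlDr ltrDl.
apply: (@lt_le_trans _ _ (\sum_(i < k) cbrt 4^-1 * ((1 - th) * (D * cell p f 0 D i)))).
  rewrite -mulr_sumr -mulr_sumr ltr_pM2l; last by rewrite powR_gt0 ?invr_gt0.
  have : (1 - th) * A2 < (1 - th) * grid_sum p f 0 D k.
    by rewrite ltr_pM2l// subr_gt0 (le_lt_trans th1)// ltr_pdivrMr// mul1r ltr1n.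
  rewrite -/(grid_sum p f 0 D k); move: thE A12; move: (grid_sum _ _ _ _ _) => u; clear; lra.
apply: ler_sum => i _; apply: lower_cell_perturb => //.
  by rewrite (le_lt_trans (tk _ (ltn_ord i)))// ltrBlDr ltrDl.
by have /p0 := Tt _ (ltnW (ltn_ord i)).
Qed.

End LowerGrid.

Lemma sum_disjoint_le d (T : measurableType d) (R : realType) (P : probability T R)
    (I : eqType) (l : seq I) (E : I -> set T) (B : set T) (v : R) :
  uniq l -> measurable B ->
  (forall i, i \in l -> [/\ measurable (E i), E i `<=` B & (v%:E <= P (E i))%E]) ->
  (forall i j w, i \in l -> j \in l -> E i w -> E j w -> i = j) ->
  (((size l)%:R * v)%:E <= P B)%E.
Proof.
elim: l B => [|i l IH] B /=; first by rewrite mul0r measure_ge0.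
move=> /andP[il ul] mB HE dis.
have [mEi EiB vE] := HE i (mem_head _ _).
have mBE : measurable (B `\` E i) by exact: measurableD.
have : (((size l)%:R * v)%:E <= P (B `\` E i))%E.
  apply: IH => // [j jl|j j' w jl jl' Ejw Ej'w].
    have jl' : j \in i :: l by rewrite inE jl orbT.
    have [mEj EjB vEj] := HE j jl'; split => // w Ejw; split; first exact: EjB.
    move=> Eiw; have := dis i j w (mem_head _ _) jl' Eiw Ejw.
    by move=> E'; move: il; rewrite E' jl.
  by apply: (dis _ _ w) => //; rewrite inE ?jl ?jl' orbT.
move=> H; rewrite -natr1 mulrDl mul1r EFinD addrC.
have -> : (P B = P (E i) + P (B `\` E i))%E.
  rewrite -measureU//; last by apply/seteqP; split => w // -[? []].
  by congr (P _); rewrite setDE setUIr setUv setIT; apply/esym/setUidPr.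
exact: (leeD vE H).
Qed.

(** * From strips to the probability of a chain *)

Section LowerAssembly.
Context {R : realType}.
Local Notation pt := (measurableTypeR R * measurableTypeR R)%type.
Local Notation leb2 := (@lebesgue_measure R \x @lebesgue_measure R)%E.

Lemma strip_bound_ge (t sigma : nat -> R) (m D : R) i r : 0 < D -> 0 < m ->
  t i.+1 = t i + D -> sigma i < sigma i.+1 ->
  (cbrt (4^-1 * m * D ^+ 2 * (sigma i.+1 - sigma i)) ^+ r / r`!%:R) ^+ 3 <=
  strip_bound t sigma m i r (t i) (sigma i).
Proof.
move=> D0 m0 tE ss; rewrite /strip_bound !maxxx tE addrAC subrr add0r.
have s0 : 0 < sigma i.+1 - sigma i by rewrite subr_gt0.
have u0 : 0 <= 4^-1 * m * D ^+ 2 * (sigma i.+1 - sigma i).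
  by rewrite !mulr_ge0 ?invr_ge0 ?sqr_ge0// ltW.
have -> : forall u f : R, 0 <= u -> (cbrt u ^+ r / f) ^+ 3 = u ^+ r / f ^+ 3.
  by move=> u f uu; rewrite exprMn exprAC cbrtK// exprVn.
rewrite //.
have -> : forall u v w y : R, (u * v * w ^+ 2 * y) ^+ r = u ^+ r * v ^+ r * w ^+ (2 * r) * y ^+ r.
  by move=> u v w y; rewrite 3!exprMn exprM.
rewrite -mul2n.
rewrite [leLHS](_ : _ = (4^-1 ^+ r / r`!%:R ^+ 2) * (m ^+ r * D ^+ (2 * r) *
   ((sigma i.+1 - sigma i) ^+ r / r`!%:R))); last first.
  have f0 : r`!%:R != 0 :> R by rewrite pnatr_eq0 -lt0n fact_gt0.
  by move: (_ ^+ r) (_ ^+ r) (_ ^+ (2 * r)) (_ ^+ r) => *; field.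
rewrite (mul2n r) [leRHS](_ : _ = (r.*2)`!%:R^-1 * (m ^+ r * D ^+ r.*2 * ((sigma i.+1 - sigma i) ^+ r / r`!%:R))).
  rewrite ler_wpM2r//.
    by rewrite !mulr_ge0 ?exprn_ge0 ?invr_ge0// ltW.
  rewrite exprVn -invfM lef_pV2 ?posrE ?mulr_gt0 ?exprn_gt0 ?ltr0n ?fact_gt0//.
  by rewrite -!natrX -natrM ler_nat fact_double_le.
  have E (x y z w : R) : x * (y / z) * w = z^-1 * (x * y * w) by move: z^-1 => v; ring.
  exact: E.
exact: u0.
Qed.

Lemma convex_path_sorted z s (l : seq (R * R)) : convex_path z s l ->
  sorted (fun u v : R * R => u.1 < v.1) l.
Proof.
case: l => // w l [_ _]; move: (_ / _) => q; elim: l w q => //= v l IH w q [wv _ pl].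
by rewrite wv (IH _ _ pl).
Qed.

Section Event.
Context d (Omega : measurableType d) (P : probability Omega R) (mu : probability pt R)
  (k : nat) (D : R) (F slopeF : R -> R) (m : nat -> R).
Context (D0 : 0 < D) (kD1 : k%:R * D < 1) (F0 : F 0 = 0)
  (S1 : forall x, 0 <= x -> x < 1 -> 0 <= slopeF x)
  (S2 : forall x y, 0 <= x -> x <= y -> y < 1 -> slopeF x <= slopeF y)
  (S3 : forall x y, 0 <= x -> x < y -> y <= 1 -> slopeF x * (y - x) <= F y - F x)
  (S4 : forall x y, 0 <= x -> x < y -> y < 1 -> F y - F x <= slopeF y * (y - x)).
Let t i : R := i%:R * D.
Let sigma i := slopeF (t i).
Context (C1 : forall i A, (i < k)%N -> measurable A ->
    A `<=` [set z | exists s, inside F sigma D i z s] -> ((m i)%:E * leb2 A <= mu A)%E)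
  (C2 : forall z s, entering F sigma D k z s -> z.1 < 1 /\ z.2 + s * (1 - z.1) < 1)
  (C3 : forall i, (i < k)%N -> 0 < m i) (C4 : forall i, (i < k)%N -> sigma i < sigma i.+1).

Lemma entering0 : entering F sigma D 0 (0, 0) 0.
Proof.
have s0 : 0 <= sigma 0 by rewrite /sigma /t mul0r S1.
split => /=; rewrite ?mul0r ?lexx ?mulr0//.
by rewrite F0 subrr normr0 !mulr_ge0 ?addr_ge0// ltW.
Qed.

Lemma strips_path_lower c n (X : 'I_n -> Omega -> pt) : iid P mu X -> sumn c = n -> size c = k ->
  (forall r, r \in c -> (0 < r)%N) ->
  ((\prod_(i < k) (lower_cell m slopeF D i ^+ nth 0%N c i / (nth 0%N c i)`!%:R) ^+ 3)%:E <=
   P (path_event X (strips t sigma 0 c) (0%R, 0%R) 0%R))%E.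
Proof.
move=> + sn; case: _ / sn X => X iX sc c0.
apply: le_trans (@strips_lower _ _ _ P mu t sigma m (entering F sigma D) (inside F sigma D) k
  _ _ _ _ _ _ _ c 0%N _ c0 X iX (0, 0) 0 entering0).
- rewrite lee_fin sc; apply: ler_prod => i _; rewrite add0n; have ik := ltn_ord i.
  apply/andP; split; first by rewrite exprn_ge0// divr_ge0// exprn_ge0// cbrt_ge0.
  apply: strip_bound_ge => //; [exact: C3| |exact: C4].
  by rewrite /t -natr1 mulrDl mul1r.
- by move=> i ik; rewrite ltW// C3.
- by move=> i ik; rewrite ler_pM2r// ler_nat.
- by move=> i ik; rewrite ltW// C4.
- by move=> i A ik mA AI; exact: C1.
- by move=> i z s ik [/andP[_ ?] /andP[_ ?] _ _].
- by move=> i z s ik; exact: (inside_entering D0 kD1 S1 S2 ik).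
- by move=> i z s z' ik EI st; have [] := step_inside D0 kD1 S1 S2 S3 S4 ik EI st.
- by rewrite add0n sc.
Qed.

Lemma strips_path_chain c n (X : 'I_n -> Omega -> pt) w : size c = k ->
  (forall r, r \in c -> (0 < r)%N) -> path_event X (strips t sigma 0 c) (0, 0) 0 w ->
  convex_chain (range (fun i => X i w)) /\
  sorted (fun u v : R * R => u.1 < v.1) (tuple_of X w).
Proof.
move=> sc c0 pw; have sc' : (0 + size c = k)%N by [].
have [cp [z' [s' [Ez' H]]]] := path_strips_convex D0 kD1 S1 S2 S3 S4 sc' c0 entering0 pw.
have pe : path_end (0, 0) 0 (tuple_of X w) by apply: H; exact: C2.
split; last exact: convex_path_sorted cp.
have -> : range (fun i => X i w) = [set` (tuple_of X w : seq pt)].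
  apply/seteqP; split => z /=.
    by move=> [i _ <-]; apply/mapP; exists i; rewrite ?mem_enum.
  by move=> /mapP[i _ ->]; exists i.
apply: ccw_convex_chain; first exact: convex_path_triangle cp pe.
exact: convex_path_ccw.
Qed.

(** The abscissas increase strictly along the path, so they determine the order: the events
    belonging to the [n]! orders are disjoint and their probabilities add up. *)
Lemma strips_perm_inj c n (X : 'I_n -> Omega -> pt) w (s s' : 'S_n) : size c = k ->
  (forall r, r \in c -> (0 < r)%N) ->
  path_event (fun i => X (s i)) (strips t sigma 0 c) (0, 0) 0 w ->
  path_event (fun i => X (s' i)) (strips t sigma 0 c) (0, 0) 0 w -> s = s'.
Proof.
move=> sc c0 /(strips_path_chain sc c0)[_ so] /(strips_path_chain sc c0)[_ so'].
pose lt1 (u v : R * R) := u.1 < v.1.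
have tr : transitive lt1 by move=> a b c'; exact: lt_trans.
have ir : irreflexive lt1 by move=> a; rewrite /lt1 ltxx.
have E : tuple_of (fun i => X (s i)) w = tuple_of (fun i => X (s' i)) w :> seq _.
  apply: (irr_sorted_eq tr ir so so') => z.
  apply/mapP/mapP => -[i _ ->].
    by exists ((s' ^-1)%g (s i)); rewrite ?mem_enum ?permKV.
  by exists ((s ^-1)%g (s' i)); rewrite ?mem_enum ?permKV.
have Xi i j : X i w = X j w -> i = j.
  move=> Xij; apply: (@perm_inj _ (s ^-1)%g); 
  have inj : injective (fun i => X (s i) w) by apply/injectiveP; exact: (sorted_uniq tr ir so).
  by apply: inj; rewrite /= !permKV.
apply/permP => i; apply: Xi.
have := congr1 (fun l : n.-tuple (R * R) => tnth l i) (val_inj E).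
by rewrite !tnth_mktuple.
Qed.

Lemma chain_prob_weight c n (X : 'I_n -> Omega -> pt) : iid P mu X -> sumn c = n -> size c = k ->
  (forall r, r \in c -> (0 < r)%N) ->
  ((n`!%:R * \prod_(i < k) (lower_cell m slopeF D i ^+ nth 0%N c i / (nth 0%N c i)`!%:R) ^+ 3)%:E <=
   P [set w | convex_chain (range (fun i => X i w))])%E.
Proof.
move=> iX sn sc c0.
have := @sum_disjoint_le _ Omega R P _ (enum 'S_n)
  (fun s : 'S_n => path_event (fun i => X (s i)) (strips t sigma 0 c) (0, 0) 0)
  [set w | convex_chain (range (fun i => X i w))]
  (\prod_(i < k) (lower_cell m slopeF D i ^+ nth 0%N c i / (nth 0%N c i)`!%:R) ^+ 3).
rewrite -cardE card_Sn; apply.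
- exact: enum_uniq.
- by apply: measurable_convex_chain; exact: iX.1.
- move=> s _; have iXs := iid_perm s iX; split.
  + rewrite -[X in measurable X]setTI; apply: (measurable_tuple_of iXs.1) => //.
    by apply: measurable_path_section; [rewrite size_strips|exact: step_measurable_strips].
  + move=> w /(strips_path_chain sc c0)[+ _].
    rewrite (_ : range (fun i => X (s i) w) = range (fun i => X i w))//.
    apply/seteqP; split => z /= [i _ <-]; first by exists (s i).
    by exists ((s ^-1)%g i) => //; rewrite permKV.
  + exact: strips_path_lower.
- by move=> s s' w _ _; exact: strips_perm_inj.
Qed.

End Event.

(** [comps_max] may leave cells empty. It is applied to [n - k], and each part is then raised by 1,
    which costs the product of the [a i], a power of their sum and a polynomial factor. *)
Lemma lower_composition (a : nat -> R) k n (B : R) : (forall i, (i < k)%N -> 0 < a i) -> (0 < k)%N ->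
  (k <= n)%N -> 0 <= B -> B <= \sum_(i < k) a i ->
  exists c, [/\ sumn c = n, size c = k, forall r, r \in c -> (0 < r)%N &
   ((\prod_(i < k) a i) / (\sum_(i < k) a i) ^+ k) ^+ 3 / n.+1%:R ^+ (6 * k) *
     (B ^+ n / n`!%:R) ^+ 3 <=
   \prod_(i < k) (a i ^+ nth 0%N c i / (nth 0%N c i)`!%:R) ^+ 3].
Proof.
(* Beyond [k] the sequence is set to 1, as [comps_max] wants positive values everywhere. *)
move=> a0 k0 kn B0 BS; pose a' i := if (i < k)%N then a i else 1.
have a'0 i : 0 < a' i by rewrite /a'; case: ifP => [/a0|].
have a'E (i : 'I_k) : a' i = a i by rewrite /a' ltn_ord.
have [c [sc sn] Hc] := comps_max (n - k) a'0 k0.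
have sc' : size [seq r.+1 | r <- c] = k by rewrite size_map.
exists [seq r.+1 | r <- c]; split => //.
- have -> : sumn [seq r.+1 | r <- c] = (sumn c + size c)%N.
    by elim: (c) => //= r l ->; rewrite addnS addSn; congr _.+1; rewrite addnA.
  by rewrite sn sc subnK.
- by move=> r /mapP[? _ ->].
have SE : \sum_(i < k) a' i = \sum_(i < k) a i by apply: eq_bigr.
rewrite SE in Hc.
set S := \sum_(i < k) a i in BS Hc *; set Q := \prod_(i < k) a i.
have S0 : 0 < S.
  rewrite /S (bigD1 (Ordinal k0))//= ltr_wpDr// ?a0//.
  by apply: sumr_ge0 => i _; rewrite ltW// a0.
have Q0 : 0 < Q by apply: prodr_gt0 => i _; exact: a0.
have n0 : 0 < n.+1%:R :> R by rewrite ltr0n.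
rewrite [leRHS](_ : _ = (\prod_(i < k) (a i ^+ nth 0%N [seq r.+1 | r <- c] i /
    (nth 0%N [seq r.+1 | r <- c] i)`!%:R)) ^+ 3); last by rewrite prodrXl.
rewrite (mulnC 6) (_ : (k * 6 = 2 * k * 3)%N); last by lia.
rewrite exprM -expr_div_n -exprMn lerXn2r ?nnegrE//.
- by rewrite !mulr_ge0 ?invr_ge0 ?exprn_ge0// ?(ltW Q0) ?(ltW S0).
- by apply: prodr_ge0 => i _; rewrite mulr_ge0 ?invr_ge0 ?exprn_ge0// ltW// a0.
apply: (@le_trans _ _ ((\prod_(i < k) (a i ^+ nth 0%N c i / (nth 0%N c i)`!%:R)) *
    (Q / n.+1%:R ^+ k))).
  have {}Hc : S ^+ (n - k) / (n - k)`!%:R <= n.+1%:R ^+ k *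
      \prod_(i < k) (a i ^+ nth 0%N c i / (nth 0%N c i)`!%:R).
    apply: le_trans Hc _.
    rewrite (eq_bigr (fun i : 'I_k => a i ^+ nth 0%N c i / (nth 0%N c i)`!%:R)); last first.
      by move=> i _; rewrite a'E.
    apply: ler_wpM2r.
      by apply: prodr_ge0 => i _; rewrite mulr_ge0 ?invr_ge0 ?exprn_ge0// ltW// a0.
    by rewrite lerXn2r ?nnegrE// ler_nat ltnS leq_subr.
  move: Hc; move: (\prod_(i < k) (_ / _)) => V Hc.
  apply: (@le_trans _ _ (Q / S ^+ k / n.+1%:R ^+ (2 * k) * (S ^+ n / (n - k)`!%:R))).
    apply: ler_wpM2l; first by rewrite !mulr_ge0 ?invr_ge0 ?exprn_ge0// ltW.
    rewrite ler_pM ?exprn_ge0 ?invr_ge0//.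
      by rewrite lerXn2r ?nnegrE// ltW.
    by rewrite lef_pV2 ?posrE ?ltr0n ?fact_gt0// ler_nat leq_fact// leq_subr.
  rewrite mul2n -addnn [n.+1%:R ^+ (_ + _)]exprD -[S ^+ n]/(S ^+ n) -[in S ^+ n](subnK kn) [S ^+ (_ + _)]exprD.
  have Sk : S ^+ k != 0 by rewrite expf_neq0// gt_eqF.
  have nk : 0 < n.+1%:R ^+ k :> R by rewrite exprn_gt0.
  have f0 : 0 < (n - k)`!%:R :> R by rewrite ltr0n fact_gt0.
  move: Sk nk f0 Hc; move: (S ^+ k) (n.+1%:R ^+ k) (S ^+ (n - k)) ((n - k)`!%:R) => Sk N Sn f Sk0 N0 f0 Hc.
  rewrite [leLHS](_ : _ = (Sn / f) * (Q / N) / N); last by field; rewrite ?Sk0 !gt_eqF.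
  rewrite ler_pdivrMr// [leRHS]mulrAC; apply: ler_wpM2r.
    by rewrite divr_ge0 ?(ltW Q0) ?(ltW N0).
  by rewrite (mulrC V).
rewrite /Q -[n.+1%:R ^+ k](_ : \prod_(i < k) n.+1%:R = _); last by rewrite prodr_const card_ord.
rewrite -prodf_div -big_split /=; apply: ler_prod => i _.
have ci : (nth 0%N c i < n.+1)%N.
  rewrite ltnS; apply: leq_trans (_ : sumn c <= n)%N; last by rewrite sn leq_subr.
  have : (i < size c)%N by rewrite sc.
  elim: (c) (nat_of_ord i) => //= r l IHl [|j] /=; first by rewrite leq_addr.
  by rewrite ltnS => /IHl h; rewrite (leq_trans h)// leq_addl.
rewrite (nth_map 0%N) ?sc// factS exprS natrM.
have f0 : 0 < (nth 0%N c i)`!%:R :> R by rewrite ltr0n fact_gt0.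
have ai := a0 i (ltn_ord i).
apply/andP; split; first by rewrite !mulr_ge0 ?invr_ge0 ?exprn_ge0// ltW.
rewrite (_ : a i * _ / _ = a i ^+ nth 0%N c i / (nth 0%N c i)`!%:R * (a i / (nth 0%N c i).+1%:R)); last first.
  by field; rewrite !gt_eqF// ltr0n.
rewrite ler_wpM2l//; first by rewrite !mulr_ge0 ?invr_ge0 ?exprn_ge0// ltW.
by rewrite ler_wpM2l ?(ltW ai)// lef_pV2 ?posrE ?ltr0n// ler_nat.
Qed.

End LowerAssembly.

Section LowerProbability.
Context {R : realType}.
Local Notation pt := (measurableTypeR R * measurableTypeR R)%type.
Local Notation leb2 := (@lebesgue_measure R \x @lebesgue_measure R)%E.

Definition density_ge (p : R * R -> R) (mu : set pt -> \bar R) :=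
  forall m (A : set pt), measurable A -> 0 <= m -> (forall z, A z -> triangle z /\ m <= p z) ->
    (m%:E * leb2 A <= mu A)%E.

Definition rate (A : R) n : R := n`!%:R * ((cbrt 4^-1 * A) ^+ n / n`!%:R) ^+ 3.

Lemma rate_ge0 A n : 0 <= A -> 0 <= rate A n.
Proof. by move=> A0; rewrite mulr_ge0// exprn_ge0// divr_ge0// exprn_ge0// mulr_ge0// cbrt_ge0. Qed.

(** The constants are fixed before the probability space and [n], since the space varies with
    [n]. *)
Lemma chain_prob_lower (p : R * R -> R) (M c : R) (f : R -> R) (A : R) :
  0 < c -> (forall z, triangle z -> c <= p z <= M) -> {within triangle, continuous p} ->
  (forall e, 0 < e -> exists2 rho, 0 < rho & forall z z', triangle z -> triangle z' ->
     `|z.1 - z'.1| < rho -> `|z.2 - z'.2| < rho -> `|p z - p z'| < e) ->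
  convex_functions f -> 0 <= A -> (A%:E < J p f)%E ->
  exists (C : R) (q n0 : nat), 0 < C /\
    forall d (Omega : measurableType d) (P : probability Omega R) (mu : probability pt R) n
      (X : 'I_n -> Omega -> pt), density_ge p mu -> (n0 <= n)%N -> iid P mu X ->
    ((C / n.+1%:R ^+ q * rate A n)%:E <= P [set w | convex_chain (range (fun i => X i w))])%E.
Proof.
move=> c0 pcM pc p_unif Ff A0 AJ.
have [k [D [F [slopeF [m [[D0 kD1 F0 k0 [S1 S2 S3 S4]] [H1 H2 H3 H4 H5]]]]]]] :=
  lower_grid c0 pcM pc p_unif Ff A0 AJ.
clear AJ Ff pc p_unif.
pose a := lower_cell m slopeF D.
have a0 i : (i < k)%N -> 0 < a i.
  move=> ik; rewrite /a /lower_cell /cbrt powR_gt0// mulr_gt0//; last by rewrite subr_gt0; exact: H4.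
  by rewrite mulr_gt0 ?exprn_gt0// mulr_gt0 ?invr_gt0//; exact: H3.
pose Q := \prod_(i < k) a i; pose S := \sum_(i < k) a i.
have Q0 : 0 < Q by apply: prodr_gt0 => i _; exact: a0.
have S0 : 0 < S.
  rewrite /S (bigD1 (Ordinal k0))//= ltr_wpDr// ?a0//.
  by apply: sumr_ge0 => i _; rewrite ltW// a0.
exists ((Q / S ^+ k) ^+ 3), (6 * k)%N, k; split.
  by rewrite exprn_gt0// divr_gt0// exprn_gt0.
move=> d Omega P mu n X mup kn iX.
have B0 : 0 <= cbrt 4^-1 * A by rewrite mulr_ge0// cbrt_ge0.
have [cc [sn sc c1 H]] := lower_composition a0 k0 kn B0 (ltW H5).
have C1 i B : (i < k)%N -> measurable B ->
    B `<=` [set z | exists s, inside F (fun i => slopeF (i%:R * D)) D i z s] ->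
    ((m i)%:E * leb2 B <= mu B)%E.
  move=> ik mB BI; apply: mup => //; first exact/ltW/H3.
  by move=> z /BI[s Is]; exact: H1 Is.
have := chain_prob_weight D0 kD1 F0 S1 S2 S3 S4 C1 H2 H3 H4 iX sn sc c1.
apply: le_trans; rewrite lee_fin /rate mulrCA ler_wpM2l//.
Qed.

End LowerProbability.

(** * The upper bound *)

Section UpperPath.
Context {R : realType}.
Local Notation pt := (R * R)%type.
Implicit Types (z u v w : pt) (l : seq pt).

(* The points of a chain, sorted by abscissa, are distributed over the cells of the grid;
   [low] and [high] bound the slopes of the chords between two points of the same cell. *)
Section Distribution.
Context (t low high : nat -> R) (dom : nat -> set pt) (n : nat) (onchain : pt -> Prop).
Context (t_homo : forall i, (i < n)%N -> t i <= t i.+1)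
  (dom_cell : forall i z, (i < n)%N -> onchain z -> t i <= z.1 < t i.+1 -> dom i z)
  (dom_tail : forall z, onchain z -> t n <= z.1 -> dom n z)
  (slope_cell : forall i u v, (i < n)%N -> onchain u -> onchain v -> t i <= u.1 -> u.1 < v.1 ->
     v.1 < t i.+1 -> low i < slope u v < high i)
  (slope_ge0 : forall u v, onchain u -> onchain v -> u.1 < v.1 -> 0 <= slope u v)
  (onchain_lt1 : forall z, onchain z -> z.1 < 1).

Definition cell_step (i : nat) : @step R :=
  if (i < n)%N then Step false (dom i) (t i) (t i.+1) (low i) (cst (high i))
  else Step false (dom n) (t n) 1 0 (fun z => slope z (1, 1)).

Definition chain_from l := exists z s, [/\ onchain z, forall u, u \in l -> onchain u &
  convex_path z s (rcons l (1, 1))].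

Lemma convex_path_corner z s w l : convex_path z s (w :: rcons l (1, 1)) ->
  slope z w < slope z (1, 1).
Proof.
move=> [zw sw /convex_path_above]; move=> /(_ (1, 1)); rewrite mem_rcons mem_head => /(_ isT)[/= w1].
rewrite /slope /= => H.
have E : (w.2 - z.2) / (w.1 - z.1) * (w.1 - z.1) = w.2 - z.2 by rewrite divfK// gt_eqF// subr_gt0.
rewrite ltr_pdivlMr; last by rewrite subr_gt0 (lt_trans zw).
by move: E H; move: (_ / _) => q E H; lra.
Qed.

Lemma tail_links l w q r : onchain w -> t n <= w.1 -> 0 <= q -> r <= q ->
  convex_path w q (rcons l (1, 1)) -> (forall u, u \in l -> onchain u) ->
  path (nseq (size l) (Step false (dom n) (t n) 1 0 (fun z => slope z (1, 1)))) w r l.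
Proof.
elim: l w q r => // v l IHl w q r ow tw q0 rq cp ol.
have vE := convex_path_corner cp; have [wv qv cp'] := cp.
have ov := ol v (mem_head _ _).
have sl : q < slope w v by rewrite /slope ltr_pdivlMr// subr_gt0.
have tv : t n <= v.1 by exact: le_trans tw (ltW wv).
split; last first.
  apply: (IHl _ (slope w v)) => //; first by exact: slope_ge0.
  by move=> u ul; apply: ol; rewrite inE ul orbT.
split; first exact: dom_tail.
split; first by rewrite /= gt_max wv (le_lt_trans tw wv) onchain_lt1.
by rewrite /= gt_max vE (le_lt_trans q0 sl) (le_lt_trans rq sl).
Qed.

(** Cells are peeled off from the left: the points before [t i.+1] form the block of cell [i]. As
    the next block begins afresh, only the convexity of the remaining path is passed on. *)
Lemma distribute m i l : (i + m = n)%N -> chain_from l -> (forall u, u \in l -> t i <= u.1) ->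
  exists c, [/\ size c = m.+1, sumn c = size l &
    forall z s, path (blocks (fun j => cell_step (i + j)) c) z s l].
Proof.
elim: m i l => [|m IH] i l im [z0 [s0 [oz ol cp]]] lt.
  exists [:: size l]; split => //=; first by rewrite addn0.
  move=> z s; rewrite cats0 addn0 in im *; rewrite im.
  case: l ol cp lt => // w l ol [zw sw cp] lt /=.
  have ow := ol w (mem_head _ _).
  have tw : t n <= w.1 by rewrite -im lt// mem_head.
  have cn : cell_step n = Step false (dom n) (t n) 1 0 (fun z => slope z (1, 1)).
    by rewrite /cell_step ltnn.
  rewrite cn; split; first by split => //; exact: dom_tail.
  have q0 : 0 <= (w.2 - z0.2) / (w.1 - z0.1) by exact: slope_ge0.
  have {}ol u : u \in l -> onchain u by move=> ul; apply: ol; rewrite inE ul orbT.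
  by apply: (tail_links (q := slope z0 w)).
have im' : (i.+1 + m = n)%N by lia.
have ilt : (i < n)%N by lia.
have ci : cell_step i = Step false (dom i) (t i) (t i.+1) (low i) (cst (high i)).
  by rewrite /cell_step ilt.
have shift c z s l' : path (blocks (fun j => cell_step (i.+1 + j)) c) z s l' ->
    path (blocks (fun j => cell_step (i + j.+1)) c) z s l'.
  by rewrite (_ : (fun j => cell_step (i + j.+1)) = (fun j => cell_step (i.+1 + j)))//;
    apply/funext => j; rewrite addnS.
(* [q] is the true slope of the edge into [w], and [r] the slope recorded by the path. They differ
   just after a fresh step, which records [low i]. *)
have inner l' w q r : onchain w -> t i <= w.1 -> w.1 < t i.+1 -> r <= maxr (low i) q ->
    convex_path w q (rcons l' (1, 1)) -> (forall u, u \in l' -> onchain u) ->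
  exists k c, [/\ size c = m.+1, (k + sumn c = size l')%N &
    path (nseq k (cell_step i) ++ blocks (fun j => cell_step (i + j.+1)) c) w r l'].
  elim: l' w q r => [|v l' IHl] w q r ow tw wt rq cpw ol'.
    have [|//|c [sc cl pc]] := IH i.+1 [::] im'; first by exists w, q.
    by exists 0%N, c; split => //; apply: shift; exact: pc.
  have ov := ol' v (mem_head _ _).
  have [vt|tv] := ltP v.1 (t i.+1); last first.
    have [||c [sc cl pc]] := IH i.+1 (v :: l') im'.
    - by exists w, q.
    - move=> u; rewrite inE => /predU1P[->//|ul].
      have [_ _ cp'] := cpw.
      have [] := convex_path_above cp' (_ : u \in rcons l' (1, 1)).
        by rewrite mem_rcons inE ul orbT.
      by move=> vu _; exact: le_trans tv (ltW vu).
    by exists 0%N, c; split => //; apply: shift; exact: pc.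
  have [wv qv cp'] := cpw.
  have sl : q < slope w v by rewrite /slope ltr_pdivlMr// subr_gt0.
  have /andP[sl1 sl2] := slope_cell ilt ow ov tw wv vt.
  have [||||||k [c [sc kc pk]]] := IHl v (slope w v) (slope w v).
  - exact: ov.
  - exact: le_trans tw (ltW wv).
  - exact: vt.
  - by rewrite le_max lexx orbT.
  - exact: cp'.
  - by move=> u ul; apply: ol'; rewrite inE ul orbT.
  exists k.+1, c; split => //; first by rewrite /= addSn kc.
  have sE : step_slope (cell_step i) w v = slope w v by rewrite /step_slope ci.
  split; last by rewrite /= sE.
  rewrite ci; split; first by apply: dom_cell => //; rewrite (le_trans tw (ltW wv)) vt.
  split; first by rewrite /= gt_max wv (le_lt_trans tw wv) vt.
  rewrite /= gt_max sl1 sl2 !andbT; apply: le_lt_trans rq _.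
  by rewrite gt_max sl1 sl.
case: l ol cp lt => [|w l] ol cp lt.
  have [|//|c [sc cl pc]] := IH i.+1 [::] im'; first by exists z0, s0.
  exists (0%N :: c); split; [by rewrite /= sc|by []|move=> z s /=].
  by apply: shift; exact: pc.
have ow := ol w (mem_head _ _).
have [wt|tw] := ltP w.1 (t i.+1); last first.
  have [||c [sc cl pc]] := IH i.+1 (w :: l) im'.
  - by exists z0, s0.
  - move=> u; rewrite inE => /predU1P[->//|ul].
    have [_ _ cp'] := cp.
    have [] := convex_path_above cp' (_ : u \in rcons l (1, 1)).
      by rewrite mem_rcons inE ul orbT.
    by move=> vu _; exact: le_trans tw (ltW vu).
  exists (0%N :: c); split; [by rewrite /= sc|by []|move=> z s /=].
  by apply: shift; exact: pc.
have [zw sw cp'] := cp.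
have tw := lt w (mem_head _ _).
have [||||||k [c [sc kc pk]]] := inner l w ((w.2 - z0.2) / (w.1 - z0.1)) (low i).
- exact: ow.
- exact: tw.
- exact: wt.
- by rewrite le_max lexx.
- exact: cp'.
- by move=> u ul; apply: ol; rewrite inE ul orbT.
exists (k.+1 :: c); split; [by rewrite /= sc|by rewrite /= addSn kc|move=> z s /=].
have sE : step_slope (fresh (cell_step i)) z w = low i by rewrite /step_slope ci.
rewrite addn0; split; last by rewrite /= sE.
by rewrite ci; split => //; apply: dom_cell => //; rewrite tw wt.
Qed.

End Distribution.
End UpperPath.

(** * Rates of the cells and the union bound *)

Section UpperProbability.
Context {R : realType}.
Local Notation pt := (measurableTypeR R * measurableTypeR R)%type.
Local Notation leb2 := (@lebesgue_measure R \x @lebesgue_measure R)%E.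

(** The weight of [k] links is turned into the cube for all [k.+1] points of the block. The missing
    point costs [a ^+ 3] and powers of [k], and [fact_double_ge] costs one more power. *)
Lemma flat_weight_le (a M D H : R) k : 0 < a -> a ^+ 3 = 4^-1 * M * D ^+ 2 * H ->
  0 <= M -> 0 <= D -> 0 <= H ->
  M ^+ k * (D ^+ k.*2 / (k.*2)`!%:R) * (H ^+ k / k`!%:R) <=
  2 / a ^+ 3 * k.+2%:R ^+ 4 * (a ^+ k.+1 / k.+1`!%:R) ^+ 3.
Proof.
move=> a0 aE M0 D0 H0.
have f0 : 0 < k`!%:R :> R by rewrite ltr0n fact_gt0.
have g0 : 0 < (k.*2)`!%:R :> R by rewrite ltr0n fact_gt0.
have E1 : (a ^+ k) ^+ 3 = 4^-1 ^+ k * (M ^+ k * D ^+ k.*2 * H ^+ k).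
  by rewrite exprAC aE 3!exprMn -exprM mul2n -!mulrA.
have U0 : 0 <= M ^+ k * D ^+ k.*2 * H ^+ k by rewrite !mulr_ge0// exprn_ge0.
have F1 : 4 ^+ k * k`!%:R ^+ 2 <= k.*2.+1%:R * (k.*2)`!%:R :> R.
  by rewrite -!natrX -!natrM ler_nat fact_double_ge.
have p4 : 0 < 4 ^+ k :> R by rewrite exprn_gt0.
apply: (@le_trans _ _ (k.*2.+1%:R * (a ^+ k / k`!%:R) ^+ 3)).
  rewrite expr_div_n E1 exprVn.
  rewrite [leLHS](_ : _ = (M ^+ k * D ^+ k.*2 * H ^+ k) / ((k.*2)`!%:R * k`!%:R)); last first.
    by move: (M ^+ k) (D ^+ k.*2) (H ^+ k) => u v w; field; rewrite !gt_eqF.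
  move: p4 F1 U0 f0 g0 {E1}.
  move: (M ^+ k * D ^+ k.*2 * H ^+ k) (4 ^+ k) (k`!%:R) ((k.*2)`!%:R) (k.*2.+1%:R) => U p f g w p0 F1 U0 f0 g0.
  rewrite (_ : w * _ = U * (w / (p * f ^+ 3))); last by field; rewrite !gt_eqF.
  apply: ler_wpM2l => //.
  rewrite -subr_ge0 (_ : _ - _ = (w * g - p * f ^+ 2) / (p * f ^+ 3 * g)); last by field; rewrite !gt_eqF.
  by rewrite divr_ge0 ?subr_ge0// !mulr_ge0// ?exprn_ge0// ltW.
have k10 : 0 < k.+1%:R :> R by rewrite ltr0n.
rewrite factS natrM [a ^+ k.+1]exprS [leRHS](_ : _ = 2 * k.+2%:R ^+ 4 / k.+1%:R ^+ 3 * (a ^+ k / k`!%:R) ^+ 3); last first.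
  by move: (a ^+ k) (k.+2%:R) => v w; field; rewrite !gt_eqF.
apply: ler_wpM2r; first by rewrite exprn_ge0// divr_ge0// exprn_ge0// ltW.
rewrite ler_pdivlMr ?exprn_gt0//.
apply: (@le_trans _ _ (2 * k.+2%:R * k.+2%:R ^+ 3)); last by rewrite -mulrA -exprS.
rewrite ler_pM ?exprn_ge0//; last by rewrite lerXn2r ?nnegrE// ler_nat.
by rewrite -natrM ler_nat -mul2n; lia.
Qed.

Lemma corner_weight_le (a M H : R) k : 0 < a -> a ^+ 3 = M * H -> 0 <= M -> 0 <= H ->
  M ^+ k * (H ^+ k / (k`!%:R * k`!%:R * k.+1`!%:R)) <=
  2 / a ^+ 3 * k.+2%:R ^+ 4 * (a ^+ k.+1 / k.+1`!%:R) ^+ 3.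
Proof.
move=> a0 aE M0 H0.
have f0 : 0 < k`!%:R :> R by rewrite ltr0n fact_gt0.
have k10 : 0 < k.+1%:R :> R by rewrite ltr0n.
have E1 : (a ^+ k) ^+ 3 = M ^+ k * H ^+ k by rewrite exprAC aE exprMn.
have W0 : 0 <= M ^+ k * H ^+ k by rewrite mulr_ge0// exprn_ge0.
rewrite factS natrM [a ^+ k.+1]exprS.
rewrite [leLHS](_ : _ = (M ^+ k * H ^+ k) * (k.+1%:R^-1 / k`!%:R ^+ 3)); last first.
  by move: (M ^+ k) (H ^+ k) => v w; field; rewrite !gt_eqF.
rewrite [leRHS](_ : _ = (a ^+ k) ^+ 3 * (2 * k.+2%:R ^+ 4 / k.+1%:R ^+ 3 / k`!%:R ^+ 3)); last first.
  by move: (a ^+ k) (k.+2%:R) => v w; field; rewrite !gt_eqF.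
rewrite E1 ler_wpM2l// ler_wpM2r ?invr_ge0 ?exprn_ge0 ?(ltW f0)//.
apply: (@le_trans _ _ 1); first by rewrite invf_le1// ler1n.
rewrite ler_pdivlMr ?exprn_gt0// mul1r.
apply: (@le_trans _ _ (k.+2%:R ^+ 3)); first by rewrite lerXn2r ?nnegrE// ler_nat.
rewrite [k.+2%:R ^+ 4]exprS mulrA ler_peMl ?exprn_ge0//.
by rewrite -natrM ler1n.
Qed.

Definition density_le (p : R * R -> R) (mu : set pt -> \bar R) :=
  forall m (A : set pt), measurable A -> 0 <= m -> (forall z, A z -> triangle z -> p z <= m) ->
    (mu A <= m%:E * leb2 A)%E.

Section Grid.
Context (t low high M : nat -> R) (dom : nat -> set pt) (N : nat) (p : R * R -> R).
Context (mdom : forall i, measurable (dom i)) (M0 : forall i, 0 < M i)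
  (t_lt : forall i, (i < N)%N -> t i < t i.+1) (tN : t N < 1)
  (low_high : forall i, (i < N)%N -> low i < high i)
  (dom_t : forall i z, (i < N)%N -> dom i z -> t i <= z.1 <= t i.+1)
  (dom_N : forall z, dom N z -> [/\ t N <= z.1, z.1 < 1, 0 <= z.2 & z.2 <= 1])
  (dom_p : forall i z, (i <= N)%N -> dom i z -> triangle z -> p z <= M i).

Definition cell_rate i : R :=
  if (i < N)%N then cbrt (4^-1 * M i * (t i.+1 - t i) ^+ 2 * (high i - low i))
  else cbrt (M N * (1 - t N)).

Definition cell_weight i k : R :=
  if (i < N)%N then
    M i ^+ k * ((t i.+1 - t i) ^+ k.*2 / (k.*2)`!%:R) * ((high i - low i) ^+ k / k`!%:R)
  else M N ^+ k * ((1 - t N) ^+ k / (k`!%:R * k`!%:R * k.+1`!%:R)).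

Lemma cell_rate_gt0 i : 0 < cell_rate i.
Proof.
rewrite /cell_rate; case: ifP => [iN|_]; rewrite /cbrt powR_gt0// !mulr_gt0 ?invr_gt0 ?exprn_gt0 ?subr_gt0//.
- exact: t_lt.
- exact: t_lt.
- exact: low_high.
Qed.

Lemma cell_weight_ge0 i k : 0 <= cell_weight i k.
Proof.
rewrite /cell_weight; case: ifP => [iN|_].
  have h1 : 0 <= t i.+1 - t i by rewrite subr_ge0 ltW// t_lt.
  have h2 : 0 <= high i - low i by rewrite subr_ge0 ltW// low_high.
  by rewrite !mulr_ge0 ?invr_ge0 ?exprn_ge0// ltW.
have h1 : 0 <= 1 - t N by rewrite subr_ge0 ltW.
by rewrite !mulr_ge0 ?invr_ge0 ?mulr_ge0 ?exprn_ge0// ltW.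
Qed.

(** The summand 1 in the constant is for an empty block, the other one for the free first point. *)
Lemma block_weight_le i r :
  block_weight cell_weight i r <=
  (1 + 2 / cell_rate i ^+ 3) * r.+1%:R ^+ 4 * (cell_rate i ^+ r / r`!%:R) ^+ 3.
Proof.
have a0 := cell_rate_gt0 i.
have v0 : 0 <= 2 / cell_rate i ^+ 3 by rewrite divr_ge0// exprn_ge0// ltW.
case: r => [|k] /=; first by rewrite expr0 fact0 divr1 !expr1n !mulr1 lerDl.
apply: (@le_trans _ _ (2 / cell_rate i ^+ 3 * k.+2%:R ^+ 4 *
    (cell_rate i ^+ k.+1 / k.+1`!%:R) ^+ 3)); last first.
  apply: ler_wpM2r; first by rewrite exprn_ge0// divr_ge0// exprn_ge0// ltW.
  by apply: ler_wpM2r; [rewrite exprn_ge0|rewrite lerDr].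
have M0' j : 0 <= M j by exact: ltW.
have := a0; rewrite /cell_weight /cell_rate; case: ifP => [iN|_] a1.
  have h1 : 0 <= t i.+1 - t i by rewrite subr_ge0 ltW// t_lt.
  have h2 : 0 <= high i - low i by rewrite subr_ge0 ltW// low_high.
  by apply: flat_weight_le; rewrite ?cbrtK// !mulr_ge0 ?invr_ge0 ?sqr_ge0.
have h1 : 0 <= 1 - t N by rewrite subr_ge0 ltW.
by apply: corner_weight_le; rewrite ?cbrtK// mulr_ge0.
Qed.

Section Event.
Context d (Omega : measurableType d) (P : probability Omega R) (mu : probability pt R)
  (mup : density_le p mu).

Lemma cell_step_bound i : (i <= N)%N ->
  block_bound P mu (cell_step t low high dom N i) (cell_weight i).
Proof.
rewrite /cell_step /cell_weight leq_eqVlt => /predU1P[->|iN]; rewrite ?ltnn ?iN.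
  apply: block_bound_corner => //; [exact: ltW|exact: ltW|].
  move=> A mA AD; apply: mup => //; first exact: ltW.
  by move=> z /AD; exact: dom_p.
apply: block_bound_flat => //; [exact/ltW/low_high|exact: ltW| |exact/ltW/t_lt|].
  by move=> z; exact: dom_t.
move=> A mA AD; apply: mup => //; first exact: ltW.
by move=> z /AD; apply: dom_p; exact: ltnW.
Qed.

Definition distributed n (X : 'I_n -> Omega -> pt) : set Omega :=
  [set w | exists (s : 'S_n) c, c \in comps N.+1 n /\
     path_event (fun i => X (s i)) (blocks (cell_step t low high dom N) c) (0%R, 0%R) 0 w].

Lemma cell_blocks_measurable c : size c = N.+1 ->
  step_measurable (blocks (cell_step t low high dom N) c).
Proof.
move=> sc; apply: (@step_measurable_blocks _ _ _ P mu _ cell_weight) => i.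
by rewrite sc ltnS => iN; exact: cell_step_bound.
Qed.

Lemma path_event_measurable n (X : 'I_n -> Omega -> pt) c z s : iid P mu X ->
  size c = N.+1 -> sumn c = n ->
  measurable (path_event X (blocks (cell_step t low high dom N) c) z s).
Proof.
move=> iX sc sn; rewrite -[X in measurable X]setTI; apply: (measurable_tuple_of iX.1) => //.
by apply: measurable_path_section; [rewrite size_blocks|exact: cell_blocks_measurable].
Qed.

Lemma distributedE n (X : 'I_n -> Omega -> pt) :
  distributed X = \big[setU/set0]_(s <- enum 'S_n) \big[setU/set0]_(c <- comps N.+1 n)
    path_event (fun i => X (s i)) (blocks (cell_step t low high dom N) c) (0%R, 0%R) 0.
Proof.
rewrite -bigcup_seq; apply/seteqP; split => w.
  move=> [s [c [cc H]]]; exists s; first by rewrite /= mem_enum.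
  by rewrite -bigcup_seq; exists c.
by move=> [s _]; rewrite -bigcup_seq => -[c cc H]; exists s, c.
Qed.

Lemma measurable_distributed n (X : 'I_n -> Omega -> pt) : iid P mu X -> measurable (distributed X).
Proof.
move=> iX; rewrite distributedE; apply: bigsetU_measurable => s _.
rewrite big_seq; apply: bigsetU_measurable => c; rewrite mem_comps => /andP[/eqP sc /eqP sn].
by apply: path_event_measurable => //; exact: iid_perm.
Qed.

Lemma measure_bigsetU_le (I : eqType) (l : seq I) (E : I -> set Omega) (v : I -> R) :
  (forall i, i \in l -> measurable (E i) /\ (P (E i) <= (v i)%:E)%E) ->
  (P (\big[setU/set0]_(i <- l) E i) <= (\sum_(i <- l) v i)%:E)%E.
Proof.
elim: l => [|i l IH] H; first by rewrite !big_nil measure0.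
have [mE vE] := H i (mem_head _ _).
have Hl j : j \in l -> measurable (E j) /\ (P (E j) <= (v j)%:E)%E.
  by move=> jl; apply: H; rewrite inE jl orbT.
rewrite !big_cons EFinD; apply: le_trans (measureU2 _ _ _) _ => //.
  by rewrite big_seq; apply: bigsetU_measurable => j /Hl[].
by apply: leeD => //; exact: IH.
Qed.

Lemma distributed_le n (X : 'I_n -> Omega -> pt) : iid P mu X ->
  (P (distributed X) <= (n`!%:R *
     (((1 + \sum_(i < N.+1) 2 / cell_rate i ^+ 3) * n.+1%:R ^+ 4) ^+ N.+1 *
      ((\sum_(i < N.+1) cell_rate i) ^+ n / n`!%:R) ^+ 3))%:E)%E.
Proof.
move=> iX; rewrite distributedE.
have w0 c : 0 <= weight (block_weight cell_weight) c.
  apply: prodr_ge0 => i _; case: nth => [|r] //=; exact: cell_weight_ge0.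
set W := \sum_(c <- comps N.+1 n) weight (block_weight cell_weight) c.
apply: (@le_trans _ _ (\sum_(s <- enum 'S_n) W)%:E).
  apply: measure_bigsetU_le => s _; have iXs := iid_perm s iX; split.
    rewrite big_seq; apply: bigsetU_measurable => c; rewrite mem_comps => /andP[/eqP sc /eqP sn].
    exact: path_event_measurable.
  apply: measure_bigsetU_le => c; rewrite mem_comps => /andP[/eqP sc /eqP sn]; split.
    exact: path_event_measurable.
  case: _ / sn (fun i => X (s i)) iXs => Y iY.
  apply: (path_event_blocks (mu := mu) _ iY) => // i; rewrite sc ltnS; exact: cell_step_bound.
rewrite lee_fin big_const_seq count_predT -cardE card_Sn iter_addr addr0 -(mulr_natl W) ler_wpM2l//.
apply: sum_comps_le.
- by rewrite addr_ge0// sumr_ge0// => i _; rewrite divr_ge0// exprn_ge0// ltW// cell_rate_gt0.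
- by move=> i; rewrite ltW// cell_rate_gt0.
- by move=> i [|r] //=; exact: cell_weight_ge0.
- move=> i r iN; apply: le_trans (block_weight_le _ _) _.
  apply: ler_wpM2r; first by rewrite exprn_ge0// divr_ge0// exprn_ge0// ltW// cell_rate_gt0.
  apply: ler_wpM2r; first by rewrite exprn_ge0.
  rewrite lerD2l (bigD1 (Ordinal iN))//= lerDl sumr_ge0// => j _.
  by rewrite divr_ge0// exprn_ge0// ltW// cell_rate_gt0.
Qed.

End Event.
End Grid.

End UpperProbability.

(** * A grid adapted to functions close to a given one *)

Section UpperGrid.
Context {R : realType}.
Local Notation pt := (measurableTypeR R * measurableTypeR R)%type.
Implicit Types (g h : R -> R).

Lemma convex01_chords h x y u v : convex01 h -> 0 <= x -> x < y -> y <= u -> u < v -> v <= 1 ->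
  (h y - h x) * (v - u) <= (h v - h u) * (y - x).
Proof.
move=> ch x0 xy; rewrite le_eqVlt => /predU1P[<- uv v1|yu uv v1]; first exact: convex01_slope.
have h1 := convex01_slope ch x0 xy yu (ltW (lt_le_trans uv v1)).
have h2 := convex01_slope ch (le_trans x0 (ltW xy)) yu uv v1.
have uy : 0 < u - y by rewrite subr_gt0.
rewrite -(ler_pM2r uy); apply: (@le_trans _ _ ((h u - h y) * (y - x) * (v - u))).
  by rewrite mulrAC ler_pM2r// subr_gt0.
by rewrite mulrAC [leRHS]mulrAC ler_pM2r// subr_gt0.
Qed.

(** A chord of [h] to the right of [t] is steeper than the chord over [[a, t]]. The latter has
    length [e] and values known up to [e ^+ 2], so its slope is known up to [2 * e]. The next lemma
    is the mirror image. *)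
Lemma slope_above g h a t e u v : convex01 g -> convex01 h -> 0 < e -> 0 <= a -> t = a + e ->
  `|h a - g a| < e ^+ 2 -> `|h t - g t| < e ^+ 2 ->
  t <= u -> u < v -> v <= 1 -> right_slope g a - 2 * e < (h v - h u) / (v - u).
Proof.
move=> cg ch e0 a0 tE ha ht tu uv v1; have vu : 0 < v - u by rewrite subr_gt0.
have at_ : a < t by rewrite tE ltrDl.
have t1 : t <= 1 by rewrite (le_trans tu)// (le_trans (ltW uv)).
have H := convex01_chords ch a0 at_ tu uv v1.
have G := right_slope_le cg a0 at_ t1.
have E : t - a = e by rewrite tE; ring.
rewrite E in H G; rewrite ltr_pdivlMr// -(ltr_pM2r e0); apply: lt_le_trans H.
rewrite mulrAC ltr_pM2r// mulrBl (_ : 2 * e * e = 2 * e ^+ 2); last by ring.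
move: ha ht; rewrite !ltr_norml => /andP[ha1 ha2] /andP[ht1 ht2].
by move: G ha1 ha2 ht1 ht2; move: (e ^+ 2) (right_slope g a * e) => ee re; clear; lra.
Qed.

Lemma slope_below g h a t e u v : convex01 g -> convex01 h -> 0 < e -> 0 <= u -> a = t + e -> a < 1 ->
  `|h a - g a| < e ^+ 2 -> `|h t - g t| < e ^+ 2 ->
  u < v -> v <= t -> (h v - h u) / (v - u) < right_slope g a + 2 * e.
Proof.
move=> cg ch e0 u0 aE a1 ha ht uv vt; have vu : 0 < v - u by rewrite subr_gt0.
have ta : t < a by rewrite aE ltrDl.
have t0 : 0 <= t by rewrite (le_trans u0)// (le_trans (ltW uv)).
have H := convex01_chords ch u0 uv vt ta (ltW a1).
have G := right_slope_ge cg t0 ta a1.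
have E : a - t = e by rewrite aE; ring.
rewrite E in H G; rewrite ltr_pdivrMr// -(ltr_pM2r e0); apply: le_lt_trans H _.
rewrite [ltRHS]mulrAC ltr_pM2r// mulrDl (_ : 2 * e * e = 2 * e ^+ 2); last by ring.
move: ha ht; rewrite !ltr_norml => /andP[ha1 ha2] /andP[ht1 ht2].
by move: G ha1 ha2 ht1 ht2; move: (e ^+ 2) (right_slope g a * e) => ee re; clear; lra.
Qed.

Definition graph_points h : R * R -> Prop := fun z => 0 <= z.1 < 1 /\ h z.1 = z.2.

Lemma upper_grid (p : R * R -> R) (M c A : R) g :
  0 < c -> (forall z, triangle z -> c <= p z <= M) -> {within triangle, continuous p} ->
  (forall e, 0 < e -> exists2 rho, 0 < rho & forall z z', triangle z -> triangle z' ->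
     `|z.1 - z'.1| < rho -> `|z.2 - z'.2| < rho -> `|p z - p z'| < e) ->
  convex01 g -> (J p g < A%:E)%E ->
  exists (N : nat) (t low high m : nat -> R) (dom : nat -> set pt),
  [/\ forall i, measurable (dom i), forall i, 0 < m i,
     forall i, (i < N)%N -> t i < t i.+1, t N < 1 &
    [/\ forall i, (i < N)%N -> low i < high i,
     forall i z, (i < N)%N -> dom i z -> t i <= z.1 <= t i.+1,
     forall z, dom N z -> [/\ t N <= z.1, z.1 < 1, 0 <= z.2 & z.2 <= 1],
     forall i z, (i <= N)%N -> dom i z -> triangle z -> p z <= m i &
     \sum_(i < N.+1) cell_rate t low high m N i < cbrt 4^-1 * A]] /\
  t 0%N = 0 /\
  exists (S : seq R) (tau : R), 0 < tau /\ forall h, convex01 h ->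
    (forall x, x \in S -> `|h x - g x| < tau) ->
    [/\ forall i z, (i < N)%N -> graph_points h z -> t i <= z.1 < t i.+1 -> dom i z,
       forall z, graph_points h z -> t N <= z.1 -> dom N z &
       forall i u v, (i < N)%N -> graph_points h u -> graph_points h v -> t i <= u.1 -> u.1 < v.1 ->
         v.1 < t i.+1 -> low i < slope u v < high i].
Proof.
move=> c0 pcM pc p_unif cg JA.
have p0 z : triangle z -> 0 <= p z <= M by move=> /pcM/andP[cp ->]; rewrite (le_trans (ltW c0) cp).
have [A1 [A10 A1A JA1]] : exists A1, [/\ 0 < A1, A1 < A & (J p g < A1%:E)%E].
  have : (0 <= J p g)%E by apply: integral_ge0 => x _; rewrite lee_fin powR_ge0.
  case: (J p g) JA => [j| |] //; rewrite lte_fin lee_fin => jA j0.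
  by exists ((j + A) / 2); rewrite lte_fin; split; lra.
have M0 : 0 < M.
  have /pcM/andP[h1 h2] : @triangle R (0, 0) by apply/triangleP; rewrite /= lexx ler01.
  by rewrite (lt_le_trans c0)// (le_trans h1).
pose th := (A - A1) / (2 * A1).
have thE : th * A1 = (A - A1) / 2 by rewrite /th; field; rewrite gt_eqF.
have th0 : 0 < th by rewrite divr_gt0//; lra.
(* The width of the last cell makes its rate at most the share [(A - A1) / 2] left for it, up to the
   constant factor. *)
pose dl := minr (1 / 2) (((A - A1) / 2) ^+ 3 / (4 * M)).
have dl0 : 0 < dl by rewrite lt_min !divr_gt0 ?exprn_gt0 ?mulr_gt0 ?divr_gt0 ?subr_gt0.
have dl12 : dl <= 1 / 2 by rewrite ge_min lexx.
have dlM : M * dl <= 4^-1 * ((A - A1) / 2) ^+ 3.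
  have : dl <= ((A - A1) / 2) ^+ 3 / (4 * M) by rewrite ge_min lexx orbT.
  by rewrite ler_pdivlMr ?mulr_gt0//; move: (_ ^+ 3) => q; rewrite mulrCA; lra.
have [rho rho0 Hrho] := p_unif _ (mulr_gt0 th0 c0).
clearbody dl th.
pose b := 1 - dl.
have b0 : 0 < b by rewrite /b; lra.
have b1 : b < 1 by rewrite /b; lra.
pose rb := right_slope g b.
have rb0 : 0 <= rb by exact: right_slope_ge0.
(* A mesh below this value keeps the enlarged cells before 1 and makes the density nearly constant
   on the box of a cell, whose height is governed by [rb]. *)
pose e1 := minr (minr dl (1 / 2)) (rho / (2 + rb)).
have e10 : 0 < e1 by rewrite !lt_min dl0 !divr_gt0// ltr_wpDr.
have [k [gk ek]] : exists k, grid_sum p g 1 (b / k.+1%:R) k.+1 < A1 /\ b / k.+1%:R < e1.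
  have H1 := grid_sum_upper cg b0 b1 p0 pc JA1.
  have H2 := near_infty_natSinv_lt (PosNum e10).
  near \oo => k; exists k; split; first by near: k.
  apply: (@le_lt_trans _ _ k.+1%:R^-1); last by near: k.
  by rewrite ler_piMl// ltW.
have kD : k.+1%:R * (b / k.+1%:R) = b by rewrite mulrCA mulfV ?mulr1// pnatr_eq0.
have D0 : 0 < b / k.+1%:R by rewrite divr_gt0.
move: kD D0 gk ek; move: (b / k.+1%:R) => D kD D0 gk.
rewrite !lt_min => /andP[/andP[Ddl D12]]; rewrite ltr_pdivlMr ?ltr_wpDr// => Drho.
clear JA JA1 pc p_unif e1 e10.
pose D2 := D ^+ 2.
have D20 : 0 < D2 by rewrite exprn_gt0.
have D2D : D2 <= D / 2 by rewrite /D2 expr2 ler_pM2l//; lra.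
pose t i : R := i%:R * D.
pose r := right_slope g.
have tS i : t i.+1 = t i + D by rewrite /t -natr1 mulrDl mul1r.
have t0 i : 0 <= t i by rewrite mulr_ge0// ltW.
have tb i : (i <= k.+1)%N -> t i <= b by move=> ik; rewrite -kD ler_pM2r// ler_nat.
have tN : t k.+1 = b by [].
have t_lt1 i : (i <= k.+1)%N -> t i < 1 by move=> ik; exact: le_lt_trans (tb i ik) b1.
have bD2 : b + D2 < 1 by rewrite /b; move: D2D Ddl D0; clear; lra.
(* With these choices [high i - low i] is exactly [increment g 1 D i]. *)
pose low i := r (t i - D2) - 2 * D2.
pose high i := r (t i.+1 + D2) + 2 * D2.
pose m i := if (i < k.+1)%N then (1 + th) * p (t i, g (t i)) else M.
(* The margin [D2 ^+ 2] is the tolerance allowed between [h] and [g] at the grid points. *)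
pose dom i : set pt := if (i < k.+1)%N
  then `[t i, t i.+1]%classic `*` `[g (t i) - D2 ^+ 2, g (t i.+1) + D2 ^+ 2]%classic
  else `[t k.+1, 1[%classic `*` `[0, 1]%classic.
have Tg i : (i < k.+1)%N -> triangle (t i, g (t i)).
  move=> ik; apply/triangleP => /=; have h1 := tb _ (ltnW ik); have h2 := t0 i.
  have t01 : 0 <= t i <= 1 by rewrite h2 /=; lra.
  have /andP[-> _] := convex01_range cg t01; rewrite convex01_le_id//; split => //; lra.
have lh i : (i < k.+1)%N -> low i < high i.
  move=> ik; have : r (t i - D2) <= r (t i.+1 + D2).
    apply: right_slope_homo => //; first by rewrite tS; move: D0 D20; clear; lra.
    by move: (tb _ ik) bD2; clear; lra.
  by rewrite /low /high; move: D20; clear; lra.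
exists k.+1, t, low, high, m, dom; split; last split.
- split.
  + move=> i; rewrite /dom; case: ifP => _; apply: measurableX => //; exact: measurable_itv.
  + move=> i; rewrite /m; case: ifP => // ik; rewrite mulr_gt0//; first lra.
    by have /pcM/andP[h _] := Tg _ ik; exact: lt_le_trans h.
  + by move=> i _; rewrite tS ltrDl.
  + by rewrite tN.
  split => //.
  + by move=> i z ik; rewrite /dom ik /= => -[]; rewrite /= !in_itv.
  + by move=> z; rewrite /dom ltnn /= => -[]; rewrite /= !in_itv /= => /andP[-> ->] /andP[-> ->].
  + move=> i z; rewrite leq_eqVlt /dom /m => /predU1P[->|ik]; rewrite ?ltnn ?ik.
      by move=> _ /p0/andP[].
    move=> [/=]; rewrite !in_itv /= => /andP[z1 z1'] /andP[z2 z2'] Tz.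
    have h1 : `|z.1 - (t i, g (t i)).1| < rho.
      rewrite /= ger0_norm ?subr_ge0//; move: z1'; rewrite tS.
      have : D <= D * (2 + rb) by rewrite ler_peMr//; [exact: ltW|move: rb0; clear; lra].
      by move: Drho; clear; lra.
    have gg : g (t i.+1) - g (t i) <= D * rb.
      apply: (@le_trans _ _ (right_slope g (t i.+1) * (t i.+1 - t i))).
        apply: right_slope_ge => //; first by rewrite tS ltrDl.
        exact: t_lt1.
      rewrite tS addrAC subrr add0r -tS mulrC ler_pM2l//.
      by apply: right_slope_homo => //; exact: tb.
    have D4 : D2 ^+ 2 <= D.
      have : D2 ^+ 2 <= D2 by rewrite expr2 ger_pMr//; move: D2D D12; clear; lra.
      by move: D2D D0; clear; lra.
    have gg0 : g (t i) <= g (t i.+1).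
      apply: convex01_homo => //; first by rewrite tS lerDl ltW.
      exact/ltW/t_lt1.
    have h2 : `|z.2 - (t i, g (t i)).2| < rho.
      have : 0 <= D * rb by rewrite mulr_ge0// ltW.
      rewrite /= ltr_norml; move: z2 z2' gg gg0 D4 Drho D0; clear => *.
      by apply/andP; split; lra.
    have := Hrho _ _ Tz (Tg _ ik) h1 h2.
    rewrite ltr_norml => /andP[_]; have /pcM/andP[h _] := Tg _ ik.
    have : th * c <= th * p (t i, g (t i)) by rewrite ler_pM2l.
    by clear; lra.
  + rewrite big_ord_recr /= /cell_rate ltnn.
    apply: (@le_lt_trans _ _ (\sum_(i < k.+1) cbrt 4^-1 * ((1 + th) * (D * cell p g 1 D i)) +
        cbrt 4^-1 * ((A - A1) / 2))).
      apply: lerD.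
        apply: ler_sum => i _; have ik := ltn_ord i; rewrite ik.
        have /p0/andP[pt0 _] := Tg _ ik; have := lh _ ik; rewrite -subr_gt0 => lh0.
        have incE : increment g 1 D i = high i - low i.
          by rewrite /increment /high /low /r !mul1r mulr1 -/(t i) -/(t i.+1) -/D2; ring.
        rewrite /cell incE -/(t i) tS addrAC subrr add0r /m ik.
        move: pt0 lh0; move: (p _) (high i - low i) => P I P0 I0.
        have PI0 : 0 <= P * (I / D) by rewrite mulr_ge0// divr_ge0// ltW.
        have th10 : 0 <= 1 + th by rewrite addr_ge0// ltW.
        clear -D0 th0 th10 P0 I0 PI0.
        rewrite -[leRHS]exprK_cbrt; last by rewrite !mulr_ge0 ?cbrt_ge0 ?(ltW D0).
        apply: cbrt_le; first by rewrite !mulr_ge0 ?invr_ge0 ?(ltW D0) ?(ltW I0).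
        rewrite 3!exprMn !cbrtK ?invr_ge0//.
        rewrite (_ : 4^-1 * (_ * P) * D ^+ 2 * I = 4^-1 * P * D ^+ 2 * I * (1 + th)); last by ring.
        rewrite [leRHS](_ : _ = 4^-1 * P * D ^+ 2 * I * (1 + th) ^+ 3); last by field; rewrite gt_eqF.
        apply: ler_wpM2l; first by rewrite !mulr_ge0 ?exprn_ge0 ?invr_ge0// ltW.
        by rewrite -[leLHS]expr1; apply: ler_weXn2l => //; lra.
      rewrite /m ltnn tN -[(A - A1) / 2]exprK_cbrt; last by rewrite divr_ge0// subr_ge0 ltW.
      rewrite -cbrtM ?invr_ge0// ?exprn_ge0 ?divr_ge0 ?subr_ge0 ?(ltW A1A)//.
      apply: cbrt_le; first by rewrite mulr_ge0 ?(ltW M0)// /b; lra.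
      by rewrite (_ : 1 - b = dl)// /b; ring.
    rewrite -mulr_sumr -mulrDr ltr_pM2l ?/cbrt ?powR_gt0 ?invr_gt0// -mulr_sumr.
    have : (1 + th) * grid_sum p g 1 D k.+1 < (1 + th) * A1 by rewrite ltr_pM2l//; lra.
    by rewrite /grid_sum; lra.
- by rewrite /t mul0r.
clear -cg D0 D20 D2D t0 tS tb tN t_lt1 bD2 b1.
(* Besides the grid points, their shifts by [D ^+ 2] are tested: the short chords between them
   control the slopes of [h]. *)
exists ([seq t i | i <- iota 0 k.+2] ++ [seq t i - D2 | i <- iota 1 k.+1] ++
  [seq t i + D2 | i <- iota 1 k.+1]), (D2 ^+ 2); split; first by rewrite exprn_gt0.
move=> h ch hg.
have H1 i : (i <= k.+1)%N -> `|h (t i) - g (t i)| < D2 ^+ 2.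
  by move=> ik; apply: hg; rewrite mem_cat map_f// mem_iota.
have H2 i : (i < k)%N -> `|h (t i.+1 - D2) - g (t i.+1 - D2)| < D2 ^+ 2.
  by move=> ik; apply: hg; rewrite !mem_cat; apply/orP; right; apply/orP; left; apply/mapP; exists i.+1; rewrite // mem_iota /= add1n ltnS ltnW.
have H3 i : (i < k.+1)%N -> `|h (t i.+1 + D2) - g (t i.+1 + D2)| < D2 ^+ 2.
  by move=> ik; apply: hg; rewrite !mem_cat; apply/orP; right; apply/orP; right; apply/mapP; exists i.+1; rewrite // mem_iota /= add1n ltnS.
split.
- move=> i z ik [/andP[z0 z1] zE] /andP[tz zt]; rewrite /dom ik; split => /=; rewrite in_itv /=.
    by rewrite tz ltW.
  rewrite -zE; have := H1 i (ltnW ik); have := H1 i.+1 ik; rewrite !ltr_norml => /andP[a1 a2] /andP[a3 a4].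
  have a5 : h (t i) <= h z.1 by apply: convex01_homo => //; exact: ltW.
  have a6 : h z.1 <= h (t i.+1).
    by apply: convex01_homo => //; [exact: ltW|have := tb _ ik; lra].
  by apply/andP; split; lra.
- move=> z [/andP[z0 z1] zE] tz; rewrite /dom ltnn; split => /=; rewrite in_itv /= ?tz//.
  by rewrite -zE; apply: convex01_range => //; rewrite z0 ltW.
- move=> i u v ik [/andP[u0 u1] uE] [/andP[v0 v1] vE] tu uv vt; rewrite /slope -uE -vE.
  apply/andP; split.
    (* There is no test point to the left of 0. In the first cell [low] is negative, because the
       right slope is 0 at negative arguments, and slopes of [h] are nonnegative. *)
    case: i ik tu vt => [|i] ik tu vt.
      rewrite /low /t mul0r sub0r {1}/r /right_slope oppr_lt0 D20 sub0r.
      apply: (@lt_le_trans _ _ 0); first by rewrite oppr_lt0 mulr_gt0.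
      rewrite divr_ge0// subr_ge0; last exact: ltW.
      by apply: convex01_homo => //; exact: ltW.
    rewrite /low; apply: (slope_above (t := t i.+1) cg ch D20) => //; last exact: ltW.
    + by rewrite tS; have := t0 i; lra.
    + by rewrite subrK.
    + exact: H2.
    + by apply: H1; exact: ltnW.
  rewrite /high; apply: (slope_below (t := t i.+1) cg ch D20) => //.
  + by have := tb _ ik; lra.
  + exact: H3.
  + exact: H1.
  + exact: ltW.
Unshelve. all: by end_near. Qed.

End UpperGrid.

Section ChainUpper.
Context {R : realType}.
Local Notation pt := (measurableTypeR R * measurableTypeR R)%type.
Implicit Types (g h : R -> R).

Lemma chain_enum n (z : 'I_n -> R * R) : convex_chain (range z) -> injective z ->
  exists2 s : 'S_n, (forall i, open_triangle (z i)) & ccw (corners [seq z (s i) | i <- enum 'I_n]).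
Proof.
move=> /convex_chain_seq[l [lE lT ul cl]] inj.
have [s sE] : exists s : 'S_n, l = [tuple tnth [tuple z i | i < n] (s i) | i < n].
  apply/tuple_permP; apply: uniq_perm => //; first by rewrite map_inj_uniq// enum_uniq.
  move=> u; apply/idP/mapP => [ul'|[i _ ->]].
    have : [set` l] u by [].
    by rewrite lE => -[i _ <-]; exists i; rewrite ?mem_enum.
  have : range z (z i) by exists i.
  by rewrite -lE.
exists s.
  move=> i; apply: lT; have : range z (z i) by exists i.
  by rewrite -lE.
rewrite (_ : [seq _ | _ <- _] = l)// sE /=; apply: eq_map => i.
by rewrite tnth_mktuple.
Qed.

(** The starting slope -1 leaves room for a first edge along the bottom of the triangle, of slope
    0. *)
Lemma chain_sorted n (z : 'I_n -> R * R) : convex_chain (range z) -> injective z ->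
  (forall i, (z i).1 < 1) -> exists2 s : 'S_n, (forall i, open_triangle (z i)) &
    convex_path (0, 0) (- 1) (rcons [seq z (s i) | i <- enum 'I_n] (1, 1)).
Proof.
move=> cz inj z1; have [s oz cs] := chain_enum cz inj; exists s => //.
have lo : forall u, u \in [seq z (s i) | i <- enum 'I_n] -> open_triangle u.
  by move=> u /mapP[i _ ->].
have l1 : forall u, u \in [seq z (s i) | i <- enum 'I_n] -> u.1 < 1.
  by move=> u /mapP[i _ ->].
case: [seq _ | _ <- _] cs lo l1 => [|w l] cs lo l1.
  by split => //=; lra.
have [w0 cp] := ccw_convex_path lo l1 cs.
split => //=; last by rewrite !subr0.
have [/triangleP + _] := lo w (mem_head _ _); rewrite /=; lra.
Qed.

(** The interpolant is cut off to 0 outside [0, 1], so as to belong to a compact set of functions on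
    the line. *)
Lemma chain_interpolant01 n (z : 'I_n -> R * R) : convex_chain (range z) -> injective z ->
  (forall i, (z i).1 < 1) -> exists h, [/\ convex01 h, h 1 = 1,
    forall x, ~~ (0 <= x <= 1) -> h x = 0 & forall i, h (z i).1 = (z i).2].
Proof.
move=> cz inj z1; have [s oz cs] := chain_enum cz inj.
have lo : forall u, u \in [seq z (s i) | i <- enum 'I_n] -> open_triangle u.
  by move=> u /mapP[i _ ->].
have l1 : forall u, u \in [seq z (s i) | i <- enum 'I_n] -> u.1 < 1.
  by move=> u /mapP[i _ ->].
have [h [hc h0 h00 h11 hz]] := chain_interpolant lo l1 cs.
pose k x := if 0 <= x <= 1 then h x else 0.
have kE x : 0 <= x <= 1 -> k x = h x by rewrite /k => ->.
exists k; split.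
- split.
  + move=> x; rewrite /= !in_itv /= => x01; rewrite kE// h0 /=.
    have /andP[x0 x1] := x01.
    have := hc 1 0 x x01; rewrite h11 h00 !mulr1 mulr0 !addr0 => /le_trans; exact.
  + move=> t x y; rewrite !inE /= !in_itv /= => /andP[x0 x1] /andP[y0 y1].
    have t0 : 0 <= t%:num by []. have t1 : t%:num <= 1 by [].
    have t'0 : 0 <= 1 - t%:num by rewrite subr_ge0.
    have := hc x y t%:num; rewrite t0 t1 => /(_ isT).
    rewrite -(kE x) ?x0// -(kE y) ?y0// -kE; first exact.
    apply/andP; split; first by rewrite addr_ge0// mulr_ge0.
    have := ler_wpM2l t0 x1; have := ler_wpM2l t'0 y1; rewrite !mulr1; lra.
  + by rewrite kE// lexx ler01.
- by rewrite kE// ler01 lexx.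
- by move=> x /negbTE; rewrite /k => ->.
- move=> i; rewrite kE; last first.
    by have [/triangleP + _] := oz i; have := z1 i; move=> zi1 [h1 [h2 h3]]; apply/andP; split; [exact: le_trans h2|exact: ltW].
  apply: hz; apply/mapP; exists ((s ^-1)%g i); rewrite ?mem_enum// permKV//.
Qed.

(** The chains with an interpolant close to [g] are enclosed in a measurable event [E], that of
    being distributed over the cells in some order. *)
Lemma chain_prob_upper (p : R * R -> R) (M c A : R) g :
  0 < c -> (forall z, triangle z -> c <= p z <= M) -> {within triangle, continuous p} ->
  (forall e, 0 < e -> exists2 rho, 0 < rho & forall z z', triangle z -> triangle z' ->
     `|z.1 - z'.1| < rho -> `|z.2 - z'.2| < rho -> `|p z - p z'| < e) ->
  convex01 g -> (J p g < A%:E)%E ->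
  exists (S : seq R) (tau K : R) (q : nat), [/\ 0 < tau, 0 <= K &
    forall d (Omega : measurableType d) (P : probability Omega R) (mu : probability pt R) n
      (X : 'I_n -> Omega -> pt), density_le p mu -> iid P mu X ->
    exists E : set Omega, [/\ measurable E, (P E <= (K * n.+1%:R ^+ q * rate A n)%:E)%E &
      forall w, convex_chain (range (fun i => X i w)) -> injective (fun i => X i w) ->
        (forall i, (X i w).1 < 1) -> forall h, convex01 h -> (forall i, h (X i w).1 = (X i w).2) ->
        (forall x, x \in S -> `|h x - g x| < tau) -> E w]].
Proof.
move=> c0 pcM pc p_unif cg JA.
have [N [t [low [high [m [dom [[mdom m0 t_lt tN [lh dom_t dom_N dom_p sumA]] [t00 [S [tau [tau0 HS]]]]]]]]]]] :=
  upper_grid c0 pcM pc p_unif cg JA.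
pose a := cell_rate t low high m N.
have a0 i : 0 < a i by exact: cell_rate_gt0.
exists S, tau, ((1 + \sum_(i < N.+1) 2 / a i ^+ 3) ^+ N.+1), (4 * N.+1)%N.
have K0 : 0 <= 1 + \sum_(i < N.+1) 2 / a i ^+ 3.
  by rewrite addr_ge0// sumr_ge0// => i _; rewrite divr_ge0// exprn_ge0// ltW.
split => //; first by rewrite exprn_ge0.
move=> d Omega P mu n X mup iX.
exists (distributed t low high dom N X); split.
- exact: (measurable_distributed mdom m0 t_lt tN lh dom_t dom_N dom_p mup iX).
- apply: le_trans (distributed_le mdom m0 t_lt tN lh dom_t dom_N dom_p mup iX) _.
  rewrite lee_fin /rate -/a.
  have S0 : 0 <= \sum_(i < N.+1) a i by rewrite sumr_ge0// => i _; rewrite ltW.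
  have le3 : ((\sum_(i < N.+1) a i) ^+ n / n`!%:R) ^+ 3 <= ((cbrt 4^-1 * A) ^+ n / n`!%:R) ^+ 3.
    have B0 : 0 <= cbrt 4^-1 * A by exact: le_trans S0 (ltW sumA).
    have S0n := exprn_ge0 n S0; have B0n := exprn_ge0 n B0.
    rewrite lerXn2r ?nnegrE ?divr_ge0//.
    by rewrite ler_wpM2r ?invr_ge0// lerXn2r ?nnegrE// ltW.
  move: le3 K0; move: (_ ^+ 3) (_ ^+ 3) (1 + _) => U V K UV K0.
  rewrite mulrCA exprM -exprMn; apply: ler_wpM2l; first by rewrite exprn_ge0// mulr_ge0// exprn_ge0.
  by apply: ler_wpM2l.
- move=> w cX inj X1 h ch hX hS.
  have [H1 H2 H3] := HS h ch hS.
  have [s oX cp] := chain_sorted cX inj X1.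
  pose l := [seq X (s i) w | i <- enum 'I_n].
  have sl : size l = n by rewrite size_map size_enum_ord.
  have lE u : u \in l -> exists i, u = X i w by move=> /mapP[i _ ->]; exists (s i).
  have gl u : u \in l -> graph_points h u.
    move=> /lE[i ->]; split; last exact: hX.
    have [/triangleP + _] := oX i; have := X1 i => zi1 [h1 [h2 h3]]; apply/andP; split; [exact: le_trans h2|exact: zi1].
  have slope0 u v : graph_points h u -> graph_points h v -> u.1 < v.1 -> 0 <= slope u v.
    move=> [/andP[u0 u1] uE] [/andP[v0 v1] vE] uv; rewrite /slope -uE -vE.
    rewrite divr_ge0// subr_ge0; last exact: ltW.
    by apply: convex01_homo => //; exact: ltW.
  have glt1 z : graph_points h z -> z.1 < 1 by move=> [/andP[]].
  have cl : chain_from (graph_points h) l.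
    exists (0, 0), (- 1); split => //; split => /=; first by rewrite lexx ltr01.
    by case: ch.
  have tl u : u \in l -> t 0%N <= u.1 by move=> /gl[/andP[]]; rewrite t00.
  have [cc [scc kcc Hcc]] := distribute H1 H2 H3 slope0 glt1 (add0n N) cl tl.
  exists s, cc; split; first by rewrite mem_comps scc kcc sl !eqxx.
  exact: Hcc.
Qed.

End ChainUpper.

(** * Densities and samples *)

Section Density.
Context {R : realType}.
Implicit Types (p : R * R -> R).

(** The triangle is the image of the unit square under the map taking (x, y) to (x, xy). *)
Lemma compact_triangle : compact (@triangle R).
Proof.
pose f (z : R * R) := (z.1, z.1 * z.2).
have -> : @triangle R = f @` (`[0, 1]%classic `*` `[0, 1]%classic).
  apply/seteqP; split => z.
    move=> /triangleP[z0 [zz z1]]; exists (z.1, z.2 / z.1).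
      split => /=; rewrite in_itv /=; first by rewrite z1 (le_trans z0).
      have [->|z10] := eqVneq z.1 0; first by rewrite invr0 mulr0 lexx ler01.
      have zp : 0 < z.1 by rewrite lt0r z10 (le_trans z0).
      by rewrite divr_ge0 ?(ltW zp)// ler_pdivrMr// mul1r.
    rewrite /f /= mulrCA; have [z10|z10] := eqVneq z.1 0.
      by apply: pair_eq => //=; rewrite z10 invr0 !mulr0; lra.
    by rewrite mulfV// mulr1 -surjective_pairing.
  move=> [w [/=]]; rewrite !in_itv /= => /andP[w10 w11] /andP[w20 w21] <-.
  apply/triangleP; rewrite /f /= mulr_ge0//; split => //; split => //.
  by rewrite ler_piMr.
apply: continuous_compact; last by apply: compact_setX; exact: segment_compact.
apply: continuous_subspaceT => z.
apply: (@cvg_pair _ _ _ (nbhs z) (nbhs z.1) (nbhs (z.1 * z.2))); first exact: cvg_fst.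
by apply: cvgM; [exact: cvg_fst|exact: cvg_snd].
Qed.

Lemma density_bounds p c : {within triangle, continuous p} -> (forall z, triangle z -> 0 <= p z) ->
  0 < c -> 2 * c <= inf (p @` triangle) -> exists M, forall z, triangle z -> c <= p z <= M.
Proof.
move=> pc p0 c0 pinf.
have /compact_bounded[N [_ HN]] := continuous_compact pc compact_triangle.
exists (N + 1) => z Tz; have pz : (p @` triangle) (p z) by exists z.
apply/andP; split.
  have : inf (p @` triangle) <= p z by apply: ge_inf => //; exists 0 => _ [u Tu <-]; exact: p0.
  by lra.
have N1 : N < N + 1 by rewrite ltrDl.
by have := HN _ N1 _ pz; apply: le_trans; exact: ler_norm.
Qed.

Lemma density_unif p e : {within triangle, continuous p} -> 0 < e ->
  exists2 rho, 0 < rho & forall z z', triangle z -> triangle z' ->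
     `|z.1 - z'.1| < rho -> `|z.2 - z'.2| < rho -> `|p z - p z'| < e.
Proof.
move=> pc e0; have e20 : 0 < e / 2 by rewrite divr_gt0.
pose Q (rho : R) (z : R * R) := triangle z -> forall z', triangle z' ->
  `|z.1 - z'.1| < rho -> `|z.2 - z'.2| < rho -> `|p z - p z'| < e.
have /compact_near_coveringP/(_ R (0^'+) Q _) := compact_triangle.
case.
  move=> z0 Tz0; have /subspace_continuousP/(_ _ Tz0)/cvgrPdist_lt/(_ _ e20) := pc.
  rewrite near_withinE => /nbhs_ballP[r /= r0 H].
  have r20 : 0 < r / 2 by rewrite divr_gt0.
  exists (ball z0 (r / 2), [set rho | rho < r / 2]).
    split; first by apply/nbhs_ballP; exists (r / 2).
    by apply: nbhs_right_lt.
  move=> [z rho] /= [[b1 b2] rr] Tz z' Tz' d1 d2.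
  have h1 : `|p z0 - p z| < e / 2.
    by apply: H => //; split; [apply: lt_trans b1 _|apply: lt_trans b2 _]; lra.
  have h2 : `|p z0 - p z'| < e / 2.
    apply: H => //; split; rewrite /ball /=.
      by apply: le_lt_trans (ler_distD z.1 _ _) _; move: b1; rewrite /ball /= => b1; lra.
    by apply: le_lt_trans (ler_distD z.2 _ _) _; move: b2; rewrite /ball /= => b2; lra.
  rewrite distrC in h1.
  by apply: le_lt_trans (ler_distD (p z0) _ _) _; lra.
move=> r /= r0 H; have r20 : 0 < r / 2 by rewrite divr_gt0.
exists (r / 2) => // z z' Tz Tz' d1 d2.
apply: (H (r / 2) _ r20 z Tz Tz z' Tz' d1 d2).
by rewrite /ball_ /= sub0r normrN gtr0_norm// ltr_pdivrMr// ltr_pMr// ltr1n.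
Qed.

End Density.

Section Samples.
Context {R : realType}.
Local Notation pt := (measurableTypeR R * measurableTypeR R)%type.
Local Notation leb2 := (@lebesgue_measure R \x @lebesgue_measure R)%E.

(** The common law is that of the first sample, hence a positive number of samples. *)
Lemma samples_iid d (Omega : measurableType d) (P : probability Omega R) (p : R * R -> R) n
    (X : 'I_n.+1 -> {RV P >-> (R * R)%type}) :
  (forall z, triangle z -> 0 <= p z) -> independent_samples triangle p X ->
  exists mu : probability pt R,
    [/\ density_ge p mu, density_le p mu & iid P mu (fun i => X i : Omega -> pt)].
Proof.
move=> p0 [indep dens].
have muE i (A : set pt) : measurable A ->
    distribution P (X i) A = (\int[leb2]_(z in triangle `&` A) (p z)%:E)%E.
  by move=> mA; exact: dens.
have mX i : measurable_fun [set: Omega] (X i : Omega -> pt).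
  by move=> _ A mA; exact: (measurable_funPT (X i) measurableT _ mA).
pose Y : {mfun Omega >-> pt} := @mfun_Sub _ _ Omega pt _ (mem_set (mX ord0)).
pose nu : probability pt R := distribution P Y.
have {}muE i (A : set pt) : measurable A -> P (X i @^-1` A) = (\int[leb2]_(z in triangle `&` A) (p z)%:E)%E.
  by move=> mA; exact: muE.
have nuE (A : set pt) : measurable A -> nu A = (\int[leb2]_(z in triangle `&` A) (p z)%:E)%E.
  by move=> mA; exact: muE.
exists nu; split.
- move=> m A mA m0 HA; rewrite nuE//.
  have -> : triangle `&` A = A by apply/seteqP; split => [z []|z Az] //; split => //; have [] := HA z Az.
  rewrite -integral_cst//; apply: le_measure_integral => //.
  by move=> z /HA[_]; rewrite lee_fin.
- move=> m A mA m0 HA; rewrite nuE//.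
  have mTA : measurable (triangle `&` A : set pt) by apply: measurableI => //; exact: measurable_triangle.
  apply: (@le_trans _ _ (m%:E * leb2 (triangle `&` A))%E).
    rewrite -integral_cst//; apply: le_measure_integral => //.
      by move=> z [Tz _]; rewrite lee_fin; exact: p0.
    by move=> z [Tz Az]; rewrite lee_fin; exact: HA.
  apply: lee_pmul => //.
  by apply: le_measure; rewrite ?inE//; exact: subIsetr.
- split; first exact: mX.
  move=> A mA; have := indep [set: 'I_n.+1]%SET A mA.
  rewrite (_ : \bigcap_(i in _) _ = [set w | forall i, A i (X i w)]); last first.
    by apply/seteqP; split => w /= H i; [apply: H; rewrite /= inE|move=> _; exact: H].
  move=> ->; rewrite (eq_bigl xpredT); last by move=> i; rewrite inE.
  by apply: eq_bigr => i _; exact: (etrans (muE i _ (mA i)) (esym (nuE _ (mA i)))).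
Qed.

Section Null.
Context d (Omega : measurableType d) (P : probability Omega R) (mu : probability pt R)
  (p : R * R -> R) (M : R).
Context (mup : density_le p mu) (pM : forall z, triangle z -> p z <= M).

Lemma iid_marginal n (X : 'I_n -> Omega -> pt) i (A : set pt) : iid P mu X -> measurable A ->
  P [set w | A (X i w)] = mu A.
Proof.
move=> [mX iX] mA.
have := iX (fun j => if j == i then A else setT).
rewrite (_ : [set w | forall j, _] = [set w | A (X i w)]); last first.
  apply/seteqP; split => w /= H; first by have := H i; rewrite eqxx.
  by move=> j; case: eqP => [->|].
move=> ->; last by move=> j; case: ifP.
rewrite (bigD1 i)//= eqxx big1 ?mule1// => j /negbTE ->.
exact: probability_setT.
Qed.

Lemma density_null (A : set pt) : measurable A -> leb2 A = 0%E -> mu A = 0%E.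
Proof.
move=> mA A0; apply/eqP; rewrite eq_le measure_ge0 andbT.
have M0 : 0 <= maxr M 0 by rewrite le_max lexx orbT.
apply: le_trans (mup mA M0 _) _; last by rewrite A0 mule0.
by move=> z _ Tz; rewrite le_max pM.
Qed.

Lemma lebesgue_measure2_line (x : R) (B : set (measurableTypeR R)) : measurable B ->
  leb2 ([set x] `*` B) = 0%E.
Proof.
move=> mB; have := product_measure1E lebesgue_measure lebesgue_measure (measurable_set1 x) mB.
by rewrite [X in (X * _)%E]lebesgue_measure_set1 mul0e.
Qed.

Lemma density_point (z : pt) : measurable [set z] /\ mu [set z] = 0%E.
Proof.
have zE : [set z] = [set z.1] `*` [set z.2] :> set pt.
  apply/seteqP; split => u /=; first by move=> ->.
  by move=> [h1 h2]; rewrite (surjective_pairing u) h1 h2 -surjective_pairing.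
have mz : measurable ([set z.1] `*` [set z.2] : set pt) by apply: measurableX; exact: measurable_set1.
split; rewrite zE//; apply: density_null => //.
exact: lebesgue_measure2_line.
Qed.

Lemma density_right_edge : measurable ([set z | z.1 = 1] : set pt) /\ mu [set z | z.1 = 1] = 0%E.
Proof.
have zE : [set z | z.1 = 1] = [set 1] `*` setT :> set pt by apply/seteqP; split => u /= // -[].
have mz : measurable ([set 1] `*` setT : set pt) by apply: measurableX => //; exact: measurable_set1.
split; rewrite zE//; apply: density_null => //.
exact: lebesgue_measure2_line.
Qed.

Definition head_repeated n : set (n.+1.-tuple pt) :=
  [set t | exists k : 'I_n, tnth t (lift ord0 k) = tnth t ord0].

Lemma measurable_head_repeated n : measurable (@head_repeated n).
Proof.
have -> : @head_repeated n = \bigcup_(k in [set: 'I_n])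
    ([set t | (tnth t (lift ord0 k)).1 <= (tnth t ord0).1] `&`
     [set t | (tnth t ord0).1 <= (tnth t (lift ord0 k)).1] `&`
    ([set t | (tnth t (lift ord0 k)).2 <= (tnth t ord0).2] `&`
     [set t | (tnth t ord0).2 <= (tnth t (lift ord0 k)).2])).
  apply/seteqP; split => t; first by move=> [k E]; exists k => //=; rewrite E !lexx.
  move=> [k _ /= [[a1 a2] [b1 b2]]]; exists k.
  rewrite (surjective_pairing (tnth t (lift ord0 k))) [RHS]surjective_pairing.
  by congr (_, _); apply/eqP; rewrite eq_le ?a1 ?a2 ?b1 ?b2.
have mt k : measurable_fun setT (fun t : n.+1.-tuple pt => tnth t k) by exact: measurable_tnth.
have m1 k : measurable_fun setT (fun t : n.+1.-tuple pt => (tnth t k).1).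
  by apply: measurableT_comp (mt k); exact: measurable_fst.
have m2 k : measurable_fun setT (fun t : n.+1.-tuple pt => (tnth t k).2).
  by apply: measurableT_comp (mt k); exact: measurable_snd.
apply: fin_bigcup_measurable => // k _.
apply: measurableI; apply: measurableI.
- exact: (measurable_le_set (m1 _) (m1 _)).
- exact: (measurable_le_set (m1 _) (m1 _)).
- exact: (measurable_le_set (m2 _) (m2 _)).
- exact: (measurable_le_set (m2 _) (m2 _)).
Qed.

(** Conditioned on the head, each other point hits it with probability 0, since points are null sets
    for a law with a density. *)
Lemma head_repeated_null n (X : 'I_n.+1 -> Omega -> pt) : iid P mu X ->
  P (tuple_of X @^-1` @head_repeated n) = 0%E.
Proof.
move=> iX; rewrite (iid_cons iX); last exact: measurable_head_repeated.
apply: integral0_eq => z _.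
have iY := iid_behead iX.
pose Y i := X (lift ord0 i); rewrite -/Y.
have nthE w (k : 'I_n) : nth z [seq Y i w | i <- enum 'I_n] k = Y k w.
  by rewrite (nth_map k) ?size_enum_ord// nth_ord_enum.
have -> : tuple_of Y @^-1` [set t : n.-tuple pt | head_repeated (cons_tuple z t)] =
    \big[setU/set0]_(k <- enum 'I_n) [set w | [set z] (Y k w)].
  rewrite -bigcup_seq; apply/seteqP; split => w.
    move=> [k]; rewrite (tnth_nth z) (tnth_nth z) /= => E; exists k; rewrite /= ?mem_enum//.
    by rewrite /= -E -[in LHS](nthE w).
  move=> [k _ /= E]; exists k; rewrite (tnth_nth z) (tnth_nth z) /=.
  exact: etrans (nthE w k) E.
have [mz z0] := density_point z.
apply/eqP; rewrite eq_le measure_ge0 andbT.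
apply: le_trans (measure_bigsetU_le (v := fun=> 0) _) _; last by rewrite big1.
move=> k _; rewrite (iid_marginal k iY mz) z0 lexx; split => //.
by rewrite -[X in measurable X]setTI; exact: iY.1.
Qed.

(** A coincidence at index [i] is brought to the head by the transposition of 0 and [i]. *)
Lemma almost_surely_distinct n (X : 'I_n.+1 -> Omega -> pt) : iid P mu X ->
  exists Z, [/\ measurable Z, P Z = 0%E & forall w, ~ Z w ->
    injective (fun i => X i w) /\ forall i, (X i w).1 <> 1].
Proof.
move=> iX; have [me me0] := density_right_edge.
pose sX (i : 'I_n.+1) k := X (tperm ord0 i k).
have isX i : iid P mu (sX i) by exact: iid_perm.
pose Zi i := tuple_of (sX i) @^-1` @head_repeated n `|` [set w | (X i w).1 = 1].
have mZi i : measurable (Zi i) /\ (P (Zi i) <= 0)%E.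
  have m1 : measurable (tuple_of (sX i) @^-1` @head_repeated n).
    rewrite -[X in measurable X]setTI; apply: (measurable_tuple_of (isX i).1) => //.
    exact: measurable_head_repeated.
  have m2 : measurable [set w | (X i w).1 = 1].
    rewrite (_ : [set w | _] = X i @^-1` [set z | z.1 = 1])//.
    by rewrite -[X in measurable X]setTI; exact: iX.1.
  split; first exact: measurableU.
  apply: le_trans (measureU2 _ m1 m2) _.
  rewrite [X in (X + _)%E](_ : _ = 0%E); last exact: head_repeated_null (isX i).
  rewrite add0e [X in (X <= _)%E](_ : _ = 0%E); last exact: etrans (iid_marginal i iX me) me0.
  exact: lexx.
exists (\big[setU/set0]_(i <- enum 'I_n.+1) Zi i); split.
- by apply: bigsetU_measurable => i _; have [] := mZi i.
- apply/eqP; rewrite eq_le measure_ge0 andbT.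
  apply: le_trans (measure_bigsetU_le (v := fun=> 0) _) _; last by rewrite big1.
  by move=> i _; exact: mZi.
- move=> w; rewrite -bigcup_seq => nZ; split; last first.
    by move=> i Xi; apply: nZ; exists i; rewrite /= ?mem_enum//; right.
  move=> i j Xij; apply/eqP/negPn/negP => ij; apply: nZ; exists i; rewrite /= ?mem_enum//; left.
  have [k kE|/eqP] := unliftP ord0 (tperm ord0 i j).
    exists k; rewrite -kE; have := tpermK ord0 i j => jE.
    transitivity (sX i (tperm ord0 i j) w); first by rewrite /tuple_of tnth_mktuple.
    by rewrite /sX jE /tuple_of tnth_mktuple /sX tpermL.
  by rewrite (canF_eq (tpermK ord0 i)) tpermL eq_sym (negbTE ij).
Qed.

End Null.
End Samples.

(** * Compactness of the set of interpolants *)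

Section Compactness.
Context {R : realType}.
Implicit Types (g h : R -> R).
Local Notation ptws := (prod_topology (fun _ : R => R^o)).

(* The values outside [0, 1] are fixed so that these functions form a compact set for the
   topology of pointwise convergence on [R]. *)
Definition chain_functions : set (R -> R) :=
  [set h | [/\ convex01 h, h 1 = 1 & forall x, ~~ (0 <= x <= 1) -> h x = 0]].

Definition close_at (S : seq R) (e : R) (g : R -> R) : set (R -> R) :=
  [set h | forall x, x \in S -> `|h x - g x| < e].

Lemma nbhs_close_at (g : ptws) S e : 0 < e -> (@nbhs ptws ptws g) (close_at S e g).
Proof.
move=> e0; have Fg : Filter (@nbhs ptws ptws g) := nbhs_filter g.
elim: S => [|x S IH].
  by apply: (@filterS _ _ Fg setT) => [h _ y|]; [rewrite in_nil|exact: filterT].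
have H : (@nbhs ptws ptws g) [set h : ptws | `|h x - g x| < e].
  have /cvgrPdist_lt/(_ _ e0) := @proj_continuous R (fun _ : R => R^o) x g.
  by apply: (@filterS _ _ Fg) => h /=; rewrite distrC.
apply: (@filterS2 _ _ Fg _ _ _ _ H IH) => h hx hS y.
by rewrite inE => /predU1P[->//|]; exact: hS.
Qed.

(** Each defining condition is a weak inequality or an equality between at most three values, so it
    passes to pointwise limits. *)
Lemma chain_functions_closed g : (forall S e, 0 < e -> exists h, chain_functions h /\ close_at S e g h) ->
  chain_functions g.
Proof.
move=> H.
have le0 (a : R) : (forall e, 0 < e -> a <= e) -> a <= 0.
  by move=> Ha; apply/ler_addgt0Pr => e e0; rewrite add0r; exact: Ha.
have eq_at x v : (forall h, chain_functions h -> h x = v) -> g x = v.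
  move=> hx; apply/eqP; rewrite -subr_eq0 -normr_le0; apply: le0 => e e0.
  have [h [Kh /(_ x)]] := H [:: x] e e0; rewrite mem_head hx// => /(_ isT).
  by rewrite distrC => /ltW.
split; last by move=> x x01; apply: eq_at => h [_ _]; exact.
  split.
  - move=> x; rewrite /= !in_itv /= => x01; apply/andP; split.
      rewrite -oppr_le0; apply: le0 => e e0.
      have [h [[ch _ _] /(_ x)]] := H [:: x] e e0; rewrite mem_head => /(_ isT).
      by have /andP[h0 h1] := convex01_range ch x01; rewrite ltr_norml => /andP[h2 h3]; lra.
    rewrite -subr_le0; apply: le0 => e e0.
    have [h [[ch _ _] /(_ x)]] := H [:: x] e e0; rewrite mem_head => /(_ isT).
    by have /andP[h0 h1] := convex01_range ch x01; rewrite ltr_norml => /andP[h2 h3]; lra.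
  - move=> t x y; rewrite !inE /= !in_itv /= => x01 y01.
    have t0 : 0 <= t%:num by []. have t1 : t%:num <= 1 by [].
    change (g (t%:num * x + (1 - t%:num) * y) <= t%:num * g x + (1 - t%:num) * g y).
    move: (t%:num) t0 t1 => {}t t0 t1; set z := t * x + _.
    rewrite -subr_le0; apply: le0 => e e0.
    have e30 : 0 < e / 2 by rewrite divr_gt0.
    have [h [[ch _ _] hS]] := H [:: x; y; z] _ e30.
    have := hS x; have := hS y; have := hS z; rewrite !inE !eqxx ?orbT.
    move=> /(_ isT) + /(_ isT) + /(_ isT); rewrite !ltr_norml => /andP[z1 z2] /andP[y1 y2] /andP[x1 x2].
    have t01 : 0 <= t <= 1 by rewrite t0.
    have := convex01_le ch x01 y01 t01; rewrite -/z.
    have : 0 <= 1 - t by lra.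
    have : t * (g x - h x + e / 2) >= 0 by rewrite mulr_ge0//; lra.
    have : (1 - t) * (g y - h y + e / 2) >= 0 by rewrite mulr_ge0//; lra.
    clear -z1 z2 y1 y2 x1 x2 t0 t1; lra.
  - by apply: eq_at => h [[]].
by apply: eq_at => h [].
Qed.

(** If finitely many neighbourhoods never sufficed, the parts they leave uncovered would generate a
    proper filter. By Tychonoff's theorem for a product of copies of [0, 1] it has a cluster point,
    which is a chain function and whose own neighbourhood gives a contradiction. *)
Lemma chain_functions_finite_cover (S : (R -> R) -> seq R) (tau : (R -> R) -> R) :
  (forall g, chain_functions g -> 0 < tau g) ->
  exists L : seq (R -> R), (forall g, g \in L -> chain_functions g) /\
    forall h, chain_functions h -> exists2 g, g \in L & close_at (S g) (tau g) g h.
Proof.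
move=> tau0; apply: contrapT => noL.
pose F : set_system (ptws) :=
  [set V | exists L : seq (R -> R), (forall g, g \in L -> chain_functions g) /\
     forall h, chain_functions h -> (forall g, g \in L -> ~ close_at (S g) (tau g) g h) -> V h].
have FF : ProperFilter F.
  apply: Build_ProperFilter.
    move=> [L [LK H]]; apply: noL; exists L; split => // h Kh.
    apply: contrapT => nh; apply: (H h Kh) => g gL gh; apply: nh; by exists g.
  split.
  - by exists [::]; split => //.
  - move=> V W [L [LK LV]] [L' [LK' LW]]; exists (L ++ L'); split.
      by move=> g; rewrite mem_cat => /orP[]; [exact: LK|exact: LK'].
    move=> h Kh hL; split; [apply: LV => // g gL|apply: LW => // g gL];
      by apply: hL; rewrite mem_cat gL ?orbT.
  - by move=> V W VW [L [LK LV]]; exists L; split => // h Kh hL; exact/VW/LV.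
have [] := @tychonoff R (fun _ => R^o) (fun _ => `[0, 1]%classic) (fun _ => @segment_compact R 0 1) F FF.
  exists [::]; split => // h [ch h1 h0] _ x; rewrite /= in_itv /=.
  have [x01|/h0 ->] := boolP (0 <= x <= 1); last by rewrite lexx ler01.
  exact: convex01_range.
move=> g [_ gF].
have Kg : chain_functions g.
  apply: chain_functions_closed => T e e0.
  have FK : F chain_functions by exists [::].
  by have [h [Kh hT]] := gF _ _ FK (nbhs_close_at g T e0); exists h.
have FU : F [set h | ~ close_at (S g) (tau g) g h].
  exists [:: g]; split => [k|h Kh]; first by rewrite inE => /eqP ->.
  by move=> /(_ g (mem_head _ _)).
by have [h []] := gF _ _ FU (nbhs_close_at g (S g) (tau0 g Kg)).
Qed.

(** For monotone functions, closeness at the points of a grid is uniform closeness as soon as [g]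
    varies little over each cell; near 1 this is the hypothesis of continuity there. *)
Lemma convex01_uniform_grid g e : convex01 g -> 0 < e ->
  (exists2 dl, 0 < dl & forall x, 0 <= x -> 1 - dl < x -> x < 1 -> g 1 - g x < e) ->
  exists S : seq R, forall h, convex01 h -> close_at S e g h ->
    forall x, 0 <= x <= 1 -> `|h x - g x| < 2 * e.
Proof.
move=> cg e0 [dl0 dl00 Hdl0].
pose dl := minr dl0 1.
have dl_gt0 : 0 < dl by rewrite lt_min dl00 ltr01.
have dl1 : dl <= 1 by rewrite ge_min lexx orbT.
have dldl : dl <= dl0 by rewrite ge_min lexx.
have Hdl x : 1 - dl < x -> x < 1 -> g 1 - g x < e by move=> h1 h2; apply: Hdl0 => //; lra.
clear Hdl0 dldl dl00; move: dl dl_gt0 dl1 Hdl => {dl0}dl dl_gt0 dl1 Hdl.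
pose r := right_slope g (1 - dl / 4).
have r0 : 0 <= r by apply: right_slope_ge0 => //; lra.
pose e1 := minr (dl / 4) (e / (1 + r)).
have e10 : 0 < e1 by rewrite lt_min !divr_gt0// ltr_wpDr.
have [N _ HN] := near_infty_natSinv_lt (PosNum e10).
have := HN N (leqnn N); rewrite /= lt_min ltr_pdivlMr ?ltr_wpDr//.
have DN : N.+1%:R * N.+1%:R^-1 = 1 :> R by rewrite mulfV// pnatr_eq0.
have D0 : 0 < N.+1%:R^-1 :> R by rewrite invr_gt0.
move: DN D0; move: (N.+1%:R^-1) => D DN D0 /andP[Ddl]; rewrite ltr_pdivlMr ?ltr_wpDr// => Dr.
exists [seq i%:R * D | i <- iota 0 N.+2] => h ch hS x /andP[x0 x1].
have hg i : (i <= N.+1)%N -> `|h (i%:R * D) - g (i%:R * D)| < e.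
  by move=> iN; apply: hS; apply/mapP; exists i; rewrite ?mem_iota.
have [i [iN ix xi]] : exists i, [/\ (i <= N)%N, i%:R * D <= x & x <= i.+1%:R * D].
  pose i := Num.truncn (x / D).
  have xD0 : 0 <= x / D by rewrite divr_ge0// ltW.
  have /andP[i1 i2] := truncn_itv xD0.
  have [iN|Ni] := leqP i N.
    exists i; split => //; first by rewrite -ler_pdivlMr.
    by rewrite -ler_pdivrMr// ltW.
  exists N; split => //; last by rewrite DN.
  apply: le_trans (_ : i%:R * D <= _); last by rewrite -ler_pdivlMr.
  by rewrite ler_pM2r// ler_nat ltnW.
have tS : i.+1%:R * D = i%:R * D + D by rewrite -natr1 mulrDl mul1r.
have t0 : 0 <= i%:R * D by rewrite mulr_ge0// ltW.
have t1 : i.+1%:R * D <= 1 by rewrite -[leRHS]DN ler_pM2r// ler_nat.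
have := hg i (leqW iN); have := hg i.+1 iN.
rewrite tS in xi t1 *; move: (i%:R * D) t0 t1 ix xi {hg hS} => t t0 t1 ix xi.
have gg : g (t + D) - g t < e.
  have [tl|tg] := leP (t + D) (1 - dl / 4).
    apply: le_lt_trans (right_slope_ge cg t0 (_ : t < t + D) _) _; [lra|lra|].
    rewrite addrAC subrr add0r; apply: le_lt_trans (_ : r * D < e).
      by rewrite ler_pM2r//; apply: right_slope_homo => //; lra.
    by move: Dr; lra.
  have : g (t + D) <= g 1 by apply: convex01_homo => //; lra.
  by have := Hdl t ltac:(lra) ltac:(lra); lra.
have a1 : h t <= h x by apply: convex01_homo.
have a2 : h x <= h (t + D) by apply: convex01_homo.
have a3 : g t <= g x by apply: convex01_homo.
have a4 : g x <= g (t + D) by apply: convex01_homo.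
rewrite !ltr_norml => /andP[b1 b2] /andP[b3 b4].
by apply/andP; split; clear -a1 a2 a3 a4 b1 b2 b3 b4 gg; lra.
Qed.

End Compactness.

(** * Conclusion *)

Section ExponentialBounds.
Context {R : realType}.

Lemma poly_le_exp (a : R) (q : nat) : 0 < a ->
  exists2 K, 0 <= K & forall n, n.+1%:R ^+ q <= K * expR (a * n%:R).
Proof.
(* [q.+1] rather than [q] avoids a division by 0. The bound is the inequality between 1 + x and the
   exponential at [x = b + b * n]. *)
move=> a0; pose b := a / q.+1%:R.
have b0 : 0 < b by rewrite divr_gt0.
exists ((expR b / b) ^+ q); first by rewrite exprn_ge0// divr_ge0 ?expR_ge0// ltW.
move=> n; have H : n.+1%:R <= expR b / b * expR (b * n%:R).
  rewrite mulrAC ler_pdivlMr// -expRD.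
  have := expR_ge1Dx (b + b * n%:R); rewrite -natr1 mulrDl mul1r mulrC; lra.
apply: (@le_trans _ _ ((expR b / b * expR (b * n%:R)) ^+ q)).
  by rewrite lerXn2r ?nnegrE ?mulr_ge0 ?invr_ge0 ?expR_ge0// ltW.
rewrite exprMn ler_wpM2l ?exprn_ge0 ?divr_ge0 ?expR_ge0 ?(ltW b0) ?(ltW a0)//.
rewrite -expRM_natl ler_expR.
rewrite mulrA ler_wpM2r// /b mulrA ler_pdivrMr// mulrC ler_pM2l// ler_nat//.
Qed.

Lemma mulVK_inside (k l e w r x : R) : x != 0 ->
  k * l / x * e * (x / w * r) = k * (l * e / w * r).
Proof. by move=> x0; move: w^-1 => v; field. Qed.

(** The quotient of the two rates is the [n]-th power of [(A / A') ^+ 3 < 1]. Half of this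
    exponential decay absorbs the polynomial factors. *)
Lemma rate_ratio (A A' K C : R) (q q' : nat) : 0 < A -> A < A' -> 0 <= K -> 0 < C ->
  exists (B a : R), [/\ 0 <= B, 0 < a & forall n,
    K * n.+1%:R ^+ q * rate A n <= B * expR (- a * n%:R) * (C / n.+1%:R ^+ q' * rate A' n)].
Proof.
move=> A0 AA' K0 C0.
have A'0 : 0 < A' by exact: lt_trans AA'.
pose x := (A / A') ^+ 3.
have x0 : 0 < x by rewrite exprn_gt0// divr_gt0.
have x1 : x < 1 by rewrite exprn_ilt1 ?divr_ge0 ?ltW// ltr_pdivrMr// mul1r.
pose a := - ln x / 2.
have a0 : 0 < a by rewrite divr_gt0// oppr_gt0 ln_lt0// x0.
have [K1 K10 HK1] := poly_le_exp (q + q') a0.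
exists (K * K1 / C), a; split => //; first by rewrite !mulr_ge0 ?invr_ge0// ltW.
move=> n; have N0 : 0 < n.+1%:R ^+ q' :> R by rewrite exprn_gt0.
have rE : rate A n = x ^+ n * rate A' n.
  rewrite /rate [RHS]mulrCA; congr (_ * _); 
  rewrite /x [((A / A') ^+ 3) ^+ n]exprAC -exprMn; congr (_ ^+ 3).
  by rewrite mulrA -exprMn mulrCA divfK ?gt_eqF.
have xE : x ^+ n = expR (- (2 * a) * n%:R).
  by rewrite -[x in LHS]lnK ?posrE// -expRM_natl mulrC; congr (expR (_ * _)); rewrite /a; field.
rewrite rE xE; clear rE xE x0 x1; clearbody a; clear x.
have -> : K * K1 / C * expR (- a * n%:R) * (C / n.+1%:R ^+ q' * rate A' n) =
   K * (K1 * expR (- a * n%:R) / n.+1%:R ^+ q' * rate A' n).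
  by apply: mulVK_inside; rewrite gt_eqF.
rewrite -[leLHS]mulrA; apply: ler_wpM2l => //.
rewrite mulrA; apply: ler_wpM2r; first by rewrite rate_ge0// ltW.
rewrite ler_pdivlMr// mulrAC -exprD.
apply: (@le_trans _ _ (K1 * expR (a * n%:R) * expR (- (2 * a) * n%:R))).
  exact: (ler_wpM2r (expR_ge0 (- (2 * a) * n%:R)) (HK1 n)).
have E : a * n%:R + - (2 * a) * n%:R = - a * n%:R by ring.
by rewrite -mulrA -expRD E.
Qed.

Lemma log_ratio_le (W V : \bar R) (B a : R) n : (0 <= W)%E -> (0 <= V)%E -> (V <= 1)%E ->
  0 <= B -> 0 < a -> (0 < n)%N -> ln (B + 1) * 2 / a <= n%:R ->
  (W <= (B * expR (- a * n%:R))%:E * V)%E ->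
  ((n%:R^-1)%:E * lne (W / V) <= (- (a / 2))%:E)%E.
Proof.
move=> W0 V0 V1 B0 a0 n0 nB WV.
have B10 : 0 < B + 1 by rewrite ltr_wpDl.
have e0 : 0 < (B + 1) * expR (- a * n%:R) by rewrite mulr_gt0// expR_gt0.
have n0' : 0 < n%:R :> R by rewrite ltr0n.
have WVle : (0 <= W / V <= ((B + 1) * expR (- a * n%:R))%:E)%E.
  move: V V0 V1 WV => [v| |] //; rewrite ?leey_eq// lee_fin => v0 _ WV.
  (* If the condition has probability 0, so has the numerator, and the quotient is 0. *)
  have [v00|v00] := eqVneq v 0.
    have -> : W = 0%E by apply/eqP; rewrite eq_le W0 andbT; move: WV; rewrite v00 mule0.
    by rewrite mul0e lexx lee_fin ltW.
  have vp : 0 < v by rewrite lt0r v00.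
  rewrite inver (negbTE v00); apply/andP; split; first by rewrite mule_ge0// lee_fin invr_ge0.
  rewrite lee_pdivrMr//; apply: le_trans WV _.
  rewrite -!EFinM lee_fin ler_wpM2r// ler_wpM2r ?expR_ge0// lerDl//.
have /andP[h1 h2] := WVle.
have : (lne (W / V) <= lne ((B + 1) * expR (- a * n%:R))%:E)%E.
  by rewrite lee_lne// in_itv /= ?h1 ?leey// ?lee_fin ?ltW.
rewrite lne_EFin// lnM ?posrE ?expR_gt0// expRK => h3.
apply: (@le_trans _ _ ((n%:R^-1)%:E * (ln (B + 1) + - a * n%:R)%:E)%E).
  by apply: lee_wpmul2l => //; rewrite lee_fin invr_ge0 ltW.
rewrite -EFinM lee_fin mulrC ler_pdivrMr//.
by move: nB; rewrite ler_pdivrMr//; lra.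
Qed.

End ExponentialBounds.

Section Main.
Context {R : realType}.
Local Notation pt := (measurableTypeR R * measurableTypeR R)%type.
Context (p : R * R -> R) (M c : R).
Context (c0 : 0 < c) (pcM : forall z, triangle z -> c <= p z <= M)
  (pc : {within triangle, continuous p}).
Context (d : nat -> measure_display) (Omega : forall n, measurableType (d n))
  (P : forall n, probability (Omega n) R) (X : forall n, 'I_n -> Omega n -> pt)
  (mu : forall n : nat, probability pt R).
Arguments X : clear implicits.
Context (iX : forall n, (0 < n)%N -> [/\ density_ge p (mu n), density_le p (mu n) & iid (P n) (mu n) (X n)]).
Context (eps : R) (eps0 : 0 < eps).

Definition chain_event n : set (Omega n) := [set w | convex_chain (range (fun i => X n i w))].

Definition far_event n : set (Omega n) :=
  [set w | (eps%:E <= distance_to_argmax p (fun i => X n i w))%E].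

(* The chains whose interpolant lies in [U] and that are far from the maximizers are
   exponentially unlikely. *)
Definition negligible (U : set (R -> R)) := exists B a : R, [/\ 0 <= B, 0 < a &
  \forall n \near \oo, exists E : set (Omega n), [/\ measurable E,
    (P n E <= (B * expR (- a * n%:R))%:E * P n (@chain_event n))%E &
    forall w h, chain_event w -> injective (fun i => X n i w) -> (forall i, (X n i w).1 < 1) ->
      far_event w -> chain_functions h -> (forall i, h (X n i w).1 = (X n i w).2) -> U h -> E w]].

Lemma distance_le n (s : 'I_n -> R * R) f (e : R) : argmax_J p f -> 0 <= e ->
  (forall i, `|f (s i).1 - (s i).2| <= e) -> (distance_to_argmax p s <= e%:E)%E.
Proof.
move=> af e0 H; apply: ge_ereal_inf; exists (max_deviation f s)%:E; first by exists f.
rewrite lee_fin /max_deviation; elim/big_ind : _ => // x y xe ye.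
by rewrite ge_max xe.
Qed.

Lemma negligible_near_argmax g : chain_functions g -> convex_functions g -> J p g = J_star p /\ True ->
  exists S tau, 0 < tau /\ negligible (close_at S tau g).
Proof.
move=> [cg g1 gout] Fg [Jg _].
have e40 : 0 < eps / 4 by rewrite divr_gt0.
have [dl dl0 Hdl] := convex_functions_left1 Fg e40.
have [|S HS] := convex01_uniform_grid cg e40.
  exists dl => // x x0 xd x1; have := Hdl x x0 xd (ltW x1).
  by rewrite ltr_norml => /andP[].
(* The exceptional event is empty: a chain with interpolant within [eps / 2] of the maximizer [g] is
   not far. *)
exists S, (eps / 4); split => //; exists 0, 1; split => //.
near=> n; exists set0; split => //.
  by rewrite measure0 mul0r mul0e.
move=> w h cw inj X1 far [ch _ _] hX hS.
have n_gt0 : (0 < n)%N by near: n; exact: nbhs_infty_gt.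
have := far; rewrite /far_event /= leNgt => /negP; apply.
apply: (@le_lt_trans _ _ (eps / 2)%:E); last by rewrite lte_fin; lra.
apply: (distance_le (f := g)) => //; first by rewrite divr_ge0// ltW.
move=> i; rewrite -hX distrC.
have Ti : triangle (X n i w) by have [_ /(_ (X n i w)) h1 _] := cw; have [] := h1 (ex_intro2 _ _ i I erefl).
have /triangleP[t0 [t1 t2]] := Ti.
have xi01 : 0 <= (X n i w).1 <= 1 by rewrite t2 (le_trans t0).
by have := HS h ch hS _ xi01; lra.
Unshelve. all: by end_near. Qed.

Lemma negligible_suboptimal g : chain_functions g -> (J p g < J_star p)%E ->
  exists S tau, 0 < tau /\ negligible (close_at S tau g).
Proof.
move=> [cg g1 gout] JgJ.
have unif e : 0 < e -> exists2 rho, 0 < rho & forall z z', triangle z -> triangle z' ->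
     `|z.1 - z'.1| < rho -> `|z.2 - z'.2| < rho -> `|p z - p z'| < e by exact: density_unif.
have [_ [f Ff <-] Jgf] := ereal_sup_gt JgJ.
(* Two levels strictly between the values at [g] and at [f]: the upper bound uses the lower level,
   the lower bound the upper one. The value at [f] may be infinite. *)
have [A [A' [A0 AA' JgA A'Jf]]] : exists A A' : R,
    [/\ 0 < A, A < A', (J p g < A%:E)%E & (A'%:E < J p f)%E].
  have : (0 <= J p g)%E by apply: integral_ge0 => x _; rewrite lee_fin powR_ge0.
  case: (J p g) Jgf => [j| |] //; case: (J p f) => [j'| |] //; rewrite ?lte_fin lee_fin => jj j0.
    by exists ((2 * j + j') / 3), ((j + 2 * j') / 3); rewrite !lte_fin; split; lra.
  by exists (j + 1), (j + 2); rewrite lte_fin ltry; split => //; lra.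
have [C [q' [n0 [C0 HC]]]] := chain_prob_lower c0 pcM pc unif Ff (ltW (lt_trans A0 AA')) A'Jf.
have [S [tau [K [q [tau0 K0 HK]]]]] := chain_prob_upper c0 pcM pc unif cg JgA.
have [B [a [B0 a0 HB]]] := rate_ratio q q' A0 AA' K0 C0.
exists S, tau; split => //; exists B, a; split => //.
near=> n.
have n_gt0 : (0 < n)%N by near: n; exact: nbhs_infty_gt.
have nn0 : (n0 <= n)%N by near: n; exact: nbhs_infty_ge.
have [mug mul iXn] := iX n_gt0.
have [E [mE PE HE]] := HK _ _ (P n) (mu n) n (X n) mul iXn.
exists E; split => //.
  apply: le_trans PE _.
  apply: (@le_trans _ _ ((B * expR (- a * n%:R))%:E * (C / n.+1%:R ^+ q' * rate A' n)%:E)%E).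
    by rewrite -EFinM lee_fin.
  apply: lee_wpmul2l; first by rewrite lee_fin mulr_ge0// expR_ge0.
  exact: (HC _ _ (P n) (mu n) n (X n) mug nn0 iXn).
by move=> w h cw inj X1 far [ch h1 hout] hX hS; exact: (HE w cw inj X1 h ch hX hS).
Unshelve. all: by end_near. Qed.

Lemma negligible_neighborhood g : chain_functions g ->
  exists St : seq R * R, 0 < St.2 /\ negligible (close_at St.1 St.2 g).
Proof.
move=> Kg; have [cg g1 gout] := Kg.
suff [S [tau [tau0 H]]] : exists S tau, 0 < tau /\ negligible (close_at S tau g) by exists (S, tau).
have [lc|nlc] := pselect (forall e, 0 < e -> exists dl, 0 < dl /\ forall x, 1 - dl < x -> x < 1 -> `|g 1 - g x| < e).
  have Fg : convex_functions g by apply: convex01_convex_functions => // e /lc[dl [dl0 Hdl]]; exists dl.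
  have : (J p g <= J_star p)%E by apply: ereal_sup_ubound; exists g.
  rewrite le_eqVlt => /orP[/eqP JE|JgJ]; last exact: negligible_suboptimal.
  by apply: negligible_near_argmax.
apply: negligible_suboptimal => //.
pose h := sup [set g x | x in `[0, 1[%classic].
have g01 x : 0 <= x -> x < 1 -> g x <= 1.
  by move=> x0 x1; have /andP[] // : 0 <= g x <= 1; apply: convex01_range; rewrite ?x0 ?ltW.
have ubh : has_sup [set g x | x in `[0, 1[%classic].
  split; first by exists (g 0), 0 => //; rewrite /= in_itv /= lexx ltr01.
  by exists 1 => y [x /=]; rewrite in_itv /= => /andP[x0 x1] <-; exact: g01.
have gh x : x < 1 -> 0 <= x -> g x <= h.
  by move=> x1 x0; apply: ub_le_sup; [exact: ubh.2|exists x => //; rewrite /= in_itv /= x0].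
have hg e : 0 < e -> exists x, [/\ 0 <= x, x < 1 & h - g x < e].
  move=> e0; have [y [x /=]] := sup_adherent e0 ubh.
  rewrite in_itv /= => /andP[x0 x1] <- hx; exists x; split; [exact: x0|exact: x1|].
  by rewrite ltrBlDr addrC -ltrBlDr.
apply: (jump_not_maximal cg c0 pcM pc (h := h)) => //.
(* A left limit of at least 1 would make [g] continuous at 1, as [g 1 = 1]. *)
rewrite ltNge; apply/negP => h1; apply: nlc => e e0.
have [x [x0 x1 hx]] := hg e e0.
exists (1 - x); split; first by rewrite subr_gt0.
move=> y xy y1; rewrite g1.
have xy' : x < y by lra.
have gxy : g x <= g y by apply: convex01_homo => //; exact: ltW.
have gy1 : g y <= 1 by apply: g01 => //; lra.
by rewrite ger0_norm ?subr_ge0//; lra.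
Qed.

Lemma measurable_far_chain n : (0 < n)%N -> measurable (@far_event n `&` @chain_event n).
Proof.
move=> n0; have [_ _ [mX _]] := iX n0.
have cP f : argmax_J p f -> {within `[0, 1], continuous f} by move=> [[]].
have m1 := measurable_close_to_some mX eps0 cP.
have m2 : measurable (@chain_event n) by exact: measurable_convex_chain.
rewrite (_ : _ `&` _ = @chain_event n `\` [set w | (forall i, triangle (X n i w)) /\
    exists2 f, argmax_J p f & max_deviation f (fun i => X n i w) < eps]); last first.
  apply/seteqP; split => w.
    move=> [far cw]; split => //; move=> [_ [f af fe]].
    have : (distance_to_argmax p (fun i => X n i w) < eps%:E)%E.
      apply: (@le_lt_trans _ _ (max_deviation f (fun i => X n i w))%:E); last by rewrite lte_fin.
      by apply: ge_ereal_inf; exists (max_deviation f (fun i => X n i w))%:E => //; exists f.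
    by rewrite ltNge far.
  move=> [cw nf]; split => //; rewrite /far_event /= leNgt; apply/negP => /ereal_inf_lt[_ [f af <-]].
  rewrite lte_fin => fe; apply: nf; split; last by exists f.
  by move=> i; have [_ /(_ (X n i w)) h1 _] := cw; have [] := h1 (ex_intro2 _ _ i I erefl).
exact: measurableD.
Qed.

Lemma negligible_cover (L : seq (R -> R)) (U : (R -> R) -> set (R -> R)) :
  (forall g, g \in L -> negligible (U g)) -> negligible [set h | exists2 g, g \in L & U g h].
Proof.
elim: L => [_|g L IH HL].
  exists 0, 1; split => //; near=> n; exists set0; split => //; first by rewrite measure0 mul0r mul0e.
  by move=> w h _ _ _ _ _ _ [].
have [B1 [a1 [B10 a10 H1]]] := HL g (mem_head _ _).
have [k kL|B2 [a2 [B20 a20 H2]]] := IH; first by apply: HL; rewrite inE kL orbT.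
exists (B1 + B2), (minr a1 a2); split; [exact: addr_ge0|by rewrite lt_min a10|].
near=> n.
have [E1 [mE1 PE1 HE1]] : exists E : set (Omega n), [/\ measurable E,
    (P n E <= (B1 * expR (- a1 * n%:R))%:E * P n (@chain_event n))%E &
    forall w h, chain_event w -> injective (fun i => X n i w) -> (forall i, (X n i w).1 < 1) ->
      far_event w -> chain_functions h -> (forall i, h (X n i w).1 = (X n i w).2) -> U g h -> E w].
  by near: n.
have [E2 [mE2 PE2 HE2]] : exists E : set (Omega n), [/\ measurable E,
    (P n E <= (B2 * expR (- a2 * n%:R))%:E * P n (@chain_event n))%E &
    forall w h, chain_event w -> injective (fun i => X n i w) -> (forall i, (X n i w).1 < 1) ->
      far_event w -> chain_functions h -> (forall i, h (X n i w).1 = (X n i w).2) ->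
      (exists2 g, g \in L & U g h) -> E w].
  by near: n.
exists (E1 `|` E2); split; first exact: measurableU.
  apply: le_trans (measureU2 _ mE1 mE2) _; apply: le_trans (leeD PE1 PE2) _.
  have le_a a : minr a1 a2 <= a -> expR (- a * n%:R) <= expR (- minr a1 a2 * n%:R).
    by move=> aa; rewrite ler_expR ler_wpM2r// lerN2.
  rewrite mulrDl EFinD ge0_muleDl; [|by rewrite lee_fin mulr_ge0 ?expR_ge0..].
  apply: leeD; apply: lee_wpmul2r => //; rewrite lee_fin ler_wpM2l// le_a// ge_min lexx ?orbT//.
move=> w h cw inj X1 far Kh hX [k]; rewrite inE => /predU1P[->|kL] Uh.
  by left; exact: (HE1 w h).
by right; apply: (HE2 w h) => //; exists k.
Unshelve. all: by end_near. Qed.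

Lemma samples_distinct n : (0 < n)%N -> exists Z, [/\ measurable Z, P n Z = 0%E & forall w, ~ Z w ->
  injective (fun i => X n i w) /\ forall i, (X n i w).1 <> 1].
Proof.
case: n => // n n0; have [_ mul iXn] := iX n0.
have pM z : triangle z -> p z <= M by move=> /pcM/andP[].
exact: (almost_surely_distinct mul pM iXn).
Qed.

Lemma far_chain_unlikely : exists B a : R, [/\ 0 <= B, 0 < a &
  \forall n \near \oo, (P n (@far_event n `&` @chain_event n) <=
     (B * expR (- a * n%:R))%:E * P n (@chain_event n))%E].
Proof.
have /choice[St HSt] : forall g, exists St : seq R * R,
    chain_functions g -> 0 < St.2 /\ negligible (close_at St.1 St.2 g).
  move=> g; have [Kg|nKg] := pselect (chain_functions g); last by exists ([::], 0).
  by have [St H] := negligible_neighborhood Kg; exists St.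
have [L [LK Lcover]] := @chain_functions_finite_cover R (fun g => (St g).1) (fun g => (St g).2)
  (fun g Kg => (HSt g Kg).1).
have [B [a [B0 a0 H]]] := @negligible_cover L (fun g => close_at (St g).1 (St g).2 g)
  (fun g gL => (HSt g (LK g gL)).2).
exists B, a; split => //; near=> n.
have n_gt0 : (0 < n)%N by near: n; exact: nbhs_infty_gt.
have [E [mE PE HE]] : exists E : set (Omega n), [/\ measurable E,
    (P n E <= (B * expR (- a * n%:R))%:E * P n (@chain_event n))%E &
    forall w h, chain_event w -> injective (fun i => X n i w) -> (forall i, (X n i w).1 < 1) ->
      far_event w -> chain_functions h -> (forall i, h (X n i w).1 = (X n i w).2) ->
      (exists2 g, g \in L & close_at (St g).1 (St g).2 g h) -> E w].
  by near: n.
have [Z [mZ Z0 HZ]] : exists Z, [/\ measurable Z, P n Z = 0%E & forall w, ~ Z w ->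
    injective (fun i => X n i w) /\ forall i, (X n i w).1 <> 1].
  exact: samples_distinct.
apply: le_trans PE.
(* Samples that coincide or lie on the right edge have no interpolant of the required kind; they go
   into the null set [Z]. *)
apply: (@le_trans _ _ (P n (E `|` Z))).
  apply: le_measure; rewrite ?inE; [exact: measurable_far_chain|exact: measurableU|].
  move=> w [far cw]; have [Zw|nZ] := pselect (Z w); [by right|left].
  have [inj X1] := HZ w nZ.
  have X1' i : (X n i w).1 < 1.
    have [_ /(_ (X n i w)) h1 _] := cw; have [/triangleP[_ [_ t1]] _] := h1 (ex_intro2 _ _ i I erefl).
    by rewrite lt_neqAle t1 andbT; apply/eqP; exact: X1.
  have [h [ch hh1 hout hX]] := chain_interpolant01 cw inj X1'.
  apply: (HE w h) => //.
  exact: Lcover.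
apply: le_trans (measureU2 _ mE mZ) _.
by rewrite [X in (_ + X)%E](_ : _ = 0%E) ?adde0; [exact: lexx|exact: Z0].
Unshelve. all: by end_near. Qed.

End Main.

Theorem theorem1p3 (R : realType) (p : R * R -> R) (c : R)
    (p_density : probability_density_on triangle p)
    (p_continuous : {within triangle, continuous p})
    (c_gt0 : 0 < c)
    (p_lower_bound : 2 * c <= inf (p @` triangle))
    (d : nat -> measure_display)
    (Omega : forall n, measurableType (d n))
    (P : forall n, probability (Omega n) R)
    (X : forall n, 'I_n -> {RV (P n) >-> (R * R)%type})
    (X_samples : forall n, independent_samples triangle p (X n))
    (eps : R) (eps_gt0 : 0 < eps) :
  (limn_esup (fun n : nat =>
     (n%:R^-1)%:E *
     lne (conditional_probability (P n)
            [set w | eps%:E <= distance_to_argmax p (fun i => X n i w)]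
            [set w | convex_chain (range (fun i => X n i w))]))
   < 0)%E.
Proof.
have [p0 _] := p_density.
have [M pcM] := density_bounds p_continuous p0 c_gt0 p_lower_bound.
have /choice[mu Hmu] : forall n, exists mu : probability (measurableTypeR R * measurableTypeR R)%type R,
    (0 < n)%N -> [/\ density_ge p mu, density_le p mu &
      iid (P n) mu (fun i => X n i : Omega n -> (measurableTypeR R * measurableTypeR R)%type)].
  (* For [n = 0] some law has to be named; the one from a sample of size 1 is taken. *)
  move=> [|n]; last by have [mu H] := samples_iid p0 (X_samples n.+1); exists mu.
  by have [mu H] := samples_iid p0 (X_samples 1%N); exists mu.
have [B [a [B0 a0 H]]] := far_chain_unlikely c_gt0 pcM p_continuous Hmu eps_gt0.
(* Half of the rate [a] is given up to absorb the constant [B], once [n] is large. *)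
apply: (@le_lt_trans _ _ (- (a / 2))%:E); last by rewrite lte_fin oppr_lt0 divr_gt0.
apply: limn_esup_le_near.
pose B1 := B + 1.
have B10 : 0 < B1 by rewrite ltr_wpDl.
near=> n.
have n0 : (0 < n)%N by near: n; exact: nbhs_infty_gt.
have nB : ln B1 * 2 / a <= n%:R by near: n; exact: nbhs_infty_ger.
have Pn : (P n ([set w | eps%:E <= distance_to_argmax p (fun i => X n i w)]%E `&`
      [set w | convex_chain (range (fun i => X n i w))]) <=
    (B * expR (- a * n%:R))%:E * P n [set w | convex_chain (range (fun i => X n i w))])%E by near: n.
rewrite /conditional_probability.
move: Pn; set W := P n (_ `&` _); set V := P n _ => Pn.
have W0 : (0 <= W)%E by exact: measure_ge0.
have V0 : (0 <= V)%E by exact: measure_ge0.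
have V1 : (V <= 1)%E.
  apply: probability_le1; apply: measurable_convex_chain.
  by have [_ _ [mX _]] := Hmu n n0.
exact: (log_ratio_le W0 V0 V1 B0 a0 n0 nB Pn).
Unshelve. all: by end_near. Qed.
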